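(* Let $\Gamma<{\it PSL}(2,\mathbb R)$ be a triangle group with signature $(n_{\mathcal A},n_{\mathcal B},n_{\mathcal C})$, $(\alpha,\beta,\gamma)=(1/n_{\mathcal A},1/n_{\mathcal B},1/n_{\mathcal C})$, $\alpha+\beta+\gamma<1$, $\rho=2/(1-\alpha-\beta-\gamma)$, and assume $\gamma=0$, with class C containing the cusp $i\infty$ of width $\upsilon$. Let $\mathcal A,\mathcal B,\mathcal C$ be the formal weight-1 forms defined below (so $\mathcal A^\rho=\mathcal B^\rho+\mathcal C^\rho$), and let $\mathcal E:=\upsilon(\mathcal C^\rho)'/\mathcal C^\rho$, a quasi-modular form of weight 2 and depth $\le1$ associated with class C. Then $$\upsilon(\mathcal A^\rho)'=\mathcal E\,\mathcal A^\rho-\mathcal A^{\rho(1-\alpha)}\mathcal B^{\rho(1-\beta)},\qquad \upsilon(\mathcal B^\rho)'=\mathcal E\,\mathcal B^\rho-\mathcal A^{\rho(1-\alpha)}\mathcal B^{\rho(1-\beta)},$$ $$\upsilon(\mathcal C^\rho)'=\mathcal E\,\mathcal C^\rho,\qquad \upsilon\rho\,\mathcal E'=\mathcal E^2-\mathcal A^{\rho(1-2\alpha)}\mathcal B^{\rho(1-2\beta)}.$$ Moreover $u=(2\pi i/\upsilon\rho)\mathcal E$ (which equals $\dot{\mathcal C}/\mathcal C$) satisfies the generalized Chazy equation $$C_{88}u_4^2u_8^2+C_{86}u_4u_6^2u_8+C_{84}u_4^4u_8+C_{66}u_6^4+C_{64}u_4^3u_6^2+C_{44}u_4^6=0$$ with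 $C_{88}=(2\alpha-1)(2\beta-1)(\alpha+\beta-1)^4$, $C_{86}=-[(2\alpha-1)(3\beta-1)+(3\alpha-1)(2\beta-1)](\alpha+\beta-1)^4$, $C_{84}=-16(2\alpha-1)(2\beta-1)(\alpha+\beta-1)^3$, $C_{66}=(3\alpha-1)(3\beta-1)(\alpha+\beta-1)^4$, $C_{64}=4[2(2\alpha-1)^2(3\beta-1)+2(3\alpha-1)(2\beta-1)^2-3(\alpha-\beta)^2](\alpha+\beta-1)^2$, $C_{44}=64(2\alpha-1)(2\beta-1)(\alpha+\beta-1)^2$.
   Context: $\mathfrak H$ is the upper half plane, $\mathfrak H^*$ it together with the cusps; $q=e^{2\pi i\tau}$; $'=(2\pi i)^{-1}d/d\tau$; dot $=d/d\tau$; $u_4=\dot u-u^2$, $u_{k+2}=\dot u_k-k\,u\,u_k$. A triangle group here is a Fuchsian group of the first kind of genus zero with a hyperbolic triangular fundamental domain, hence with exactly three inequivalent classes A, B, C of fixed points on $\mathfrak H^*$, whose stabilizers have orders $n_{\mathcal A},n_{\mathcal B},n_{\mathcal C}\in\{2,3,\dots\}\cup\{\infty\}$ ($\infty$ = parabolic, i.e. cusp; $1/\infty:=0$); the signature is $(n_{\mathcal A},n_{\mathcal B},n_{\mathcal C})$. The width $\upsilon>0$ of $i\infty$ means its stabilizer is generated by $\tau\mapsto\tau+\upsilon$. Let $t$ be a Hauptmodul for $\Gamma$ with $t=0$ on class C, $t=t^*$ (a nonzero constant) on class A and $t=\infty$ on class B; then $\tau$, as a multivalued function of $t$, is a ratio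 of two independent solutions of $\mathcal L_{\alpha,\beta,\gamma}f=0$, where $\mathcal L_{\alpha,\beta,\gamma}=D_t^2+[\frac{\alpha+\beta}{t}+\frac{1-\alpha}{t-t^*}]D_t+\frac{[\gamma^2-(1-\alpha-\beta)^2]t^*}{4t^2(t-t^* )}$. Near the infinite cusp define (and continue analytically; the results may be multivalued) $\mathcal B(\tau)={}_2F_1\bigl(\tfrac{1-\alpha-\beta-\gamma}2,\tfrac{1-\alpha+\beta-\gamma}2;1-\gamma;t(\tau)/t^*\bigr)$, $\mathcal A(\tau)={}_2F_1\bigl(\tfrac{1-\alpha-\beta-\gamma}2,\tfrac{1+\alpha-\beta-\gamma}2;1-\gamma;t(\tau)/(t(\tau)-t^* )\bigr)$, $\mathcal C(\tau)=(-t(\tau)/t^* )^{1/\rho}\mathcal B(\tau)$; equivalently $\mathcal A=[(t-t^* )/t]^{1/\rho}\mathcal C$ and $\mathcal B=[-t^*/t]^{1/\rho}\mathcal C$. These vanish respectively on classes A, B, C. *)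

(* Defs.v *)
(* Complex numbers are Coquelicot's; complex derivatives are taken over
   [C_AbsRing], and [C_derive] is the corresponding total operator. *)
From Stdlib Require Import Reals List ZArith.
From Coquelicot Require Import Coquelicot.
Import ListNotations.
Open Scope R_scope.

(** ** Complex analysis *)

Definition Cexp (z : C) : C :=
  (exp (Re z) * cos (Im z), exp (Re z) * sin (Im z)).

Definition holomorphic_at (f : C -> C) (z : C) : Prop :=
  @ex_derive C_AbsRing C_NormedModule f z.

Definition inH (tau : C) : Prop := 0 < Im tau.

Definition holomorphic_H (f : C -> C) : Prop :=
  forall tau, inH tau -> holomorphic_at f tau.

(* The derivation written with a prime: (2 pi i)^{-1} d/dtau. *)
Definition Dq (f : C -> C) (tau : C) : C :=
  (C_derive f tau / (2 * PI * Ci))%C.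

Fixpoint pochhammer (a : R) (n : nat) : R :=
  match n with
  | O => 1
  | S m => pochhammer a m * (a + INR m)
  end.

Definition hyp2F1_term (a b c : R) (z : C) (n : nat) : C :=
  (RtoC (pochhammer a n * pochhammer b n
         / (pochhammer c n * INR (Factorial.fact n))) * z ^ n)%C.

(* Real and imaginary parts are summed separately; this is the sum of the
   complex series whenever it converges, in particular for |z| < 1, which is
   the only range in which it is used. *)
Definition hyp2F1 (a b c : R) (z : C) : C :=
  (Series (fun n => Re (hyp2F1_term a b c z n)),
   Series (fun n => Im (hyp2F1_term a b c z n))).

(** ** The Riemann sphere and Moebius transformations *)

(* [None] is the point at infinity.  The upper half plane, its boundary
   R u {oo} and the cusps all live in [P1]. *)
Definition P1 : Type := option C.

Record mat2 : Type := Mat2 { ma : R; mb : R; mc : R; md : R }.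

Definition mdet (g : mat2) : R := ma g * md g - mb g * mc g.
Definition mid : mat2 := Mat2 1 0 0 1.
Definition mopp (g : mat2) : mat2 := Mat2 (- ma g) (- mb g) (- mc g) (- md g).
Definition mmul (g h : mat2) : mat2 :=
  Mat2 (ma g * ma h + mb g * mc h) (ma g * mb h + mb g * md h)
       (mc g * ma h + md g * mc h) (mc g * mb h + md g * md h).
(* the adjugate, i.e. the inverse when the determinant is 1 *)
Definition madj (g : mat2) : mat2 := Mat2 (md g) (- mb g) (- mc g) (ma g).

Definition autJ (g : mat2) (tau : C) : C := (mc g * tau + md g)%C.

Definition mobC (g : mat2) (tau : C) : C :=
  ((ma g * tau + mb g) / autJ g tau)%C.

Definition mob (g : mat2) (s : P1) : P1 :=
  match s with
  | Some z => if Ceq_dec (autJ g z) 0 then None else Some (mobC g z)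
  | None => if Req_EM_T (mc g) 0 then None else Some (RtoC (ma g / mc g))
  end.

(** ** Subgroups of PSL(2,R) *)

(* A subgroup of PSL(2,R) is given by its full preimage in SL(2,R), i.e. by a
   subgroup of SL(2,R) containing -1. *)
Record PSL2R_subgroup (G : mat2 -> Prop) : Prop := {
  sg_det : forall g, G g -> mdet g = 1;
  sg_one : G mid;
  sg_opp : forall g, G g -> G (mopp g);
  sg_mul : forall g h, G g -> G h -> G (mmul g h);
  sg_inv : forall g, G g -> G (madj g)
}.

Definition equiv (G : mat2 -> Prop) (s s' : P1) : Prop :=
  exists g, G g /\ mob g s = s'.

Definition discrete_group (G : mat2 -> Prop) : Prop :=
  exists eps, 0 < eps /\
    forall g, G g ->
      Rabs (ma g - 1) < eps -> Rabs (mb g) < eps ->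
      Rabs (mc g) < eps -> Rabs (md g - 1) < eps -> g = mid.

(* Every boundary point is a limit point; the set of limit points being closed
   in R u {oo}, real points suffice. *)
Definition first_kind (G : mat2 -> Prop) : Prop :=
  forall (tau : C) (x eps : R), inH tau -> 0 < eps ->
    exists g, G g /\ Cmod (mobC g tau - RtoC x)%C < eps.

Definition parabolic (g : mat2) : Prop :=
  (ma g + md g) ^ 2 = 4 /\ g <> mid /\ g <> mopp mid.

Definition cusp (G : mat2 -> Prop) (s : P1) : Prop :=
  exists g, G g /\ parabolic g /\ mob g s = s.

Definition inH_pt (s : P1) : Prop :=
  match s with Some tau => inH tau | None => False end.

Definition Hstar (G : mat2 -> Prop) (s : P1) : Prop := inH_pt s \/ cusp G s.

Definition fixed_point (G : mat2 -> Prop) (s : P1) : Prop :=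
  Hstar G s /\ exists g, G g /\ g <> mid /\ g <> mopp mid /\ mob g s = s.

(* Orders of stabilizers in PSL(2,R): [None] is the order oo of a cusp.  As [G]
   is a preimage in SL(2,R), an order n corresponds to 2n matrices. *)
Definition stabilizer_order (G : mat2 -> Prop) (s : P1) (n : option nat) : Prop :=
  match n with
  | Some m =>
      (2 <= m)%nat /\ inH_pt s /\
      exists l : list mat2, NoDup l /\ length l = (2 * m)%nat /\
        forall g, In g l <-> (G g /\ mob g s = s)
  | None => cusp G s
  end.

Definition inv_order (n : option nat) : R :=
  match n with Some m => / INR m | None => 0 end.

Definition cusp_width_infty (G : mat2 -> Prop) (w : R) : Prop :=
  0 < w /\
  forall g, (G g /\ mob g None = None) <->
    exists k : Z, g = Mat2 1 (IZR k * w) 0 1 \/ g = mopp (Mat2 1 (IZR k * w) 0 1).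

(** ** Hauptmoduln *)

Definition P1_ball (v : P1) (eps : R) (w : P1) : Prop :=
  match v, w with
  | Some z, Some z' => Cmod (z' - z)%C < eps
  | Some _, None => False
  | None, Some z' => / eps < Cmod z'
  | None, None => True
  end.

(* Horoballs {tau | M < height s tau} are the basic neighbourhoods of the cusp
   [s] in the topology of the extended upper half plane. *)
Definition height (s : P1) (tau : C) : R :=
  match s with
  | None => Im tau
  | Some x => Im tau / (Cmod (tau - x)%C) ^ 2
  end.

(* affine coordinate and its inverse, with the missing point sent to 0 *)
Definition fin_part (v : P1) : C := match v with Some z => z | None => RtoC 0 end.
Definition inv_part (v : P1) : C :=
  match v with Some z => (/ z)%C | None => RtoC 0 end.

Definition meromorphic_H (t : P1 -> P1) : Prop :=
  forall tau, inH tau ->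
    (t (Some tau) <> None ->
       locally (T := C_UniformSpace) tau (fun z => t (Some z) <> None) /\
       holomorphic_at (fun z => fin_part (t (Some z))) tau) /\
    (t (Some tau) = None ->
       locally (T := C_UniformSpace) tau (fun z => t (Some z) <> Some (RtoC 0)) /\
       holomorphic_at (fun z => inv_part (t (Some z))) tau).

Definition continuous_at_cusps (G : mat2 -> Prop) (t : P1 -> P1) : Prop :=
  forall s, cusp G s -> forall eps, 0 < eps ->
    exists M, forall tau, inH tau -> M < height s tau ->
      P1_ball (t s) eps (t (Some tau)).

(* [t] induces an isomorphism from the compactified quotient of the upper half
   plane onto the Riemann sphere.  Only its values on [Hstar G] matter. *)
Record hauptmodul (G : mat2 -> Prop) (t : P1 -> P1) : Prop := {
  hm_mero : meromorphic_H t;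
  hm_cusp : continuous_at_cusps G t;
  hm_inv : forall g s, G g -> Hstar G s -> t (mob g s) = t s;
  hm_inj : forall s s', Hstar G s -> Hstar G s' -> t s = t s' -> equiv G s s';
  hm_surj : forall v : P1, exists s, Hstar G s /\ t s = v
}.

(** ** Hyperbolic triangles *)

(* (p,q,r) with q^2 - 4pr > 0 encodes the open half plane
   p |tau|^2 + q Re tau + r > 0 of the hyperbolic plane, bounded by a geodesic. *)
Record halfplane : Type := HalfPlane { hp : R; hq : R; hr : R }.

Definition hp_valid (h : halfplane) : Prop := 0 < hq h ^ 2 - 4 * hp h * hr h.

(* At oo the defining function is normalised by |tau|^2; its sign (or vanishing)
   tells whether an ideal point lies inside the half plane (or on its boundary
   geodesic). *)
Definition hp_val (h : halfplane) (s : P1) : R :=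
  match s with
  | Some z => hp h * Cmod z ^ 2 + hq h * Re z + hr h
  | None => hp h
  end.

(* the hyperbolic reflection in the boundary geodesic of [h] *)
Definition hp_reflect (h : halfplane) (tau : C) : C :=
  (- (hq h * Cconj tau + 2 * hr h) / (2 * hp h * Cconj tau + hq h))%C.

(* [h1], [h2], [h3] are the half planes cut out by the sides opposite to the
   vertices [v1], [v2], [v3], which may be ideal. *)
Definition triangle_sides (v1 v2 v3 : P1) (h1 h2 h3 : halfplane) : Prop :=
  hp_valid h1 /\ hp_valid h2 /\ hp_valid h3 /\
  0 < hp_val h1 v1 /\ hp_val h1 v2 = 0 /\ hp_val h1 v3 = 0 /\
  hp_val h2 v1 = 0 /\ 0 < hp_val h2 v2 /\ hp_val h2 v3 = 0 /\
  hp_val h3 v1 = 0 /\ hp_val h3 v2 = 0 /\ 0 < hp_val h3 v3.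

Definition open_triangle (h1 h2 h3 : halfplane) (tau : C) : Prop :=
  inH tau /\ 0 < hp_val h1 (Some tau) /\ 0 < hp_val h2 (Some tau) /\
  0 < hp_val h3 (Some tau).

Definition closed_triangle (h1 h2 h3 : halfplane) (tau : C) : Prop :=
  inH tau /\ 0 <= hp_val h1 (Some tau) /\ 0 <= hp_val h2 (Some tau) /\
  0 <= hp_val h3 (Some tau).

(* A fundamental domain is formed by a hyperbolic triangle together with its
   mirror image in a side: the group consists of the orientation-preserving
   elements of the group generated by the reflections in the sides. *)
Definition triangular_fundamental_domain (G : mat2 -> Prop) (v1 v2 v3 : P1) : Prop :=
  exists h1 h2 h3,
    triangle_sides v1 v2 v3 h1 h2 h3 /\
    (forall tau, inH tau -> exists tau',
       equiv G (Some tau) (Some tau') /\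
       (closed_triangle h1 h2 h3 tau' \/
        closed_triangle h1 h2 h3 (hp_reflect h3 tau'))) /\
    (forall tau tau', inH tau -> inH tau' ->
       (open_triangle h1 h2 h3 tau \/ open_triangle h1 h2 h3 (hp_reflect h3 tau)) ->
       (open_triangle h1 h2 h3 tau' \/ open_triangle h1 h2 h3 (hp_reflect h3 tau')) ->
       equiv G (Some tau) (Some tau') -> tau = tau').

(** ** Triangle groups *)

(* [vA], [vB], [vC] are representatives of the three classes of fixed points.
   Genus zero is expressed by the existence of a Hauptmodul. *)
Record triangle_group (G : mat2 -> Prop) (vA vB vC : P1) (nA nB nC : option nat)
  : Prop := {
  tg_group : PSL2R_subgroup G;
  tg_discrete : discrete_group G;
  tg_first_kind : first_kind G;
  tg_genus_zero : exists t, hauptmodul G t;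
  tg_domain : triangular_fundamental_domain G vA vB vC;
  tg_fixA : fixed_point G vA;
  tg_fixB : fixed_point G vB;
  tg_fixC : fixed_point G vC;
  tg_AB : ~ equiv G vA vB;
  tg_BC : ~ equiv G vB vC;
  tg_CA : ~ equiv G vC vA;
  tg_classes : forall s, fixed_point G s ->
    equiv G vA s \/ equiv G vB s \/ equiv G vC s;
  tg_ordA : stabilizer_order G vA nA;
  tg_ordB : stabilizer_order G vB nB;
  tg_ordC : stabilizer_order G vC nC
}.

(** ** The formal weight-1 forms *)

Definition near_icusp (P : C -> Prop) : Prop :=
  exists Y : R, forall tau, Y < Im tau -> P tau.

Definition calB (al be ga : R) (tstar : C) (t : P1 -> P1) (tau : C) : C :=
  let z := fin_part (t (Some tau)) in
  hyp2F1 ((1 - al - be - ga) / 2) ((1 - al + be - ga) / 2) (1 - ga)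
         (z / tstar)%C.

Definition calA (al be ga : R) (tstar : C) (t : P1 -> P1) (tau : C) : C :=
  let z := fin_part (t (Some tau)) in
  hyp2F1 ((1 - al - be - ga) / 2) ((1 + al - be - ga) / 2) (1 - ga)
         (z / (z - tstar))%C.

Definition log_branch (f l : C -> C) : Prop :=
  near_icusp (fun tau => holomorphic_at l tau /\ Cexp (l tau) = f tau).

Definition vanishes_at_icusp (l : C -> C) : Prop :=
  forall eps, 0 < eps -> near_icusp (fun tau => Cmod (l tau) < eps).

(* Branches, near i oo, of the logarithms of calA, calB and
   calC = (- t / t* )^{1/rho} calB.  The first two forms tend to 1 at i oo and
   the principal branch is taken; for calC any branch of log (- t / t* ) is
   allowed. *)
Definition formal_forms (al be ga : R) (tstar : C) (t : P1 -> P1)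
    (lA lB lC : C -> C) : Prop :=
  let rho := 2 / (1 - al - be - ga) in
  log_branch (calA al be ga tstar t) lA /\ vanishes_at_icusp lA /\
  log_branch (calB al be ga tstar t) lB /\ vanishes_at_icusp lB /\
  exists lt : C -> C,
    log_branch (fun tau => (- fin_part (t (Some tau)) / tstar)%C) lt /\
    near_icusp (fun tau => lC tau = (lt tau / rho + lB tau)%C).

(* [F] is the (necessarily unique) single-valued analytic continuation to the
   upper half plane of the power with exponent [s] of the form whose logarithm
   near i oo is [l]. *)
Definition continued_power (l : C -> C) (s : R) (F : C -> C) : Prop :=
  holomorphic_H F /\ near_icusp (fun tau => F tau = Cexp (RtoC s * l tau)%C).

(** ** Quasi-modular forms *)

(* Weight [k] and depth at most [p]; the last clause is holomorphy at the
   cusps. *)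
Definition quasi_modular (G : mat2 -> Prop) (k p : nat) (f : C -> C) : Prop :=
  holomorphic_H f /\
  (exists F : nat -> C -> C,
     (forall r, (r <= p)%nat -> holomorphic_H (F r)) /\
     forall g tau, G g -> inH tau ->
       f (mobC g tau) =
       (autJ g tau ^ k *
        sum_n (G := C_AbelianMonoid)
          (fun r => (F r tau * (mc g / autJ g tau) ^ r)%C) p)%C) /\
  (forall s, mdet s = 1 -> cusp G (mob s None) ->
     exists M, near_icusp (fun tau =>
       Cmod (f (mobC s tau)) <= M * Cmod (autJ s tau) ^ k)).

(** ** The generalized Chazy equation *)

Definition chazy_u4 (u : C -> C) (tau : C) : C :=
  (C_derive u tau - u tau ^ 2)%C.

(* u_{k+2} from u_k *)
Definition chazy_next (k : nat) (u uk : C -> C) (tau : C) : C :=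
  (C_derive uk tau - INR k * u tau * uk tau)%C.

Definition chazy_u6 (u : C -> C) : C -> C := chazy_next 4 u (chazy_u4 u).
Definition chazy_u8 (u : C -> C) : C -> C := chazy_next 6 u (chazy_u6 u).

Definition C88 (al be : R) : R :=
  (2 * al - 1) * (2 * be - 1) * (al + be - 1) ^ 4.
Definition C86 (al be : R) : R :=
  - ((2 * al - 1) * (3 * be - 1) + (3 * al - 1) * (2 * be - 1))
  * (al + be - 1) ^ 4.
Definition C84 (al be : R) : R :=
  - 16 * (2 * al - 1) * (2 * be - 1) * (al + be - 1) ^ 3.
Definition C66 (al be : R) : R :=
  (3 * al - 1) * (3 * be - 1) * (al + be - 1) ^ 4.
Definition C64 (al be : R) : R :=
  4 * (2 * (2 * al - 1) ^ 2 * (3 * be - 1) + 2 * (3 * al - 1) * (2 * be - 1) ^ 2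
       - 3 * (al - be) ^ 2) * (al + be - 1) ^ 2.
Definition C44 (al be : R) : R :=
  64 * (2 * al - 1) * (2 * be - 1) * (al + be - 1) ^ 2.

Definition gen_chazy (al be : R) (u : C -> C) (tau : C) : Prop :=
  let u4 := chazy_u4 u tau in
  let u6 := chazy_u6 u tau in
  let u8 := chazy_u8 u tau in
  (C88 al be * u4 ^ 2 * u8 ^ 2 + C86 al be * u4 * u6 ^ 2 * u8
   + C84 al be * u4 ^ 4 * u8 + C66 al be * u6 ^ 4
   + C64 al be * u4 ^ 3 * u6 ^ 2 + C44 al be * u4 ^ 6)%C = RtoC 0.

(* Main.v *)
(* Put y = t^*/t, so that y is holomorphic on H and equals 1, 0, oo on the classes A, B, C.
   The function
     u = (1/2) (log (y' y^(be-1) (1-y)^(al-1)))'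
   extends holomorphically to H, because y - 1 and y vanish to the orders 1/al and 1/be at the
   elliptic points, and it transforms like a logarithmic derivative of weight 1.  Hence
   (u' - u^2) y (y-1) / y'^2 is Gamma-invariant, so it is a function of y; it is holomorphic off
   0 and 1, and the local expansions at 0, 1 and oo together with Liouville's theorem show that
   it is the constant -1/rho^2.  This Riccati equation is the hypergeometric equation for the
   form with logarithmic derivative u - (log y^(-1/rho))', which therefore is the
   hypergeometric series in 1/y; exchanging the classes A and B gives the other series.
   Consequently C = exp (int u), B^rho = - y C^rho and A^rho = (1-y) C^rho.  All powers in the
   statement then exist on the simply connected H, and every identity becomes an algebraic
   consequence of the Riccati equation and of the definition of u near the cusp, which spreads
   over H by the identity theorem. *)

Require Import Defs.
From Stdlib Require Import Reals List ZArith.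
From Coquelicot Require Import Coquelicot.
From Stdlib Require Import Lra Lia Psatz Classical ClassicalEpsilon.
Open Scope R_scope.

(** * Complex derivatives *)

(** The shape of [u] is dictated by the answer. Write A^rho = (1-y) C^rho, B^rho = -y C^rho and y' =
    dy/dtau. If A^(rho(1-al)) B^(rho(1-be)) is to be (upsilon / 2 pi i) y' C^rho, then rho (1-al-be)
    = 2 makes y' y^(be-1) (1-y)^(al-1) a constant multiple of C^2, and half its logarithmic
    derivative can only be that of C. The constant of the Riccati equation is read at the infinite
    cusp, where u' tends to 0 and u y / y' to -1/rho. The obstacle is multiplicity. The Hauptmodul
    is given as a meromorphic bijection on orbits, so the order of y at an elliptic point and the
    order of 1/y in q at the infinite cusp must be extracted from discreteness: if the order is m,
    multiplying the local coordinate by an m-th root of unity yields nearby points with equal y,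
    hence group elements, and discreteness confines these to the stabiliser. Order exactly 1 at the
    infinite cusp fixes the factor upsilon in the system and makes 1/y a local coordinate in which
    the hypergeometric equation is solved. *)

Definition Ccont (f : C -> C) (z : C) : Prop :=
  forall eps, 0 < eps -> exists d, 0 < d /\
    forall w, Cmod (w - z)%C < d -> Cmod (f w - f z)%C < eps.

(* Caratheodory's form of differentiability. *)
Definition Cd (f : C -> C) (z l : C) : Prop :=
  exists phi, Ccont phi z /\ phi z = l /\
    forall w, f w = (f z + phi w * (w - z))%C.

Definition near (z : C) (P : C -> Prop) : Prop :=
  exists d, 0 < d /\ forall w, Cmod (w - z)%C < d -> P w.

Lemma near_and (z : C) (P Q : C -> Prop) :
  near z P -> near z Q -> near z (fun w => P w /\ Q w).
Proof.
  intros [d [Hd H]] [e [He H']]; exists (Rmin d e); split.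
  - apply Rmin_pos; assumption.
  - intros w Hw; split; [apply H | apply H'];
      (eapply Rlt_le_trans; [exact Hw|]); [apply Rmin_l | apply Rmin_r].
Qed.

Lemma near_mono (z : C) (P Q : C -> Prop) :
  (forall w, P w -> Q w) -> near z P -> near z Q.
Proof. intros H [d [Hd H']]; exists d; split; auto. Qed.

Lemma Cmod_m_sym (a b : C) : Cmod (a - b)%C = Cmod (b - a)%C.
Proof. rewrite <- Cmod_opp; f_equal; ring. Qed.

Lemma Cmod_m_0 (a : C) : Cmod (a - a)%C = 0.
Proof. replace (a - a)%C with (RtoC 0) by ring; apply Cmod_0. Qed.

Lemma near_here (z : C) (P : C -> Prop) : near z P -> P z.
Proof. intros [d [Hd H]]; apply H; rewrite Cmod_m_0; assumption. Qed.

Lemma Cmod_tri (a b c : C) : Cmod (a - c)%C <= Cmod (a - b)%C + Cmod (b - c)%C.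
Proof.
  replace (a - c)%C with ((a - b) + (b - c))%C by ring; apply Cmod_triangle.
Qed.

Lemma Cmod_tri_inv (a b : C) : Cmod a <= Cmod b + Cmod (a - b)%C.
Proof.
  replace a with (b + (a - b))%C at 1 by ring; apply Cmod_triangle.
Qed.

Lemma near_near (z : C) (P : C -> Prop) : near z P -> near z (fun w => near w P).
Proof.
  intros [d [Hd H]]; exists d; split; [assumption|].
  intros w Hw; exists (d - Cmod (w - z)%C); split; [lra|].
  intros v Hv; apply H; pose proof (Cmod_tri v w z); lra.
Qed.

Lemma Ccont_ext_near (f g : C -> C) (z : C) :
  near z (fun w => f w = g w) -> Ccont f z -> Ccont g z.
Proof.
  intros Hn Hf eps He; pose proof (near_here _ _ Hn) as H0.
  destruct (near_and _ _ _ Hn (Hf eps He)) as [d [Hd H]]; exists d; split; auto.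
  intros w Hw; destruct (H w Hw) as [E1 E2]; rewrite <- E1, <- H0; exact E2.
Qed.

Lemma Ccont_const (c z : C) : Ccont (fun _ => c) z.
Proof. intros eps He; exists 1; split; [lra|]; intros; rewrite Cmod_m_0; auto. Qed.

Lemma Ccont_id (z : C) : Ccont (fun w => w) z.
Proof. intros eps He; exists eps; split; auto. Qed.

Lemma Ccont_plus (f g : C -> C) (z : C) :
  Ccont f z -> Ccont g z -> Ccont (fun w => f w + g w)%C z.
Proof.
  intros Hf Hg eps He.
  assert (He2 : 0 < eps / 2) by lra.
  destruct (near_and _ _ _ (Hf _ He2) (Hg _ He2)) as [d [Hd H]].
  exists d; split; auto; intros w Hw; destruct (H w Hw).
  replace (f w + g w - (f z + g z))%C with ((f w - f z) + (g w - g z))%C by ring.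
  pose proof (Cmod_triangle (f w - f z) (g w - g z)); lra.
Qed.

Lemma Ccont_bounded (f : C -> C) (z : C) :
  Ccont f z -> near z (fun w => Cmod (f w) < Cmod (f z) + 1).
Proof.
  intros Hf; destruct (Hf 1 Rlt_0_1) as [d [Hd H]]; exists d; split; auto.
  intros w Hw; specialize (H w Hw); pose proof (Cmod_tri_inv (f w) (f z)); lra.
Qed.

Lemma Ccont_mult (f g : C -> C) (z : C) :
  Ccont f z -> Ccont g z -> Ccont (fun w => f w * g w)%C z.
Proof.
  intros Hf Hg eps He.
  set (A := Cmod (f z) + 1); set (B := Cmod (g z) + 1).
  assert (HA : 0 < A) by (pose proof (Cmod_ge_0 (f z)); unfold A; lra).
  assert (HB : 0 < B) by (pose proof (Cmod_ge_0 (g z)); unfold B; lra).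
  assert (H1 : 0 < eps / (2 * B)) by (apply Rdiv_lt_0_compat; lra).
  assert (H2 : 0 < eps / (2 * A)) by (apply Rdiv_lt_0_compat; lra).
  destruct (near_and _ _ _ (near_and _ _ _ (Hf _ H1) (Hg _ H2)) (Ccont_bounded f z Hf))
    as [d [Hd H]].
  exists d; split; auto; intros w Hw; destruct (H w Hw) as [[K1 K2] K3].
  replace (f w * g w - f z * g z)%C with (f w * (g w - g z) + (f w - f z) * g z)%C by ring.
  eapply Rle_lt_trans; [apply Cmod_triangle|]; rewrite !Cmod_mult.
  fold A in K3.
  assert (Cmod (f w) * Cmod (g w - g z) <= A * Cmod (g w - g z)%C).
  { apply Rmult_le_compat_r; [apply Cmod_ge_0|lra]. }
  assert (A * Cmod (g w - g z)%C < A * (eps / (2 * A))) by (apply Rmult_lt_compat_l; auto).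
  assert (Cmod (f w - f z)%C * Cmod (g z) <= eps / (2 * B) * B).
  { apply Rmult_le_compat; try apply Cmod_ge_0; [lra|unfold B; lra]. }
  replace (A * (eps / (2 * A))) with (eps / 2) in * by (field; lra).
  replace (eps / (2 * B) * B) with (eps / 2) in * by (field; lra).
  lra.
Qed.

Lemma Ccont_opp (f : C -> C) (z : C) : Ccont f z -> Ccont (fun w => - f w)%C z.
Proof.
  intros Hf eps He; destruct (Hf eps He) as [d [Hd H]]; exists d; split; auto.
  intros w Hw; replace (- f w - - f z)%C with (- (f w - f z))%C by ring.
  rewrite Cmod_opp; auto.
Qed.

Lemma Ccont_minus (f g : C -> C) (z : C) :
  Ccont f z -> Ccont g z -> Ccont (fun w => f w - g w)%C z.
Proof. intros; apply Ccont_plus; auto; apply Ccont_opp; auto. Qed.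

Lemma Ccont_neq (f : C -> C) (z c : C) :
  Ccont f z -> f z <> c -> near z (fun w => f w <> c).
Proof.
  intros Hf Hc.
  assert (H0 : 0 < Cmod (f z - c)%C) by (apply Cmod_gt_0, Cminus_eq_contra; auto).
  destruct (Hf _ H0) as [d [Hd H]]; exists d; split; auto.
  intros w Hw E; specialize (H w Hw); rewrite E, Cmod_m_sym in H; lra.
Qed.

Lemma Ccont_lower (f : C -> C) (z : C) :
  Ccont f z -> f z <> 0 -> near z (fun w => Cmod (f z) / 2 < Cmod (f w)).
Proof.
  intros Hf Hc.
  assert (H0 : 0 < Cmod (f z) / 2) by (apply Cmod_gt_0 in Hc; lra).
  destruct (Hf _ H0) as [d [Hd H]]; exists d; split; auto.
  intros w Hw; specialize (H w Hw); rewrite Cmod_m_sym in H.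
  pose proof (Cmod_tri_inv (f z) (f w)); lra.
Qed.

Lemma Ccont_inv (f : C -> C) (z : C) :
  Ccont f z -> f z <> 0 -> Ccont (fun w => / f w)%C z.
Proof.
  intros Hf Hc eps He.
  assert (M0 : 0 < Cmod (f z)) by (apply Cmod_gt_0; auto).
  assert (H1 : 0 < eps * (Cmod (f z) * Cmod (f z) / 2)).
  { apply Rmult_lt_0_compat; auto; apply Rdiv_lt_0_compat; [|lra].
    apply Rmult_lt_0_compat; auto. }
  destruct (near_and _ _ _ (Hf _ H1) (Ccont_lower f z Hf Hc)) as [d [Hd H]].
  exists d; split; auto; intros w Hw; destruct (H w Hw) as [K1 K2].
  assert (Hw0 : f w <> 0) by (apply Cmod_gt_0; lra).
  replace (/ f w - / f z)%C with ((f z - f w) / (f w * f z))%C by (field; auto).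
  rewrite Cmod_div by (apply Cmult_neq_0; auto).
  rewrite Cmod_mult, Cmod_m_sym.
  apply Rlt_div_l; [apply Rmult_lt_0_compat; lra|].
  eapply Rlt_le_trans; [exact K1|]; apply Rmult_le_compat_l; [lra|].
  nra.
Qed.

Lemma Ccont_div (f g : C -> C) (z : C) :
  Ccont f z -> Ccont g z -> g z <> 0 -> Ccont (fun w => f w / g w)%C z.
Proof. intros; apply Ccont_mult; auto; apply Ccont_inv; auto. Qed.

Lemma Ccont_comp (f g : C -> C) (z : C) :
  Ccont f z -> Ccont g (f z) -> Ccont (fun w => g (f w)) z.
Proof.
  intros Hf Hg eps He; destruct (Hg eps He) as [d [Hd H]].
  destruct (Hf d Hd) as [d' [Hd' H']]; exists d'; split; auto.
Qed.

Lemma near_comp (f : C -> C) (z : C) (P : C -> Prop) :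
  Ccont f z -> near (f z) P -> near z (fun w => P (f w)).
Proof.
  intros Hf [d [Hd H]]; destruct (Hf d Hd) as [d' [Hd' H']]; exists d'; split; auto.
Qed.

Lemma Ccont_pow (f : C -> C) (z : C) (n : nat) :
  Ccont f z -> Ccont (fun w => f w ^ n)%C z.
Proof.
  intros Hf; induction n as [|n IH]; simpl.
  - apply Ccont_const.
  - apply Ccont_mult; auto.
Qed.

Lemma Cd_cont (f : C -> C) (z l : C) : Cd f z l -> Ccont f z.
Proof.
  intros [p [Hp [_ E]]].
  apply (Ccont_ext_near (fun w => f z + p w * (w - z))%C).
  - exists 1; split; [lra|]; intros; symmetry; apply E.
  - apply Ccont_plus; [apply Ccont_const|]; apply Ccont_mult; auto.
    apply Ccont_minus; [apply Ccont_id|apply Ccont_const].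
Qed.

Lemma Cd_const (c z : C) : Cd (fun _ => c) z 0.
Proof. exists (fun _ => RtoC 0); repeat split; [apply Ccont_const|]; intros; ring. Qed.

Lemma Cd_id (z : C) : Cd (fun w => w) z 1.
Proof. exists (fun _ => RtoC 1); repeat split; [apply Ccont_const|]; intros; ring. Qed.

Lemma Cd_plus (f g : C -> C) (z a b : C) :
  Cd f z a -> Cd g z b -> Cd (fun w => f w + g w)%C z (a + b)%C.
Proof.
  intros [p [Hp [Ep Hf]]] [q [Hq [Eq Hg]]]; exists (fun w => p w + q w)%C; repeat split.
  - apply Ccont_plus; auto.
  - congruence.
  - intros w; rewrite Hf, Hg; ring.
Qed.

Lemma Cd_opp (f : C -> C) (z a : C) : Cd f z a -> Cd (fun w => - f w)%C z (- a)%C.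
Proof.
  intros [p [Hp [Ep Hf]]]; exists (fun w => - p w)%C; repeat split.
  - apply Ccont_opp; auto.
  - congruence.
  - intros w; rewrite Hf; ring.
Qed.

Lemma Cd_minus (f g : C -> C) (z a b : C) :
  Cd f z a -> Cd g z b -> Cd (fun w => f w - g w)%C z (a - b)%C.
Proof. intros; apply Cd_plus; auto; apply Cd_opp; auto. Qed.

Lemma Cd_mult (f g : C -> C) (z a b : C) :
  Cd f z a -> Cd g z b -> Cd (fun w => f w * g w)%C z (a * g z + f z * b)%C.
Proof.
  intros Df Dg; pose proof (Cd_cont _ _ _ Df) as Cf.
  destruct Df as [p [Hp [Ep Hf]]]; destruct Dg as [q [Hq [Eq Hg]]].
  exists (fun w => p w * g z + f w * q w)%C; repeat split.
  - apply Ccont_plus; apply Ccont_mult; auto; apply Ccont_const.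
  - congruence.
  - intros w; rewrite (Hg w), (Hf w); ring.
Qed.

Lemma Cd_inv (f : C -> C) (z a : C) :
  Cd f z a -> f z <> 0 -> Cd (fun w => / f w)%C z (- a / (f z * f z))%C.
Proof.
  intros Df H0; pose proof (Cd_cont _ _ _ Df) as Cf.
  destruct Df as [p [Hp [Ep Hf]]].
  (* The slope identity is demanded at every [w], including zeros of [f] away from [z]. There the
     slope is whatever the total inverse prescribes; continuity at [z] is unaffected because [f] is
     nonzero nearby. *)
  set (psi := fun w => if Ceq_dec (f w) 0
                       then (if Ceq_dec w z then RtoC 0 else ((/ f w - / f z) / (w - z))%C)
                       else (- p w / (f w * f z))%C).
  exists psi; repeat split.
  - apply (Ccont_ext_near (fun w => - p w / (f w * f z))%C).
    + apply (near_mono _ (fun w => f w <> 0)); [|apply Ccont_neq; auto].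
      intros w Hw; unfold psi; destruct (Ceq_dec (f w) 0); [contradiction|reflexivity].
    + apply Ccont_div; [apply Ccont_opp; auto| |apply Cmult_neq_0; auto].
      apply Ccont_mult; auto; apply Ccont_const.
  - unfold psi; destruct (Ceq_dec (f z) 0); [contradiction|congruence].
  - intros w; unfold psi; destruct (Ceq_dec (f w) 0) as [E|E].
    + destruct (Ceq_dec w z) as [E'|E']; [subst; contradiction|].
      generalize (/ f w)%C; intros x; field; split; [auto|apply Cminus_eq_contra; auto].
    + assert (K := Hf w).
      replace (- p w / (f w * f z) * (w - z))%C
        with (- (p w * (w - z)) / (f w * f z))%C by (field; auto).
      replace (p w * (w - z))%C with (f w - f z)%C by (rewrite K at 1; ring).
      field; auto.
Qed.

Lemma Cd_comp (f g : C -> C) (z a b : C) :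
  Cd f z a -> Cd g (f z) b -> Cd (fun w => g (f w)) z (b * a)%C.
Proof.
  intros Df [q [Hq [Eq Hg]]]; pose proof (Cd_cont _ _ _ Df) as Cf.
  destruct Df as [p [Hp [Ep Hf]]].
  exists (fun w => q (f w) * p w)%C; repeat split.
  - apply Ccont_mult; auto; apply Ccont_comp; auto.
  - congruence.
  - intros w; rewrite (Hg (f w)).
    replace (f w - f z)%C with (p w * (w - z))%C by (rewrite (Hf w) at 1; ring); ring.
Qed.

Lemma Cd_eqn (f : C -> C) (z a b : C) : Cd f z a -> a = b -> Cd f z b.
Proof. intros; subst; auto. Qed.

Lemma Cd_ext_near (f g : C -> C) (z l : C) :
  near z (fun w => f w = g w) -> Cd f z l -> Cd g z l.
Proof.
  intros Hn [p [Hp [Ep Hf]]].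
  set (psi := fun w => if Ceq_dec w z then p w else ((g w - g z) / (w - z))%C).
  pose proof (near_here _ _ Hn) as H0; simpl in H0.
  exists psi; repeat split.
  - apply (Ccont_ext_near p); auto.
    apply (near_mono _ (fun w => f w = g w)); auto.
    intros w Hw; unfold psi; destruct (Ceq_dec w z) as [E|E]; auto.
    rewrite <- Hw, <- H0, (Hf w); field; apply Cminus_eq_contra; auto.
  - unfold psi; destruct (Ceq_dec z z); congruence.
  - intros w; unfold psi; destruct (Ceq_dec w z) as [E|E].
    + subst; ring.
    + field; apply Cminus_eq_contra; auto.
Qed.

Lemma Cd_ext (f g : C -> C) (z l : C) : (forall w, f w = g w) -> Cd f z l -> Cd g z l.
Proof. intros H; apply Cd_ext_near; exists 1; split; [lra|auto]. Qed.

Lemma Cd_div (f g : C -> C) (z a b : C) :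
  Cd f z a -> Cd g z b -> g z <> 0 ->
  Cd (fun w => f w / g w)%C z ((a * g z - f z * b) / (g z * g z))%C.
Proof.
  intros Df Dg H0.
  eapply Cd_eqn; [exact (Cd_mult _ _ _ _ _ Df (Cd_inv _ _ _ Dg H0))|]; cbv beta; field; auto.
Qed.

Lemma Cd_pow (f : C -> C) (z a : C) (n : nat) :
  Cd f z a -> Cd (fun w => f w ^ n)%C z (INR n * f z ^ pred n * a)%C.
Proof.
  intros Df; induction n as [|n IH].
  - eapply Cd_eqn; [exact (Cd_const 1 z)|]; simpl; ring.
  - eapply Cd_eqn; [exact (Cd_mult _ _ _ _ _ Df IH)|].
    rewrite S_INR, RtoC_plus; destruct n; simpl; ring.
Qed.

(** Slopes make the rules of calculus purely algebraic; the little-o estimate is the form needed for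
    path integrals and for comparison with [is_derive]. *)
Lemma Cd_spec (f : C -> C) (z l : C) :
  Cd f z l <-> forall eps, 0 < eps ->
    near z (fun w => Cmod (f w - f z - l * (w - z))%C <= eps * Cmod (w - z)%C).
Proof.
  split.
  - intros [p [Hp [Ep Hf]]] eps He; destruct (Hp eps He) as [d [Hd H]].
    exists d; split; auto; intros w Hw; rewrite (Hf w), <- Ep.
    replace (f z + p w * (w - z) - f z - p z * (w - z))%C with ((p w - p z) * (w - z))%C by ring.
    rewrite Cmod_mult; apply Rmult_le_compat_r; [apply Cmod_ge_0|].
    apply Rlt_le; auto.
  - intros H.
    exists (fun w => if Ceq_dec w z then l else ((f w - f z) / (w - z))%C); repeat split.
    + intros eps He; assert (He2 : 0 < eps / 2) by lra.
      destruct (H _ He2) as [d [Hd K]]; exists d; split; auto.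
      intros w Hw; destruct (Ceq_dec z z) as [_|]; [|congruence].
      destruct (Ceq_dec w z) as [E|E]; [rewrite Cmod_m_0; auto|].
      assert (N : (w - z)%C <> 0) by (apply Cminus_eq_contra; auto).
      replace ((f w - f z) / (w - z) - l)%C
        with ((f w - f z - l * (w - z)) / (w - z))%C by (field; auto).
      rewrite Cmod_div by auto.
      apply Rlt_div_l; [apply Cmod_gt_0; auto|].
      eapply Rle_lt_trans; [apply K; auto|].
      apply Rmult_lt_compat_r; [apply Cmod_gt_0; auto|lra].
    + destruct (Ceq_dec z z); congruence.
    + intros w; destruct (Ceq_dec w z) as [E|E]; [subst; ring|].
      field; apply Cminus_eq_contra; auto.
Qed.

Lemma Cd_is_derive (f : C -> C) (z l : C) :
  Cd f z l <-> @is_derive C_AbsRing C_NormedModule f z l.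
Proof.
  rewrite Cd_spec; split.
  - intros H; split; [apply is_linear_scal_l|].
    intros x Hx; 
    assert (E : z = x) by exact (@is_filter_lim_locally_unique C_AbsRing (AbsRing_NormedModule C_AbsRing) z x Hx).
    subst x.
    intros eps; destruct (H eps (cond_pos eps)) as [d [Hd K]].
    exists (mkposreal d Hd); intros w Hw.
    specialize (K w Hw); rewrite (Cmult_comm l) in K.
    exact K.
  - intros [_ H] eps He.
    destruct (H z (fun P K => K) (mkposreal eps He)) as [d K].
    exists d; split; [apply cond_pos|]; intros w Hw.
    rewrite (Cmult_comm l); exact (K w Hw).
Qed.

Lemma Cd_C_derive (f : C -> C) (z l : C) : Cd f z l -> C_derive f z = l.
Proof. intros H; apply is_C_derive_unique, Cd_is_derive, H. Qed.

Lemma hol_Cd (f : C -> C) (z : C) : holomorphic_at f z <-> Cd f z (C_derive f z).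
Proof.
  split.
  - intros H; apply Cd_is_derive, C_derive_correct; [exact (RtoC 0)|exact H].
  - intros H; exists (C_derive f z); apply Cd_is_derive, H.
Qed.

Lemma Cd_hol (f : C -> C) (z l : C) : Cd f z l -> holomorphic_at f z.
Proof. intros H; exists l; apply Cd_is_derive, H. Qed.

Lemma Cd_unique (f : C -> C) (z a b : C) : Cd f z a -> Cd f z b -> a = b.
Proof. intros Ha Hb; rewrite <- (Cd_C_derive _ _ _ Ha); apply Cd_C_derive, Hb. Qed.

Lemma hol_cont (f : C -> C) (z : C) : holomorphic_at f z -> Ccont f z.
Proof. intros H; apply hol_Cd in H; eapply Cd_cont, H. Qed.

Lemma hol_ext_near (f g : C -> C) (z : C) :
  near z (fun w => f w = g w) -> holomorphic_at f z -> holomorphic_at g z.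
Proof. intros H Hf; apply hol_Cd in Hf; eapply Cd_hol, Cd_ext_near; eauto. Qed.

Lemma C_derive_ext_near (f g : C -> C) (z : C) :
  near z (fun w => f w = g w) -> holomorphic_at f z -> C_derive f z = C_derive g z.
Proof.
  intros H Hf; apply hol_Cd in Hf; symmetry; eapply Cd_C_derive, Cd_ext_near; eauto.
Qed.

Lemma hol_const (c z : C) : holomorphic_at (fun _ => c) z.
Proof. eapply Cd_hol, Cd_const. Qed.
Lemma hol_id (z : C) : holomorphic_at (fun w => w) z.
Proof. eapply Cd_hol, Cd_id. Qed.
Lemma hol_plus (f g : C -> C) (z : C) :
  holomorphic_at f z -> holomorphic_at g z -> holomorphic_at (fun w => f w + g w)%C z.
Proof. intros Hf%hol_Cd Hg%hol_Cd; eapply Cd_hol, Cd_plus; eauto. Qed.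
Lemma hol_opp (f : C -> C) (z : C) :
  holomorphic_at f z -> holomorphic_at (fun w => - f w)%C z.
Proof. intros Hf%hol_Cd; eapply Cd_hol, Cd_opp; eauto. Qed.
Lemma hol_minus (f g : C -> C) (z : C) :
  holomorphic_at f z -> holomorphic_at g z -> holomorphic_at (fun w => f w - g w)%C z.
Proof. intros Hf%hol_Cd Hg%hol_Cd; eapply Cd_hol, Cd_minus; eauto. Qed.
Lemma hol_mult (f g : C -> C) (z : C) :
  holomorphic_at f z -> holomorphic_at g z -> holomorphic_at (fun w => f w * g w)%C z.
Proof. intros Hf%hol_Cd Hg%hol_Cd; eapply Cd_hol, Cd_mult; eauto. Qed.
Lemma hol_inv (f : C -> C) (z : C) :
  holomorphic_at f z -> f z <> 0 -> holomorphic_at (fun w => / f w)%C z.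
Proof. intros Hf%hol_Cd H0; eapply Cd_hol, Cd_inv; eauto. Qed.
Lemma hol_div (f g : C -> C) (z : C) :
  holomorphic_at f z -> holomorphic_at g z -> g z <> 0 ->
  holomorphic_at (fun w => f w / g w)%C z.
Proof. intros Hf%hol_Cd Hg%hol_Cd H0; eapply Cd_hol, Cd_div; eauto. Qed.
Lemma hol_pow (f : C -> C) (z : C) (n : nat) :
  holomorphic_at f z -> holomorphic_at (fun w => f w ^ n)%C z.
Proof. intros Hf%hol_Cd; eapply Cd_hol, Cd_pow; eauto. Qed.
Lemma hol_comp (f g : C -> C) (z : C) :
  holomorphic_at f z -> holomorphic_at g (f z) -> holomorphic_at (fun w => g (f w)) z.
Proof. intros Hf%hol_Cd Hg%hol_Cd; eapply Cd_hol, Cd_comp; eauto. Qed.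

(** * Goursat's theorem *)

Notation CR := C_R_CompleteNormedModule.

Definition seg (a b : C) (s : R) : C := (a + s * (b - a))%C.

Definition sint (f : C -> C) (a b : C) : C :=
  RInt (V := CR) (fun s => ((b - a) * f (seg a b s))%C) 0 1.

Definition contseg (f : C -> C) (a b : C) : Prop :=
  forall s, 0 <= s <= 1 -> Ccont f (seg a b s).

Lemma C_R_norm (z : C) : @norm R_AbsRing CR z = Cmod z.
Proof.
  destruct z as [x y]; change (sqrt (Rabs x ^ 2 + Rabs y ^ 2) = sqrt (x ^ 2 + y ^ 2)).
  rewrite !pow2_abs; reflexivity.
Qed.

Lemma seg_diff (a b : C) (s r : R) : (seg a b s - seg a b r)%C = (RtoC (s - r) * (b - a))%C.
Proof. unfold seg; rewrite RtoC_minus; ring. Qed.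

Lemma continuous_path (f : C -> C) (a b : C) (s : R) :
  Ccont f (seg a b s) -> continuous (U := CR) (fun s : R => f (seg a b s)) s.
Proof.
  intros Hf; apply filterlim_locally; intros eps.
  destruct (Hf eps (cond_pos eps)) as [d [Hd H]].
  assert (HL : 0 < Cmod (b - a)%C + 1) by (pose proof (Cmod_ge_0 (b - a)%C); lra).
  assert (Hd' : 0 < d / (Cmod (b - a)%C + 1)) by (apply Rdiv_lt_0_compat; auto).
  exists (mkposreal _ Hd'); intros r Hr.
  apply C_NormedModule_mixin_compat1, H.
  rewrite seg_diff, Cmod_mult, Cmod_R.
  assert (K : Rabs (r - s) < d / (Cmod (b - a)%C + 1)) by exact Hr.
  apply Rlt_div_r in K; auto.
  pose proof (Rabs_pos (r - s)); nra.
Qed.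

Lemma continuous_path_scal (f : C -> C) (a b k : C) (s : R) :
  Ccont f (seg a b s) -> continuous (U := CR) (fun s : R => (k * f (seg a b s))%C) s.
Proof.
  intros H; apply (continuous_path (fun w => k * f w)%C).
  apply Ccont_mult; auto; apply Ccont_const.
Qed.

Lemma sint_ex (f : C -> C) (a b : C) : contseg f a b ->
  ex_RInt (V := CR) (fun s => ((b - a) * f (seg a b s))%C) 0 1.
Proof.
  intros H; apply (ex_RInt_continuous (V := CR)); intros s Hs.
  rewrite Rmin_left, Rmax_right in Hs by lra; apply continuous_path_scal; auto.
Qed.

Lemma sint_ext (f g : C -> C) (a b : C) :
  (forall s, 0 <= s <= 1 -> f (seg a b s) = g (seg a b s)) -> sint f a b = sint g a b.
Proof.
  intros H; unfold sint; apply (RInt_ext (V := CR)); intros s Hs.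
  rewrite Rmin_left, Rmax_right in Hs by lra; rewrite H; [reflexivity|lra].
Qed.

Lemma sint_plus (f g : C -> C) (a b : C) : contseg f a b -> contseg g a b ->
  sint (fun w => f w + g w)%C a b = (sint f a b + sint g a b)%C.
Proof.
  intros Hf Hg; unfold sint.
  transitivity (RInt (V := CR) (fun s => plus ((b - a) * f (seg a b s))%C ((b - a) * g (seg a b s))%C) 0 1).
  - apply (RInt_ext (V := CR)); intros s _; simpl; change plus with Cplus; ring.
  - apply (RInt_plus (V := CR)); apply sint_ex; auto.
Qed.

Lemma sint_scal (f : C -> C) (a b k : C) : contseg f a b ->
  sint (fun w => k * f w)%C a b = (k * sint f a b)%C.
Proof.
  intros Hf.
  (* Linearity of the integral over the reals gives real scalars. Multiplication by [Ci] is done on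
     the two components, and a general [k] is assembled from its real and imaginary parts. *)
  assert (K : forall r : R, forall h, contseg h a b ->
     sint (fun w => RtoC r * h w)%C a b = (RtoC r * sint h a b)%C).
  { intros r h Hh; unfold sint; rewrite <- scal_R_Cmult.
    rewrite <- (RInt_scal (V := CR)) by (apply sint_ex; auto).
    apply (RInt_ext (V := CR)); intros s _; simpl; rewrite scal_R_Cmult; simpl; ring. }
  assert (Ki : sint (fun w => Ci * f w)%C a b = (Ci * sint f a b)%C).
  { unfold sint.
    destruct (sint_ex f a b Hf) as [l Hl].
    rewrite (is_RInt_unique (V := CR) _ _ _ _ Hl).
    apply (is_RInt_unique (V := CR)).
    pose proof (is_RInt_fct_extend_fst _ _ _ _ Hl) as H1.
    pose proof (is_RInt_fct_extend_snd _ _ _ _ Hl) as H2.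
    replace (Ci * l)%C with (opp (snd l), fst l)
      by (destruct l; unfold Ci, Cmult, opp; simpl; f_equal; unfold opp; simpl; ring).
    apply (is_RInt_fct_extend_pair (U := R_NormedModule) (V := R_NormedModule)).
    - eapply is_RInt_ext; [|apply (is_RInt_opp (V := R_NormedModule)); exact H2].
      intros s _; unfold Ci, Cmult, opp; simpl; ring.
    - eapply is_RInt_ext; [|exact H1].
      intros s _; unfold Ci, Cmult; simpl; ring. }
  assert (Hi : contseg (fun w => Ci * f w)%C a b)
    by (intros s Hs; apply Ccont_mult; [apply Ccont_const|auto]).
  rewrite (sint_ext _ (fun w => RtoC (Re k) * f w + RtoC (Im k) * (Ci * f w))%C).
  - rewrite sint_plus.
    + rewrite !K, Ki; auto.
      destruct k as [x y]; simpl; unfold Ci, RtoC, Cmult, Cplus; simpl; f_equal; ring.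
    + intros s Hs; apply Ccont_mult; [apply Ccont_const|auto].
    + intros s Hs; apply Ccont_mult; [apply Ccont_const|auto].
  - intros s _; destruct k as [x y]; unfold Ci, RtoC, Cmult, Cplus; simpl; f_equal; ring.
Qed.

Lemma sint_opp (f : C -> C) (a b : C) : contseg f a b ->
  sint (fun w => - f w)%C a b = (- sint f a b)%C.
Proof.
  intros Hf; rewrite (sint_ext _ (fun w => RtoC (-1) * f w)%C) by (intros; ring).
  rewrite sint_scal by auto; ring.
Qed.

Lemma sint_bound (f : C -> C) (a b : C) (M : R) : contseg f a b ->
  (forall s, 0 <= s <= 1 -> Cmod (f (seg a b s)) <= M) ->
  Cmod (sint f a b) <= Cmod (b - a)%C * M.
Proof.
  intros Hf HM; unfold sint.
  pose proof (RInt_correct (V := CR) _ _ _ (sint_ex f a b Hf)) as H.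
  rewrite <- C_R_norm.
  replace (Cmod (b - a)%C * M) with ((1 - 0) * (Cmod (b - a)%C * M)) by ring.
  refine (norm_RInt_le_const (V := CR) _ 0 1 _ _ _ _ H); [lra|].
  intros s Hs; rewrite C_R_norm, Cmod_mult; apply Rmult_le_compat_l; auto using Cmod_ge_0.
Qed.

Lemma sint_FTC (F f : C -> C) (a b : C) :
  (forall s, 0 <= s <= 1 -> Cd F (seg a b s) (f (seg a b s))) -> contseg f a b ->
  sint f a b = (F b - F a)%C.
Proof.
  intros HF Hf; unfold sint; apply (is_RInt_unique (V := CR)).
  replace (F b - F a)%C with (minus (G := CR) (F (seg a b 1)) (F (seg a b 0))).
  2:{ change minus with Cminus; unfold seg.
      replace (a + 1 * (b - a))%C with b by ring.
      replace (a + 0 * (b - a))%C with a by ring; reflexivity. }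
  apply (is_RInt_derive (V := CR) (fun s => F (seg a b s))).
  - intros s Hs; rewrite Rmin_left, Rmax_right in Hs by lra.
    split; [apply is_linear_scal_l|].
    intros x Hx.
    assert (E : s = x) by exact (@is_filter_lim_locally_unique R_AbsRing R_NormedModule s x Hx).
    subst x; intros eps.
    set (L := Cmod (b - a)%C + 1).
    assert (HL : 0 < L) by (pose proof (Cmod_ge_0 (b - a)%C); unfold L; lra).
    assert (He : 0 < eps / L) by (apply Rdiv_lt_0_compat; [apply cond_pos|auto]).
    destruct (proj1 (Cd_spec _ _ _) (HF s Hs) _ He) as [d [Hd K]].
    assert (Hd' : 0 < d / L) by (apply Rdiv_lt_0_compat; auto).
    exists (mkposreal _ Hd'); intros r Hr.
    assert (Hr' : Rabs (r - s) < d / L) by exact Hr.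
    apply Rlt_div_r in Hr'; auto.
    assert (B : Cmod (seg a b r - seg a b s)%C <= Rabs (r - s) * L).
    { rewrite seg_diff, Cmod_mult, Cmod_R; apply Rmult_le_compat_l; [apply Rabs_pos|unfold L; lra]. }
    rewrite C_R_norm; change (norm (minus r s)) with (Rabs (r - s)).
    rewrite scal_R_Cmult.
    change (Cmod (F (seg a b r) - F (seg a b s) - RtoC (r - s) * ((b - a) * f (seg a b s)))%C
            <= eps * Rabs (r - s)).
    replace (F (seg a b r) - F (seg a b s) - RtoC (r - s) * ((b - a) * f (seg a b s)))%C
      with (F (seg a b r) - F (seg a b s) - f (seg a b s) * (seg a b r - seg a b s))%C
      by (rewrite seg_diff; ring).
    eapply Rle_trans; [apply K; lra|].
    eapply Rle_trans; [apply Rmult_le_compat_l; [lra|exact B]|].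
    apply Req_le; field; lra.
  - intros s Hs; rewrite Rmin_left, Rmax_right in Hs by lra; apply continuous_path_scal; auto.
Qed.

Lemma sint_split (f : C -> C) (a b : C) (k : R) : 0 <= k <= 1 -> contseg f a b ->
  sint f a b = (sint f a (seg a b k) + sint f (seg a b k) b)%C.
Proof.
  intros Hk Hf.
  set (g := fun s : R => ((b - a) * f (seg a b s))%C : CR).
  assert (Hg : forall x y, 0 <= x <= 1 -> 0 <= y <= 1 -> ex_RInt (V := CR) g x y).
  { intros x y Hx Hy; apply (ex_RInt_continuous (V := CR)); intros s Hs.
    apply continuous_path_scal, Hf.
    pose proof (Rmin_l x y); pose proof (Rmax_l x y); unfold Rmin, Rmax in *; destruct (Rle_dec x y); lra. }
  unfold sint at 1; fold g.
  rewrite <- (RInt_Chasles (V := CR) g 0 k 1) by (apply Hg; lra).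
  change (@plus CR) with Cplus; f_equal.
  - transitivity (RInt (V:=CR) g (k*0+0) (k*1+0)); [f_equal; ring|].
    rewrite <- (RInt_comp_lin (V := CR) g k 0 0 1) by (apply Hg; lra).
    apply (RInt_ext (V := CR)); intros s _; rewrite scal_R_Cmult; unfold g, seg; simpl.
    replace (a + RtoC (k * s + 0) * (b - a))%C with (a + s * (a + k * (b - a) - a))%C.
    + ring.
    + rewrite RtoC_plus, RtoC_mult; ring.
  - transitivity (RInt (V:=CR) g ((1 - k)*0+k) ((1 - k)*1+k)); [f_equal; ring|].
    rewrite <- (RInt_comp_lin (V := CR) g (1 - k) k 0 1) by (apply Hg; lra).
    apply (RInt_ext (V := CR)); intros s _; rewrite scal_R_Cmult; unfold g, seg; simpl.
    replace (a + RtoC ((1 - k) * s + k) * (b - a))%C with (a + k * (b - a) + s * (b - (a + k * (b - a))))%C.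
    + rewrite RtoC_minus; ring.
    + rewrite RtoC_plus, RtoC_mult, RtoC_minus; ring.
Qed.

Lemma sint_rev (f : C -> C) (a b : C) : contseg f a b -> sint f b a = (- sint f a b)%C.
Proof.
  intros Hf.
  set (g := fun s : R => ((b - a) * f (seg a b s))%C : CR).
  assert (Hg : ex_RInt (V := CR) g 0 1) by (apply sint_ex; auto).
  assert (E : RInt (V := CR) g ((-1) * 0 + 1) ((-1) * 1 + 1) = opp (RInt (V := CR) g 0 1)).
  { replace ((-1) * 0 + 1) with 1 by lra; replace ((-1) * 1 + 1) with 0 by lra.
    symmetry; apply (opp_RInt_swap (V := CR)); auto. }
  rewrite <- (RInt_comp_lin (V := CR) g (-1) 1 0 1) in E.
  - transitivity (opp (G := CR) (RInt (V := CR) g 0 1)); [|reflexivity].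
    rewrite <- E; apply (RInt_ext (V := CR)); intros s _; rewrite scal_R_Cmult; unfold g, seg; simpl.
    replace (a + RtoC ((-1) * s + 1) * (b - a))%C with (b + s * (a - b))%C.
    + ring.
    + rewrite RtoC_plus, RtoC_mult; ring.
  - replace ((-1) * 0 + 1) with 1 by lra; replace ((-1) * 1 + 1) with 0 by lra.
    apply ex_RInt_swap; auto.
Qed.

Definition convex (U : C -> Prop) : Prop :=
  forall a b, U a -> U b -> forall s, 0 <= s <= 1 -> U (seg a b s).

Definition opn (U : C -> Prop) : Prop := forall z, U z -> near z U.

Definition tri (f : C -> C) (a b c : C) : C := (sint f a b + sint f b c + sint f c a)%C.

Lemma contseg_convex (U : C -> Prop) (f : C -> C) (a b : C) :
  convex U -> (forall z, U z -> Ccont f z) -> U a -> U b -> contseg f a b.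
Proof. intros HU Hf Ha Hb s Hs; apply Hf, HU; auto. Qed.

Lemma seg_half (a b : C) : seg a b (1 / 2) = ((a + b) / 2)%C.
Proof. unfold seg; rewrite RtoC_div by lra; field. Qed.

Lemma pow_half_small (e : R) : 0 < e -> exists n, (1 / 2) ^ n < e.
Proof.
  intros He; destruct (pow_lt_1_zero (1/2)) with (y := e) as [N HN]; auto.
  - rewrite Rabs_pos_eq; lra.
  - exists N; specialize (HN N (le_n _)).
    rewrite Rabs_pos_eq in HN; auto; apply pow_le; lra.
Qed.

(** With such steps [x n - 2 * (1/2)^n] increases and [x n + 2 * (1/2)^n] decreases; the supremum of
    the former is the limit and comes with an explicit rate. *)
Lemma half_cauchy (x : nat -> R) :
  (forall n, Rabs (x (S n) - x n) <= (1 / 2) ^ n) ->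
  exists l, forall n, Rabs (x n - l) <= 2 * (1 / 2) ^ n.
Proof.
  intros H.
  assert (P : forall n, 0 <= (1 / 2) ^ n) by (intros; apply pow_le; lra).
  assert (I : forall n m, x n - 2 * (1/2)^n <= x (n + m)%nat - 2 * (1/2)^(n+m)
              /\ x (n + m)%nat + 2 * (1/2)^(n+m) <= x n + 2 * (1/2)^n).
  { intros n m; induction m as [|m [I1 I2]]; [rewrite Nat.add_0_r; lra|].
    rewrite Nat.add_succ_r; simpl pow.
    pose proof (H (n + m)%nat) as K; apply Rabs_le_between in K; simpl in K.
    pose proof (P (n + m)%nat); lra. }
  assert (J : forall n m, x n - 2 * (1/2)^n <= x m + 2 * (1/2)^m).
  { intros n m; destruct (Nat.le_ge_cases n m) as [L|L];
    [replace m with (n + (m - n))%nat by lia; destruct (I n (m - n)%nat)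
    |replace n with (m + (n - m))%nat by lia; destruct (I m (n - m)%nat)];
    pose proof (P (n + (m - n))%nat); pose proof (P (m + (n - m))%nat); lra. }
  destruct (completeness (fun y => exists n, y = x n - 2 * (1/2)^n)) as [l [L1 L2]].
  - exists (x O + 2 * (1/2)^0); intros y [n ->]; apply J.
  - exists (x O - 2 * (1/2)^0); exists O; reflexivity.
  - exists l; intros n; apply Rabs_le_between.
    assert (x n - 2 * (1/2)^n <= l) by (apply L1; eauto).
    assert (l <= x n + 2 * (1/2)^n) by (apply L2; intros y [m ->]; apply J).
    lra.
Qed.

Section Goursat.
Variables (U : C -> Prop) (f : C -> C) (a b c : C).
Hypotheses (HU : convex U) (Hf : forall z, U z -> holomorphic_at f z)
  (Ha : U a) (Hb : U b) (Hc : U c).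

(** A complex number carries a pair of affine coordinates relative to [a], [b], [c]. Bisection thus
    takes place in one reference triangle, and degenerate triangles are not exceptional. *)
Definition baryc (w : C) : C := (a + Re w * (b - a) + Im w * (c - a))%C.
Definition simplex (w : C) : Prop := 0 <= Re w /\ 0 <= Im w /\ Re w + Im w <= 1.
(** The size [k] is signed: the middle piece of a subdivision is inverted and has negative [k]. *)
Definition subtri (w : C) (k : R) : C :=
  tri f (baryc w) (baryc (w + k)) (baryc (w + k * Ci)).

Lemma simplex_U (w : C) : simplex w -> U (baryc w).
Proof.
  intros [H1 [H2 H3]]; unfold baryc.
  destruct (Req_dec (Re w + Im w) 0) as [E|E].
  - replace (Re w) with 0 by lra; replace (Im w) with 0 by lra.
    replace (a + 0 * (b - a) + 0 * (c - a))%C with a by ring; auto.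
  - assert (E' : 0 < Re w + Im w) by (destruct (Rle_lt_or_eq_dec 0 (Re w + Im w)); lra).
    set (s := Re w + Im w) in *.
    replace (a + Re w * (b - a) + Im w * (c - a))%C with (seg a (seg b c (Im w / s)) s).
    + apply HU; auto; [|split; lra].
      apply HU; auto; split; [apply Rdiv_le_0_compat; auto|].
      apply Rle_div_l; unfold s in *; lra.
    + unfold seg; rewrite RtoC_div by auto; unfold s; rewrite RtoC_plus; field.
      rewrite <- RtoC_plus; fold s; intros K; apply RtoC_inj in K; auto.
Qed.

Lemma simplex_mid (v w : C) : simplex v -> simplex w -> simplex ((v + w) / 2)%C.
Proof.
  intros [A1 [A2 A3]] [B1 [B2 B3]]; unfold simplex.
  replace ((v + w) / 2)%C with (RtoC (/ 2) * (v + w))%C by (rewrite RtoC_inv by lra; field).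
  rewrite re_scal_l, im_scal_l, re_plus, im_plus; lra.
Qed.

Definition valid (w : C) (k : R) : Prop :=
  simplex w /\ simplex (w + k)%C /\ simplex (w + k * Ci)%C.

(** Each inner edge is traversed twice in opposite directions, so only the halves of the outer edges
    remain. *)
Lemma subtri_quarter (w : C) (k : R) : valid w k ->
  (subtri w k = subtri w (k / 2) + subtri (w + k / 2) (k / 2)
    + subtri (w + k / 2 * Ci) (k / 2) + subtri (w + k / 2 * (1 + Ci)) (- (k / 2)))%C.
Proof.
  intros [V1 [V2 V3]].
  assert (M : forall v x, baryc ((v + x) / 2) = ((baryc v + baryc x) / 2)%C).
  { intros v x; unfold baryc.
    replace ((v + x) / 2)%C with (RtoC (/ 2) * (v + x))%C by (rewrite RtoC_inv by lra; field).
    rewrite re_scal_l, im_scal_l, re_plus, im_plus, !RtoC_mult, !RtoC_plus, RtoC_inv by lra; field. }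
  set (B := (w + k)%C) in *; set (D := (w + k * Ci)%C) in *.
  unfold subtri; fold B D.
  replace (w + RtoC (k / 2))%C with ((w + B) / 2)%C by (unfold B, D; rewrite RtoC_div by lra; field).
  replace (w + k / 2)%C with ((w + B) / 2)%C by (unfold B, D; field).
  replace ((w + B) / 2 + RtoC (k / 2))%C with B by (unfold B, D; rewrite RtoC_div by lra; field).
  replace (w + RtoC (k / 2) * Ci)%C with ((w + D) / 2)%C by (unfold B, D; rewrite RtoC_div by lra; field).
  replace (w + k / 2 * Ci)%C with ((w + D) / 2)%C by (unfold B, D; field).
  replace ((w + D) / 2 + RtoC (k / 2))%C with ((B + D) / 2)%C
    by (unfold B, D; rewrite RtoC_div by lra; field).
  replace ((w + B) / 2 + RtoC (k / 2) * Ci)%C with ((B + D) / 2)%C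
    by (unfold B, D; rewrite RtoC_div by lra; field).
  replace ((w + D) / 2 + RtoC (k / 2) * Ci)%C with D
    by (unfold B, D; rewrite RtoC_div by lra; field).
  replace (w + k / 2 * (1 + Ci))%C with ((B + D) / 2)%C by (unfold B, D; field).
  replace ((B + D) / 2 + RtoC (- (k / 2)))%C with ((w + D) / 2)%C
    by (unfold B, D; rewrite RtoC_opp, RtoC_div by lra; field).
  replace ((B + D) / 2 + RtoC (- (k / 2)) * Ci)%C with ((w + B) / 2)%C
    by (unfold B, D; rewrite RtoC_opp, RtoC_div by lra; field).
  assert (Cf : forall v x, simplex v -> simplex x -> contseg f (baryc v) (baryc x)).
  { intros v x Sv Sx; apply (contseg_convex U); auto using simplex_U.
    intros z Hz; apply hol_cont; auto. }
  assert (Sp : forall v x, simplex v -> simplex x ->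
    sint f (baryc v) (baryc x) = (sint f (baryc v) (baryc ((v + x) / 2))
       + sint f (baryc ((v + x) / 2)) (baryc x))%C).
  { intros v x Sv Sx; rewrite M, <- seg_half; apply sint_split; auto; lra. }
  unfold tri.
  rewrite (Sp w B), (Sp B D), (Sp D w) by auto.
  replace ((D + w) / 2)%C with ((w + D) / 2)%C by (f_equal; ring).
  assert (SAB := simplex_mid w B V1 V2); assert (SBD := simplex_mid B D V2 V3);
  assert (SAD := simplex_mid w D V1 V3).
  rewrite (sint_rev f (baryc ((w + D) / 2)) (baryc ((B + D) / 2))) by auto.
  rewrite (sint_rev f (baryc ((w + B) / 2)) (baryc ((w + D) / 2))) by auto.
  rewrite (sint_rev f (baryc ((B + D) / 2)) (baryc ((w + B) / 2))) by auto.
  ring.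
Qed.

Definition child (w : C) (k : R) (w' : C) (k' : R) : Prop :=
  valid w' k' /\ Rabs k' = Rabs k / 2 /\
  Rabs (Re w' - Re w) <= Rabs k / 2 /\ Rabs (Im w' - Im w) <= Rabs k / 2 /\
  Cmod (subtri w k) / 4 <= Cmod (subtri w' k').

Lemma child_ex (w : C) (k : R) : valid w k -> exists w' k', child w k w' k'.
Proof.
  intros V; pose proof (subtri_quarter w k V) as Q; destruct V as [V1 [V2 V3]].
  set (t1 := subtri w (k / 2)) in *; set (t2 := subtri (w + k / 2) (k / 2)) in *.
  set (t3 := subtri (w + k / 2 * Ci) (k / 2)) in *;
  set (t4 := subtri (w + k / 2 * (1 + Ci)) (- (k / 2))) in *.
  assert (B : Cmod (subtri w k) <= Cmod t1 + Cmod t2 + Cmod t3 + Cmod t4).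
  { rewrite Q; pose proof (Cmod_triangle (t1 + t2 + t3) t4);
    pose proof (Cmod_triangle (t1 + t2) t3); pose proof (Cmod_triangle t1 t2); lra. }
  assert (R1 : Rabs (k / 2) = Rabs k / 2)
    by (unfold Rdiv; rewrite Rabs_mult, (Rabs_pos_eq (/ 2)) by lra; reflexivity).
  assert (P0 : 0 <= Rabs k / 2) by (pose proof (Rabs_pos k); lra).
  assert (E2 : (w + k / 2)%C = (w + RtoC (k / 2))%C) by (rewrite RtoC_div by lra; reflexivity).
  assert (E3 : (w + k / 2 * Ci)%C = (w + RtoC (k / 2) * Ci)%C)
    by (rewrite RtoC_div by lra; reflexivity).
  assert (E4 : (w + k / 2 * (1 + Ci))%C = (w + RtoC (k / 2) * (1 + Ci))%C)
    by (rewrite RtoC_div by lra; reflexivity).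
  assert (S : forall x, simplex x <-> 0 <= Re x /\ 0 <= Im x /\ Re x + Im x <= 1) by reflexivity.
  rewrite S in V1, V2, V3; clear S.
  destruct w as [wx wy]; unfold Ci, RtoC, Cplus, Cmult in V1, V2, V3; simpl in V1, V2, V3.
  destruct (Rle_dec (Cmod (subtri (wx, wy) k) / 4) (Cmod t1));
  [|destruct (Rle_dec (Cmod (subtri (wx, wy) k) / 4) (Cmod t2));
  [|destruct (Rle_dec (Cmod (subtri (wx, wy) k) / 4) (Cmod t3));
  [|destruct (Rle_dec (Cmod (subtri (wx, wy) k) / 4) (Cmod t4)); [|exfalso; lra]]]].
  - exists (wx, wy), (k / 2); repeat split; auto; unfold Ci, RtoC, Cplus, Cmult; simpl; try lra;
    rewrite Rminus_diag, Rabs_R0; auto.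
  - exists ((wx, wy) + k / 2)%C, (k / 2); repeat split; auto; rewrite ?E2;
    unfold Ci, RtoC, Cplus, Cmult; simpl; try lra.
    + replace (wx + k / 2 - wx) with (k / 2) by ring; lra.
    + replace (wy + 0 - wy) with 0 by ring; rewrite Rabs_R0; auto.
  - exists ((wx, wy) + k / 2 * Ci)%C, (k / 2); repeat split; auto; rewrite ?E3;
    unfold Ci, RtoC, Cplus, Cmult; simpl; try lra.
    + match goal with |- Rabs ?x <= _ => replace x with 0 by ring end; rewrite Rabs_R0; auto.
    + match goal with |- Rabs ?x <= _ => replace x with (k / 2) by field end; lra.
  - exists ((wx, wy) + k / 2 * (1 + Ci))%C, (- (k / 2)); repeat split; auto; rewrite ?E4;
    unfold Ci, RtoC, Cplus, Cmult; simpl; try lra.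
    + rewrite Rabs_Ropp; lra.
    + match goal with |- Rabs ?x <= _ => replace x with (k / 2) by field end; lra.
    + match goal with |- Rabs ?x <= _ => replace x with (k / 2) by field end; lra.
Qed.

Definition next (st : C * R) : C * R :=
  epsilon (inhabits st) (fun st' => child (fst st) (snd st) (fst st') (snd st')).

Fixpoint nest (n : nat) : C * R :=
  match n with O => (RtoC 0, 1) | S m => next (nest m) end.

Lemma nest_spec (n : nat) :
  valid (fst (nest n)) (snd (nest n)) /\ Rabs (snd (nest n)) = (1 / 2) ^ n /\
  child (fst (nest n)) (snd (nest n)) (fst (nest (S n))) (snd (nest (S n))).
Proof.
  assert (N : forall st, valid (fst st) (snd st) ->
    child (fst st) (snd st) (fst (next st)) (snd (next st))).
  { intros st V; unfold next.
    apply (epsilon_spec (inhabits st)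
             (fun st' => child (fst st) (snd st) (fst st') (snd st'))).
    destruct (child_ex _ _ V) as [w' [k' H]]; exists (w', k'); exact H. }
  induction n as [|n [V [E K]]].
  - assert (V : valid (fst (nest 0)) (snd (nest 0)))
      by (repeat split; unfold Ci, RtoC, Cplus, Cmult; simpl; lra).
    split; [exact V|split; [simpl; apply Rabs_R1|apply N; exact V]].
  - destruct K as [V' [E' K]]; split; [exact V'|split].
    + rewrite E', E; simpl; field.
    + apply N; exact V'.
Qed.

Lemma nest_size (n : nat) :
  Cmod (tri f a b c) * ((1 / 2) ^ n * (1 / 2) ^ n) <= Cmod (subtri (fst (nest n)) (snd (nest n))).
Proof.
  induction n as [|n IH].
  - simpl; unfold subtri.
    replace (baryc 0) with a by (unfold baryc; simpl; ring).
    replace (baryc (0 + 1)) with b.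
    2:{ unfold baryc; rewrite <- RtoC_plus, re_RtoC, im_RtoC, Rplus_0_l; ring. }
    replace (baryc (0 + 1 * Ci)) with c.
    2:{ unfold baryc, Ci, RtoC, Cplus, Cmult; simpl; destruct a, b, c; simpl; f_equal; ring. }
    lra.
  - destruct (nest_spec n) as [_ [_ [_ [_ [_ [_ K]]]]]].
    eapply Rle_trans; [|exact K].
    simpl pow; lra.
Qed.

Lemma tri_affine (p k l x y z : C) : tri (fun w => k + l * (w - p))%C x y z = 0.
Proof.
  assert (H : forall x y, sint (fun w => k + l * (w - p))%C x y =
     ((fun w => k * w + l * (w - p) * (w - p) / 2) y - (fun w => k * w + l * (w - p) * (w - p) / 2) x)%C).
  { intros u v.
    apply (sint_FTC (fun w => k * w + l * (w - p) * (w - p) / 2)%C (fun w => k + l * (w - p))%C).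
    - intros s _; set (q := seg u v s).
      assert (D1 : Cd (fun w => w - p)%C q 1)
        by (eapply Cd_eqn; [apply Cd_minus; [apply Cd_id|apply Cd_const]|ring]).
      eapply Cd_eqn.
      + apply Cd_plus; [apply Cd_mult; [apply Cd_const|apply Cd_id]|].
        unfold Cdiv; apply Cd_mult; [|apply Cd_const].
        apply Cd_mult; [|exact D1].
        apply Cd_mult; [apply Cd_const|exact D1].
      + cbv beta; field.
    - intros s _; apply Ccont_plus; [apply Ccont_const|].
      apply Ccont_mult; [apply Ccont_const|]; apply Ccont_minus; [apply Ccont_id|apply Ccont_const]. }
  unfold tri; rewrite !H; cbv beta; ring.
Qed.

Lemma seg_ball (p x y : C) (r s : R) : 0 <= s <= 1 ->
  Cmod (x - p)%C <= r -> Cmod (y - p)%C <= r -> Cmod (seg x y s - p)%C <= r.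
Proof.
  intros Hs Hx Hy.
  replace (seg x y s - p)%C with (RtoC (1 - s) * (x - p) + RtoC s * (y - p))%C
    by (unfold seg; rewrite RtoC_minus; ring).
  eapply Rle_trans; [apply Cmod_triangle|]; rewrite !Cmod_mult, !Cmod_R, !Rabs_pos_eq by lra.
  nra.
Qed.

Theorem Goursat : tri f a b c = 0.
Proof.
  destruct (half_cauchy (fun n => Re (fst (nest n)))) as [lx Hx].
  { intros n; destruct (nest_spec n) as [_ [E [_ [_ [K _]]]]].
    pose proof (Rabs_pos (snd (nest n))); lra. }
  destruct (half_cauchy (fun n => Im (fst (nest n)))) as [ly Hy].
  { intros n; destruct (nest_spec n) as [_ [E [_ [_ [_ [K _]]]]]].
    pose proof (Rabs_pos (snd (nest n))); lra. }
  assert (Hl : simplex (lx, ly)).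
  { assert (L : forall e, 0 < e -> - e <= lx /\ - e <= ly /\ lx + ly <= 1 + e).
    { intros e He; destruct (pow_half_small (e / 4)) as [n Hn]; [lra|].
      destruct (nest_spec n) as [[V _] _].
      specialize (Hx n); specialize (Hy n); apply Rabs_le_between in Hx, Hy.
      unfold simplex in V; lra. }
    unfold simplex; simpl; split; [|split]; apply Rnot_lt_le; intros K.
    - destruct (L (- lx / 2)); lra.
    - destruct (L (- ly / 2)) as [_ [? _]]; lra.
    - destruct (L ((lx + ly - 1) / 2)) as [_ [_ ?]]; lra. }
  set (p := baryc (lx, ly)).
  pose proof (Hf p (simplex_U _ Hl)) as Hp; apply hol_Cd in Hp.
  set (f' := C_derive f p) in *.
  set (D := Cmod (b - a)%C + Cmod (c - a)%C).
  assert (HD : 0 <= D) by (unfold D; pose proof (Cmod_ge_0 (b - a)%C); pose proof (Cmod_ge_0 (c - a)%C); lra).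
  (* At stage [n] the sides have length at most [D * h] and stay within [3 * D * h] of [p]: two [h]
     from the rate of convergence of the corners, one from the size of the triangle. Three sides
     with error [eps * (3 * D * h)] give [9 * D * D * eps * h * h], to be compared with the lower
     bound [Cmod (tri f a b c) * (h * h)]. *)
  assert (Main : forall eps, 0 < eps -> Cmod (tri f a b c) <= eps * (9 * D * D)).
  { intros eps He.
    destruct (proj1 (Cd_spec _ _ _) Hp eps He) as [d [Hd K]].
    destruct (pow_half_small (d / (3 * D + 1))) as [n Hn]; [apply Rdiv_lt_0_compat; lra|].
    set (h := (1 / 2) ^ n) in *.
    assert (Hh : 0 < h) by (apply pow_lt; lra).
    assert (Hn' : 3 * D * h < d).
    { apply Rlt_div_r in Hn; [|lra]; nra. }
    destruct (nest_spec n) as [[V1 [V2 V3]] [E _]].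
    pose proof (nest_size n) as Sz; fold h in Sz.
    set (w := fst (nest n)) in *; set (k := snd (nest n)) in *.
    specialize (Hx n); specialize (Hy n); fold w in Hx, Hy; fold h in Hx, Hy, E.
    assert (Bd : forall v, Rabs (Re v - lx) <= 3 * h -> Rabs (Im v - ly) <= 3 * h ->
        Cmod (baryc v - p)%C <= 3 * D * h).
    { intros v B1 B2; unfold p, baryc.
      replace (a + Re v * (b - a) + Im v * (c - a) -
           (a + Re (lx, ly) * (b - a) + Im (lx, ly) * (c - a)))%C
        with (RtoC (Re v - lx) * (b - a) + RtoC (Im v - ly) * (c - a))%C
        by (rewrite !RtoC_minus; simpl; ring).
      eapply Rle_trans; [apply Cmod_triangle|]; rewrite !Cmod_mult, !Cmod_R.
      unfold D; pose proof (Cmod_ge_0 (b - a)%C); pose proof (Cmod_ge_0 (c - a)%C); nra. }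
    assert (Ck : Rabs k <= h) by lra.
    assert (B1 : Cmod (baryc w - p)%C <= 3 * D * h) by (apply Bd; lra).
    assert (B2 : Cmod (baryc (w + k) - p)%C <= 3 * D * h).
    { apply Bd; rewrite ?re_plus, ?im_plus, ?re_RtoC, ?im_RtoC.
      - replace (Re w + k - lx) with ((Re w - lx) + k) by ring.
        pose proof (Rabs_triang (Re w - lx) k); lra.
      - rewrite Rplus_0_r; lra. }
    assert (B3 : Cmod (baryc (w + k * Ci) - p)%C <= 3 * D * h).
    { apply Bd; rewrite ?re_plus, ?im_plus, ?re_scal_l, ?im_scal_l; simpl.
      - rewrite Rmult_0_r, Rplus_0_r; lra.
      - replace (Im w + k * 1 - ly) with ((Im w - ly) + k) by ring.
        pose proof (Rabs_triang (Im w - ly) k); lra. }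
    set (err := fun z => (f z - (f p + f' * (z - p)))%C).
    assert (Caff : forall z, Ccont (fun z => f p + f' * (z - p))%C z).
    { intros z; apply Ccont_plus; [apply Ccont_const|].
      apply Ccont_mult; [apply Ccont_const|]; apply Ccont_minus; [apply Ccont_id|apply Ccont_const]. }
    assert (Side : forall x y L, simplex x -> simplex y -> Cmod (baryc x - p)%C <= 3 * D * h ->
       Cmod (baryc y - p)%C <= 3 * D * h -> Cmod (baryc y - baryc x)%C <= L ->
       Cmod (sint f (baryc x) (baryc y) - sint (fun z => f p + f' * (z - p))%C (baryc x) (baryc y))%C
         <= L * (eps * (3 * D * h))).
    { intros x y L Sx Sy Bx By BL.
      assert (Cf : contseg f (baryc x) (baryc y)).
      { apply (contseg_convex U); auto using simplex_U; intros; apply hol_cont; auto. }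
      assert (Ca : contseg (fun z => f p + f' * (z - p))%C (baryc x) (baryc y))
        by (intros s _; apply Caff).
      assert (Ca' : contseg (fun z => - (f p + f' * (z - p)))%C (baryc x) (baryc y))
        by (intros s _; apply Ccont_opp, Caff).
      unfold Cminus at 1; rewrite <- sint_opp, <- sint_plus by auto.
      eapply Rle_trans; [apply (sint_bound _ _ _ (eps * (3 * D * h)))|].
      - intros s Hs; apply Ccont_plus; auto.
      - intros s Hs.
        replace (f (seg (baryc x) (baryc y) s) + - (f p + f' * (seg (baryc x) (baryc y) s - p)))%C
        with (f (seg (baryc x) (baryc y) s) - f p - f' * (seg (baryc x) (baryc y) s - p))%C by ring.
        pose proof (seg_ball p _ _ _ s Hs Bx By) as BB.
        eapply Rle_trans; [apply K; lra|].
        apply Rmult_le_compat_l; lra.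
      - apply Rmult_le_compat_r; auto.
        apply Rmult_le_pos; [lra|]; nra. }
    assert (L1 : Cmod (baryc (w + k) - baryc w)%C <= D * h).
    { replace (baryc (w + k) - baryc w)%C with (RtoC k * (b - a))%C
        by (unfold baryc; rewrite re_plus, im_plus, re_RtoC, im_RtoC, !RtoC_plus; ring).
      rewrite Cmod_mult, Cmod_R; unfold D; pose proof (Cmod_ge_0 (b - a)%C); pose proof (Cmod_ge_0 (c - a)%C); nra. }
    assert (L3 : Cmod (baryc w - baryc (w + k * Ci))%C <= D * h).
    { replace (baryc w - baryc (w + k * Ci))%C with (- (RtoC k * (c - a)))%C
        by (unfold baryc; rewrite re_plus, im_plus, re_scal_l, im_scal_l, !RtoC_plus, !RtoC_mult; simpl; ring).
      rewrite Cmod_opp, Cmod_mult, Cmod_R; unfold D; pose proof (Cmod_ge_0 (b - a)%C); pose proof (Cmod_ge_0 (c - a)%C); nra. }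
    assert (L2 : Cmod (baryc (w + k * Ci) - baryc (w + k))%C <= D * h).
    { replace (baryc (w + k * Ci) - baryc (w + k))%C with (RtoC k * (c - a) + RtoC (- k) * (b - a))%C
        by (unfold baryc; rewrite !re_plus, !im_plus, re_scal_l, im_scal_l, re_RtoC, im_RtoC,
             !RtoC_plus, !RtoC_mult, RtoC_opp; simpl; ring).
      eapply Rle_trans; [apply Cmod_triangle|]; rewrite !Cmod_mult, !Cmod_R, Rabs_Ropp.
      unfold D; pose proof (Cmod_ge_0 (b - a)%C); pose proof (Cmod_ge_0 (c - a)%C); nra. }
    pose proof (Side _ _ _ V1 V2 B1 B2 L1) as S1.
    pose proof (Side _ _ _ V2 V3 B2 B3 L2) as S2.
    pose proof (Side _ _ _ V3 V1 B3 B1 L3) as S3.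
    assert (T : Cmod (subtri w k) <= 3 * (D * h * (eps * (3 * D * h)))).
    { unfold subtri.
      set (A := (fun z => f p + f' * (z - p))%C) in *.
      pose proof (tri_affine p (f p) f' (baryc w) (baryc (w + k)) (baryc (w + k * Ci))) as TA.
      fold A in TA.
      replace (tri f (baryc w) (baryc (w + k)) (baryc (w + k * Ci))) with
        ((sint f (baryc w) (baryc (w + k)) - sint A (baryc w) (baryc (w + k)))
         + (sint f (baryc (w + k)) (baryc (w + k * Ci)) - sint A (baryc (w + k)) (baryc (w + k * Ci)))
         + (sint f (baryc (w + k * Ci)) (baryc w) - sint A (baryc (w + k * Ci)) (baryc w))
         + tri A (baryc w) (baryc (w + k)) (baryc (w + k * Ci)))%C by (unfold tri; ring).
      rewrite TA, Cplus_0_r.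
      eapply Rle_trans; [apply Cmod_triangle|].
      pose proof (Cmod_triangle (sint f (baryc w) (baryc (w + k)) - sint A (baryc w) (baryc (w + k)))
        (sint f (baryc (w + k)) (baryc (w + k * Ci)) - sint A (baryc (w + k)) (baryc (w + k * Ci)))).
      lra. }
    assert (Hhh : 0 < h * h) by nra.
    apply (Rmult_le_reg_r (h * h)); auto.
    nra. }
  apply Cmod_eq_0, Rle_antisym; [|apply Cmod_ge_0].
  apply Rnot_lt_le; intros K.
  assert (P : 0 < 9 * D * D + 1) by nra.
  specialize (Main (Cmod (tri f a b c) / (2 * (9 * D * D + 1)))).
  assert (Q : 0 < Cmod (tri f a b c) / (2 * (9 * D * D + 1))) by (apply Rdiv_lt_0_compat; lra).
  specialize (Main Q).
  assert (Z : Cmod (tri f a b c) = Cmod (tri f a b c) / (2 * (9 * D * D + 1)) * (9 * D * D)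
     + Cmod (tri f a b c) / (2 * (9 * D * D + 1)) * (9 * D * D + 2)) by (field; lra).
  nra.
Qed.
End Goursat.

(** * Cauchy's theorem with an exceptional point; primitives on convex domains *)

Definition hull (a b c z : C) : Prop :=
  exists x y t : R, 0 <= x /\ 0 <= y /\ 0 <= t /\ x + y + t = 1 /\
    z = (x * a + y * b + t * c)%C.

Lemma hull_convex (a b c : C) : convex (hull a b c).
Proof.
  intros z w [x [y [t [X [Y [T [E ->]]]]]]] [x' [y' [t' [X' [Y' [T' [E' ->]]]]]]] s Hs.
  exists ((1 - s) * x + s * x'), ((1 - s) * y + s * y'), ((1 - s) * t + s * t').
  repeat split; try nra.
  unfold seg; rewrite !RtoC_plus, !RtoC_mult, !RtoC_minus; ring.
Qed.

Lemma hull_sub (U : C -> Prop) (a b c z : C) :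
  convex U -> U a -> U b -> U c -> hull a b c z -> U z.
Proof.
  intros HU Ha Hb Hc [x [y [t [X [Y [T [E ->]]]]]]].
  destruct (Req_dec (y + t) 0) as [K|K].
  - replace y with 0 by lra; replace t with 0 by lra; replace x with 1 by lra.
    replace (1 * a + 0 * b + 0 * c)%C with a by ring; auto.
  - assert (K' : 0 < y + t) by lra.
    replace (x * a + y * b + t * c)%C with (seg a (seg b c (t / (y + t))) (y + t)).
    + apply HU; auto; [|lra].
      apply HU; auto; split; [apply Rdiv_le_0_compat; lra|].
      apply Rle_div_l; lra.
    + replace x with (1 - (y + t)) by lra.
      unfold seg; rewrite RtoC_div by auto; rewrite !RtoC_minus, !RtoC_plus; field.
      rewrite <- RtoC_plus; intros K2; apply RtoC_inj in K2; auto.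
Qed.

Lemma tri_off_point (U : C -> Prop) (f : C -> C) (p a b c : C) :
  convex U -> (forall z, U z -> z <> p -> holomorphic_at f z) ->
  U a -> U b -> U c -> ~ hull a b c p -> tri f a b c = 0.
Proof.
  intros HU Hf Ha Hb Hc Hp; apply (Goursat (hull a b c)).
  - apply hull_convex.
  - intros z Hz; apply Hf; [apply (hull_sub U a b c); auto|].
    intro E0; subst; contradiction.
  - exists 1, 0, 0; repeat split; try lra; ring.
  - exists 0, 1, 0; repeat split; try lra; ring.
  - exists 0, 0, 1; repeat split; try lra; ring.
Qed.

Section Exceptional.
Variables (U : C -> Prop) (f : C -> C) (p : C).
Hypotheses (HU : convex U) (Cf : forall z, U z -> Ccont f z)
  (Hf : forall z, U z -> z <> p -> holomorphic_at f z).

Lemma U_contseg (a b : C) : U a -> U b -> contseg f a b.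
Proof. apply contseg_convex; auto. Qed.

(** Cut off a copy of the triangle at [p], scaled by [e]. The remaining quadrilateral splits into
    two triangles avoiding [p], where Goursat applies; the small copy has perimeter of order [e]
    while [f] is bounded near [p]. *)
Lemma tri_vertex (b c : C) : U p -> U b -> U c -> tri f p b c = 0.
Proof.
  intros Hp Hb Hc.
  (* If [p] lies on the opposite side, the triangle is degenerate and its edges cancel. *)
  destruct (classic (exists k, 0 <= k <= 1 /\ p = seg b c k)) as [[k [Hk E]]|N].
  - unfold tri.
    rewrite (sint_split f b c k), <- E by auto using U_contseg.
    rewrite (sint_rev f b p), (sint_rev f p c) by auto using U_contseg; ring.
  (* Otherwise [p] is an extreme point: it is a convex combination of [p], [b], [c] only with full
     weight on itself. This keeps it out of the two large pieces. *)
  - assert (Off : forall x y t : R, 0 <= x < 1 -> 0 <= y -> 0 <= t -> x + y + t = 1 ->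
              p <> (x * p + y * b + t * c)%C).
    { intros x y t Hx Hy Ht E K; apply N; exists (t / (1 - x)); split.
      - split; [apply Rdiv_le_0_compat; lra|apply Rle_div_l; lra].
      - assert (D : RtoC (1 - x) <> 0) by (intros Z; apply RtoC_inj in Z; lra).
        assert (K' : (RtoC (1 - x) * p)%C = (y * b + t * c)%C).
        { rewrite RtoC_minus; replace ((1 - x) * p)%C with (p - x * p)%C by ring.
          rewrite K at 1; ring. }
        replace p with ((RtoC (1 - x) * p) / RtoC (1 - x))%C by (field; auto).
        rewrite K'; unfold seg; rewrite RtoC_div by lra.
        replace y with (1 - x - t) by lra; rewrite !RtoC_minus in *; field; auto. }
    set (L := Cmod (b - p)%C + Cmod (c - b)%C + Cmod (c - p)%C + 1).
    assert (HL : 0 < L) by (pose proof (Cmod_ge_0 (b - p)%C); pose proof (Cmod_ge_0 (c - b)%C);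
      pose proof (Cmod_ge_0 (c - p)%C); unfold L; lra).
    set (M := Cmod (f p) + 1).
    assert (HM : 0 < M) by (pose proof (Cmod_ge_0 (f p)); unfold M; lra).
    destruct (Ccont_bounded f p (Cf p Hp)) as [d [Hd Bd]]; fold M in Bd.
    assert (Main : forall e, 0 < e < 1 -> e * L < d -> Cmod (tri f p b c) <= e * (L * M)).
    { intros e He Hed.
      set (b' := seg p b e); set (c' := seg p c e).
      assert (Hb' : U b') by (apply HU; auto; lra).
      assert (Hc' : U c') by (apply HU; auto; lra).
      assert (E1 : tri f b' b c = 0).
      { apply (tri_off_point U f p); auto.
        intros [x [y [t [X [Y [T [E K]]]]]]].
        apply (Off (x * (1 - e)) (x * e + y) t); try nra.
        rewrite K at 1; unfold b', seg; rewrite RtoC_plus, !RtoC_mult, RtoC_minus; ring. }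
      assert (E2 : tri f b' c c' = 0).
      { apply (tri_off_point U f p); auto.
        intros [x [y [t [X [Y [T [E K]]]]]]].
        apply (Off ((x + t) * (1 - e)) (x * e) (y + t * e)); try nra.
        rewrite K at 1; unfold b', c', seg; rewrite !RtoC_plus, !RtoC_mult, RtoC_minus, RtoC_plus; ring. }
      assert (E : tri f p b c = (tri f p b' c' + tri f b' b c + tri f b' c c')%C).
      { unfold tri.
        rewrite (sint_split f p b e) by (auto using U_contseg; lra); fold b'.
        rewrite (sint_rev f p c), (sint_split f p c e) by (auto using U_contseg; lra); fold c'.
        rewrite (sint_rev f c' c), (sint_rev f b' c'), (sint_rev f c' p), (sint_rev f b' c) by auto using U_contseg.
        ring. }
      rewrite E, E1, E2, !Cplus_0_r.
      assert (Eb : (b' - p)%C = (RtoC e * (b - p))%C) by (unfold b', seg; ring).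
      assert (Ec : (c' - p)%C = (RtoC e * (c - p))%C) by (unfold c', seg; ring).
      assert (Nb : Cmod (b' - p)%C <= e * L).
      { rewrite Eb, Cmod_mult, Cmod_R, Rabs_pos_eq by lra; unfold L.
        pose proof (Cmod_ge_0 (c - b)%C); pose proof (Cmod_ge_0 (c - p)%C); nra. }
      assert (Nc : Cmod (c' - p)%C <= e * L).
      { rewrite Ec, Cmod_mult, Cmod_R, Rabs_pos_eq by lra; unfold L.
        pose proof (Cmod_ge_0 (c - b)%C); pose proof (Cmod_ge_0 (b - p)%C); nra. }
      assert (Np : Cmod (p - p)%C <= e * L) by (rewrite Cmod_m_0; nra).
      assert (Sd : forall x y, U x -> U y -> Cmod (x - p)%C <= e * L -> Cmod (y - p)%C <= e * L ->
         Cmod (sint f x y) <= Cmod (y - x)%C * M).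
      { intros x y Ux Uy Nx Ny; apply sint_bound; [auto using U_contseg|].
        intros s Hs; apply Rlt_le, Bd.
        pose proof (seg_ball p x y _ s Hs Nx Ny); lra. }
      pose proof (Sd _ _ Hp Hb' Np Nb) as S1.
      pose proof (Sd _ _ Hb' Hc' Nb Nc) as S2.
      pose proof (Sd _ _ Hc' Hp Nc Np) as S3.
      replace (c' - b')%C with (RtoC e * (c - b))%C in S2 by (unfold b', c', seg; ring).
      rewrite Cmod_m_sym in S3; rewrite Eb in S1; rewrite Ec in S3.
      rewrite Cmod_mult, Cmod_R, Rabs_pos_eq in S1, S2, S3 by lra.
      unfold tri.
      pose proof (Cmod_triangle (sint f p b' + sint f b' c') (sint f c' p)).
      pose proof (Cmod_triangle (sint f p b') (sint f b' c')).
      unfold L; nra. }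
    apply Cmod_eq_0, Rle_antisym; [|apply Cmod_ge_0].
    apply Rnot_lt_le; intros K; set (T := Cmod (tri f p b c)) in *.
    assert (HLM : 0 < L * M) by nra.
    set (e := Rmin (1 / 2) (Rmin (d / (2 * L)) (T / (2 * (L * M))))).
    assert (He : 0 < e).
    { unfold e; repeat apply Rmin_pos; try apply Rdiv_lt_0_compat; lra. }
    assert (e <= 1 / 2) by apply Rmin_l.
    assert (I1 : e <= d / (2 * L)) by (eapply Rle_trans; [apply Rmin_r|apply Rmin_l]).
    assert (I2 : e <= T / (2 * (L * M))) by (eapply Rle_trans; [apply Rmin_r|apply Rmin_r]).
    apply Rle_div_r in I1; [|lra]; apply Rle_div_r in I2; [|lra].
    assert (Hd2 : e * L < d) by nra.
    assert (He1 : 0 < e < 1) by lra.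
    specialize (Main e He1 Hd2); nra.
Qed.

Lemma tri_zero (a b c : C) : U a -> U b -> U c -> tri f a b c = 0.
Proof.
  intros Ha Hb Hc; destruct (classic (U p)) as [Hp|Hp].
  - pose proof (tri_vertex a b Hp Ha Hb) as T1; pose proof (tri_vertex b c Hp Hb Hc) as T2;
    pose proof (tri_vertex c a Hp Hc Ha) as T3.
    replace (tri f a b c) with (tri f p a b + tri f p b c + tri f p c a)%C.
    + rewrite T1, T2, T3; ring.
    + unfold tri.
      rewrite (sint_rev f p a), (sint_rev f p b), (sint_rev f p c) by auto using U_contseg; ring.
  - apply (Goursat U); auto; intros z Hz; apply Hf; auto; intro E0; subst; contradiction.
Qed.

(** Only continuity is required at [p]. This lets Cauchy's formula integrate a difference quotient,
    whose differentiability at the centre is not yet known. *)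
Theorem primitive_exc : opn U -> exists F, forall z, U z -> Cd F z (f z).
Proof.
  intros Uo; destruct (classic (exists z0, U z0)) as [[z0 H0]|N].
  2:{ exists (fun _ => RtoC 0); intros z Hz; exfalso; eauto. }
  exists (fun z => sint f z0 z); intros z Hz; apply Cd_spec; intros eps He.
  destruct (near_and _ _ _ (Uo z Hz) (Cf z Hz eps He)) as [d [Hd K]].
  exists d; split; auto; intros w Hw.
  assert (Uw : U w) by (apply K; auto).
  pose proof (tri_zero z0 z w H0 Hz Uw) as T; unfold tri in T.
  rewrite (sint_rev f z0 w) in T by auto using U_contseg.
  assert (E : (sint f z0 w - sint f z0 z)%C = sint f z w).
  { replace (sint f z0 w) with (sint f z0 w + (sint f z0 z + sint f z w + - sint f z0 w))%C
      by (rewrite T; ring); ring. }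
  rewrite E.
  assert (Ec : (f z * (w - z))%C = sint (fun _ => f z) z w).
  { rewrite (sint_FTC (fun v => f z * v)%C (fun _ => f z)).
    - ring.
    - intros s _; eapply Cd_eqn; [apply Cd_mult; [apply Cd_const|apply Cd_id]|]; cbv beta; ring.
    - intros s _; apply Ccont_const. }
  rewrite Ec; unfold Cminus at 1; rewrite <- sint_opp, <- sint_plus
    by (auto using U_contseg || (intros s _; try apply Ccont_opp; apply Ccont_const)).
  rewrite Rmult_comm; apply sint_bound.
  - intros s Hs; apply Ccont_plus; [apply U_contseg; auto|apply Ccont_const].
  - intros s Hs; apply Rlt_le, K.
    replace (seg z w s - z)%C with (RtoC s * (w - z))%C by (unfold seg; ring).
    rewrite Cmod_mult, Cmod_R, Rabs_pos_eq by lra.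
    pose proof (Cmod_ge_0 (w - z)%C); nra.
Qed.
End Exceptional.

Theorem primitive (U : C -> Prop) (f : C -> C) :
  convex U -> opn U -> (forall z, U z -> holomorphic_at f z) ->
  exists F, forall z, U z -> Cd F z (f z).
Proof.
  intros HU Uo Hf; apply (primitive_exc U f 0); auto; intros; apply hol_cont; auto.
Qed.

Definition Cdisc (a : C) (r : R) (z : C) : Prop := Cmod (z - a)%C < r.

Lemma Cdisc_convex (a : C) (r : R) : convex (Cdisc a r).
Proof.
  intros x y Hx Hy s Hs; unfold Cdisc in *.
  pose proof (seg_ball a x y (Rmax (Cmod (x - a)%C) (Cmod (y - a)%C)) s Hs (Rmax_l _ _) (Rmax_r _ _)) as K.
  eapply Rle_lt_trans; [exact K|]; apply Rmax_lub_lt; auto.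
Qed.

Lemma Cdisc_opn (a : C) (r : R) : opn (Cdisc a r).
Proof.
  intros z Hz; exists (r - Cmod (z - a)%C); split; [unfold Cdisc in Hz; lra|].
  intros w Hw; unfold Cdisc; pose proof (Cmod_tri w z a); lra.
Qed.

Lemma Cd_zero_const (U : C -> Prop) (f : C -> C) (a b : C) :
  convex U -> (forall z, U z -> Cd f z 0) -> U a -> U b -> f a = f b.
Proof.
  intros HU Hf Ha Hb.
  pose proof (sint_FTC f (fun _ => RtoC 0) a b) as K.
  assert (Z : sint (fun _ => RtoC 0) a b = 0).
  { rewrite (sint_FTC (fun _ => RtoC 0) (fun _ => RtoC 0)).
    - ring.
    - intros; apply Cd_const.
    - intros s _; apply Ccont_const. }
  rewrite Z in K.
  replace (f b) with (f a + (f b - f a))%C by ring.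
  rewrite <- K; [ring| |intros s _; apply Ccont_const].
  intros s Hs; apply Hf, HU; auto.
Qed.

(** * The exponential function and Taylor expansions *)

Definition tpi : C := (2 * PI * Ci)%C.

Lemma tpi_pair : tpi = (0, 2 * PI).
Proof. unfold tpi, RtoC, Ci, Cmult; simpl; f_equal; ring. Qed.

Lemma tpi_nz : tpi <> 0.
Proof.
  rewrite tpi_pair; intros E; apply (f_equal snd) in E; simpl in E.
  pose proof PI_RGT_0; lra.
Qed.

Lemma Cexp_plus (z w : C) : Cexp (z + w)%C = (Cexp z * Cexp w)%C.
Proof.
  unfold Cexp; rewrite re_plus, im_plus, exp_plus, cos_plus, sin_plus.
  unfold Cmult; simpl; f_equal; ring.
Qed.

Lemma Cexp_0 : Cexp 0 = 1.
Proof. unfold Cexp; simpl; rewrite exp_0, cos_0, sin_0; unfold RtoC; f_equal; ring. Qed.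

Lemma Cexp_opp_l (z : C) : (Cexp (- z) * Cexp z)%C = 1.
Proof. rewrite <- Cexp_plus; replace (- z + z)%C with (RtoC 0) by ring; apply Cexp_0. Qed.

Lemma Cexp_nz (z : C) : Cexp z <> 0.
Proof.
  intros E; pose proof (Cexp_opp_l z) as K; rewrite E, Cmult_0_r in K.
  apply C1_nz; auto.
Qed.

Lemma Cexp_opp (z : C) : Cexp (- z)%C = (/ Cexp z)%C.
Proof.
  pose proof (Cexp_nz z); replace (Cexp (- z)) with (Cexp (- z) * Cexp z / Cexp z)%C by (field; auto).
  rewrite Cexp_opp_l; field; auto.
Qed.

Lemma Cexp_minus (z w : C) : Cexp (z - w)%C = (Cexp z / Cexp w)%C.
Proof. unfold Cminus; rewrite Cexp_plus, Cexp_opp; reflexivity. Qed.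

Lemma Cexp_nat (n : nat) (z : C) : Cexp (INR n * z)%C = (Cexp z ^ n)%C.
Proof.
  induction n as [|n IH].
  - simpl; rewrite Cmult_0_l; apply Cexp_0.
  - rewrite S_INR, RtoC_plus; replace ((INR n + 1) * z)%C with (z + INR n * z)%C by ring.
    rewrite Cexp_plus, IH; simpl; reflexivity.
Qed.

Lemma Cmod_Cexp (z : C) : Cmod (Cexp z) = exp (Re z).
Proof.
  unfold Cexp, Cmod; simpl fst; simpl snd.
  replace ((exp (Re z) * cos (Im z)) ^ 2 + (exp (Re z) * sin (Im z)) ^ 2)
    with ((exp (Re z)) ^ 2 * ((sin (Im z))² + (cos (Im z))²)) by (unfold Rsqr; ring).
  rewrite sin2_cos2, Rmult_1_r; apply sqrt_pow2; left; apply exp_pos.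
Qed.

Lemma Cexp_tpi : Cexp tpi = 1.
Proof.
  rewrite tpi_pair; unfold Cexp; simpl; rewrite exp_0, cos_2PI, sin_2PI.
  unfold RtoC; f_equal; ring.
Qed.

Lemma Rderive_small (f : R -> R) (l : R) : derivable_pt_lim f 0 l ->
  forall e, 0 < e -> exists d, 0 < d /\ forall x, Rabs x < d -> Rabs (f x - f 0 - l * x) <= e * Rabs x.
Proof.
  intros H e He; destruct (H e He) as [d K]; exists d; split; [apply cond_pos|].
  intros x Hx; destruct (Req_dec x 0) as [->|N].
  - replace (f 0 - f 0 - l * 0) with 0 by ring; rewrite Rabs_R0; lra.
  - specialize (K x N Hx); rewrite Rplus_0_l in K.
    replace (f x - f 0 - l * x) with (((f x - f 0) / x - l) * x) by (field; auto).
    rewrite Rabs_mult; apply Rmult_le_compat_r; [apply Rabs_pos|lra].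
Qed.

Lemma Cmod_le_sum (x y : R) : Cmod (x, y) <= Rabs x + Rabs y.
Proof.
  replace (x, y) with (RtoC x + RtoC y * Ci)%C
    by (unfold RtoC, Ci, Cplus, Cmult; simpl; f_equal; ring).
  eapply Rle_trans; [apply Cmod_triangle|]; rewrite Cmod_mult, !Cmod_R, Cmod_Ci; lra.
Qed.

Lemma Cmod_Re (z : C) : Rabs (Re z) <= Cmod z.
Proof. pose proof (Rmax_Cmod z); pose proof (Rmax_l (Rabs (fst z)) (Rabs (snd z))).
  unfold Re; lra. Qed.
Lemma Cmod_Im (z : C) : Rabs (Im z) <= Cmod z.
Proof. pose proof (Rmax_Cmod z); pose proof (Rmax_r (Rabs (fst z)) (Rabs (snd z))).
  unfold Im; lra. Qed.

Lemma Cd_Cexp0 : Cd Cexp 0 1.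
Proof.
  apply Cd_spec; intros eps He; set (e := Rmin 1 (eps / 12)).
  assert (He1 : 0 < e) by (apply Rmin_pos; lra).
  assert (e <= 1) by apply Rmin_l; assert (e <= eps / 12) by apply Rmin_r.
  destruct (Rderive_small exp 1 derivable_pt_lim_exp_0 e He1) as [d1 [P1 K1]].
  destruct (Rderive_small sin 1 derivable_pt_lim_sin_0 e He1) as [d2 [P2 K2]].
  assert (C0 : derivable_pt_lim cos 0 0).
  { pose proof (derivable_pt_lim_cos 0) as K; rewrite sin_0, Ropp_0 in K; exact K. }
  destruct (Rderive_small cos 0 C0 e He1) as [d3 [P3 K3]].
  exists (Rmin (Rmin d1 d2) (Rmin d3 e)); split; [repeat apply Rmin_pos; auto; lra|].
  intros w Hw.
  replace (w - 0)%C with w in * by ring.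
  pose proof (Cmod_Re w) as Bx; pose proof (Cmod_Im w) as By.
  assert (L : Cmod w < d1 /\ Cmod w < d2 /\ Cmod w < d3 /\ Cmod w < e).
  { pose proof (Rmin_l (Rmin d1 d2) (Rmin d3 e)); pose proof (Rmin_r (Rmin d1 d2) (Rmin d3 e)).
    pose proof (Rmin_l d1 d2); pose proof (Rmin_r d1 d2); pose proof (Rmin_l d3 e); pose proof (Rmin_r d3 e); lra. }
  rewrite Cexp_0; destruct w as [x y]; simpl Re in *; simpl Im in *.
  specialize (K1 x ltac:(lra)); specialize (K2 y ltac:(lra)); specialize (K3 y ltac:(lra)).
  rewrite exp_0 in K1; rewrite sin_0 in K2; rewrite cos_0 in K3.
  set (n := Cmod (x, y)) in *.
  set (p := exp x - 1 - 1 * x) in *; set (q := sin y - 0 - 1 * y) in *; set (r := cos y - 1 - 0 * y) in *.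
  assert (Ep : exp x = 1 + x + p) by (unfold p; ring).
  assert (Eq : sin y = y + q) by (unfold q; ring).
  assert (Er : cos y = 1 + r) by (unfold r; ring).
  assert (n0 : 0 <= n) by apply Cmod_ge_0.
  assert (Bp : Rabs p <= e * n) by (eapply Rle_trans; [exact K1|]; apply Rmult_le_compat_l; lra).
  assert (Bq : Rabs q <= e * n) by (eapply Rle_trans; [exact K2|]; apply Rmult_le_compat_l; lra).
  assert (Br : Rabs r <= e * n) by (eapply Rle_trans; [exact K3|]; apply Rmult_le_compat_l; lra).
  replace (Cexp (x, y) - 1 - 1 * (x, y))%C with (p + r + (x + p) * r, q + (x + p) * (y + q)).
  2:{ unfold Cexp; simpl; rewrite Ep, Eq, Er; unfold Cminus, Cplus, Copp, RtoC, Cmult; simpl; f_equal; ring. }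
  eapply Rle_trans; [apply Cmod_le_sum|].
  assert (Sm : e * n <= 1) by nra.
  assert (B1 : Rabs (x + p) <= 2) by (pose proof (Rabs_triang x p); lra).
  assert (B1' : Rabs (x + p) <= 2 * e) by (pose proof (Rabs_triang x p); nra).
  assert (B2 : Rabs (y + q) <= 2 * n) by (pose proof (Rabs_triang y q); nra).
  pose proof (Rabs_triang (p + r) ((x + p) * r)); pose proof (Rabs_triang p r).
  pose proof (Rabs_triang q ((x + p) * (y + q))).
  rewrite Rabs_mult in *.
  assert (Rabs (x + p) * Rabs r <= 2 * (e * n))
    by (apply Rmult_le_compat; auto using Rabs_pos).
  assert (Rabs (x + p) * Rabs (y + q) <= (2 * e) * (2 * n))
    by (apply Rmult_le_compat; auto using Rabs_pos).
  assert (e * n <= eps / 12 * n) by (apply Rmult_le_compat_r; lra).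
  nra.
Qed.

Lemma Cd_Cexp (z : C) : Cd Cexp z (Cexp z).
Proof.
  apply (Cd_ext (fun w => Cexp z * Cexp (w - z))%C).
  { intros w; rewrite <- Cexp_plus; f_equal; ring. }
  eapply Cd_eqn; [apply Cd_mult; [apply Cd_const|]|].
  - apply (Cd_comp (fun w => w - z)%C Cexp z); [apply Cd_minus; [apply Cd_id|apply Cd_const]|].
    replace (z - z)%C with (RtoC 0) by ring; apply Cd_Cexp0.
  - cbv beta; ring.
Qed.

Lemma Cd_exp (f : C -> C) (z l : C) : Cd f z l -> Cd (fun w => Cexp (f w)) z (Cexp (f z) * l)%C.
Proof. intros H; apply (Cd_comp f Cexp); auto; apply Cd_Cexp. Qed.

Lemma hol_exp (f : C -> C) (z : C) : holomorphic_at f z -> holomorphic_at (fun w => Cexp (f w)) z.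
Proof. intros H%hol_Cd; eapply Cd_hol, Cd_exp; eauto. Qed.

Lemma Ccont_exp (f : C -> C) (z : C) : Ccont f z -> Ccont (fun w => Cexp (f w)) z.
Proof. intros H; apply (Ccont_comp f Cexp); auto; eapply Cd_cont, Cd_Cexp. Qed.

(* [cint phi x] integrates over one period of the exponential, so that
   [cint (fun w => g (a + Cexp w) * Cexp w)] is a contour integral over the circle
   of centre [a] and radius [exp x]. *)
Definition cint (phi : C -> C) (x : R) : C := sint phi x (x + tpi)%C.

Lemma cseg_re (x s : R) : Re (seg x (x + tpi) s) = x.
Proof. rewrite tpi_pair; unfold seg, RtoC, Cplus, Cminus, Cmult; simpl; ring. Qed.

Lemma cint_cont (phi : C -> C) (x : R) :
  (forall w, Re w = x -> Ccont phi w) -> contseg phi x (x + tpi)%C.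
Proof. intros H s _; apply H, cseg_re. Qed.

Lemma cint_bound (phi : C -> C) (x M : R) :
  (forall w, Re w = x -> Ccont phi w) -> (forall w, Re w = x -> Cmod (phi w) <= M) ->
  Cmod (cint phi x) <= 2 * PI * M.
Proof.
  intros Hc HM; eapply Rle_trans; [apply (sint_bound _ _ _ M)|].
  - apply cint_cont; auto.
  - intros s _; apply HM, cseg_re.
  - replace (x + tpi - x)%C with tpi by ring; rewrite tpi_pair.
    unfold Cmod; simpl fst; simpl snd.
    replace (0 ^ 2 + (2 * PI) ^ 2) with ((2 * PI) ^ 2) by ring.
    rewrite sqrt_pow2 by (pose proof PI_RGT_0; lra); lra.
Qed.

Lemma cint_exact (F phi : C -> C) (x : R) :
  (forall w, Re w = x -> Cd F w (phi w)) -> (forall w, Re w = x -> Ccont phi w) ->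
  F (x + tpi)%C = F x -> cint phi x = 0.
Proof.
  intros HF Hc E; unfold cint; rewrite (sint_FTC F phi).
  - rewrite E; ring.
  - intros s _; apply HF, cseg_re.
  - apply cint_cont; auto.
Qed.

Lemma Cexp_period (z : C) : Cexp (z + tpi)%C = Cexp z.
Proof. rewrite Cexp_plus, Cexp_tpi; ring. Qed.

Fixpoint csum (c : nat -> C) (n : nat) : C :=
  match n with O => RtoC 0 | S m => (csum c m + c m)%C end.

Section Kernel.
Variables (phi : C -> C) (x : R) (h : C).
Hypotheses (Hphi : forall w, Re w = x -> Ccont phi w) (Hh : Cmod h < exp x).

Lemma circ_nz (w : C) : Re w = x -> (Cexp w - h)%C <> 0.
Proof.
  intros E K; assert (Cexp w = h) by (replace (Cexp w) with (Cexp w - h + h)%C by ring; rewrite K; ring).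
  pose proof (Cmod_Cexp w) as M; rewrite H, E in M; lra.
Qed.

(** With [zeta = Cexp w], whose derivative is [Cexp w] again, this is the Cauchy kernel
    [phi / (zeta - h)] times the [n]-th power of the ratio [h / zeta]: the remainder of the
    geometric series after [n] terms. *)
Definition kern (n : nat) (w : C) : C := (phi w * (Cexp w / (Cexp w - h)) * (h / Cexp w) ^ n)%C.

Lemma kern_cont (n : nat) (w : C) : Re w = x -> Ccont (kern n) w.
Proof.
  intros E; assert (Ce : Ccont Cexp w) by (eapply Cd_cont, Cd_Cexp).
  apply Ccont_mult; [apply Ccont_mult; auto|].
  - apply Ccont_div; auto; [|apply circ_nz; auto].
    apply Ccont_minus; auto; apply Ccont_const.
  - apply (Ccont_pow (fun w => h / Cexp w)%C), Ccont_div; auto; [apply Ccont_const|apply Cexp_nz].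
Qed.

Lemma kern_bound (n : nat) (M : R) :
  (forall w, Re w = x -> Cmod (phi w) <= M) ->
  Cmod (cint (kern n) x) <= 2 * PI * (M * (exp x / (exp x - Cmod h)) * (Cmod h / exp x) ^ n).
Proof.
  intros HM; apply cint_bound; [intros; apply kern_cont; auto|].
  intros w E; unfold kern; rewrite !Cmod_mult, Cmod_pow, !Cmod_div, Cmod_Cexp, E
    by (apply Cexp_nz || apply circ_nz; auto).
  assert (0 <= Cmod h) by apply Cmod_ge_0.
  apply Rmult_le_compat_r; [apply pow_le, Rdiv_le_0_compat; auto using exp_pos|].
  assert (L : exp x - Cmod h <= Cmod (Cexp w - h)%C).
  { pose proof (Cmod_tri_inv (Cexp w) h) as K; rewrite Cmod_Cexp, E in K; lra. }
  apply Rmult_le_compat; auto using Cmod_ge_0.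
  - apply Rdiv_le_0_compat; [left; apply exp_pos|lra].
  - apply Rmult_le_compat_l; [left; apply exp_pos|].
    apply Rinv_le_contravar; lra.
Qed.

(** Cauchy's integral for the [n]-th Taylor coefficient; the factor [Cexp w] from the change of
    variable has cancelled one inverse power. *)
Definition coef (n : nat) : C := (/ tpi * cint (fun w => phi w * (/ Cexp w) ^ n)%C x)%C.

Lemma coef_cont (n : nat) (w : C) : Re w = x -> Ccont (fun w => phi w * (/ Cexp w) ^ n)%C w.
Proof.
  intros E; apply Ccont_mult; auto.
  apply (Ccont_pow (fun w => / Cexp w)%C), Ccont_inv; [eapply Cd_cont, Cd_Cexp|apply Cexp_nz].
Qed.

Lemma kern_step (n : nat) :
  cint (kern n) x = (tpi * (coef n * h ^ n) + cint (kern (S n)) x)%C.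
Proof.
  unfold coef.
  replace (tpi * (/ tpi * cint (fun w => phi w * (/ Cexp w) ^ n)%C x * h ^ n))%C
    with (h ^ n * cint (fun w => phi w * (/ Cexp w) ^ n)%C x)%C by (field; apply tpi_nz).
  unfold cint; rewrite <- sint_scal, <- sint_plus.
  - apply sint_ext; intros s _; set (w := seg x (x + tpi) s).
    pose proof (Cexp_nz w); pose proof (circ_nz w (cseg_re x s)).
    unfold kern; unfold Cdiv; rewrite !Cpow_mult_l; simpl; field; auto.
  - intros s _; apply Ccont_mult; [apply Ccont_const|]; apply coef_cont, cseg_re.
  - intros s _; apply kern_cont, cseg_re.
  - intros s _; apply coef_cont, cseg_re.
Qed.

Lemma kern_expand (n : nat) :
  cint (kern 0) x = (tpi * csum (fun k => coef k * h ^ k)%C n + cint (kern n) x)%C.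
Proof.
  induction n as [|n IH]; [simpl; ring|].
  rewrite IH, kern_step; simpl; ring.
Qed.
End Kernel.

Lemma geom_small (k A e : R) : 0 <= k < 1 -> 0 <= A -> 0 < e -> exists n, A * k ^ n < e.
Proof.
  intros Hk HA He.
  destruct (pow_lt_1_zero k) with (y := e / (A + 1)) as [N HN].
  - rewrite Rabs_pos_eq; lra.
  - apply Rdiv_lt_0_compat; lra.
  - exists N; specialize (HN N (le_n _)).
    assert (P : 0 <= k ^ N) by (apply pow_le; lra).
    rewrite Rabs_pos_eq in HN by auto.
    apply Rlt_div_r in HN; [|lra]; nra.
Qed.

Lemma Cmod_small_0 (z : C) : (forall e, 0 < e -> Cmod z <= e) -> z = 0.
Proof.
  intros H; apply Cmod_eq_0, Rle_antisym; [|apply Cmod_ge_0].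
  apply Rnot_lt_le; intros K; specialize (H (Cmod z / 2)); lra.
Qed.

(** In the geometric expansion every coefficient but the first vanishes, since a negative power of
    [Cexp] has a periodic primitive; the remainder tends to 0. The winding number is thus computed
    without deforming the circle. *)
Lemma cint_cauchy_one (x : R) (h : C) : Cmod h < exp x ->
  cint (kern (fun _ => RtoC 1) h 0) x = tpi.
Proof.
  intros Hh.
  assert (Hc : forall w, Re w = x -> Ccont (fun _ : C => RtoC 1) w) by (intros; apply Ccont_const).
  assert (C0 : coef (fun _ => RtoC 1) x 0 = 1).
  { unfold coef, cint; rewrite (sint_FTC (fun w => w) _).
    - field; apply tpi_nz.
    - intros s _; eapply Cd_eqn; [apply Cd_id|]; simpl; ring.
    - intros s _; apply (coef_cont _ x); auto; apply cseg_re. }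
  assert (Cn : forall n, coef (fun _ => RtoC 1) x (S n) = 0).
  { intros n; unfold coef; rewrite (cint_exact (fun w => - / INR (S n) * (/ Cexp w) ^ (S n))%C); [ring| | |].
    - intros w _; eapply Cd_eqn.
      + apply Cd_mult; [apply Cd_const|]; apply Cd_pow, Cd_inv; [apply Cd_Cexp|apply Cexp_nz].
      + cbv beta; pose proof (Cexp_nz w).
        assert (RtoC (INR (S n)) <> 0) by (intros K; apply RtoC_inj in K; pose proof (pos_INR n); rewrite S_INR in K; lra).
        simpl pred; rewrite Cpow_S; field; auto.
    - intros w E; apply (coef_cont _ x); auto.
    - rewrite Cexp_period; reflexivity. }
  assert (Sm : forall n, csum (fun k => coef (fun _ => RtoC 1) x k * h ^ k)%C (S n) = 1).
  { induction n as [|n IH]; [simpl; rewrite C0; ring|].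
    change (csum (fun k => coef (fun _ => RtoC 1) x k * h ^ k)%C (S n) +
       coef (fun _ => RtoC 1) x (S n) * h ^ (S n) = 1)%C.
    rewrite IH, Cn; ring. }
  apply Ceq_minus, Cmod_small_0; intros e He.
  assert (Hh0 : 0 <= Cmod h) by apply Cmod_ge_0.
  pose proof PI_RGT_0.
  destruct (geom_small (Cmod h / exp x) (2 * PI * (1 * (exp x / (exp x - Cmod h)))) e) as [n Hn]; auto.
  - split; [apply Rdiv_le_0_compat; auto using exp_pos|apply Rlt_div_l; [apply exp_pos|lra]].
  - rewrite Rmult_1_l; apply Rmult_le_pos; [lra|apply Rdiv_le_0_compat; [left; apply exp_pos|lra]].
  - rewrite (kern_expand _ x h Hc Hh (S n)), Sm.
    replace (tpi * 1 + cint (kern (fun _ => 1) h (S n)) x - tpi)%C with (cint (kern (fun _ => 1) h (S n)) x) by ring.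
    eapply Rle_trans; [apply (kern_bound _ x h Hc Hh (S n) 1)|].
    + intros; rewrite Cmod_1; lra.
    + eapply Rle_trans; [|apply Rlt_le, Hn]; rewrite Rmult_assoc.
      rewrite <- Rmult_assoc; rewrite <- (Rmult_assoc (2 * PI)).
      apply Rmult_le_compat_l.
      * rewrite Rmult_1_l; apply Rmult_le_pos; [lra|apply Rdiv_le_0_compat; [left; apply exp_pos|lra]].
      * simpl; rewrite <- (Rmult_1_l ((Cmod h / exp x) ^ n)) at 2.
        apply Rmult_le_compat_r; [apply pow_le, Rdiv_le_0_compat; auto using exp_pos|].
        apply Rle_div_l; [apply exp_pos|lra].
Qed.

Lemma diff_quot_cont (f : C -> C) (z w l : C) :
  Cd f z l -> Ccont f w ->
  Ccont (fun v => if Ceq_dec v z then l else ((f v - f z) / (v - z))%C) w.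
Proof.
  intros [p [Cp [Ep Hp]]] Cw.
  destruct (Ceq_dec w z) as [->|N].
  - apply (Ccont_ext_near p); auto; exists 1; split; [lra|]; intros v _.
    destruct (Ceq_dec v z) as [->|N]; auto.
    rewrite (Hp v); field; apply Cminus_eq_contra; auto.
  - apply (Ccont_ext_near (fun v => (f v - f z) / (v - z))%C).
    + apply (near_mono _ (fun v => v <> z)); [|apply (Ccont_neq (fun v => v)); auto; apply Ccont_id].
      intros v Hv; destruct (Ceq_dec v z); [contradiction|reflexivity].
    + apply Ccont_div; [apply Ccont_minus; auto; apply Ccont_const| |apply Cminus_eq_contra; auto].
      apply Ccont_minus; [apply Ccont_id|apply Ccont_const].
Qed.

Lemma diff_quot_hol (f : C -> C) (z w l : C) : w <> z -> holomorphic_at f w ->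
  holomorphic_at (fun v => if Ceq_dec v z then l else ((f v - f z) / (v - z))%C) w.
Proof.
  intros N Hw; apply (hol_ext_near (fun v => (f v - f z) / (v - z))%C).
  - apply (near_mono _ (fun v => v <> z)); [|apply (Ccont_neq (fun v => v)); auto; apply Ccont_id].
    intros v Hv; destruct (Ceq_dec v z); [contradiction|reflexivity].
  - apply hol_div; [apply hol_minus; auto; apply hol_const| |apply Cminus_eq_contra; auto].
    apply hol_minus; [apply hol_id|apply hol_const].
Qed.

(** The difference quotient of [f] at [a + h] is continuous and holomorphic off that point, so it
    has a primitive on the disc, whose pull-back by [a + Cexp w] is periodic. What remains is
    [f (a + h)] times the integral for the constant 1. *)
Theorem Cauchy_formula (f : C -> C) (a h : C) (Rr x : R) :
  (forall z, Cdisc a Rr z -> holomorphic_at f z) -> exp x < Rr -> Cmod h < exp x ->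
  cint (kern (fun w => f (a + Cexp w)%C) h 0) x = (tpi * f (a + h))%C.
Proof.
  intros Hf Hx Hh; set (z := (a + h)%C).
  assert (Dw : forall w, Re w = x -> Cdisc a Rr (a + Cexp w)%C).
  { intros w E; unfold Cdisc; replace (a + Cexp w - a)%C with (Cexp w) by ring.
    rewrite Cmod_Cexp, E; auto. }
  assert (Dz : Cdisc a Rr z) by (unfold Cdisc, z; replace (a + h - a)%C with h by ring; lra).
  pose proof (proj1 (hol_Cd _ _) (Hf z Dz)) as Hz; set (l := C_derive f z) in *.
  set (q := fun v => if Ceq_dec v z then l else ((f v - f z) / (v - z))%C).
  destruct (primitive_exc (Cdisc a Rr) q z) as [Q HQ].
  - apply Cdisc_convex.
  - intros v Hv; apply diff_quot_cont; auto; apply hol_cont; auto.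
  - intros v Hv N; apply diff_quot_hol; auto.
  - apply Cdisc_opn.
  - assert (Ca : forall w, Ccont (fun w => a + Cexp w)%C w).
    { intros w; apply Ccont_plus; [apply Ccont_const|eapply Cd_cont, Cd_Cexp]. }
    assert (K0 : cint (fun w => q (a + Cexp w) * Cexp w)%C x = 0).
    { apply (cint_exact (fun w => Q (a + Cexp w)%C)).
      - intros w E; apply (Cd_comp (fun w => a + Cexp w)%C Q); [|apply HQ, Dw; auto].
        eapply Cd_eqn; [apply Cd_plus; [apply Cd_const|apply Cd_Cexp]|ring].
      - intros w E; apply Ccont_mult; [|eapply Cd_cont, Cd_Cexp].
        apply (Ccont_comp (fun w => a + Cexp w)%C q); auto.
        apply diff_quot_cont; auto; apply hol_cont; auto.
      - rewrite Cexp_period; reflexivity. }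
    assert (Cf : forall w, Re w = x -> Ccont (fun w => f (a + Cexp w)%C) w).
    { intros w E; apply (Ccont_comp (fun w => a + Cexp w)%C f); auto; apply hol_cont; auto. }
    assert (C1 : forall w, Re w = x -> Ccont (fun _ : C => RtoC 1) w) by (intros; apply Ccont_const).
    rewrite <- (cint_cauchy_one x h Hh), Cmult_comm.
    rewrite <- (Cplus_0_r (_ * _)), <- K0.
    unfold cint; rewrite <- sint_scal, <- sint_plus.
    + apply sint_ext; intros s _; set (w := seg x (x + tpi) s).
      pose proof (circ_nz x h Hh w (cseg_re x s)) as N.
      unfold kern, q; simpl.
      destruct (Ceq_dec (a + Cexp w)%C z) as [E|E].
      * exfalso; apply N; replace (Cexp w) with (a + Cexp w - a)%C by ring; rewrite E; unfold z; ring.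
      * replace (a + Cexp w - z)%C with (Cexp w - h)%C by (unfold z; ring).
        field; auto.
    + intros s _; apply Ccont_mult; [apply Ccont_const|]; apply (kern_cont _ x); auto; apply cseg_re.
    + apply cint_cont; intros w E; apply Ccont_mult; [|eapply Cd_cont, Cd_Cexp].
      apply (Ccont_comp (fun w => a + Cexp w)%C q); auto.
      apply diff_quot_cont; auto; apply hol_cont; auto.
    + apply cint_cont; intros w E; apply (kern_cont _ x); auto.
Qed.

(** Formulated through truncations with an explicit geometric remainder: local factorisation,
    derivatives and uniqueness of expansions then follow from finite sums alone. *)
Theorem Taylor (f : C -> C) (a : C) (Rr r M : R) :
  0 < r < Rr -> (forall z, Cdisc a Rr z -> holomorphic_at f z) ->
  (forall z, Cmod (z - a)%C = r -> Cmod (f z) <= M) ->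
  exists c, (forall n, Cmod (c n) <= M / r ^ n) /\
    forall z n, Cdisc a r z ->
      Cmod (f z - csum (fun k => c k * (z - a) ^ k) n)%C
        <= M * (r / (r - Cmod (z - a)%C)) * (Cmod (z - a)%C / r) ^ n.
Proof.
  intros Hr Hf HM; set (x := ln r).
  assert (Ex : exp x = r) by (apply exp_ln; lra).
  set (phi := fun w => f (a + Cexp w)%C).
  assert (Nc : forall w, Re w = x -> Cmod (a + Cexp w - a)%C = r).
  { intros w E; replace (a + Cexp w - a)%C with (Cexp w) by ring; rewrite Cmod_Cexp, E; auto. }
  assert (Cf : forall w, Re w = x -> Ccont phi w).
  { intros w E; apply (Ccont_comp (fun w => a + Cexp w)%C f).
    - apply Ccont_plus; [apply Ccont_const|eapply Cd_cont, Cd_Cexp].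
    - apply hol_cont, Hf; unfold Cdisc; rewrite Nc; auto; lra. }
  assert (Bf : forall w, Re w = x -> Cmod (phi w) <= M) by (intros w E; apply HM, Nc; auto).
  assert (Ntpi : Cmod tpi = 2 * PI).
  { rewrite tpi_pair; unfold Cmod; simpl fst; simpl snd.
    replace (0 ^ 2 + (2 * PI) ^ 2) with ((2 * PI) ^ 2) by ring.
    apply sqrt_pow2; pose proof PI_RGT_0; lra. }
  pose proof PI_RGT_0.
  exists (coef phi x); split.
  - intros n; unfold coef; rewrite Cmod_mult, Cmod_inv, Ntpi by apply tpi_nz.
    assert (K : Cmod (cint (fun w => phi w * (/ Cexp w) ^ n)%C x) <= 2 * PI * (M / r ^ n)).
    { apply cint_bound.
      - intros w E; apply (coef_cont phi x); auto.
      - intros w E; rewrite Cmod_mult, Cmod_pow, Cmod_inv, Cmod_Cexp, E, Ex by apply Cexp_nz.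
        rewrite pow_inv; apply Rmult_le_compat_r; auto.
        left; apply Rinv_0_lt_compat, pow_lt; lra. }
    apply (Rmult_le_reg_l (2 * PI)); [lra|].
    rewrite <- Rmult_assoc, Rinv_r, Rmult_1_l by lra; exact K.
  - intros z n Hz; unfold Cdisc in Hz; set (h := (z - a)%C) in *.
    assert (Hh : Cmod h < exp x) by lra.
    assert (Hx : exp x < Rr) by lra.
    pose proof (Cauchy_formula f a h Rr x Hf Hx Hh) as K.
    change (fun w => f (a + Cexp w)%C) with phi in K.
    rewrite (kern_expand phi x h Cf Hh n) in K.
    replace (a + h)%C with z in K by (unfold h; ring).
    assert (E : (f z - csum (fun k => coef phi x k * h ^ k) n)%C = (/ tpi * cint (kern phi h n) x)%C).
    { pose proof tpi_nz.
      replace (cint (kern phi h n) x) with (tpi * f z - tpi * csum (fun k => coef phi x k * h ^ k)%C n)%C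
        by (rewrite <- K; ring).
      field; auto. }
    rewrite E, Cmod_mult, Cmod_inv, Ntpi by apply tpi_nz.
    pose proof (kern_bound phi x h Cf Hh n M Bf) as B; rewrite Ex in B.
    apply (Rmult_le_reg_l (2 * PI)); [lra|].
    rewrite <- Rmult_assoc, Rinv_r, Rmult_1_l by lra; exact B.
Qed.

(** * Local theory of holomorphic functions *)

Lemma near_gt (z : C) (P : C -> Prop) (d0 : R) : near z P -> 0 < d0 ->
  exists d, 0 < d < d0 /\ forall w, Cmod (w - z)%C < d -> P w.
Proof.
  intros [d [Hd H]] H0; exists (Rmin d d0 / 2).
  assert (0 < Rmin d d0) by (apply Rmin_pos; auto).
  pose proof (Rmin_l d d0); pose proof (Rmin_r d d0).
  split; [lra|intros w Hw; apply H; lra].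
Qed.

Lemma csum_leading (c : nat -> C) (h : C) (m : nat) :
  (forall k, (k < m)%nat -> c k = 0) -> csum (fun k => c k * h ^ k)%C m = 0.
Proof.
  induction m as [|m IH]; intros H; [reflexivity|].
  simpl; rewrite IH, H by (intros; try apply H; lia); ring.
Qed.

Lemma Taylor_local (f : C -> C) (a : C) : near a (holomorphic_at f) ->
  exists c r M, 0 < r /\ 0 <= M /\ near a (holomorphic_at f) /\ c O = f a /\ Cd f a (c 1%nat) /\
    forall z n, Cmod (z - a)%C <= r ->
      Cmod (f z - csum (fun k => c k * (z - a) ^ k) n)%C <= M * Cmod (z - a)%C ^ n / r ^ n.
Proof.
  intros Hn; pose proof (hol_cont _ _ (near_here _ _ Hn)) as Ca.
  destruct (near_and _ _ _ Hn (Ccont_bounded f a Ca)) as [d [Hd K]].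
  set (M := Cmod (f a) + 1) in *.
  assert (HM : 0 <= M) by (pose proof (Cmod_ge_0 (f a)); unfold M; lra).
  destruct (Taylor f a d (d / 2) M) as [c [_ Hc]].
  - lra.
  - intros z Hz; apply K, Hz.
  - intros z Hz; left; apply K; lra.
  - set (r := d / 2) in *.
    (* Staying within [r / 2] bounds the factor [r / (r - |z - a|)] by 2, so the bound becomes a
       plain power of the distance. *)
    assert (B : forall z n, Cmod (z - a)%C <= r / 2 ->
      Cmod (f z - csum (fun k => c k * (z - a) ^ k) n)%C <= 2 * M * Cmod (z - a)%C ^ n / r ^ n).
    { intros z n Hz; assert (0 < r) by (unfold r; lra).
      eapply Rle_trans; [apply Hc; unfold Cdisc; lra|].
      replace (2 * M * Cmod (z - a) ^ n / r ^ n) with (M * 2 * (Cmod (z - a)%C / r) ^ n)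
        by (unfold Rdiv; rewrite Rpow_mult_distr, pow_inv; ring).
      apply Rmult_le_compat_r.
      - apply pow_le, Rdiv_le_0_compat; auto using Cmod_ge_0.
      - apply Rmult_le_compat_l; auto; apply Rle_div_l; lra. }
    assert (Hr : 0 < r) by (unfold r; lra).
    assert (c0 : c O = f a).
    { specialize (B a 1%nat); rewrite Cmod_m_0 in B; specialize (B ltac:(lra)).
      simpl in B; replace (a - a)%C with (RtoC 0) in B by ring.
      replace (f a - (0 + c O * 1))%C with (f a - c O)%C in B by ring.
      symmetry; apply Ceq_minus, Cmod_eq_0, Rle_antisym; [|apply Cmod_ge_0].
      eapply Rle_trans; [exact B|]; apply Req_le; field; lra. }
    exists c, (r / 2), (2 * M); repeat split; auto; try lra.
    + apply Cd_spec; intros eps He.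
      exists (Rmin (r / 2) (eps * (r * r) / (2 * M + 1))); split.
      * apply Rmin_pos; [lra|apply Rdiv_lt_0_compat; [|lra]]; apply Rmult_lt_0_compat; nra.
      * intros w Hw.
        pose proof (Rmin_l (r / 2) (eps * (r * r) / (2 * M + 1))).
        pose proof (Rmin_r (r / 2) (eps * (r * r) / (2 * M + 1))).
        specialize (B w 2%nat ltac:(lra)); simpl in B.
        replace (f w - (0 + c O * 1 + c 1%nat * ((w - a) * 1)))%C with (f w - f a - c 1%nat * (w - a))%C in B
          by (rewrite <- c0; ring).
        eapply Rle_trans; [exact B|].
        set (t := Cmod (w - a)%C) in *.
        assert (t0 : 0 <= t) by apply Cmod_ge_0.
        apply Rle_div_l; [nra|].
        assert (T : t <= eps * (r * r) / (2 * M + 1)) by lra.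
        apply Rle_div_r in T; [|lra].
        nra.
    + intros z n Hz; eapply Rle_trans; [apply B; auto|].
      apply Rmult_le_compat_l; [apply Rmult_le_pos; [lra|apply pow_le, Cmod_ge_0]|].
      apply Rinv_le_contravar; [apply pow_lt; lra|apply pow_incr; lra].
Qed.

Definition pdiv (f : C -> C) (a l : C) (m : nat) (z : C) : C :=
  if Ceq_dec z a then l else (f z / (z - a) ^ m)%C.

Lemma pdiv_off (f : C -> C) (a l : C) (m : nat) (z : C) :
  z <> a -> holomorphic_at f z -> holomorphic_at (pdiv f a l m) z.
Proof.
  intros N H; assert (N' : (z - a)%C <> 0) by (apply Cminus_eq_contra; auto).
  apply (hol_ext_near (fun v => f v / (v - a) ^ m)%C).
  - apply (near_mono _ (fun v => v <> a)); [|apply (Ccont_neq (fun v => v)); auto; apply Ccont_id].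
    intros v Hv; unfold pdiv; destruct (Ceq_dec v a); [contradiction|reflexivity].
  - apply hol_div; auto; [|apply Cpow_nz; auto].
    apply (hol_pow (fun v => v - a)%C), hol_minus; [apply hol_id|apply hol_const].
Qed.

(** Truncation at order [m + 2] leaves two terms and an error which, after division by the [m]-th
    power, is quadratic in the distance to [a]; the next coefficient is therefore the derivative of
    the quotient. *)
Lemma pdiv_at (f : C -> C) (a : C) (m : nat) (c : nat -> C) (r M : R) :
  0 < r -> 0 <= M -> (forall k, (k < m)%nat -> c k = 0) ->
  (forall z n, Cmod (z - a)%C <= r ->
      Cmod (f z - csum (fun k => c k * (z - a) ^ k) n)%C <= M * Cmod (z - a)%C ^ n / r ^ n) ->
  Cd (pdiv f a (c m) m) a (c (S m)).
Proof.
  intros Hr HM Hc HB; apply Cd_spec; intros eps He.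
  assert (Rm : 0 < r ^ (S (S m))) by (apply pow_lt; auto).
  exists (Rmin r (eps * r ^ (S (S m)) / (M + 1))); split.
  { apply Rmin_pos; auto; apply Rdiv_lt_0_compat; [apply Rmult_lt_0_compat|]; lra. }
  intros w Hw.
  pose proof (Rmin_l r (eps * r ^ (S (S m)) / (M + 1))).
  pose proof (Rmin_r r (eps * r ^ (S (S m)) / (M + 1))).
  unfold pdiv; destruct (Ceq_dec a a) as [_|]; [|congruence].
  destruct (Ceq_dec w a) as [->|N].
  - replace (c m - c m - c (S m) * (a - a))%C with (RtoC 0) by ring.
    rewrite Cmod_0, Cmod_m_0; lra.
  - assert (N' : (w - a)%C <> 0) by (apply Cminus_eq_contra; auto).
    specialize (HB w (S (S m)) ltac:(lra)).
    change (csum (fun k => c k * (w - a) ^ k)%C (S (S m))) with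
      (csum (fun k => c k * (w - a) ^ k)%C m + c m * (w - a) ^ m + c (S m) * (w - a) ^ (S m))%C in HB.
    rewrite csum_leading, Cplus_0_l in HB by auto.
    replace (f w / (w - a) ^ m - c m - c (S m) * (w - a))%C
      with ((f w - (c m * (w - a) ^ m + c (S m) * (w - a) ^ S m)) / (w - a) ^ m)%C.
    2:{ rewrite Cpow_S; field; apply Cpow_nz; auto. }
    rewrite Cmod_div, Cmod_pow by (apply Cpow_nz; auto).
    set (t := Cmod (w - a)%C) in *.
    assert (t0 : 0 < t) by (apply Cmod_gt_0; auto).
    assert (tm : 0 < t ^ m) by (apply pow_lt; auto).
    apply Rle_div_l; auto.
    eapply Rle_trans; [exact HB|]; apply Rle_div_l; auto.
    assert (T : t <= eps * r ^ (S (S m)) / (M + 1)) by lra.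
    apply Rle_div_r in T; [|lra].
    replace (t ^ (S (S m))) with (t * t * t ^ m) by (simpl; ring).
    assert (M * t <= eps * r ^ (S (S m))) by nra.
    replace (M * (t * t * t ^ m)) with (M * t * (t * t ^ m)) by ring.
    replace (eps * t * t ^ m * r ^ (S (S m))) with (eps * r ^ (S (S m)) * (t * t ^ m)) by ring.
    apply Rmult_le_compat_r; auto; nra.
Qed.

(** Either all Taylor coefficients vanish and the geometric remainder kills [f] near [a], or the
    first nonzero one gives the order. The factorisation is claimed for every [z], not just near
    [a], because off [a] the cofactor is defined by division. *)
Lemma order_dichotomy (f : C -> C) (a : C) : near a (holomorphic_at f) ->
  near a (fun z => f z = 0) \/
  exists m g, near a (holomorphic_at g) /\ g a <> 0 /\ forall z, f z = ((z - a) ^ m * g z)%C.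
Proof.
  intros Hn; destruct (Taylor_local f a Hn) as [c [r [M [Hr [HM [_ [c0 [_ HB]]]]]]]].
  destruct (classic (exists m, c m <> 0)) as [E|E].
  - right; assert (exists m, c m <> 0 /\ forall k, (k < m)%nat -> c k = 0) as [m [Em Lm]].
    { destruct E as [m Em]; revert Em; induction m as [m IH] using lt_wf_ind; intros Em.
      destruct (classic (exists k, (k < m)%nat /\ c k <> 0)) as [[k [Lk Ek]]|N].
      - eapply IH; eauto.
      - exists m; split; auto; intros k Lk; apply NNPP; intros K; apply N; eauto. }
    exists m, (pdiv f a (c m) m); split; [|split].
    + apply (near_mono _ (fun z => holomorphic_at f z)); [|auto].
      intros z Hz; destruct (Ceq_dec z a) as [->|N]; [|apply pdiv_off; auto].
      eapply Cd_hol, pdiv_at; eauto.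
    + unfold pdiv; destruct (Ceq_dec a a); congruence.
    + intros z; unfold pdiv; destruct (Ceq_dec z a) as [->|N].
      * replace (a - a)%C with (RtoC 0) by ring; destruct m as [|m]; [simpl; rewrite c0; ring|].
        rewrite <- c0, Lm by lia; simpl; ring.
      * assert ((z - a)%C <> 0) by (apply Cminus_eq_contra; auto).
        field; apply Cpow_nz; auto.
  - left; exists (r / 2); split; [lra|]; intros z Hz; apply Cmod_small_0; intros e He.
    assert (t0 : 0 <= Cmod (z - a)%C) by apply Cmod_ge_0.
    destruct (geom_small (Cmod (z - a)%C / r) M e) as [n Hn']; auto.
    + split; [apply Rdiv_le_0_compat; auto|apply Rlt_div_l; lra].
    + specialize (HB z n ltac:(lra)).
      rewrite csum_leading in HB by (intros; apply NNPP; intros K; apply E; eauto).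
      replace (f z - 0)%C with (f z) in HB by ring.
      unfold Rdiv in Hn'; rewrite Rpow_mult_distr, pow_inv in Hn'.
      unfold Rdiv in HB; lra.
Qed.

Definition dq (f : C -> C) (a v : C) : C :=
  if Ceq_dec v a then C_derive f a else ((f v - f a) / (v - a))%C.

Lemma dq_hol (f : C -> C) (a z : C) : near a (holomorphic_at f) -> holomorphic_at f z ->
  holomorphic_at (dq f a) z.
Proof.
  intros Hn Hz; destruct (Ceq_dec z a) as [->|N]; [|apply diff_quot_hol; auto].
  set (h := fun v => (f v - f a)%C).
  assert (Hh : near a (holomorphic_at h)).
  { apply (near_mono _ (fun v => holomorphic_at f v)); auto; intros v Hv.
    apply hol_minus; auto; apply hol_const. }
  destruct (Taylor_local h a Hh) as [c [r [M [Hr [HM [_ [c0 [c1 HB]]]]]]]].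
  assert (E : c 1%nat = C_derive f a).
  { symmetry; apply Cd_C_derive.
    apply (Cd_ext (fun v => h v + f a)%C); [intros; unfold h; ring|].
    eapply Cd_eqn; [apply Cd_plus; [exact c1|apply Cd_const]|ring]. }
  assert (K : Cd (pdiv h a (c 1%nat) 1) a (c 2%nat)).
  { eapply pdiv_at; eauto; intros k Lk; replace k with O by lia.
    rewrite c0; unfold h; ring. }
  eapply Cd_hol, Cd_ext; [|exact K].
  intros v; unfold pdiv, dq, h; rewrite E; destruct (Ceq_dec v a); auto; simpl.
  rewrite Cmult_1_r; reflexivity.
Qed.

Lemma dq_eq (f : C -> C) (a z : C) : f z = (f a + dq f a z * (z - a))%C.
Proof.
  unfold dq; destruct (Ceq_dec z a) as [->|N]; [ring|].
  field; apply Cminus_eq_contra; auto.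
Qed.

(** The growth condition says that [(z - a)^2 * f z] has derivative 0 at [a], so it is holomorphic
    there with a double zero; taking difference quotients at [a] twice restores [f]. *)
Theorem removable (f : C -> C) (a : C) :
  near a (fun z => z <> a -> holomorphic_at f z) ->
  (forall e, 0 < e -> near a (fun z => Cmod ((z - a) * f z)%C <= e)) ->
  exists l, holomorphic_at (fun z => if Ceq_dec z a then l else f z) a.
Proof.
  intros Hf Hl; set (g := fun z => ((z - a) * ((z - a) * f z))%C).
  assert (Dg : Cd g a 0).
  { apply Cd_spec; intros e He; apply (near_mono _ (fun z => Cmod ((z - a) * f z)%C <= e)); auto.
    intros z Hz; unfold g.
    replace ((z - a) * ((z - a) * f z) - (a - a) * ((a - a) * f a) - 0 * (z - a))%C
      with (((z - a) * f z) * (z - a))%C by ring.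
    rewrite Cmod_mult; apply Rmult_le_compat_r; auto using Cmod_ge_0. }
  assert (Hg : near a (holomorphic_at g)).
  { apply (near_mono _ (fun z => z <> a -> holomorphic_at f z)); auto.
    intros z Hz; destruct (Ceq_dec z a) as [->|N]; [eapply Cd_hol; eauto|].
    assert (holomorphic_at (fun z => z - a)%C z) by (apply hol_minus; [apply hol_id|apply hol_const]).
    apply hol_mult; auto; apply hol_mult; auto. }
  set (k := dq g a).
  assert (Hk : near a (holomorphic_at k)).
  { apply (near_mono _ (fun z => holomorphic_at g z)); auto; intros z Hz; apply dq_hol; auto. }
  assert (Ek : forall z, k z = ((z - a) * f z)%C).
  { intros z; unfold k, dq; destruct (Ceq_dec z a) as [->|N].
    - rewrite (Cd_C_derive _ _ _ Dg); ring.
    - unfold g; field; apply Cminus_eq_contra; auto. }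
  exists (C_derive k a).
  apply (hol_ext_near (dq k a)); [|apply dq_hol; auto; apply near_here; auto].
  exists 1; split; [lra|]; intros z _; unfold dq; destruct (Ceq_dec z a) as [->|N]; auto.
  rewrite !Ek; field; apply Cminus_eq_contra; auto.
Qed.

Lemma Cauchy_estimate (f : C -> C) (a : C) (Rr r M : R) : 0 < r < Rr ->
  (forall z, Cdisc a Rr z -> holomorphic_at f z) ->
  (forall z, Cmod (z - a)%C = r -> Cmod (f z) <= M) ->
  Cmod (f a) <= M /\ Cmod (C_derive f a) <= M / r.
Proof.
  intros Hr Hf HM.
  destruct (Taylor f a Rr r M Hr Hf HM) as [c [Hc HB]].
  assert (M0 : 0 <= M).
  { eapply Rle_trans; [apply Cmod_ge_0|apply (HM (a + r)%C)].
    replace (a + r - a)%C with (RtoC r) by ring; rewrite Cmod_R, Rabs_pos_eq; lra. }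
  assert (c0 : c O = f a).
  { specialize (HB a 1%nat); unfold Cdisc in HB; rewrite Cmod_m_0 in HB; specialize (HB ltac:(lra)).
    simpl in HB; replace (a - a)%C with (RtoC 0) in HB by ring.
    replace (f a - (0 + c O * 1))%C with (f a - c O)%C in HB by ring.
    symmetry; apply Ceq_minus, Cmod_eq_0, Rle_antisym; [|apply Cmod_ge_0].
    eapply Rle_trans; [exact HB|]; apply Req_le; field; lra. }
  assert (c1 : Cd f a (c 1%nat)).
  { apply Cd_spec; intros e He.
    exists (Rmin (r / 2) (e * (r * r) / (2 * M + 1))); split.
    - apply Rmin_pos; [lra|apply Rdiv_lt_0_compat; [|lra]]; apply Rmult_lt_0_compat; nra.
    - intros w Hw.
      pose proof (Rmin_l (r / 2) (e * (r * r) / (2 * M + 1))).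
      pose proof (Rmin_r (r / 2) (e * (r * r) / (2 * M + 1))).
      assert (Dw : Cdisc a r w) by (unfold Cdisc; lra).
      specialize (HB w 2%nat Dw); simpl in HB.
      replace (f w - (0 + c O * 1 + c 1%nat * ((w - a) * 1)))%C with (f w - f a - c 1%nat * (w - a))%C in HB
        by (rewrite <- c0; ring).
      eapply Rle_trans; [exact HB|].
      set (t := Cmod (w - a)%C) in *.
      assert (t0 : 0 <= t) by apply Cmod_ge_0.
      assert (T : t <= e * (r * r) / (2 * M + 1)) by lra.
      apply Rle_div_r in T; [|lra].
      assert (Q : r / (r - t) <= 2) by (apply Rle_div_l; lra).
      replace (t / r * (t / r * 1)) with (t * t / (r * r)) by (field; lra).
      apply Rle_trans with (M * 2 * (t * t / (r * r))).
      + apply Rmult_le_compat_r; [apply Rdiv_le_0_compat; nra|].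
        apply Rmult_le_compat_l; auto.
      + replace (M * 2 * (t * t / (r * r))) with (2 * M * (t * t) / (r * r)) by (field; lra).
        apply Rle_div_l; nra. }
  split.
  - rewrite <- c0; eapply Rle_trans; [apply Hc|]; simpl; apply Req_le; field.
  - rewrite (Cd_C_derive _ _ _ c1); eapply Rle_trans; [apply Hc|]; simpl; apply Req_le; field; lra.
Qed.

Lemma hol_poly2 (k0 k1 k2 a z : C) :
  Cd (fun w => k0 + k1 * (w - a) + k2 * (w - a) ^ 2)%C z (k1 + 2 * k2 * (z - a))%C.
Proof.
  assert (D1 : Cd (fun w => w - a)%C z 1)
    by (eapply Cd_eqn; [apply Cd_minus; [apply Cd_id|apply Cd_const]|ring]).
  eapply Cd_eqn.
  - apply Cd_plus; [apply Cd_plus; [apply Cd_const|]|]; apply Cd_mult; try apply Cd_const; [exact D1|].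
    apply Cd_pow; exact D1.
  - simpl; replace (RtoC (1 + 1)) with (RtoC 2) by (f_equal; lra); ring.
Qed.

(** Subtract the quadratic Taylor polynomial. On the circle of radius [t = |z - a|] about [z] the
    remainder is of order [t^3], so by the Cauchy estimate its derivative at [z] is of order [t^2],
    which is little-o of [t]. *)
Theorem derive_hol (f : C -> C) (a : C) : near a (holomorphic_at f) -> holomorphic_at (C_derive f) a.
Proof.
  intros Hn; destruct (Taylor_local f a Hn) as [c [r [M [Hr [HM [_ [c0 [c1 HB]]]]]]]].
  destruct (near_gt _ _ r Hn Hr) as [d [Hd Hh]].
  set (K := M / r ^ 3).
  assert (K0 : 0 <= K) by (apply Rdiv_le_0_compat; [auto|apply pow_lt; auto]).
  apply (Cd_hol _ _ (2 * c 2%nat)%C), Cd_spec; intros e He.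
  exists (Rmin (d / 4) (e / (8 * K + 1))); split.
  { apply Rmin_pos; [lra|apply Rdiv_lt_0_compat; lra]. }
  intros z Hz.
  pose proof (Rmin_l (d / 4) (e / (8 * K + 1))); pose proof (Rmin_r (d / 4) (e / (8 * K + 1))).
  rewrite (Cd_C_derive _ _ _ c1).
  destruct (Ceq_dec z a) as [->|N].
  { rewrite (Cd_C_derive _ _ _ c1).
    replace (c 1%nat - c 1%nat - 2 * c 2%nat * (a - a))%C with (RtoC 0) by ring.
    rewrite Cmod_0, Cmod_m_0; lra. }
  set (h := fun w => (f w - (c O + c 1%nat * (w - a) + c 2%nat * (w - a) ^ 2))%C).
  set (t := Cmod (z - a)%C) in *.
  assert (t0 : 0 < t) by (apply Cmod_gt_0, Cminus_eq_contra; auto).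
  assert (Hf : forall w, Cdisc z (2 * t) w -> holomorphic_at f w).
  { intros w Hw; apply Hh; unfold Cdisc in Hw; pose proof (Cmod_tri w z a); fold t in H1; lra. }
  assert (E : Cmod (C_derive h z) <= 8 * K * t ^ 3 / t).
  { apply (Cauchy_estimate h z (2 * t) t).
    - lra.
    - intros w Hw; apply hol_minus; auto; eapply Cd_hol, hol_poly2.
    - intros w Hw; pose proof (Cmod_tri w z a) as T; fold t in T.
      specialize (HB w 3%nat ltac:(lra)); simpl csum in HB; unfold h.
      replace (f w - (c O + c 1%nat * (w - a) + c 2%nat * (w - a) ^ 2))%C with
       (f w - (0 + c O * (w - a) ^ 0 + c 1%nat * (w - a) ^ 1 + c 2%nat * (w - a) ^ 2))%C by (simpl; ring).
      eapply Rle_trans; [exact HB|].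
      replace (M * Cmod (w - a) ^ 3 / r ^ 3) with (K * Cmod (w - a) ^ 3) by (unfold K; field; lra).
      replace (8 * K * t ^ 3) with (K * (2 * t) ^ 3) by ring.
      apply Rmult_le_compat_l; auto; apply pow_incr; split; [apply Cmod_ge_0|lra]. }
  assert (Dh : C_derive h z = (C_derive f z - (c 1%nat + 2 * c 2%nat * (z - a)))%C).
  { apply Cd_C_derive, Cd_minus; [|apply hol_poly2].
    apply hol_Cd, Hf; unfold Cdisc; rewrite Cmod_m_0; lra. }
  rewrite Dh in E.
  replace (C_derive f z - c 1%nat - 2 * c 2%nat * (z - a))%C with
    (C_derive f z - (c 1%nat + 2 * c 2%nat * (z - a)))%C by ring.
  eapply Rle_trans; [exact E|].
  replace (8 * K * t ^ 3 / t) with (8 * K * t * t) by (field; lra).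
  assert (T : t <= e / (8 * K + 1)) by lra; apply Rle_div_r in T; [|lra].
  apply Rmult_le_compat_r; nra.
Qed.

Lemma pow_0_S (m : nat) : (RtoC 0 ^ S m)%C = 0.
Proof. simpl; ring. Qed.

(** If a value [v] close to [f a] were omitted, [1 / (f - v)] would be holomorphic near [a]. On a
    small circle the order of [f - f a] keeps [|f - v|] at least [D], whereas at the centre it is
    smaller than [D], contrary to the Cauchy estimate. *)
Theorem open_mapping (f : C -> C) (a : C) (e : R) : near a (holomorphic_at f) ->
  ~ near a (fun z => f z = f a) -> 0 < e ->
  near (f a) (fun v => exists w, Cmod (w - a)%C < e /\ f w = v).
Proof.
  intros Hn Hc He; set (h := fun v => (f v - f a)%C).
  assert (Hh : near a (holomorphic_at h)).
  { apply (near_mono _ (fun v => holomorphic_at f v)); auto; intros v Hv.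
    apply hol_minus; auto; apply hol_const. }
  destruct (order_dichotomy h a Hh) as [Z|[m [g [Hg [g0 Eg]]]]].
  { exfalso; apply Hc; revert Z; apply near_mono; intros z Hz; apply Ceq_minus; exact Hz. }
  destruct (near_gt _ _ e (near_and _ _ _ Hn (Ccont_lower g a (hol_cont _ _ (near_here _ _ Hg)) g0)) He)
    as [d [Hd K]].
  set (r := d / 2); assert (Hr : 0 < r < d) by (unfold r; lra).
  set (D := r ^ m * (Cmod (g a) / 2) / 2).
  assert (ga : 0 < Cmod (g a)) by (apply Cmod_gt_0; auto).
  assert (Rm : 0 < r ^ m) by (apply pow_lt; lra).
  assert (HD : 0 < D) by (unfold D; apply Rdiv_lt_0_compat; [|lra]; apply Rmult_lt_0_compat; lra).
  exists D; split; auto; intros v Hv; apply NNPP; intros N.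
  assert (Nz : forall w, Cdisc a d w -> (f w - v)%C <> 0).
  { intros w Hw E; apply N; exists w; split; [unfold Cdisc in Hw; lra|].
    replace (f w) with (f w - v + v)%C by ring; rewrite E; ring. }
  assert (Da : Cdisc a d a) by (unfold Cdisc; rewrite Cmod_m_0; lra).
  destruct (Cauchy_estimate (fun w => / (f w - v))%C a d r (/ D) Hr) as [E _].
  - intros w Hw; apply hol_inv; auto; apply hol_minus; [apply K, Hw|apply hol_const].
  - intros w Hw; assert (Dw : Cdisc a d w) by (unfold Cdisc; lra).
    rewrite Cmod_inv by auto; apply Rinv_le_contravar; auto.
    destruct (K w Dw) as [_ L].
    assert (L2 : 2 * D <= Cmod (f w - f a)%C).
    { change (f w - f a)%C with (h w); rewrite Eg, Cmod_mult, Cmod_pow, Hw; unfold D.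
      apply Rle_trans with (r ^ m * (Cmod (g a) / 2)); [lra|].
      apply Rmult_le_compat_l; lra. }
    pose proof (Cmod_tri (f w) v (f a)); lra.
  - simpl in E; rewrite Cmod_inv in E by auto.
    assert (Q : D <= Cmod (f a - v)%C).
    { apply Rnot_lt_le; intros Lt.
      assert (0 < Cmod (f a - v)%C) by (apply Cmod_gt_0; auto).
      assert (/ D < / Cmod (f a - v)%C) by (apply Rinv_lt_contravar; nra); lra. }
    rewrite Cmod_m_sym in Q; lra.
Qed.

Lemma nonconst_derive (f : C -> C) (a l : C) : Cd f a l -> l <> 0 -> ~ near a (fun z => f z = f a).
Proof.
  intros D L N; apply L; apply (Cd_unique f a); auto.
  apply (Cd_ext_near (fun _ => f a)); [|apply Cd_const].
  revert N; apply near_mono; intros; symmetry; auto.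
Qed.

(** Convexity allows propagation along the segment from [z0] to [z]. At the supremum of the good
    parameters [f] has zeros accumulating, so [order_dichotomy] leaves only local vanishing, and the
    supremum can be passed. *)
Theorem identity_theorem (U : C -> Prop) (f : C -> C) (z0 z : C) :
  convex U -> opn U -> (forall z, U z -> holomorphic_at f z) ->
  U z0 -> near z0 (fun w => f w = 0) -> U z -> f z = 0.
Proof.
  intros HU Uo Hf U0 H0 Uz.
  destruct (Ceq_dec z z0) as [->|Nz]; [apply (near_here _ _ H0)|].
  assert (HL : 0 < Cmod (z - z0)%C) by (apply Cmod_gt_0, Cminus_eq_contra; auto).
  set (P := fun s => near (seg z0 z s) (fun w => f w = 0)).
  set (E := fun s => 0 <= s <= 1 /\ forall s', 0 <= s' <= s -> P s').
  assert (S0 : seg z0 z 0 = z0) by (unfold seg; ring).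
  assert (S1 : seg z0 z 1 = z) by (unfold seg; ring).
  assert (E0 : E 0).
  { split; [lra|]; intros s' Hs'; replace s' with 0 by lra; unfold P; rewrite S0; auto. }
  destruct (completeness E) as [s [L1 L2]].
  - exists 1; intros x [Hx _]; lra.
  - exists 0; auto.
  - assert (s0 : 0 <= s) by (apply L1; auto).
    assert (s1 : s <= 1) by (apply L2; intros x [Hx _]; lra).
    assert (Below : forall s', 0 <= s' < s -> P s').
    { intros s' Hs'; apply NNPP; intros N.
      assert (s <= s'); [|lra]; apply L2; intros x [Hx Kx].
      apply Rnot_lt_le; intros Lt; apply N, Kx; lra. }
    assert (Dist : forall x y, Cmod (seg z0 z x - seg z0 z y)%C = Rabs (x - y) * Cmod (z - z0)%C).
    { intros x y; rewrite seg_diff, Cmod_mult, Cmod_R; auto. }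
    assert (Ps : P s).
    { destruct (Rle_lt_or_eq_dec 0 s s0) as [Lt|<-]; [|apply E0; lra].
      set (p := seg z0 z s).
      assert (Hn : near p (holomorphic_at f)).
      { apply (near_mono _ U); auto; apply Uo; apply HU; auto. }
      destruct (order_dichotomy f p Hn) as [Z|[m [g [Hg [g0 Eg]]]]]; [exact Z|exfalso].
      destruct (Ccont_neq g p 0 (hol_cont _ _ (near_here _ _ Hg)) g0) as [d [Hd K]].
      set (s' := Rmax 0 (s - d / (2 * Cmod (z - z0)%C))).
      assert (Q : 0 < d / (2 * Cmod (z - z0)%C)) by (apply Rdiv_lt_0_compat; lra).
      assert (Hs' : 0 <= s' < s) by (unfold s'; split; [apply Rmax_l|apply Rmax_lub_lt; lra]).
      assert (Hs2 : s - s' <= d / (2 * Cmod (z - z0)%C)) by (unfold s'; pose proof (Rmax_r 0 (s - d / (2 * Cmod (z - z0)%C))); lra).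
      apply Rle_div_r in Hs2; [|lra].
      assert (Ed : Cmod (seg z0 z s' - p)%C = (s - s') * Cmod (z - z0)%C).
      { unfold p; rewrite Dist, Rabs_left1 by lra; ring. }
      pose proof (near_here _ _ (Below s' Hs')) as F; simpl in F.
      rewrite Eg in F.
      assert (N1 : (seg z0 z s' - p)%C <> 0) by (apply Cmod_gt_0; rewrite Ed; nra).
      apply (Cmult_neq_0 _ _ (Cpow_nz _ m N1) (K (seg z0 z s') ltac:(rewrite Ed; nra))); exact F. }
    destruct (Rle_lt_or_eq_dec s 1 s1) as [Lt|E1].
    + exfalso; destruct Ps as [d [Hd K]].
      set (h := Rmin (1 - s) (d / (4 * Cmod (z - z0)%C))).
      assert (Q : 0 < d / (4 * Cmod (z - z0)%C)) by (apply Rdiv_lt_0_compat; lra).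
      assert (Hh : 0 < h) by (apply Rmin_pos; lra).
      assert (h1 : h <= 1 - s) by apply Rmin_l.
      assert (h2 : h <= d / (4 * Cmod (z - z0)%C)) by apply Rmin_r.
      apply Rle_div_r in h2; [|lra].
      assert (s + h <= s); [|lra]; apply L1; split; [lra|].
      intros s' Hs'; destruct (Rlt_or_le s' s); [apply Below; lra|].
      exists (d / 2); split; [lra|]; intros w Hw; apply K.
      pose proof (Cmod_tri w (seg z0 z s') (seg z0 z s)) as T.
      rewrite Dist, Rabs_pos_eq in T by lra; nra.
    + rewrite E1 in Ps; unfold P in Ps; rewrite S1 in Ps; apply (near_here _ _ Ps).
Qed.

Theorem Liouville_zero (f : C -> C) :
  (forall z, holomorphic_at f z) ->
  (forall e, 0 < e -> exists B, forall z, B < Cmod z -> Cmod (f z) <= e) -> forall z, f z = 0.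
Proof.
  intros Hf Hl z; apply Cmod_small_0; intros e He; destruct (Hl e He) as [B HB].
  set (r := Rabs B + Cmod z + 1).
  assert (Hr : 0 < r) by (pose proof (Rabs_pos B); pose proof (Cmod_ge_0 z); unfold r; lra).
  apply (Cauchy_estimate f z (r + 1) r e); [lra|auto|].
  intros w Hw; apply HB.
  pose proof (Cmod_triangle w (- z)) as T; rewrite Cmod_opp in T.
  replace (w + - z)%C with (w - z)%C in T by ring; rewrite Hw in T; unfold r in T.
  pose proof (Rle_abs B); lra.
Qed.

Lemma Cexp_surj (z : C) : z <> 0 -> exists w, Cexp w = z.
Proof.
  intros N; assert (P : 0 < Cmod z) by (apply Cmod_gt_0; auto).
  destruct z as [x y]; set (r := Cmod (x, y)) in *.
  assert (R2 : x ^ 2 + y ^ 2 = r ^ 2).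
  { unfold r, Cmod; simpl fst; simpl snd; rewrite pow2_sqrt; auto.
    pose proof (pow2_ge_0 x); pose proof (pow2_ge_0 y); lra. }
  assert (Bx : -1 <= x / r <= 1).
  { assert (Rabs x <= r) by apply (Cmod_Re (x, y)).
    apply Rabs_le_between in H; split; [apply Rle_div_r|apply Rle_div_l]; lra. }
  set (th := acos (x / r)).
  assert (Ct : cos th = x / r) by (apply cos_acos; auto).
  assert (St : (sin th) ^ 2 = (y / r) ^ 2).
  { pose proof (sin2_cos2 th) as K; unfold Rsqr in K; rewrite Ct in K.
    replace ((y / r) ^ 2) with (1 - x / r * (x / r)).
    - simpl; lra.
    - replace ((y / r) ^ 2) with (y ^ 2 / r ^ 2) by (field; lra).
      replace (y ^ 2) with (r ^ 2 - x ^ 2) by lra; field; lra. }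
  assert (D : sin th = y / r \/ sin th = - (y / r)).
  { assert ((sin th - y / r) * (sin th + y / r) = 0) by (ring_simplify; lra).
    apply Rmult_integral in H; destruct H; [left|right]; lra. }
  destruct D as [D|D].
  - exists (ln r, th); unfold Cexp; simpl; rewrite exp_ln, Ct, D by auto; f_equal; field; lra.
  - exists (ln r, - th); unfold Cexp; simpl; rewrite exp_ln, cos_neg, sin_neg, Ct, D by auto; f_equal; field; lra.
Qed.

Theorem log_exists (U : C -> Prop) (f : C -> C) : convex U -> opn U ->
  (forall z, U z -> holomorphic_at f z) -> (forall z, U z -> f z <> 0) ->
  exists L, forall z, U z -> Cd L z (C_derive f z / f z)%C /\ Cexp (L z) = f z.
Proof.
  intros HU Uo Hf Nf.
  destruct (classic (exists z0, U z0)) as [[z0 U0]|N].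
  2:{ exists (fun _ => RtoC 0); intros z Hz; exfalso; eauto. }
  destruct (primitive U (fun z => C_derive f z / f z)%C HU Uo) as [L HL].
  { intros z Hz; apply hol_div; auto; apply derive_hol.
    apply (near_mono _ U); auto. }
  destruct (Cexp_surj (f z0 / Cexp (L z0))%C) as [k Hk].
  { apply Cmult_neq_0; auto; intros E.
    apply (Cexp_nz (- L z0)%C); rewrite Cexp_opp; exact E. }
  exists (fun z => L z + k)%C; intros z Hz; split.
  - eapply Cd_eqn; [apply Cd_plus; [apply HL; auto|apply Cd_const]|ring].
  - assert (E : (f z * Cexp (- L z))%C = (f z0 * Cexp (- L z0))%C).
    { apply (Cd_zero_const U (fun z => f z * Cexp (- L z))%C); auto.
      intros w Hw; eapply Cd_eqn.
      - apply Cd_mult; [apply hol_Cd; auto|apply Cd_exp, Cd_opp, HL; auto].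
      - cbv beta; field; auto. }
    rewrite Cexp_plus, Hk; unfold Cdiv; rewrite <- Cexp_opp, <- E, Cexp_opp; field; apply Cexp_nz.
Qed.

(** Meant for functions [T] defined by an arbitrary choice of preimages under [p], about which no
    continuity is known. The open mapping theorem supplies, for each value near [p a], a preimage
    near [a], and along it the difference quotient of [T] is the ratio of the slopes of [F] and
    [p]. *)
Theorem quotient_hol (T p F : C -> C) (a l l' : C) :
  near a (holomorphic_at p) -> Cd p a l -> l <> 0 -> Cd F a l' ->
  near a (fun z => T (p z) = F z) -> Cd T (p a) (l' / l)%C.
Proof.
  intros Hp Dp L DF HT.
  pose proof (open_mapping p a) as OM.
  pose proof (nonconst_derive _ _ _ Dp L) as NC.
  pose proof (near_here _ _ HT) as T0; simpl in T0.
  destruct Dp as [ps [Cps [Eps Hps]]], DF as [ph [Cph [Eph Hph]]].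
  set (S := fun v => if Ceq_dec v (p a) then (l' / l)%C else ((T v - T (p a)) / (v - p a))%C).
  exists S; repeat split.
  - intros e He.
    assert (Cq : Ccont (fun z => ph z / ps z)%C a) by (apply Ccont_div; auto; congruence).
    destruct (near_and _ _ _ (near_and _ _ _ (Cq e He) HT) (Ccont_neq ps a 0 Cps ltac:(congruence)))
      as [d [Hd K]].
    destruct (OM d Hp NC Hd) as [d' [Hd' K']]; exists d'; split; auto.
    intros v Hv; unfold S; destruct (Ceq_dec (p a) (p a)) as [_|]; [|congruence].
    destruct (Ceq_dec v (p a)) as [E|N]; [rewrite Cmod_m_0; auto|].
    destruct (K' v Hv) as [w [Hw <-]]; destruct (K w Hw) as [[K1 K2] K3].
    rewrite K2, T0, (Hph w), (Hps w).
    assert (Nw : (w - a)%C <> 0).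
    { intros E; apply N; rewrite (Hps w), E; ring. }
    rewrite <- Eph, <- Eps.
    replace ((F a + ph w * (w - a) - F a) / (p a + ps w * (w - a) - p a))%C with (ph w / ps w)%C; auto.
    field; repeat split; auto.
    replace (p a + ps w * (w - a) - p a)%C with (ps w * (w - a))%C by ring; apply Cmult_neq_0; auto.
  - unfold S; destruct (Ceq_dec (p a) (p a)); congruence.
  - intros v; unfold S; destruct (Ceq_dec v (p a)) as [->|N]; [ring|].
    field; apply Cminus_eq_contra; auto.
Qed.

(** * Expansions at a cusp *)

Lemma RtoC_nz (x : R) : x <> 0 -> RtoC x <> 0.
Proof. intros H E; apply RtoC_inj in E; auto. Qed.

Lemma Cexp_eq_1 (z : C) : Cexp z = 1 -> exists k : Z, z = (IZR k * tpi)%C.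
Proof.
  intros E; assert (M := Cmod_Cexp z); rewrite E, Cmod_1 in M.
  assert (Rz : Re z = 0) by (apply exp_inv; rewrite exp_0; auto).
  destruct z as [x y]; simpl in Rz; subst x.
  unfold Cexp in E; simpl in E; rewrite exp_0 in E.
  assert (Ec : cos y = 1) by (apply (f_equal fst) in E; simpl in E; lra).
  assert (Es : sin y = 0) by (apply (f_equal snd) in E; simpl in E; lra).
  apply sin_eq_0_0 in Es; destruct Es as [k Ek].
  destruct (Z.Even_or_Odd k) as [[j Hj]|[j Hj]].
  - exists j; rewrite tpi_pair; unfold RtoC, Cmult; simpl; f_equal; [ring|].
    rewrite Ek, Hj, mult_IZR; ring.
  - exfalso.
    assert (cos y = -1); [|lra].
    rewrite Ek, Hj, plus_IZR, mult_IZR.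
    replace ((2 * IZR j + 1) * PI) with (PI + 2 * IZR j * PI) by ring.
    rewrite Rtrigo_facts.cos_pi_plus.
    assert (cos (2 * IZR j * PI) = 1); [|lra].
    replace (2 * IZR j * PI) with (2 * (IZR j * PI)) by ring.
    rewrite cos_2a_sin, (sin_eq_0_1 (IZR j * PI)); [ring|exists j; reflexivity].
Qed.

Definition qexp (w : R) (tau : C) : C := Cexp (tpi * tau / w)%C.

Lemma qexp_mod (w : R) (tau : C) : w <> 0 -> Cmod (qexp w tau) = exp (- (2 * PI) * Im tau / w).
Proof.
  intros Hw; unfold qexp; rewrite Cmod_Cexp; f_equal.
  replace (tpi * tau / w)%C with (RtoC (/ w) * (tpi * tau))%C
    by (rewrite RtoC_inv by auto; field; apply RtoC_nz; auto).
  rewrite re_scal_l, tpi_pair, re_mult; simpl; field; auto.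
Qed.

Lemma qexp_nz (w : R) (tau : C) : qexp w tau <> 0.
Proof. apply Cexp_nz. Qed.

Lemma Cd_qexp (w : R) (tau : C) : w <> 0 -> Cd (qexp w) tau (qexp w tau * (tpi / w))%C.
Proof.
  intros Hw; pose proof (RtoC_nz w Hw); apply Cd_exp; eapply Cd_eqn.
  - apply Cd_div; [apply Cd_mult; [apply Cd_const|apply Cd_id]|apply Cd_const|auto].
  - cbv beta; field; auto.
Qed.

Lemma qexp_surj (w : R) (z : C) : w <> 0 -> z <> 0 -> exists tau, qexp w tau = z.
Proof.
  intros Hw Hz; destruct (Cexp_surj z Hz) as [v Hv]; exists (v * w / tpi)%C.
  unfold qexp; rewrite <- Hv; f_equal; field; split; auto using RtoC_nz, tpi_nz.
Qed.

Lemma qexp_eq (w : R) (tau tau' : C) : w <> 0 -> qexp w tau = qexp w tau' ->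
  exists k : Z, tau' = (tau + IZR k * w)%C.
Proof.
  intros Hw E; pose proof (RtoC_nz w Hw).
  destruct (Cexp_eq_1 (tpi * tau' / w - tpi * tau / w)%C) as [k Hk].
  - rewrite Cexp_minus; unfold qexp in E; rewrite E; field; apply Cexp_nz.
  - exists k; pose proof tpi_nz.
    replace tau' with (tau + (tpi * tau' / w - tpi * tau / w) * w / tpi)%C by (field; auto).
    rewrite Hk; field; auto.
Qed.

Lemma qexp_lt (w Y : R) (tau : C) : 0 < w ->
  Cmod (qexp w tau) < exp (- (2 * PI) * Y / w) <-> Y < Im tau.
Proof.
  intros Hw; rewrite qexp_mod by lra; pose proof PI_RGT_0.
  assert (Hi : 0 < / w) by (apply Rinv_0_lt_compat; auto).
  split; intros K.
  - apply exp_lt_inv in K; unfold Rdiv in K; apply Rmult_lt_reg_r in K; auto; nra.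
  - apply exp_increasing; unfold Rdiv; apply Rmult_lt_compat_r; auto; nra.
Qed.

Lemma Im_plus_R (tau : C) (x : R) : Im (tau + x)%C = Im tau.
Proof. rewrite im_plus, im_RtoC; ring. Qed.

Lemma upper_near (tau : C) (Y : R) : Y < Im tau -> near tau (fun z => Y < Im z).
Proof.
  intros H; exists (Im tau - Y); split; [lra|]; intros z Hz.
  pose proof (Cmod_Im (z - tau)) as K.
  replace (z - tau)%C with (z + - tau)%C in K by ring; rewrite im_plus, im_opp in K.
  replace (z + - tau)%C with (z - tau)%C in K by ring.
  apply Rabs_le_between in K; lra.
Qed.

Lemma upper_opn (Y : R) : opn (fun z => Y < Im z).
Proof. intros z Hz; apply upper_near; auto. Qed.

Lemma upper_convex (Y : R) : convex (fun z => Y < Im z).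
Proof.
  intros a b Ha Hb s Hs; unfold seg, Cminus; rewrite im_plus, im_scal_l, im_plus, im_opp.
  destruct (Req_dec s 0) as [->|N]; [lra|].
  assert (s * (Im b - Y) > 0) by nra; nra.
Qed.

Lemma upper_near_icusp (P : C -> Prop) : near_icusp P -> exists Y, 0 < Y /\ forall tau, Y < Im tau -> P tau.
Proof.
  intros [Y H]; exists (Rmax 1 Y); split; [pose proof (Rmax_l 1 Y); lra|].
  intros tau Ht; apply H; pose proof (Rmax_r 1 Y); lra.
Qed.

Lemma periodic_Z (F : C -> C) (w Y : R) : (forall tau, Y < Im tau -> F (tau + w)%C = F tau) ->
  forall k : Z, forall tau, Y < Im tau -> F (tau + IZR k * w)%C = F tau.
Proof.
  intros H.
  assert (N : forall n : nat, forall tau, Y < Im tau -> F (tau + INR n * w)%C = F tau).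
  { induction n as [|n IH]; intros tau Ht.
    - simpl; f_equal; ring.
    - rewrite S_INR, RtoC_plus; replace (tau + (INR n + 1) * w)%C with ((tau + INR n * w) + w)%C by ring.
      rewrite H, IH; auto.
      rewrite <- RtoC_mult, Im_plus_R; auto. }
  intros k tau Ht; destruct (Z.le_ge_cases 0 k) as [L|L].
  - rewrite <- (Z2Nat.id k L), <- INR_IZR_INZ; auto.
  - set (n := Z.to_nat (- k)).
    assert (E : IZR k = - INR n) by (unfold n; rewrite INR_IZR_INZ, Z2Nat.id, opp_IZR by lia; ring).
    rewrite E, <- (N n); [f_equal; rewrite RtoC_opp; ring|].
    rewrite <- RtoC_mult, Im_plus_R; auto.
Qed.

(* The Fourier expansion at a cusp of width [w]. *)
Theorem qchart (F : C -> C) (w Y : R) (l : C) : 0 < w ->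
  (forall tau, Y < Im tau -> holomorphic_at F tau) ->
  (forall tau, Y < Im tau -> F (tau + w)%C = F tau) ->
  (forall e, 0 < e -> near_icusp (fun tau => Cmod (F tau - l)%C < e)) ->
  exists T : C -> C, T 0 = l /\
    (forall z, Cmod z < exp (- (2 * PI) * Y / w) -> holomorphic_at T z) /\
    (forall tau, Y < Im tau -> F tau = T (qexp w tau)).
Proof.
  intros Hw Hf Hp Hl.
  set (r := exp (- (2 * PI) * Y / w)).
  assert (Hr : 0 < r) by apply exp_pos.
  (* An arbitrary preimage under [qexp w] suffices: two of them differ by a multiple of [w], under
     which [F] is invariant. *)
  set (sec := fun z : C => epsilon (inhabits (RtoC 0)) (fun tau => Y < Im tau /\ qexp w tau = z)).
  assert (Hsec : forall z : C, z <> 0 -> Cmod z < r -> Y < Im (sec z) /\ qexp w (sec z) = z).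
  { intros z Nz Hz; unfold sec.
    apply (epsilon_spec (inhabits (RtoC 0)) (fun tau => Y < Im tau /\ qexp w tau = z)).
    destruct (qexp_surj w z ltac:(lra) Nz) as [tau Ht]; exists tau; split; auto.
    apply (qexp_lt w); auto; rewrite Ht; auto. }
  set (T := fun z : C => if Ceq_dec z 0 then l else F (sec z)).
  assert (HT : forall tau, Y < Im tau -> T (qexp w tau) = F tau).
  { intros tau Ht; unfold T; destruct (Ceq_dec (qexp w tau) 0) as [E|N]; [apply qexp_nz in E; tauto|].
    assert (Q : Cmod (qexp w tau) < r) by (apply (qexp_lt w Y); auto).
    destruct (Hsec (qexp w tau) N Q) as [S1 S2].
    destruct (qexp_eq w tau (sec (qexp w tau))) as [k Hk]; [lra|auto|].
    rewrite Hk, (periodic_Z F w Y); auto. }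
  assert (Hol : forall z : C, z <> 0 -> Cmod z < r -> holomorphic_at T z).
  { intros z Nz Hz; destruct (Hsec z Nz Hz) as [S1 S2]; rewrite <- S2.
    eapply Cd_hol; apply (quotient_hol T (qexp w) F (sec z)).
    - apply (near_mono _ (fun _ => True)); [|exists 1; split; [lra|auto]].
      intros v _; eapply Cd_hol, Cd_qexp; lra.
    - apply Cd_qexp; lra.
    - apply Cmult_neq_0; [apply qexp_nz|].
      apply Cmult_neq_0; [apply tpi_nz|].
      rewrite <- RtoC_inv by lra; apply RtoC_nz, Rinv_neq_0_compat; lra.
    - apply hol_Cd, Hf; auto.
    - apply (near_mono _ (fun z => Y < Im z)); [|apply upper_near; auto]; intros v Hv; apply HT; auto. }
  assert (Lim : forall e, 0 < e -> near 0 (fun z => Cmod (T z - l)%C < e)).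
  { intros e He; destruct (Hl e He) as [Y' HY'].
    exists (Rmin r (exp (- (2 * PI) * Y' / w))); split; [apply Rmin_pos; auto; apply exp_pos|].
    intros z Hz; replace (z - 0)%C with z in Hz by ring.
    pose proof (Rmin_l r (exp (- (2 * PI) * Y' / w))); pose proof (Rmin_r r (exp (- (2 * PI) * Y' / w))).
    unfold T; destruct (Ceq_dec z 0) as [E|N]; [rewrite Cmod_m_0; auto|].
    destruct (Hsec z N) as [S1 S2]; [lra|].
    apply HY', (qexp_lt w); auto; rewrite S2; lra. }
  assert (T0 : T 0 = l) by (unfold T; destruct (Ceq_dec 0 0); congruence).
  exists T; split; [auto|split].
  - intros z Hz; destruct (Ceq_dec z 0) as [->|N]; [|auto].
    destruct (removable T 0) as [l' Hl'].
    + exists r; split; auto; intros v Hv Nv; apply Hol; auto.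
      replace (v - 0)%C with v in Hv by ring; auto.
    + intros e He; destruct (Lim 1 Rlt_0_1) as [d [Hd K]].
      assert (B : 0 < Cmod l + 1) by (pose proof (Cmod_ge_0 l); lra).
      exists (Rmin d (e / (Cmod l + 1))); split; [apply Rmin_pos; auto; apply Rdiv_lt_0_compat; auto|].
      intros v Hv; pose proof (Rmin_l d (e / (Cmod l + 1))); pose proof (Rmin_r d (e / (Cmod l + 1))).
      specialize (K v ltac:(lra)).
      pose proof (Cmod_tri_inv (T v) l).
      assert (Q : Cmod (v - 0)%C < e / (Cmod l + 1)) by lra.
      apply Rlt_div_r in Q; auto.
      rewrite Cmod_mult; pose proof (Cmod_ge_0 (v - 0)%C).
      apply Rle_trans with (Cmod (v - 0)%C * (Cmod l + 1)); [|lra].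
      apply Rmult_le_compat_l; lra.
    (* The value supplied by [removable] must be identified with [l], since [T 0] was set to [l]
       beforehand. *)
    + assert (E : l' = l).
      { apply Ceq_minus, Cmod_small_0; intros e He.
        pose proof (hol_cont _ _ Hl') as Cl; destruct (near_and _ _ _ (Cl (e / 2) ltac:(lra)) (Lim (e / 2) ltac:(lra)))
          as [d [Hd K]].
        specialize (K (RtoC (d / 2))); replace (d / 2 - 0)%C with (RtoC (d / 2)) in K
          by (rewrite RtoC_div by lra; ring).
        replace (RtoC (d / 2) - 0)%C with (RtoC (d / 2)) in K by ring.
        rewrite Cmod_R, Rabs_pos_eq in K by lra; assert (Hd2 : d / 2 < d) by lra; specialize (K Hd2); cbv beta in K; revert K.
        destruct (Ceq_dec 0 0) as [_|]; [|congruence].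
        destruct (Ceq_dec (RtoC (d / 2)) 0) as [Z|_]; [apply RtoC_inj in Z; lra|].
        intros [K1 K2]; pose proof (Cmod_tri l' (T (RtoC (d / 2))) l).
        rewrite (Cmod_m_sym l' (T (RtoC (d / 2)))) in H; lra. }
      apply (hol_ext_near (fun z => if Ceq_dec z 0 then l' else T z)); auto.
      exists 1; split; [lra|]; intros v _; destruct (Ceq_dec v 0) as [->|]; [congruence|auto].
  - intros tau Ht; symmetry; auto.
Qed.

(** * Moebius transformations and discreteness *)

Ltac RtoC_push := rewrite ?RtoC_plus, ?RtoC_minus, ?RtoC_opp, ?RtoC_mult.

Lemma inH_near (tau : C) : inH tau -> near tau inH.
Proof. apply upper_near. Qed.

Lemma inH_opn : opn inH.
Proof. exact (upper_opn 0). Qed.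

Lemma inH_convex : convex inH.
Proof. exact (upper_convex 0). Qed.

Lemma autJ_im (g : mat2) (tau : C) : Im (autJ g tau) = mc g * Im tau.
Proof. unfold autJ; rewrite im_plus, im_scal_l, im_RtoC; ring. Qed.

Lemma autJ_re (g : mat2) (tau : C) : Re (autJ g tau) = mc g * Re tau + md g.
Proof. unfold autJ; rewrite re_plus, re_scal_l, re_RtoC; ring. Qed.

Lemma autJ_nz (g : mat2) (tau : C) : mdet g = 1 -> inH tau -> autJ g tau <> 0.
Proof.
  intros D H E; unfold inH in H.
  pose proof (autJ_im g tau) as I; pose proof (autJ_re g tau) as R0; rewrite E in I, R0; simpl in I, R0.
  assert (mc g = 0) by nra; unfold mdet in D; rewrite H0 in *; assert (md g = 0) by lra; rewrite H1 in D; lra.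
Qed.

Lemma mob_H (g : mat2) (tau : C) : mdet g = 1 -> inH tau -> mob g (Some tau) = Some (mobC g tau).
Proof.
  intros D H; simpl; destruct (Ceq_dec (autJ g tau) 0) as [E|]; auto.
  exfalso; apply (autJ_nz g tau); auto.
Qed.

Lemma Im_mobC (g : mat2) (tau : C) : mdet g = 1 -> inH tau ->
  Im (mobC g tau) = Im tau / Cmod (autJ g tau) ^ 2.
Proof.
  intros D H; pose proof (autJ_nz g tau D H) as N.
  assert (P : 0 < Cmod (autJ g tau) ^ 2) by (apply pow_lt, Cmod_gt_0; auto).
  rewrite Cmod2_alt, autJ_re, autJ_im in *.
  unfold mobC; destruct tau as [x y], g as [a b c d]; simpl in *.
  unfold autJ, Cdiv, Cinv, Cmult, Cplus, RtoC; simpl; unfold mdet in D; simpl in D.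
  set (Q := (c * x + d) * ((c * x + d) * 1) + c * y * (c * y * 1)) in *.
  replace (y / Q) with ((a * d - b * c) * y / Q) by (rewrite D; field; lra).
  unfold Q; field; unfold Q in P; repeat split; nra.
Qed.

Lemma mobC_H (g : mat2) (tau : C) : mdet g = 1 -> inH tau -> inH (mobC g tau).
Proof.
  intros D H; unfold inH; rewrite Im_mobC by auto.
  apply Rdiv_lt_0_compat; auto; apply pow_lt, Cmod_gt_0, autJ_nz; auto.
Qed.

Lemma det_C (g : mat2) : mdet g = 1 -> (ma g * md g - mb g * mc g)%C = 1.
Proof. intros D; rewrite <- !RtoC_mult, <- RtoC_minus; unfold mdet in D; rewrite D; auto. Qed.

Lemma mobC_diff (g : mat2) (z w : C) : mdet g = 1 -> autJ g z <> 0 -> autJ g w <> 0 ->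
  (mobC g z - mobC g w)%C = ((z - w) / (autJ g z * autJ g w))%C.
Proof.
  intros D Nz Nw; apply det_C in D; unfold mobC, autJ in *.
  transitivity ((ma g * md g - mb g * mc g) * (z - w) / ((mc g * z + md g) * (mc g * w + md g)))%C.
  - field; auto.
  - rewrite D; field; auto.
Qed.

Lemma Cd_autJ (g : mat2) (z : C) : Cd (autJ g) z (mc g).
Proof.
  eapply Cd_eqn; [apply Cd_plus; [apply Cd_mult; [apply Cd_const|apply Cd_id]|apply Cd_const]|]; cbv beta; ring.
Qed.

Lemma Cd_mobC (g : mat2) (z : C) : mdet g = 1 -> autJ g z <> 0 ->
  Cd (mobC g) z (/ (autJ g z * autJ g z))%C.
Proof.
  intros D N; eapply Cd_eqn.
  - unfold mobC; apply Cd_div; [|apply Cd_autJ|auto].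
    apply Cd_plus; [apply Cd_mult; [apply Cd_const|apply Cd_id]|apply Cd_const].
  - apply det_C in D; cbv beta; unfold autJ in *.
    transitivity ((ma g * md g - mb g * mc g) / ((mc g * z + md g) * (mc g * z + md g)))%C.
    + field; auto.
    + rewrite D; field; auto.
Qed.

Lemma autJ_mul (g h : mat2) (z : C) : autJ h z <> 0 ->
  autJ (mmul g h) z = (autJ g (mobC h z) * autJ h z)%C.
Proof.
  intros N; unfold mobC; unfold autJ at 1 2; simpl; RtoC_push.
  set (j := autJ h z) in *; field_simplify; auto; unfold j, autJ; ring.
Qed.

Lemma mobC_mul (g h : mat2) (z : C) : autJ h z <> 0 -> autJ g (mobC h z) <> 0 ->
  mobC (mmul g h) z = mobC g (mobC h z).
Proof.
  intros N N2; unfold mobC at 1; rewrite autJ_mul by auto; unfold mobC at 2; simpl; RtoC_push.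
  replace ((ma g * ma h + mb g * mc h) * z + (ma g * mb h + mb g * md h))%C
    with ((ma g * mobC h z + mb g) * autJ h z)%C.
  - field; auto.
  - unfold mobC; replace ((ma g * ((ma h * z + mb h) / autJ h z) + mb g) * autJ h z)%C
      with (ma g * (ma h * z + mb h) + mb g * autJ h z)%C by (field; auto).
    unfold autJ; ring.
Qed.

Lemma mdet_mul (g h : mat2) : mdet (mmul g h) = mdet g * mdet h.
Proof. unfold mdet, mmul; simpl; ring. Qed.

Lemma mdet_adj (g : mat2) : mdet (madj g) = mdet g.
Proof. unfold mdet, madj; simpl; ring. Qed.

Lemma mat2_ext (g h : mat2) : ma g = ma h -> mb g = mb h -> mc g = mc h -> md g = md h -> g = h.
Proof. destruct g, h; simpl; intros; subst; auto. Qed.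

Lemma mobC_adj (g : mat2) (z : C) : mdet g = 1 -> inH z -> mobC (madj g) (mobC g z) = z.
Proof.
  intros D H; assert (D' : mdet (madj g) = 1) by (rewrite mdet_adj; auto).
  rewrite <- mobC_mul.
  - replace (mmul (madj g) g) with mid.
    + unfold mobC, autJ, mid; simpl; field.
    + unfold mdet in D; apply mat2_ext; simpl; lra.
  - apply autJ_nz; auto.
  - apply autJ_nz; auto; apply mobC_H; auto.
Qed.

(** Infinite index sets stand in for subsequences, so that repeated extraction needs no
    reindexing. *)
Definition often (I : nat -> Prop) : Prop := forall N, exists k, (N <= k)%nat /\ I k.

Lemma often_or (I J K : nat -> Prop) : (forall k, I k -> J k \/ K k) -> often I -> often J \/ often K.
Proof.
  intros H HI; destruct (classic (often J)) as [|NJ]; auto; right; intros N.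
  apply (not_all_ex_not nat (fun N => exists k, (N <= k)%nat /\ J k)) in NJ; destruct NJ as [N0 NJ].
  destruct (HI (max N N0)) as [k [Lk Ik]]; exists k; split; [lia|].
  destruct (H k Ik); auto; exfalso; apply NJ; exists k; split; auto; lia.
Qed.

Lemma often_mono (I J : nat -> Prop) : (forall k, I k -> J k) -> often I -> often J.
Proof. intros H HI N; destruct (HI N) as [k [L K]]; eauto. Qed.

Lemma often_bisect (I : nat -> Prop) (x : nat -> R) (a b : R) (n : nat) : a <= b ->
  often (fun k => I k /\ a <= x k <= b) ->
  exists a' b', b' - a' = (b - a) * (1 / 2) ^ n /\ often (fun k => I k /\ a' <= x k <= b').
Proof.
  revert a b; induction n as [|n IH]; intros a b Hab H.
  - exists a, b; split; [simpl; ring|auto].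
  - set (m := (a + b) / 2).
    assert (Sp : forall k, I k /\ a <= x k <= b -> (I k /\ a <= x k <= m) \/ (I k /\ m <= x k <= b)).
    { intros k [Ik [X1 X2]]; destruct (Rle_dec (x k) m); [left|right]; repeat split; auto; lra. }
    destruct (often_or _ _ _ Sp H) as [K|K].
    + destruct (IH a m ltac:(unfold m; lra) K) as [a' [b' [E O]]]; exists a', b'; split; auto.
      rewrite E; unfold m; simpl; field.
    + destruct (IH m b ltac:(unfold m; lra) K) as [a' [b' [E O]]]; exists a', b'; split; auto.
      rewrite E; unfold m; simpl; field.
Qed.

(** A finite form of Bolzano-Weierstrass: of two halves of an interval one is visited infinitely
    often, and bisection continues until the length is below [e]. *)
Lemma often_close (I : nat -> Prop) (x : nat -> R) (M e : R) : 0 < e ->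
  often I -> (forall k, I k -> Rabs (x k) <= M) ->
  exists J, often J /\ (forall k, J k -> I k) /\ forall j k, J j -> J k -> Rabs (x j - x k) < e.
Proof.
  intros He HI HM.
  assert (M0 : 0 <= M) by (destruct (HI O) as [k [_ Ik]]; specialize (HM k Ik); pose proof (Rabs_pos (x k)); lra).
  destruct (pow_half_small (e / (2 * M + 1))) as [n Hn]; [apply Rdiv_lt_0_compat; lra|].
  destruct (often_bisect I x (- M) M n ltac:(lra)) as [a [b [E O]]].
  - revert HI; apply often_mono; intros k Ik; split; auto; apply Rabs_le_between; auto.
  - exists (fun k => I k /\ a <= x k <= b); split; auto; split; [tauto|].
    intros j k [_ Hj] [_ Hk].
    assert (b - a < e).
    { rewrite E; apply Rlt_div_r in Hn; [|lra].
      assert (0 < (1 / 2) ^ n) by (apply pow_lt; lra); nra. }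
    apply Rabs_def1; lra.
Qed.

(** On an infinite index set all four entries agree up to [e]. Each entry of [gs k] times the
    inverse of [gs k0] then differs from that of the identity by two products of size at most
    [e * M], whence [e = eps / (2 * M + 1)], and discreteness forces equality. *)
Lemma discrete_subsequence (G : mat2 -> Prop) (gs : nat -> mat2) (M : R) (I : nat -> Prop) :
  PSL2R_subgroup G -> discrete_group G -> often I ->
  (forall k, I k -> G (gs k) /\ Rabs (ma (gs k)) <= M /\ Rabs (mb (gs k)) <= M /\
     Rabs (mc (gs k)) <= M /\ Rabs (md (gs k)) <= M) ->
  exists g, G g /\ often (fun k => I k /\ gs k = g).
Proof.
  intros HG [eps [He Hd]] HI HB.
  assert (M0 : 0 <= M).
  { destruct (HI O) as [k [_ Ik]]; destruct (HB k Ik) as [_ [B _]].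
    pose proof (Rabs_pos (ma (gs k))); lra. }
  set (e := eps / (2 * M + 1)).
  assert (He' : 0 < e) by (apply Rdiv_lt_0_compat; lra).
  assert (Hem : e * (2 * M + 1) = eps) by (unfold e; field; lra).
  destruct (often_close I (fun k => ma (gs k)) M e He' HI) as [J1 [O1 [S1 C1]]].
  { intros k Ik; apply HB; auto. }
  destruct (often_close J1 (fun k => mb (gs k)) M e He' O1) as [J2 [O2 [S2 C2]]].
  { intros k Ik; apply HB; auto. }
  destruct (often_close J2 (fun k => mc (gs k)) M e He' O2) as [J3 [O3 [S3 C3]]].
  { intros k Ik; apply HB; auto. }
  destruct (often_close J3 (fun k => md (gs k)) M e He' O3) as [J4 [O4 [S4 C4]]].
  { intros k Ik; apply HB; auto. }
  destruct (O4 O) as [k0 [_ K0]]; exists (gs k0).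
  assert (B0 := HB k0 (S1 _ (S2 _ (S3 _ (S4 _ K0))))); destruct B0 as [G0 [A1 [A2 [A3 A4]]]].
  split; auto; revert O4; apply often_mono; intros k Kk; split; [auto|].
  assert (Gk : G (gs k)) by (apply HB; auto).
  specialize (C1 k k0 ltac:(auto) ltac:(auto)); specialize (C2 k k0 ltac:(auto) ltac:(auto)).
  specialize (C3 k k0 ltac:(auto) ltac:(auto)); specialize (C4 k k0 ltac:(auto) ltac:(auto)).
  pose proof (sg_det G HG _ G0) as D0; pose proof (sg_det G HG _ Gk) as Dk; unfold mdet in D0, Dk.
  assert (Small : forall p q r s, Rabs p < e -> Rabs q < e -> Rabs r <= M -> Rabs s <= M ->
            Rabs (p * r - q * s) < eps).
  { intros p q r s Hp Hq Hr Hs.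
    pose proof (Rabs_triang (p * r) (- (q * s))) as T; rewrite Rabs_Ropp, !Rabs_mult in T.
    replace (p * r + - (q * s)) with (p * r - q * s) in T by ring.
    pose proof (Rabs_pos p); pose proof (Rabs_pos q); pose proof (Rabs_pos r); pose proof (Rabs_pos s).
    assert (Rabs p * Rabs r <= e * M) by (apply Rmult_le_compat; lra).
    assert (Rabs q * Rabs s <= e * M) by (apply Rmult_le_compat; lra).
    lra. }
  assert (E : mmul (gs k) (madj (gs k0)) = mid).
  { apply Hd.
    - apply (sg_mul G HG); auto; apply (sg_inv G HG); auto.
    - simpl; replace (ma (gs k) * md (gs k0) + mb (gs k) * - mc (gs k0) - 1) with
       ((ma (gs k) - ma (gs k0)) * md (gs k0) - (mb (gs k) - mb (gs k0)) * mc (gs k0)) by lra; auto.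
    - simpl; replace (ma (gs k) * - mb (gs k0) + mb (gs k) * ma (gs k0)) with
       ((mb (gs k) - mb (gs k0)) * ma (gs k0) - (ma (gs k) - ma (gs k0)) * mb (gs k0)) by ring; auto.
    - simpl; replace (mc (gs k) * md (gs k0) + md (gs k) * - mc (gs k0)) with
       ((mc (gs k) - mc (gs k0)) * md (gs k0) - (md (gs k) - md (gs k0)) * mc (gs k0)) by ring; auto.
    - simpl; replace (mc (gs k) * - mb (gs k0) + md (gs k) * ma (gs k0) - 1) with
       ((md (gs k) - md (gs k0)) * ma (gs k0) - (mc (gs k) - mc (gs k0)) * mb (gs k0)) by lra; auto. }
  set (g := gs k) in *; set (h := gs k0) in *; clearbody g h.
  pose proof (f_equal ma E) as E1; pose proof (f_equal mb E) as E2;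
  pose proof (f_equal mc E) as E3; pose proof (f_equal md E) as E4; simpl in E1, E2, E3, E4.
  apply mat2_ext.
  - transitivity (ma g * (ma h * md h - mb h * mc h)); [rewrite D0; ring|].
    replace (ma g * (ma h * md h - mb h * mc h)) with
      (ma h * (ma g * md h + mb g * - mc h) + mc h * (ma g * - mb h + mb g * ma h)) by ring.
    rewrite E1, E2; ring.
  - transitivity (mb g * (ma h * md h - mb h * mc h)); [rewrite D0; ring|].
    replace (mb g * (ma h * md h - mb h * mc h)) with
      (mb h * (ma g * md h + mb g * - mc h) + md h * (ma g * - mb h + mb g * ma h)) by ring.
    rewrite E1, E2; ring.
  - transitivity (mc g * (ma h * md h - mb h * mc h)); [rewrite D0; ring|].
    replace (mc g * (ma h * md h - mb h * mc h)) with
      (ma h * (mc g * md h + md g * - mc h) + mc h * (mc g * - mb h + md g * ma h)) by ring.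
    rewrite E3, E4; ring.
  - transitivity (md g * (ma h * md h - mb h * mc h)); [rewrite D0; ring|].
    replace (md g * (ma h * md h - mb h * mc h)) with
      (mb h * (mc g * md h + md g * - mc h) + md h * (mc g * - mb h + md g * ma h)) by ring.
    rewrite E3, E4; ring.
Qed.

(** The formula for [Im v] bounds [c * tau + d], and [a * tau + b] is [v] times it. A real
    combination [p * tau + q] of bounded modulus has bounded coefficients because [Im tau] is
    bounded below. *)
Lemma entries_bound (g : mat2) (tau v : C) (B : R) : mdet g = 1 -> 0 < B ->
  / B < Im tau -> Cmod tau < B -> / B < Im v -> Cmod v < B -> mobC g tau = v ->
  Rabs (ma g) <= 2 * (B * B * B * B) /\ Rabs (mb g) <= 2 * (B * B * B * B) /\
  Rabs (mc g) <= 2 * (B * B * B * B) /\ Rabs (md g) <= 2 * (B * B * B * B).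
Proof.
  intros D HB It Mt Iv Mv E.
  assert (HB' : 0 < / B) by (apply Rinv_0_lt_compat; auto).
  assert (HH : inH tau) by (unfold inH; lra).
  pose proof (autJ_nz g tau D HH) as N.
  assert (J0 : 0 < Cmod (autJ g tau)) by (apply Cmod_gt_0; auto).
  assert (B1 : 1 <= B).
  { pose proof (Cmod_Im tau) as K; rewrite Rabs_pos_eq in K by lra.
    assert (/ B < B) by lra; assert (/ B * B = 1) by (field; lra); nra. }
  assert (J : Cmod (autJ g tau) <= B).
  { pose proof (Im_mobC g tau D HH) as K; rewrite E in K.
    assert (K2 : Im v * Cmod (autJ g tau) ^ 2 = Im tau) by (rewrite K; field; lra).
    pose proof (Cmod_Im tau) as K3; rewrite Rabs_pos_eq in K3 by lra.
    apply Rnot_lt_le; intros Lt.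
    assert (B * B < Cmod (autJ g tau) ^ 2) by (simpl; nra).
    assert (/ B * (B * B) < Im v * Cmod (autJ g tau) ^ 2) by (apply Rmult_gt_0_lt_compat; nra).
    replace (/ B * (B * B)) with B in H0 by (field; lra); lra. }
  assert (Nm : (ma g * tau + mb g)%C = (v * autJ g tau)%C).
  { rewrite <- E; unfold mobC; field; auto. }
  assert (Lin : forall p q K : R, Cmod (p * tau + q)%C <= K -> 0 <= K -> Rabs p <= B * K /\ Rabs q <= K + B * K * B).
  { intros p q K HK K0.
    pose proof (Cmod_Im (p * tau + q)) as I1; rewrite im_plus, im_scal_l, im_RtoC, Rplus_0_r, Rabs_mult in I1.
    rewrite (Rabs_pos_eq (Im tau)) in I1 by lra.
    assert (P1 : Rabs p <= B * K).
    { pose proof (Rabs_pos p); assert (Rabs p * / B <= K) by nra.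
      replace (Rabs p) with (B * (Rabs p * / B)) by (field; lra).
      apply Rmult_le_compat_l; lra. }
    split; auto.
    pose proof (Cmod_tri_inv q (p * tau + q)) as T.
    replace (q - (p * tau + q))%C with (- (p * tau))%C in T by ring.
    rewrite Cmod_opp, Cmod_mult, !Cmod_R in T.
    assert (Rabs p * Cmod tau <= B * K * B) by (apply Rmult_le_compat; auto using Rabs_pos, Cmod_ge_0; lra).
    lra. }
  destruct (Lin (mc g) (md g) B J ltac:(lra)) as [L1 L2].
  destruct (Lin (ma g) (mb g) (B * B)) as [L3 L4].
  - rewrite Nm, Cmod_mult; apply Rmult_le_compat; auto using Cmod_ge_0; lra.
  - nra.
  - assert (B <= B * B) by nra; assert (B * B <= B * B * B) by nra.
    assert (B * B * B <= B * B * B * B) by nra.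
    repeat split; lra.
Qed.

(** * Ramification at elliptic points *)

Lemma choice_fun (A : Type) (P : nat -> A -> Prop) : (forall n, exists x, P n x) ->
  exists f, forall n, P n (f n).
Proof.
  intros H; exists (fun n => proj1_sig (constructive_indefinite_description _ (H n))).
  intros n; apply (proj2_sig (constructive_indefinite_description _ (H n))).
Qed.

Lemma local_root (g : C -> C) (a : C) (m : nat) : (0 < m)%nat ->
  near a (holomorphic_at g) -> g a <> 0 ->
  exists Gr, near a (holomorphic_at Gr) /\ near a (fun z => (Gr z ^ m)%C = g z).
Proof.
  intros Hm Hg g0.
  destruct (near_and _ _ _ Hg (Ccont_neq g a 0 (hol_cont _ _ (near_here _ _ Hg)) g0)) as [d [Hd K]].
  destruct (log_exists (Cdisc a d) g) as [L HL].
  - apply Cdisc_convex.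
  - apply Cdisc_opn.
  - intros z Hz; apply K, Hz.
  - intros z Hz; apply K, Hz.
  - assert (Nm : RtoC (INR m) <> 0) by (apply RtoC_nz, not_0_INR; lia).
    exists (fun z => Cexp (L z / INR m)); split; exists d; split; auto; intros z Hz.
    + apply hol_exp, hol_div; [eapply Cd_hol, HL, Hz|apply hol_const|auto].
    + rewrite <- Cexp_nat; replace (INR m * (L z / INR m))%C with (L z) by (field; auto).
      apply HL, Hz.
Qed.

Definition invn (n : nat) : R := / (INR n + 1).

Lemma invn_pos (n : nat) : 0 < invn n.
Proof. apply Rinv_0_lt_compat; pose proof (pos_INR n); lra. Qed.

Lemma invn_small (e : R) : 0 < e -> exists N, forall n, (N <= n)%nat -> invn n < e.
Proof.
  intros He; destruct (INR_unbounded (/ e)) as [N HN]; exists N; intros n Hn.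
  apply le_INR in Hn; unfold invn; rewrite <- (Rinv_inv e).
  apply Rinv_lt_contravar; [|lra]; apply Rmult_lt_0_compat; [apply Rinv_0_lt_compat; auto|].
  pose proof (pos_INR n); lra.
Qed.

Lemma near_punctured (a : C) (P : C -> Prop) : near a P -> exists w, w <> a /\ P w.
Proof.
  intros [d [Hd H]]; exists (a + RtoC (d / 2))%C; split.
  - intros E; assert (K : RtoC (d / 2) = 0).
    { replace (RtoC (d / 2)) with (a + RtoC (d / 2) - a)%C by ring; rewrite E; ring. }
    apply RtoC_inj in K; lra.
  - apply H; replace (a + RtoC (d / 2) - a)%C with (RtoC (d / 2)) by ring.
    rewrite Cmod_R, Rabs_pos_eq; lra.
Qed.

(* Writing [x = k^m] with [k] a local coordinate, [v n] is the point with [k (v n) = zeta * k (w n)]. *)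
Lemma twist (x g : C -> C) (a zeta : C) (m : nat) : (0 < m)%nat ->
  near a (holomorphic_at g) -> g a <> 0 -> near a (fun z => x z = ((z - a) ^ m * g z)%C) ->
  (zeta ^ m)%C = 1 ->
  exists (w v : nat -> C) (Gr : C -> C), near a (holomorphic_at Gr) /\ Gr a <> 0 /\
    forall n, Cmod (w n - a)%C < invn n /\ Cmod (v n - a)%C < invn n /\ w n <> a /\
      Gr (w n) <> 0 /\
      x (v n) = x (w n) /\ ((v n - a) * Gr (v n))%C = (zeta * ((w n - a) * Gr (w n)))%C.
Proof.
  intros Hm Hg g0 Hx Hz.
  destruct (local_root g a m Hm Hg g0) as [Gr [HGr EGr]].
  assert (Gr0 : Gr a <> 0).
  { intros E; pose proof (near_here _ _ EGr) as K; simpl in K; rewrite E in K.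
    apply g0; rewrite <- K; destruct m; [lia|apply pow_0_S]. }
  set (k := fun z => ((z - a) * Gr z)%C).
  assert (Hk : near a (holomorphic_at k)).
  { revert HGr; apply near_mono; intros z K; apply hol_mult; auto.
    apply hol_minus; [apply hol_id|apply hol_const]. }
  assert (ka : k a = 0) by (unfold k; ring).
  assert (Dk : Cd k a (Gr a)).
  { eapply Cd_eqn.
    - apply Cd_mult; [apply Cd_minus; [apply Cd_id|apply Cd_const]|].
      apply hol_Cd, (near_here _ _ HGr).
    - cbv beta; ring. }
  assert (Ek : near a (fun z => x z = (k z ^ m)%C)).
  { generalize (near_and _ _ _ Hx EGr); apply near_mono; intros z [E1 E2]; unfold k.
    rewrite Cpow_mult_l, E1, E2; auto. }
  assert (Step : forall n, exists wv : C * C, Cmod (fst wv - a)%C < invn n /\ Cmod (snd wv - a)%C < invn n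
     /\ fst wv <> a /\ Gr (fst wv) <> 0 /\ x (snd wv) = x (fst wv) /\ k (snd wv) = (zeta * k (fst wv))%C).
  { intros n.
    destruct (near_gt _ _ (invn n) Ek (invn_pos n)) as [d [Hd Kd]].
    pose proof (open_mapping k a d Hk (nonconst_derive _ _ _ Dk Gr0) (proj1 Hd)) as OM.
    rewrite ka in OM.
    assert (Cz : Ccont (fun z => zeta * k z)%C a).
    { apply Ccont_mult; [apply Ccont_const|apply hol_cont, (near_here _ _ Hk)]. }
    assert (N1 : near a (fun z => exists w, Cmod (w - a)%C < d /\ k w = (zeta * k z)%C)).
    { apply (near_comp (fun z => zeta * k z)%C a (fun u => exists w, Cmod (w - a)%C < d /\ k w = u)); auto; rewrite ka.
      replace (zeta * 0)%C with (RtoC 0) by ring; exact OM. }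
    assert (N2 : near a (fun z => Cmod (z - a)%C < d)) by (exists d; split; [lra|auto]).
    assert (N3 : near a (fun z => Gr z <> 0)) by (apply Ccont_neq; auto; apply hol_cont, (near_here _ _ HGr)).
    destruct (near_punctured _ _ (near_and _ _ _ N1 (near_and _ _ _ N2 N3))) as [w [Nw [[v [Hv Ev]] [Hw Gw]]]].
    exists (w, v); simpl; repeat split; auto; try lra.
    rewrite (Kd v Hv), (Kd w Hw), Ev, Cpow_mult_l, Hz; ring. }
  destruct (choice_fun _ _ Step) as [f Hf].
  exists (fun n => fst (f n)), (fun n => snd (f n)), Gr; split; [auto|split; auto].
Qed.

Lemma often_cont_zero (Phi : C -> C) (a : C) (w : nat -> C) :
  Ccont Phi a -> (forall n, Cmod (w n - a)%C < invn n) -> often (fun n => Phi (w n) = 0) -> Phi a = 0.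
Proof.
  intros HP Hw HO; apply Cmod_small_0; intros e He; destruct (HP e He) as [d [Hd K]].
  destruct (invn_small d Hd) as [N HN]; destruct (HO N) as [n [Ln En]].
  specialize (K (w n)); rewrite En in K; replace (0 - Phi a)%C with (- Phi a)%C in K by ring.
  rewrite Cmod_opp in K; left; apply K; specialize (Hw n); specialize (HN n Ln); lra.
Qed.

Section Discontinuity.
Variable G : mat2 -> Prop.
Hypotheses (HG : PSL2R_subgroup G) (HD : discrete_group G).

(** Both sequences converge to [a], so the connecting elements have bounded entries; by discreteness
    one of them occurs infinitely often, and in the limit it fixes [a]. *)
Lemma stab_limit (a : C) (w v : nat -> C) : inH a ->
  (forall n, Cmod (w n - a)%C < invn n) -> (forall n, Cmod (v n - a)%C < invn n) ->
  (exists N0, forall n, (N0 <= n)%nat -> exists g, G g /\ mobC g (w n) = v n) ->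
  exists g, G g /\ mobC g a = a /\ often (fun n => mobC g (w n) = v n).
Proof.
  intros Ha Hw Hv [N0 Hg].
  assert (Hg' : forall n, exists g, (N0 <= n)%nat -> G g /\ mobC g (w n) = v n).
  { intros n; destruct (Nat.le_gt_cases N0 n) as [L|L].
    - destruct (Hg n L) as [g K]; exists g; auto.
    - exists mid; lia. }
  destruct (choice_fun _ _ Hg') as [gs Hgs].
  set (B := Cmod a + 1 + 2 / Im a).
  assert (Ia : 0 < Im a) by exact Ha.
  assert (P2 : 0 < 2 / Im a) by (apply Rdiv_lt_0_compat; lra).
  assert (HB : 0 < B) by (pose proof (Cmod_ge_0 a); unfold B; lra).
  assert (Nb : near a (fun z => Im a / 2 < Im z)) by (apply upper_near; lra).
  destruct (near_gt _ _ 1 Nb Rlt_0_1) as [d [Hd Kd]].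
  assert (iB : / B < Im a / 2).
  { apply (Rmult_lt_reg_l B); auto; rewrite Rinv_r by lra.
    apply Rlt_le_trans with ((1 + 2 / Im a) * (Im a / 2)).
    - replace ((1 + 2 / Im a) * (Im a / 2)) with (Im a / 2 + 1) by (field; lra); lra.
    - apply Rmult_le_compat_r; [lra|]; unfold B; pose proof (Cmod_ge_0 a); lra. }
  assert (Good : forall z, Cmod (z - a)%C < d -> / B < Im z /\ Cmod z < B).
  { intros z Hz; split; [specialize (Kd z Hz); lra|].
    pose proof (Cmod_tri_inv z a); unfold B; lra. }
  destruct (invn_small d (proj1 Hd)) as [N1 HN1].
  destruct (discrete_subsequence G gs (2 * (B * B * B * B)) (fun n => (max N0 N1 <= n)%nat)) as [g [Gg O]]; auto.
  - intros N; exists (max N (max N0 N1)); split; lia.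
  - intros n Hn; destruct (Hgs n ltac:(lia)) as [G1 E1]; split; auto.
    specialize (HN1 n ltac:(lia)); specialize (Hw n); specialize (Hv n).
    destruct (Good (w n) ltac:(lra)); destruct (Good (v n) ltac:(lra)).
    apply (entries_bound (gs n) (w n) (v n) B); auto; apply (sg_det G HG); auto.
  - assert (O' : often (fun n => mobC g (w n) = v n)).
    { revert O; apply often_mono; intros n [Hn <-]; apply Hgs; lia. }
    exists g; split; auto; split; auto.
    apply Ceq_minus, Cmod_small_0; intros e He.
    assert (Cg : Ccont (mobC g) a).
    { eapply Cd_cont, Cd_mobC; [apply (sg_det G HG); auto|apply autJ_nz; auto; apply (sg_det G HG); auto]. }
    destruct (Cg (e / 2) ltac:(lra)) as [d' [Hd' K']].
    destruct (invn_small (Rmin d' (e / 2)) ltac:(apply Rmin_pos; lra)) as [N2 HN2].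
    destruct (O' N2) as [n [Ln En]]; specialize (HN2 n Ln); specialize (Hw n); specialize (Hv n).
    pose proof (Rmin_l d' (e / 2)); pose proof (Rmin_r d' (e / 2)).
    specialize (K' (w n) ltac:(lra)); rewrite En in K'.
    pose proof (Cmod_tri (mobC g a) (v n) a) as T; rewrite (Cmod_m_sym (mobC g a) (v n)) in T; lra.
Qed.

Section Ramification.
Variables (y : C -> C) (a : C) (m : nat) (g : C -> C).
Hypotheses (Ha : inH a)
  (Hinv : forall h tau, G h -> inH tau -> y (mobC h tau) = y tau)
  (Hinj : forall tau tau', inH tau -> inH tau' -> y tau = y tau' -> exists h, G h /\ mobC h tau = tau')
  (Hm : (0 < m)%nat) (Hg : near a (holomorphic_at g)) (g0 : g a <> 0)
  (Ey : near a (fun z => (y z - y a)%C = ((z - a) ^ m * g z)%C)).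

(** The twisted pairs have equal [y], hence are related by group elements, which accumulate at some
    [h] fixing [a]. It multiplies the local coordinate by [zeta], while its derivative at [a] is the
    inverse square of [autJ h a]. *)
Lemma ramif_onto (zeta : C) : (zeta ^ m)%C = 1 ->
  exists h, G h /\ mobC h a = a /\ (zeta * (autJ h a * autJ h a))%C = 1.
Proof.
  intros Hz.
  destruct (twist (fun z => y z - y a)%C g a zeta m Hm Hg g0 Ey Hz) as [w [v [Gr [HGr [Gr0 Hn]]]]].
  destruct (stab_limit a w v Ha) as [h [Gh [Fh O]]]; try (intros; apply Hn).
  - destruct (inH_near a Ha) as [d [Hd Kd]].
    destruct (invn_small d Hd) as [N HN]; exists N; intros n Ln.
    destruct (Hn n) as [B1 [B2 [_ [_ [E _]]]]]; specialize (HN n Ln).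
    apply Hinj; [apply Kd; lra|apply Kd; lra|].
    replace (y (w n)) with (y (w n) - y a + y a)%C by ring; rewrite <- E; ring.
  - exists h; split; [auto|split; auto].
    pose proof (sg_det G HG h Gh) as D; pose proof (autJ_nz h a D Ha) as Na.
    (* The relation between [w n] and [v n] divided by [w n - a] through [mobC_diff]; in this form
       it makes sense at [a] and passes to the limit. *)
    set (Phi := fun z => (Gr (mobC h z) - zeta * (Gr z * (autJ h z * autJ h a)))%C).
    assert (C1 : Ccont Gr a) by (apply hol_cont, (near_here _ _ HGr)).
    assert (Cm : Ccont (mobC h) a) by (eapply Cd_cont, Cd_mobC; auto).
    assert (P0 : Phi a = 0).
    { apply (often_cont_zero Phi a w).
      - apply Ccont_minus; [apply (Ccont_comp (mobC h) Gr); auto; rewrite Fh; auto|].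
        apply Ccont_mult; [apply Ccont_const|]; apply Ccont_mult; auto.
        apply Ccont_mult; [eapply Cd_cont, Cd_autJ|apply Ccont_const].
      - intros n; apply Hn.
      - destruct (inH_near a Ha) as [d [Hd Kd]].
        destruct (invn_small d Hd) as [N HN]; intros N'.
        destruct (O (max N N')) as [n [Ln En]]; exists n; split; [lia|].
        destruct (Hn n) as [B1 [_ [Nw [_ [_ E]]]]]; specialize (HN n ltac:(lia)).
        assert (Hw : inH (w n)) by (apply Kd; lra).
        pose proof (autJ_nz h (w n) D Hw) as Nj.
        pose proof (mobC_diff h (w n) a D Nj Na) as Df; rewrite Fh, En in Df.
        unfold Phi; rewrite En.
        assert (Nwa : (w n - a)%C <> 0) by (apply Cminus_eq_contra; auto).
        rewrite Df in E.
        replace (Gr (v n)) with (autJ h (w n) * autJ h a / (w n - a) * ((w n - a) / (autJ h (w n) * autJ h a) * Gr (v n)))%C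
          by (field; auto).
        rewrite E; field; auto. }
    unfold Phi in P0; rewrite Fh in P0.
    replace (zeta * (autJ h a * autJ h a))%C with
      (1 - (Gr a - zeta * (Gr a * (autJ h a * autJ h a))) / Gr a)%C by (field; auto).
    rewrite P0; field; auto.
Qed.

(** Comparing leading coefficients in [y (mobC h z) = y z] at the fixed point [a] shows that the
    [m]-th power of the derivative of [h] there is 1. *)
Lemma ramif_into (h : mat2) : G h -> mobC h a = a -> (autJ h a ^ (2 * m))%C = 1.
Proof.
  intros Gh Fh; pose proof (sg_det G HG h Gh) as D; pose proof (autJ_nz h a D Ha) as Na.
  set (Phi := fun z => (g (mobC h z) - g z * (autJ h z * autJ h a) ^ m)%C).
  assert (Cg : Ccont g a) by (apply hol_cont, (near_here _ _ Hg)).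
  assert (Cm : Ccont (mobC h) a) by (eapply Cd_cont, Cd_mobC; auto).
  assert (P0 : Phi a = 0).
  { assert (CP : Ccont Phi a).
    { apply Ccont_minus; [apply (Ccont_comp (mobC h) g); auto; rewrite Fh; auto|].
      apply Ccont_mult; auto; apply (Ccont_pow (fun z => autJ h z * autJ h a)%C).
      apply Ccont_mult; [eapply Cd_cont, Cd_autJ|apply Ccont_const]. }
    assert (N1 : near a (fun z => z <> a -> Phi z = 0)).
    { assert (N2 : near a (fun z => (y (mobC h z) - y a)%C = ((mobC h z - a) ^ m * g (mobC h z))%C)).
      { apply (near_comp (mobC h) a (fun z => (y z - y a)%C = ((z - a) ^ m * g z)%C)); auto.
        rewrite Fh; auto. }
      generalize (near_and _ _ _ (inH_near a Ha) (near_and _ _ _ Ey N2)); apply near_mono.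
      intros z [Hz [E1 E2]] Nz.
      pose proof (autJ_nz h z D Hz) as Nj.
      pose proof (mobC_diff h z a D Nj Na) as Df; rewrite Fh in Df.
      rewrite Hinv, E1, Df in E2 by auto.
      assert (Nza : (z - a)%C <> 0) by (apply Cminus_eq_contra; auto).
      unfold Phi; unfold Cdiv in E2; rewrite Cpow_mult_l, Cpow_inv in E2 by (apply Cmult_neq_0; auto).
      assert (Nj2 : ((autJ h z * autJ h a) ^ m)%C <> 0) by (apply Cpow_nz, Cmult_neq_0; auto).
      assert (Nzm : ((z - a) ^ m)%C <> 0) by (apply Cpow_nz; auto).
      replace (g z) with (/ (z - a) ^ m * ((z - a) ^ m * g z))%C by (field; auto).
      rewrite E2; field; auto. }
    apply Cmod_small_0; intros e He.
    destruct (near_punctured _ _ (near_and _ _ _ N1 (CP e He))) as [z [Nz [K1 K2]]].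
    rewrite (K1 Nz) in K2; replace (0 - Phi a)%C with (- Phi a)%C in K2 by ring.
    rewrite Cmod_opp in K2; lra. }
  unfold Phi in P0; rewrite Fh in P0.
  rewrite Cpow_mult_r; replace (autJ h a ^ 2)%C with (autJ h a * autJ h a)%C by (simpl; ring).
  replace ((autJ h a * autJ h a) ^ m)%C with
    (1 - (g a - g a * (autJ h a * autJ h a) ^ m) / g a)%C by (field; auto).
  rewrite P0; field; auto.
Qed.
End Ramification.
End Discontinuity.

Lemma root_of_unity (N : nat) (z : C) : (0 < N)%nat -> (z ^ N)%C = 1 ->
  exists j, (j < N)%nat /\ z = Cexp (tpi * INR j / INR N)%C.
Proof.
  intros HN E.
  assert (Nn : RtoC (INR N) <> 0) by (apply RtoC_nz, not_0_INR; lia).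
  assert (Nz : z <> 0).
  { intros ->; destruct N; [lia|rewrite pow_0_S in E; apply C1_nz; auto]. }
  destruct (Cexp_surj z Nz) as [v Hv].
  rewrite <- Hv, <- Cexp_nat in E; destruct (Cexp_eq_1 _ E) as [k Hk].
  pose proof (Z.mod_pos_bound k (Z.of_nat N) ltac:(lia)) as MB.
  exists (Z.to_nat (k mod Z.of_nat N)); split; [lia|].
  rewrite <- Hv, INR_IZR_INZ, Z2Nat.id by lia.
  assert (Kd : IZR k = INR N * IZR (k / Z.of_nat N) + IZR (k mod Z.of_nat N)).
  { rewrite INR_IZR_INZ, <- mult_IZR, <- plus_IZR; f_equal; apply Z.div_mod; lia. }
  assert (Ev : v = (tpi * IZR (k mod Z.of_nat N) / INR N + IZR (k / Z.of_nat N) * tpi)%C).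
  { replace v with (INR N * v / INR N)%C by (field; auto); rewrite Hk, Kd, RtoC_plus, RtoC_mult; field; auto. }
  rewrite Ev, Cexp_plus.
  assert (P : forall n : nat, Cexp (INR n * tpi)%C = 1)
    by (intros n; rewrite Cexp_nat, Cexp_tpi; apply Cpow_1_l).
  assert (Q : Cexp (IZR (k / Z.of_nat N) * tpi)%C = 1).
  { destruct (Z.le_ge_cases 0 (k / Z.of_nat N)) as [L|L].
    - rewrite <- (Z2Nat.id _ L), <- INR_IZR_INZ; auto.
    - replace (k / Z.of_nat N)%Z with (- Z.of_nat (Z.to_nat (- (k / Z.of_nat N))))%Z by lia.
      rewrite opp_IZR, <- INR_IZR_INZ, RtoC_opp.
      replace (- INR (Z.to_nat (- (k / Z.of_nat N))) * tpi)%C with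
        (- (INR (Z.to_nat (- (k / Z.of_nat N))) * tpi))%C by ring.
      rewrite Cexp_opp, P; field; apply C1_nz. }
  rewrite Q; ring.
Qed.

Lemma root_of_unity_pow (N j : nat) : (0 < N)%nat -> (Cexp (tpi * INR j / INR N) ^ N)%C = 1.
Proof.
  intros HN; assert (Nn : RtoC (INR N) <> 0) by (apply RtoC_nz, not_0_INR; lia).
  rewrite <- Cexp_nat; replace (INR N * (tpi * INR j / INR N))%C with (INR j * tpi)%C by (field; auto).
  rewrite Cexp_nat, Cexp_tpi; apply Cpow_1_l.
Qed.

Lemma root_of_unity_inj (N i j : nat) : (i < N)%nat -> (j < N)%nat ->
  Cexp (tpi * INR i / INR N)%C = Cexp (tpi * INR j / INR N)%C -> i = j.
Proof.
  intros Hi Hj E; assert (Nn : RtoC (INR N) <> 0) by (apply RtoC_nz, not_0_INR; lia).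
  destruct (Cexp_eq_1 (tpi * INR i / INR N - tpi * INR j / INR N)%C) as [k Hk].
  { rewrite Cexp_minus, E; field; apply Cexp_nz. }
  assert (K : RtoC (INR i - INR j) = RtoC (IZR k * INR N)).
  { pose proof tpi_nz; rewrite RtoC_minus, RtoC_mult.
    replace (INR i - INR j)%C with ((tpi * INR i / INR N - tpi * INR j / INR N) * INR N / tpi)%C by (field; auto).
    rewrite Hk; field; auto. }
  apply RtoC_inj in K; rewrite !INR_IZR_INZ, <- minus_IZR, <- mult_IZR in K.
  apply eq_IZR in K.
  assert (k = 0)%Z by nia; subst; lia.
Qed.

Lemma NoDup_map_inj (A B : Type) (f : A -> B) (l : list A) :
  (forall x y, In x l -> In y l -> f x = f y -> x = y) -> NoDup l -> NoDup (map f l).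
Proof.
  induction l as [|x l IH]; intros Hi Hn; simpl; [constructor|].
  inversion Hn; subst; constructor.
  - intros K; apply in_map_iff in K; destruct K as [z [E Z]].
    apply Hi in E; simpl; auto; subst; contradiction.
  - apply IH; auto; intros; apply Hi; simpl; auto.
Qed.

(** As [1] and [a] are independent over the reals, [autJ g a] determines the lower row, and
    [a * autJ g a], which is the numerator at a fixed point, determines the upper row. *)
Lemma autJ_inj (g h : mat2) (a : C) : inH a -> mdet g = 1 -> mdet h = 1 ->
  mobC g a = a -> mobC h a = a -> autJ g a = autJ h a -> g = h.
Proof.
  intros Ha Dg Dh Fg Fh E.
  assert (L : forall p q p' q' : R, (p * a + q)%C = (p' * a + q')%C -> p = p' /\ q = q').
  { intros p q p' q' K; pose proof (f_equal Im K) as I1; pose proof (f_equal Re K) as R1.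
    rewrite !im_plus, !im_scal_l, !im_RtoC in I1; rewrite !re_plus, !re_scal_l, !re_RtoC in R1.
    assert (0 < Im a) by exact Ha.
    assert (p = p') by nra; subst; split; auto; lra. }
  destruct (L _ _ _ _ E) as [Ec Ed].
  assert (N1 : (ma g * a + mb g)%C = (a * autJ g a)%C)
    by (rewrite <- Fg at 2; unfold mobC; field; apply autJ_nz; auto).
  assert (N2 : (ma h * a + mb h)%C = (a * autJ h a)%C)
    by (rewrite <- Fh at 2; unfold mobC; field; apply autJ_nz; auto).
  rewrite E, <- N2 in N1; destruct (L _ _ _ _ N1) as [Ea Eb].
  apply mat2_ext; auto.
Qed.

Lemma autJ_opp (g : mat2) (z : C) : autJ (mopp g) z = (- autJ g z)%C.
Proof. unfold autJ, mopp; simpl; RtoC_push; ring. Qed.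

Lemma mobC_opp (g : mat2) (z : C) : autJ g z <> 0 -> mobC (mopp g) z = mobC g z.
Proof. intros N; unfold mobC; rewrite autJ_opp; simpl; RtoC_push; field; auto. Qed.

(* The stabiliser of [a] in SL(2,R) is mapped by [autJ _ a] onto the 2m-th roots of unity. *)
Theorem ramification_order (G : mat2 -> Prop) (y : C -> C) (a : C) (m n : nat) (g : C -> C) (l : list mat2) :
  PSL2R_subgroup G -> discrete_group G -> inH a ->
  (forall h tau, G h -> inH tau -> y (mobC h tau) = y tau) ->
  (forall tau tau', inH tau -> inH tau' -> y tau = y tau' -> exists h, G h /\ mobC h tau = tau') ->
  (0 < m)%nat -> near a (holomorphic_at g) -> g a <> 0 ->
  near a (fun z => (y z - y a)%C = ((z - a) ^ m * g z)%C) ->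
  NoDup l -> length l = (2 * n)%nat -> (forall h, In h l <-> G h /\ mobC h a = a) -> m = n.
Proof.
  intros HG HD Ha Hinv Hinj Hm Hg g0 Ey Nl Ll Hl.
  set (roots := map (fun j => Cexp (tpi * INR j / INR (2 * m))%C) (seq 0 (2 * m))).
  assert (Nr : NoDup roots).
  { apply NoDup_map_inj; [|apply seq_NoDup]; intros i j Hi Hj E.
    apply in_seq in Hi, Hj; apply (root_of_unity_inj (2 * m)); auto; lia. }
  set (js := map (fun h => autJ h a) l).
  assert (Nj : NoDup js).
  { apply NoDup_map_inj; auto; intros h k Hh Hk E; apply Hl in Hh, Hk.
    destruct Hh, Hk; apply (autJ_inj h k a); auto; apply (sg_det G HG); auto. }
  assert (I1 : incl js roots).
  { intros z Hz; apply in_map_iff in Hz; destruct Hz as [h [<- Hh]]; apply Hl in Hh; destruct Hh as [Gh Fh].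
    pose proof (ramif_into G HG y a m g Ha Hinv Hg g0 Ey h Gh Fh) as K.
    destruct (root_of_unity (2 * m) (autJ h a) ltac:(lia) K) as [j [Lj Ej]].
    rewrite Ej; apply in_map_iff; exists j; split; auto; apply in_seq; lia. }
  assert (I2 : incl roots js).
  { intros z Hz; apply in_map_iff in Hz; destruct Hz as [j [Ez Hj]].
    assert (Z2 : (z ^ (2 * m))%C = 1) by (rewrite <- Ez; apply root_of_unity_pow; lia).
    assert (Nz : z <> 0) by (rewrite <- Ez; apply Cexp_nz).
    assert (Zm : ((/ (z * z)) ^ m)%C = 1).
    { rewrite Cpow_inv by (apply Cmult_neq_0; auto).
      rewrite Cpow_mult_r in Z2; replace (z ^ 2)%C with (z * z)%C in Z2 by (simpl; ring).
      rewrite Z2; field; apply C1_nz. }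
    destruct (ramif_onto G HG HD y a m g Ha Hinj Hm Hg g0 Ey _ Zm) as [h [Gh [Fh E]]].
    (* [ramif_onto] controls only the square of [autJ h a]. If the sign is wrong, [mopp h] is taken
       instead; this is why the count is done in SL(2,R), with [2 * m] roots against [2 * n]
       matrices. *)
    assert (E2 : ((autJ h a - z) * (autJ h a + z))%C = 0).
    { replace ((autJ h a - z) * (autJ h a + z))%C with (z * z * (/ (z * z) * (autJ h a * autJ h a)) - z * z)%C by (field; auto).
      rewrite E; ring. }
    apply in_map_iff.
    pose proof (autJ_nz h a (sg_det G HG h Gh) Ha) as Nh.
    destruct (Ceq_dec (autJ h a) z) as [Eq|Ne].
    - exists h; split; auto; apply Hl; auto.
    - exists (mopp h); split.
      + rewrite autJ_opp; apply NNPP; intros Ne2.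
        apply (Cmult_neq_0 (autJ h a - z) (autJ h a + z)); auto.
        * apply Cminus_eq_contra; auto.
        * intros K; apply Ne2; replace z with (autJ h a + z - autJ h a)%C by ring; rewrite K; ring.
      + apply Hl; split; [apply (sg_opp G HG); auto|rewrite mobC_opp; auto]. }
  pose proof (NoDup_incl_length Nj I1) as L1; pose proof (NoDup_incl_length Nr I2) as L2.
  unfold js, roots in L1, L2; rewrite !length_map, length_seq in L1, L2; lia.
Qed.

(** * Logarithmic derivatives of a local coordinate *)

Lemma near_all (a : C) (P : C -> Prop) : (forall z, P z) -> near a P.
Proof. intros H; exists 1; split; [lra|auto]. Qed.

(** The derivative function near [a] is part of the witness, so second derivatives are computed by
    the same rules as first ones, with explicit values. *)
Definition Cd2 (f : C -> C) (a l1 l2 : C) : Prop :=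
  exists f1, near a (fun z => Cd f z (f1 z)) /\ f1 a = l1 /\ Cd f1 a l2.

Lemma Cd2_derive (f : C -> C) (a l1 l2 : C) : Cd2 f a l1 l2 ->
  C_derive f a = l1 /\ C_derive (C_derive f) a = l2.
Proof.
  intros [f1 [H1 [E1 H2]]]; split.
  - apply Cd_C_derive; rewrite <- E1; apply (near_here _ _ H1).
  - apply Cd_C_derive, (Cd_ext_near f1); auto.
    revert H1; apply near_mono; intros z Hz; symmetry; apply Cd_C_derive; auto.
Qed.

Lemma Cd2_of_hol (f : C -> C) (a : C) : near a (holomorphic_at f) ->
  Cd2 f a (C_derive f a) (C_derive (C_derive f) a).
Proof.
  intros H; exists (C_derive f); split; [|split; auto].
  - revert H; apply near_mono; intros z Hz; apply hol_Cd; auto.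
  - apply hol_Cd, derive_hol; auto.
Qed.

Lemma near_derive_hol (f : C -> C) (a : C) : near a (holomorphic_at f) ->
  near a (holomorphic_at (C_derive f)).
Proof. intros H; apply near_near in H; revert H; apply near_mono; intros z; apply derive_hol. Qed.

Lemma C_derive_near (f g : C -> C) (a : C) : near a (fun z => f z = g z) -> near a (holomorphic_at g) ->
  near a (fun z => C_derive f z = C_derive g z).
Proof.
  intros H Hg; apply near_near in H; generalize (near_and _ _ _ H Hg); apply near_mono.
  intros z [E Hz]; symmetry; apply C_derive_ext_near; auto; revert E; apply near_mono; auto.
Qed.

(* For a local coordinate [f] on the quotient with exponents [e0] at [f = 0] and [e1] at
   [f = 1], [W e0 e1 f] is half the logarithmic derivative of
   [f' f^(-e0) (1 - f)^(-e1)]. *)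
Definition W (e0 e1 : R) (f : C -> C) (z : C) : C :=
  ((C_derive (C_derive f) z / C_derive f z - e0 * (C_derive f z / f z)
    + e1 * (C_derive f z / (1 - f z))) / 2)%C.

Lemma W_eq (e0 e1 : R) (f : C -> C) (z l1 l2 : C) : Cd2 f z l1 l2 ->
  W e0 e1 f z = ((l2 / l1 - e0 * (l1 / f z) + e1 * (l1 / (1 - f z))) / 2)%C.
Proof. intros H; unfold W; destruct (Cd2_derive _ _ _ _ H) as [-> ->]; auto. Qed.

Lemma W_ext (e0 e1 : R) (f g : C -> C) (z : C) : near z (fun v => f v = g v) ->
  near z (holomorphic_at g) -> W e0 e1 f z = W e0 e1 g z.
Proof.
  intros H Hg; unfold W.
  pose proof (C_derive_near f g z H Hg) as D1.
  pose proof (C_derive_near _ _ z D1 (near_derive_hol _ _ Hg)) as D2.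
  rewrite (near_here _ _ H), (near_here _ _ D1), (near_here _ _ D2); auto.
Qed.

Lemma Cd2_one_minus (f : C -> C) (a l1 l2 : C) : Cd2 f a l1 l2 ->
  Cd2 (fun z => 1 - f z)%C a (- l1)%C (- l2)%C.
Proof.
  intros [f1 [H1 [<- H2]]]; exists (fun z => - f1 z)%C; split; [|split; auto].
  - revert H1; apply near_mono; intros z Hz.
    eapply Cd_eqn; [apply Cd_minus; [apply Cd_const|exact Hz]|ring].
  - apply Cd_opp; auto.
Qed.

Lemma Cd2_inv (f : C -> C) (a l1 l2 : C) : Cd2 f a l1 l2 -> f a <> 0 ->
  Cd2 (fun z => / f z)%C a (- l1 / (f a * f a))%C
    ((2 * l1 * l1 / f a - l2) / (f a * f a))%C.
Proof.
  intros [f1 [H1 [E1 H2]]] N.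
  pose proof (near_here _ _ H1) as D1; simpl in D1.
  exists (fun z => - f1 z / (f z * f z))%C; split; [|split].
  - generalize (near_and _ _ _ H1 (Ccont_neq f a 0 (Cd_cont _ _ _ D1) N)); apply near_mono.
    intros z [Hz Nz]; apply Cd_inv; auto.
  - rewrite E1; auto.
  - eapply Cd_eqn.
    + apply Cd_div; [apply Cd_opp; exact H2|apply Cd_mult; exact D1|apply Cmult_neq_0; auto].
    + cbv beta; rewrite <- E1; field; auto.
Qed.

Lemma W_one_minus (e0 e1 : R) (f : C -> C) (z : C) : near z (holomorphic_at f) ->
  C_derive f z <> 0 -> f z <> 0 -> f z <> 1 -> W e0 e1 (fun v => 1 - f v)%C z = W e1 e0 f z.
Proof.
  intros H N1 N2 N3; rewrite (W_eq _ _ _ _ _ _ (Cd2_one_minus _ _ _ _ (Cd2_of_hol f z H))).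
  unfold W; assert ((1 - f z)%C <> 0) by (apply Cminus_eq_contra; auto).
  field; repeat split; auto.
Qed.

(** The exponents at 0, 1 and infinity add up to 2, because the derivative of [1 / f] contributes
    [f^(-2)]; inversion exchanges the first with the third. *)
Lemma W_inv (e0 e1 : R) (f : C -> C) (z : C) : near z (holomorphic_at f) ->
  C_derive f z <> 0 -> f z <> 0 -> f z <> 1 ->
  W e0 e1 (fun v => / f v)%C z = W (2 - e0 - e1) e1 f z.
Proof.
  intros H N1 N2 N3; rewrite (W_eq _ _ _ _ _ _ (Cd2_inv _ _ _ _ (Cd2_of_hol f z H) N2)).
  unfold W; assert (N4 : (1 - f z)%C <> 0) by (apply Cminus_eq_contra; auto).
  rewrite !RtoC_minus; field; repeat split; auto.
  intros E; apply N4; replace (1 - f z)%C with (- (f z - 1))%C by ring; rewrite E; ring.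
Qed.

Lemma Cd2_slash (s : mat2) (f : C -> C) (z l1 l2 : C) : mdet s = 1 -> autJ s z <> 0 ->
  Cd2 f (mobC s z) l1 l2 ->
  Cd2 (fun v => f (mobC s v)) z (l1 / autJ s z ^ 2)%C
    (l2 / autJ s z ^ 4 - 2 * mc s * l1 / autJ s z ^ 3)%C.
Proof.
  intros D N [f1 [H1 [E1 H2]]].
  pose proof (Cd_mobC s z D N) as Dm.
  assert (Nn : near z (fun v => autJ s v <> 0)).
  { apply Ccont_neq; auto; eapply Cd_cont, Cd_autJ. }
  exists (fun v => f1 (mobC s v) * / (autJ s v * autJ s v))%C; split; [|split].
  - generalize (near_and _ _ _ Nn (near_comp _ _ _ (Cd_cont _ _ _ Dm) H1)); apply near_mono.
    intros v [Nv Hv]; apply (Cd_comp (mobC s) f); auto; apply Cd_mobC; auto.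
  - rewrite E1; simpl; field; auto.
  - eapply Cd_eqn.
    + apply Cd_mult; [apply (Cd_comp (mobC s) f1); eauto|].
      apply Cd_inv; [apply Cd_mult; apply Cd_autJ|apply Cmult_neq_0; auto].
    + cbv beta; rewrite E1; simpl; field; auto.
Qed.

Lemma W_slash (e0 e1 : R) (s : mat2) (f : C -> C) (z : C) : mdet s = 1 -> autJ s z <> 0 ->
  near (mobC s z) (holomorphic_at f) -> C_derive f (mobC s z) <> 0 ->
  f (mobC s z) <> 0 -> f (mobC s z) <> 1 ->
  W e0 e1 f (mobC s z) = (autJ s z ^ 2 * W e0 e1 (fun v => f (mobC s v)) z + mc s * autJ s z)%C.
Proof.
  intros D N H N1 N2 N3.
  rewrite (W_eq _ _ _ _ _ _ (Cd2_slash s f z _ _ D N (Cd2_of_hol f _ H))).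
  unfold W; assert (N4 : (1 - f (mobC s z))%C <> 0) by (apply Cminus_eq_contra; auto).
  field; repeat split; auto.
Qed.

Section Elliptic.
Variables (x g : C -> C) (a : C) (n : nat).
Hypotheses (Hn : (0 < n)%nat) (Hg : near a (holomorphic_at g)) (g0 : g a <> 0)
  (Ex : near a (fun z => x z = ((z - a) ^ n * g z)%C)).

(** The cofactor of [(z - a)^(n-1)] in the derivative of [(z - a)^n * g]. *)
Definition ell_k (z : C) : C := (INR n * g z + (z - a) * C_derive g z)%C.

Lemma ell_k_hol : near a (holomorphic_at ell_k).
Proof.
  generalize (near_and _ _ _ Hg (near_derive_hol _ _ Hg)); apply near_mono; intros z [H1 H2].
  apply hol_plus; apply hol_mult; auto; [apply hol_const|].
  apply hol_minus; [apply hol_id|apply hol_const].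
Qed.

Lemma ell_k_nz : ell_k a <> 0.
Proof.
  unfold ell_k; replace (INR n * g a + (a - a) * C_derive g a)%C with (INR n * g a)%C by ring.
  apply Cmult_neq_0; auto; apply RtoC_nz, not_0_INR; lia.
Qed.

Lemma Cd_shift_pow (z : C) (k : nat) : Cd (fun v => (v - a) ^ k)%C z (INR k * (z - a) ^ pred k)%C.
Proof.
  eapply Cd_eqn; [apply (Cd_pow (fun v => v - a)%C); apply Cd_minus; [apply Cd_id|apply Cd_const]|ring].
Qed.

Lemma ell_derive : near a (fun z => Cd x z ((z - a) ^ pred n * ell_k z)%C).
Proof.
  generalize (near_and _ _ _ Hg (near_near _ _ Ex)); apply near_mono; intros z [H1 H2].
  apply (Cd_ext_near (fun v => (v - a) ^ n * g v)%C).
  - revert H2; apply near_mono; intros; symmetry; auto.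
  - eapply Cd_eqn; [apply Cd_mult; [apply Cd_shift_pow|apply hol_Cd; auto]|].
    unfold ell_k; destruct n as [|n']; [lia|]; simpl pred; rewrite Cpow_S; ring.
Qed.

Lemma ell_derive2 : near a (fun z => z <> a ->
  Cd2 x z ((z - a) ^ pred n * ell_k z)%C
    ((z - a) ^ pred n * (INR (pred n) / (z - a) * ell_k z + C_derive ell_k z))%C).
Proof.
  generalize (near_and _ _ _ ell_k_hol (near_near _ _ ell_derive)); apply near_mono; intros z [H1 H2] Nz.
  exists (fun z => (z - a) ^ pred n * ell_k z)%C; split; [auto|split; auto].
  eapply Cd_eqn; [apply Cd_mult; [apply Cd_shift_pow|apply hol_Cd; auto]|].
  assert (N : (z - a)%C <> 0) by (apply Cminus_eq_contra; auto).
  destruct (pred n) as [|n']; simpl pred; [simpl; field; auto|rewrite Cpow_S; field; auto].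
Qed.

(* The right-hand side vanishes at [z = a] when [e0 = 1 - 1/n]. *)
Lemma ell_W (e0 e1 : R) : near a (fun z => z <> a ->
  ((z - a) * W e0 e1 x z)%C =
  ((INR (pred n) + (z - a) * C_derive ell_k z / ell_k z - e0 * (ell_k z / g z)
    + e1 * ((z - a) ^ n * ell_k z / (1 - (z - a) ^ n * g z))) / 2)%C).
Proof.
  assert (Nk : near a (fun z => ell_k z <> 0)).
  { apply Ccont_neq; [apply hol_cont, (near_here _ _ ell_k_hol)|apply ell_k_nz]. }
  assert (Ng : near a (fun z => g z <> 0)) by (apply Ccont_neq; auto; apply hol_cont, (near_here _ _ Hg)).
  assert (N1 : near a (fun z => ((z - a) ^ n * g z)%C <> 1)).
  { apply (Ccont_neq (fun z => (z - a) ^ n * g z)%C).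
    - apply Ccont_mult; [apply (Ccont_pow (fun z => z - a)%C); apply Ccont_minus; [apply Ccont_id|apply Ccont_const]|].
      apply hol_cont, (near_here _ _ Hg).
    - replace (a - a)%C with (RtoC 0) by ring; destruct n as [|n']; [lia|].
      rewrite pow_0_S, Cmult_0_l; intros E; symmetry in E; apply C1_nz; auto. }
  generalize (near_and _ _ _ ell_derive2 (near_and _ _ _ Ex (near_and _ _ _ Nk (near_and _ _ _ Ng N1)))).
  apply near_mono; intros z [D2 [E [K1 [K2 K3]]]] Nz.
  rewrite (W_eq _ _ _ _ _ _ (D2 Nz)), E.
  assert (N : (z - a)%C <> 0) by (apply Cminus_eq_contra; auto).
  assert (N4 : (1 - (z - a) ^ n * g z)%C <> 0) by (apply Cminus_eq_contra; auto).
  destruct n as [|n']; [lia|]; simpl pred in *; rewrite Cpow_S in *.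
  assert (Np : ((z - a) ^ n')%C <> 0) by (apply Cpow_nz; auto).
  field; repeat split; auto.
Qed.
End Elliptic.

(** * The same logarithmic derivatives in the coordinate q at a cusp *)

Lemma qexp_near (w : R) (P : C -> Prop) : 0 < w -> near 0 P ->
  exists Y, forall tau, Y < Im tau -> P (qexp w tau).
Proof.
  intros Hw [d [Hd H]]; pose proof PI_RGT_0.
  exists (- (w * ln d) / (2 * PI)); intros tau Ht; apply H.
  replace (qexp w tau - 0)%C with (qexp w tau) by ring.
  apply (qexp_lt w _ _ Hw) in Ht.
  replace (- (2 * PI) * (- (w * ln d) / (2 * PI)) / w) with (ln d) in Ht by (field; lra).
  rewrite exp_ln in Ht; auto.
Qed.

Lemma qexp_hits (w : R) (Y : R) : 0 < w ->
  near 0 (fun q => q <> 0 -> exists tau, Y < Im tau /\ qexp w tau = q).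
Proof.
  intros Hw; exists (exp (- (2 * PI) * Y / w)); split; [apply exp_pos|]; intros q Hq Nq.
  destruct (qexp_surj w q ltac:(lra) Nq) as [tau Ht]; exists tau; split; auto.
  apply (qexp_lt w); auto; rewrite Ht; replace q with (q - 0)%C by ring; auto.
Qed.

Lemma Cd_qcomp (w : R) (F : C -> C) (tau l : C) : 0 < w -> Cd F (qexp w tau) l ->
  Cd (fun z => F (qexp w z)) tau (tpi / w * (qexp w tau * l))%C.
Proof.
  intros Hw H; eapply Cd_eqn; [apply (Cd_comp (qexp w) F); [apply Cd_qexp; lra|exact H]|].
  field; apply RtoC_nz; lra.
Qed.

Lemma tpi_w_nz (w : R) : 0 < w -> (tpi / w)%C <> 0.
Proof.
  intros Hw E; apply tpi_nz; replace tpi with (tpi / w * w)%C by (field; apply RtoC_nz; lra).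
  rewrite E; ring.
Qed.

Section Cusp.
Variables (w Y : R) (x T g : C -> C) (m : nat).
Hypotheses (Hw : 0 < w) (Hm : (0 < m)%nat) (Hg : near 0 (holomorphic_at g)) (g0 : g 0 <> 0)
  (ET : forall q, T q = (q ^ m * g q)%C) (Ex : forall tau, Y < Im tau -> x tau = T (qexp w tau)).

(** This is [q * T' / T] with the factor [q^m] cancelled, hence regular at 0 with value the order
    [m]; the logarithmic derivative of [x] is [tpi / w] times it. *)
Definition cA (q : C) : C := (ell_k g 0 m q / g q)%C.
(** [W e0 e1 x] rewritten in [q]. It is holomorphic at 0, where it gives the limit of [W] at the
    cusp. *)
Definition cU (e0 e1 : R) (q : C) : C :=
  (tpi / w * (cA q + q * C_derive cA q / cA q - e0 * cA q + e1 * (T q * cA q / (1 - T q))) / 2)%C.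

Lemma cT0 : T 0 = 0.
Proof. rewrite ET; destruct m; [lia|rewrite pow_0_S; ring]. Qed.

Lemma cT_hol : near 0 (holomorphic_at T).
Proof.
  revert Hg; apply near_mono; intros z Hz; apply (hol_ext_near (fun q => q ^ m * g q)%C).
  - apply near_all; intros; symmetry; auto.
  - apply hol_mult; auto; apply (hol_pow (fun q => q)), hol_id.
Qed.

Lemma cg_nz : near 0 (fun q => g q <> 0).
Proof. apply Ccont_neq; auto; apply hol_cont, (near_here _ _ Hg). Qed.

Lemma cA_hol : near 0 (holomorphic_at cA).
Proof.
  generalize (near_and _ _ _ (ell_k_hol g 0 m Hg) (near_and _ _ _ Hg cg_nz)); apply near_mono.
  intros z [H1 [H2 H3]]; apply hol_div; auto.
Qed.

Lemma cA0 : cA 0 = INR m.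
Proof. unfold cA, ell_k; field; auto. Qed.

Lemma INR_m_nz : RtoC (INR m) <> 0.
Proof. apply RtoC_nz, not_0_INR; lia. Qed.

Lemma cA_nz : near 0 (fun q => cA q <> 0).
Proof. apply Ccont_neq; [apply hol_cont, (near_here _ _ cA_hol)|rewrite cA0; apply INR_m_nz]. Qed.

Lemma cT_n1 : near 0 (fun q => T q <> 1).
Proof.
  apply Ccont_neq; [apply hol_cont, (near_here _ _ cT_hol)|rewrite cT0].
  intros E; symmetry in E; apply C1_nz; auto.
Qed.

Lemma cT_nz : near 0 (fun q => q <> 0 -> T q <> 0).
Proof.
  generalize cg_nz; apply near_mono; intros q Hq Nq; rewrite ET.
  apply Cmult_neq_0; auto; apply Cpow_nz; auto.
Qed.

Lemma cT_derive : near 0 (fun q => (q * C_derive T q)%C = (T q * cA q)%C).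
Proof.
  pose proof (ell_derive T g 0 m Hm Hg) as D.
  assert (E0 : near 0 (fun z => T z = ((z - 0) ^ m * g z)%C)).
  { apply near_all; intros z; rewrite ET; do 2 f_equal; ring. }
  specialize (D E0).
  generalize (near_and _ _ _ D cg_nz); apply near_mono; intros q [H1 H2].
  rewrite (Cd_C_derive _ _ _ H1), ET; unfold cA.
  replace (q - 0)%C with q by ring.
  destruct m as [|m']; [lia|]; simpl pred; rewrite Cpow_S; field; auto.
Qed.

Lemma cU_hol (e0 e1 : R) : near 0 (holomorphic_at (cU e0 e1)).
Proof.
  generalize (near_and _ _ _ cA_hol (near_and _ _ _ (near_derive_hol _ _ cA_hol)
    (near_and _ _ _ cA_nz (near_and _ _ _ cT_hol cT_n1)))).
  apply near_mono; intros q [H1 [H2 [H3 [H4 H5]]]].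
  assert (N : (1 - T q)%C <> 0) by (apply Cminus_eq_contra; auto).
  unfold cU; apply hol_div; [|apply hol_const|intros K; apply RtoC_inj in K; lra].
  apply hol_mult; [apply hol_const|]; apply hol_plus; [apply hol_minus; [apply hol_plus; auto|]|].
  - apply hol_div; auto; apply hol_mult; auto; apply hol_id.
  - apply hol_mult; auto; apply hol_const.
  - apply hol_mult; [apply hol_const|]; apply hol_div; auto; [apply hol_mult; auto|].
    apply hol_minus; auto; apply hol_const.
Qed.

Lemma cU0 (e0 e1 : R) : cU e0 e1 0 = (tpi / w * (INR m * (1 - e0)) / 2)%C.
Proof.
  unfold cU; rewrite cA0, cT0; field; split; [apply RtoC_nz; lra|apply INR_m_nz].
Qed.

Lemma cusp_W (e0 e1 : R) : exists Y', forall tau, Y' < Im tau ->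
  x tau = T (qexp w tau) /\ x tau <> 0 /\ x tau <> 1 /\ cA (qexp w tau) <> 0 /\
  C_derive x tau = (tpi / w * (T (qexp w tau) * cA (qexp w tau)))%C /\ C_derive x tau <> 0 /\
  W e0 e1 x tau = cU e0 e1 (qexp w tau).
Proof.
  destruct (qexp_near w _ Hw (near_and _ _ _ cT_derive (near_and _ _ _ cA_hol (near_and _ _ _ cA_nz
    (near_and _ _ _ cT_hol (near_and _ _ _ cT_n1 cT_nz)))))) as [Y1 H1].
  exists (Rmax Y Y1); intros tau Ht.
  assert (Hy : Y < Im tau) by (pose proof (Rmax_l Y Y1); lra).
  assert (Hy1 : Y1 < Im tau) by (pose proof (Rmax_r Y Y1); lra).
  destruct (H1 tau Hy1) as [E1 [E2 [E3 [E4 [E5 E6]]]]].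
  pose proof (E6 (qexp_nz w tau)) as NT.
  assert (Nw : RtoC w <> 0) by (apply RtoC_nz; lra).
  assert (D : Cd2 x tau (tpi / w * (T (qexp w tau) * cA (qexp w tau)))%C
    (tpi / w * (tpi / w * (T (qexp w tau) * (cA (qexp w tau) * cA (qexp w tau)
      + qexp w tau * C_derive cA (qexp w tau)))))%C).
  { exists (fun z => tpi / w * (T (qexp w z) * cA (qexp w z)))%C; split; [|split; auto].
    - generalize (near_and _ _ _ (near_near _ _ (upper_near tau Y Hy)) (upper_near tau Y1 Hy1)).
      apply near_mono; intros z [Hz Hz1]; destruct (H1 z Hz1) as [F1 [F2 [F3 [F4 _]]]].
      apply (Cd_ext_near (fun z => T (qexp w z))).
      + revert Hz; apply near_mono; intros v Hv; symmetry; auto.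
      + eapply Cd_eqn; [apply Cd_qcomp; auto; apply hol_Cd; auto|]; rewrite F1; auto.
    - eapply Cd_eqn.
      + apply Cd_mult; [apply Cd_const|]; apply Cd_mult; apply Cd_qcomp; auto; apply hol_Cd; auto.
      + cbv beta; rewrite E1; ring. }
  rewrite Ex by auto; destruct (Cd2_derive _ _ _ _ D) as [D1 _].
  repeat split; auto.
  - rewrite D1; apply Cmult_neq_0; [apply tpi_w_nz; auto|apply Cmult_neq_0; auto].
  - rewrite (W_eq _ _ _ _ _ _ D), Ex by auto; unfold cU.
    assert (N : (1 - T (qexp w tau))%C <> 0) by (apply Cminus_eq_contra; auto).
    field; repeat split; auto using tpi_nz.
Qed.

(** By openness of [T] at 0, limits in the value of [x] can be tested on points as high as
    desired. *)
Lemma cusp_hits (Y' : R) : near 0 (fun v => v <> 0 -> exists tau, Y' < Im tau /\ Y < Im tau /\ x tau = v).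
Proof.
  destruct (qexp_hits w (Rmax Y Y') Hw) as [d [Hd K]].
  assert (NC : ~ near 0 (fun z => T z = T 0)).
  { intros N; destruct (near_punctured _ _ (near_and _ _ _ N cT_nz)) as [q [Nq [E1 E2]]].
    apply (E2 Nq); rewrite E1, cT0; auto. }
  pose proof (open_mapping T 0 d cT_hol NC Hd) as O; rewrite cT0 in O.
  revert O; apply near_mono; intros v [q [Hq Eq]] Nv.
  destruct (K q Hq) as [tau [Ht Et]].
  - intros ->; apply Nv; rewrite <- Eq; apply cT0.
  - pose proof (Rmax_l Y Y'); pose proof (Rmax_r Y Y'); exists tau; repeat split; try lra.
    rewrite Ex, Et by lra; auto.
Qed.
End Cusp.

Lemma cusp_factor (T : C -> C) : near 0 (holomorphic_at T) -> T 0 = 0 -> ~ near 0 (fun q => T q = 0) ->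
  exists m g, (0 < m)%nat /\ near 0 (holomorphic_at g) /\ g 0 <> 0 /\ forall q, T q = (q ^ m * g q)%C.
Proof.
  intros H T0 N; destruct (order_dichotomy T 0 H) as [Z|[m [g [Hg [g0 E]]]]]; [contradiction|].
  assert (E' : forall q, T q = (q ^ m * g q)%C).
  { intros q; rewrite E; replace (q - 0)%C with q by ring; reflexivity. }
  exists m, g; repeat split; auto; destruct m; [|lia].
  exfalso; apply g0; specialize (E' (RtoC 0)); rewrite T0 in E'; simpl in E'; rewrite Cmult_1_l in E'; auto.
Qed.

(** * Expressions of weight 4, extension over isolated points, and the data attached to [y] *)

Definition phi (u : C -> C) (z : C) : C := (C_derive u z - u z ^ 2)%C.
(** Like [phi u], in which the square cancels the anomaly of the derivative, this has weight 4 for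
    an invariant [f]; so the quotient of the two is invariant. *)
Definition Qf (f : C -> C) (z : C) : C := (C_derive f z ^ 2 / (f z * (f z - 1)))%C.

(** The weight 2 action corrected by the anomaly of a logarithmic derivative, so that the
    transformation law of [u] reads as plain invariance. The same expression for [s] outside the
    group describes [u] at another cusp. *)
Definition slash2 (s : mat2) (u : C -> C) (z : C) : C :=
  ((u (mobC s z) - mc s * autJ s z) / autJ s z ^ 2)%C.

Lemma Cd_slash2 (s : mat2) (u : C -> C) (z l : C) : mdet s = 1 -> autJ s z <> 0 ->
  Cd u (mobC s z) l ->
  Cd (slash2 s u) z ((l / autJ s z ^ 2 - mc s * mc s) / autJ s z ^ 2
     - 2 * mc s * (u (mobC s z) - mc s * autJ s z) / autJ s z ^ 3)%C.
Proof.
  intros D N Hu; eapply Cd_eqn.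
  - unfold slash2; apply Cd_div; [|apply (Cd_pow (autJ s)), Cd_autJ|apply Cpow_nz; auto].
    apply Cd_minus; [apply (Cd_comp (mobC s) u); [apply Cd_mobC; auto|exact Hu]|].
    apply Cd_mult; [apply Cd_const|apply Cd_autJ].
  - cbv beta; simpl; replace (RtoC (1 + 1)) with (RtoC 2) by (f_equal; lra); field; auto.
Qed.

Lemma phi_slash (s : mat2) (u : C -> C) (z : C) : mdet s = 1 -> autJ s z <> 0 ->
  holomorphic_at u (mobC s z) ->
  phi (slash2 s u) z = (phi u (mobC s z) / autJ s z ^ 4)%C.
Proof.
  intros D N Hu%hol_Cd; unfold phi; rewrite (Cd_C_derive _ _ _ (Cd_slash2 s u z _ D N Hu)).
  unfold slash2; simpl; field; auto.
Qed.

Lemma Qf_slash (s : mat2) (f : C -> C) (z : C) : mdet s = 1 -> autJ s z <> 0 ->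
  holomorphic_at f (mobC s z) -> f (mobC s z) <> 0 -> f (mobC s z) <> 1 ->
  Qf (fun v => f (mobC s v)) z = (Qf f (mobC s z) / autJ s z ^ 4)%C.
Proof.
  intros D N Hf%hol_Cd N0 N1; unfold Qf.
  assert (E : C_derive (fun v => f (mobC s v)) z = (C_derive f (mobC s z) * / (autJ s z * autJ s z))%C).
  { apply Cd_C_derive, (Cd_comp (mobC s) f); auto; apply Cd_mobC; auto. }
  rewrite E; simpl; field; repeat split; auto; apply Cminus_eq_contra; auto.
Qed.

Lemma phi_ext (u v : C -> C) (z : C) : near z (fun w => u w = v w) -> holomorphic_at v z ->
  phi u z = phi v z.
Proof.
  intros H Hv; unfold phi; rewrite (near_here _ _ H).
  rewrite (C_derive_ext_near v u); auto.
  revert H; apply near_mono; intros; symmetry; auto.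
Qed.

(** Near each point the exceptional set is at most that point, so the limits can be chosen
    independently of each other and the function so completed agrees locally with a single
    application of [removable]. *)
Lemma glue_removable (U : C -> Prop) (S : C -> Prop) (f : C -> C) :
  (forall a, U a -> S a -> near a S /\ holomorphic_at f a) ->
  (forall a, U a -> near a (fun z => z <> a -> S z /\ holomorphic_at f z)) ->
  (forall a, U a -> ~ S a -> forall e, 0 < e -> near a (fun z => z <> a -> Cmod ((z - a) * f z)%C <= e)) ->
  exists u, (forall a, U a -> holomorphic_at u a) /\ forall a, S a -> u a = f a.
Proof.
  intros H1 H2 H3.
  set (u := fun z => if excluded_middle_informative (S z) then f z
       else epsilon (inhabits (RtoC 0)) (fun l => holomorphic_at (fun v => if Ceq_dec v z then l else f v) z)).
  assert (Eu : forall a, S a -> u a = f a).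
  { intros a Sa; unfold u; destruct (excluded_middle_informative (S a)); [auto|contradiction]. }
  exists u; split; auto; intros a Ua; destruct (classic (S a)) as [Sa|Na].
  - destruct (H1 a Ua Sa) as [N Hf]; apply (hol_ext_near f); auto.
    revert N; apply near_mono; intros; symmetry; auto.
  - destruct (removable f a) as [l Hl].
    + generalize (H2 a Ua); apply near_mono; intros z Hz Nz; apply Hz; auto.
    + intros e He; generalize (H3 a Ua Na e He); apply near_mono; intros z Hz.
      destruct (Ceq_dec z a) as [->|Nz]; auto.
      replace ((a - a) * f a)%C with (RtoC 0) by ring; rewrite Cmod_0; lra.
    + pose proof (epsilon_spec (inhabits (RtoC 0))
        (fun l => holomorphic_at (fun v => if Ceq_dec v a then l else f v) a) (ex_intro _ l Hl)) as Hs.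
      apply (hol_ext_near _ _ _) with (2 := Hs).
      generalize (H2 a Ua); apply near_mono; intros z Hz.
      destruct (Ceq_dec z a) as [->|Nz]; [|symmetry; apply Eu, Hz; auto].
      unfold u; destruct (excluded_middle_informative (S a)); [contradiction|reflexivity].
Qed.

Lemma cont_eq_punctured (f g : C -> C) (a : C) : Ccont f a -> Ccont g a ->
  near a (fun z => z <> a -> f z = g z) -> f a = g a.
Proof.
  intros Cf Cg H; apply Ceq_minus, Cmod_small_0; intros e He.
  pose proof (Ccont_minus f g a Cf Cg e He) as K.
  destruct (near_punctured _ _ (near_and _ _ _ K H)) as [z [Nz [K1 K2]]].
  rewrite (K2 Nz) in K1; replace (g z - g z - (f a - g a))%C with (- (f a - g a))%C in K1 by ring.
  rewrite Cmod_opp in K1; lra.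
Qed.

Definition cusp_infinite (f : C -> C) : Prop :=
  forall M, near_icusp (fun tau => M < Cmod (f tau)).
Definition periodic (w : R) (f : C -> C) : Prop :=
  0 < w /\ forall tau, inH tau -> f (tau + w)%C = f tau.

(* The analytic content of the hypotheses on the Hauptmodul [t], for [y = t^* / t]: it takes
   the value [1] on class A, [0] on class B and is infinite at the cusps of class C. *)
Record tri_fun (G : mat2 -> Prop) (al be ups : R) (y : C -> C) : Prop := {
  tf_group : PSL2R_subgroup G;
  tf_hol : forall a, inH a -> holomorphic_at y a;
  tf_inv : forall g a, G g -> inH a -> y (mobC g a) = y a;
  tf_inj : forall a b, inH a -> inH b -> y a = y b -> exists g, G g /\ mobC g a = b;
  tf_surj : forall v, v <> RtoC 0 -> v <> RtoC 1 -> exists a, inH a /\ y a = v;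
  tf_reg : forall a, inH a -> y a <> 0 -> y a <> 1 -> C_derive y a <> 0;
  tf_one : forall a, inH a -> y a = 1 -> exists n g, (2 <= n)%nat /\ al = / INR n /\
    near a (holomorphic_at g) /\ g a <> 0 /\ near a (fun z => (1 - y z)%C = ((z - a) ^ n * g z)%C);
  tf_zero : forall a, inH a -> y a = 0 -> exists n g, (2 <= n)%nat /\ be = / INR n /\
    near a (holomorphic_at g) /\ g a <> 0 /\ near a (fun z => y z = ((z - a) ^ n * g z)%C);
  tf_one_ex : (exists a, inH a /\ y a = 1) \/
    (al = 0 /\ exists s w, mdet s = 1 /\ periodic w (fun z => y (mobC s z)) /\
       vanishes_at_icusp (fun z => 1 - y (mobC s z))%C);
  tf_zero_ex : (exists a, inH a /\ y a = 0) \/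
    (be = 0 /\ exists s w, mdet s = 1 /\ periodic w (fun z => y (mobC s z)) /\
       vanishes_at_icusp (fun z => y (mobC s z)));
  tf_cusp : forall s, mdet s = 1 -> cusp G (mob s None) -> exists w,
    periodic w (fun z => y (mobC s z)) /\
    (vanishes_at_icusp (fun z => 1 - y (mobC s z))%C \/ vanishes_at_icusp (fun z => y (mobC s z)) \/
     cusp_infinite (fun z => y (mobC s z)));
  tf_periodic : periodic ups y;
  tf_infinite : cusp_infinite y;
  tf_simple : forall T : C -> C, near 0 (holomorphic_at T) -> T 0 = 0 ->
    (exists Y, forall tau, Y < Im tau -> (/ y tau)%C = T (qexp ups tau)) -> C_derive T 0 <> 0
}.

(** * The function u and its Riccati equation *)

Lemma Ccont_val (f : C -> C) (a c : C) : Ccont f a -> f a = c -> forall e, 0 < e ->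
  near a (fun z => Cmod (f z - c)%C < e).
Proof. intros H <-; exact H. Qed.

Lemma near_icusp_and (P Q : C -> Prop) : near_icusp P -> near_icusp Q -> near_icusp (fun z => P z /\ Q z).
Proof.
  intros [Y1 H1] [Y2 H2]; exists (Rmax Y1 Y2); intros tau Ht.
  pose proof (Rmax_l Y1 Y2); pose proof (Rmax_r Y1 Y2); split; [apply H1|apply H2]; lra.
Qed.

Lemma near_icusp_mono (P Q : C -> Prop) : (forall z, P z -> Q z) -> near_icusp P -> near_icusp Q.
Proof. intros H [Y K]; exists Y; auto. Qed.

Lemma one_minus_neq (x : C) : x <> 1 -> (1 - x)%C <> 0.
Proof. intros H; apply Cminus_eq_contra; auto. Qed.

Lemma cusp_infinite_one_minus (f : C -> C) : cusp_infinite f -> cusp_infinite (fun z => 1 - f z)%C.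
Proof.
  intros H M; generalize (H (M + 1)); apply near_icusp_mono; intros z Hz.
  pose proof (Cmod_tri_inv (f z) 1) as K; rewrite Cmod_1 in K.
  replace (f z - 1)%C with (- (1 - f z))%C in K by ring; rewrite Cmod_opp in K; lra.
Qed.

Lemma cusp_limit_ext (f g : C -> C) : (forall z, f z = g z) -> vanishes_at_icusp f -> vanishes_at_icusp g.
Proof. intros E H e He; generalize (H e He); apply near_icusp_mono; intros z; rewrite E; auto. Qed.

(** Replacing [y] by [1 - y] exchanges classes A and B and fixes class C. Every local result at
    [y = 0] becomes available at [y = 1], and the series for B yields the one for A. *)
Lemma tri_fun_sym (G : mat2 -> Prop) (al be ups : R) (y : C -> C) :
  tri_fun G al be ups y -> tri_fun G be al ups (fun z => 1 - y z)%C.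
Proof.
  intros H.
  assert (K : forall z, (1 - (1 - y z))%C = y z) by (intros; ring).
  constructor.
  - apply H.
  - intros a Ha; apply hol_minus; [apply hol_const|apply (tf_hol _ _ _ _ _ H); auto].
  - intros g a Hg Ha; rewrite (tf_inv _ _ _ _ _ H); auto.
  - intros a b Ha Hb E; apply (tf_inj _ _ _ _ _ H); auto; rewrite <- (K a), E; ring.
  - intros v N0 N1; destruct (tf_surj _ _ _ _ _ H (1 - v)%C) as [a [Ha E]].
    + apply one_minus_neq; auto.
    + intros E; apply N0; replace v with (1 - (1 - v))%C by ring; rewrite E; ring.
    + exists a; split; auto; rewrite E; ring.
  - intros a Ha N0 N1.
    rewrite (Cd_C_derive _ _ _ (Cd_minus _ _ _ _ _ (Cd_const 1 a)
       (proj1 (hol_Cd _ _) (tf_hol _ _ _ _ _ H a Ha)))).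
    intros E; apply (tf_reg _ _ _ _ _ H a Ha).
    + intros E0; apply N1; rewrite E0; ring.
    + intros E0; apply N0; rewrite E0; ring.
    + replace (C_derive y a) with (- (0 - C_derive y a))%C by ring; rewrite E; ring.
  - intros a Ha E; destruct (tf_zero _ _ _ _ _ H a Ha) as [n [g [K1 [K2 [K3 [K4 K5]]]]]].
    + rewrite <- (K a), E; ring.
    + exists n, g; repeat split; auto; revert K5; apply near_mono; intros z Hz; rewrite K; auto.
  - intros a Ha E; destruct (tf_one _ _ _ _ _ H a Ha) as [n [g [K1 [K2 [K3 [K4 K5]]]]]].
    + rewrite <- (K a), E; ring.
    + exists n, g; repeat split; auto.
  - destruct (tf_zero_ex _ _ _ _ _ H) as [[a [Ha E]]|[E [s [w [D [[Hw P] L]]]]]]; [left|right; split; auto].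
    + exists a; split; auto; rewrite E; ring.
    + exists s, w; split; [auto|split; [split; auto|]].
      * intros tau Ht; rewrite (P tau Ht); auto.
      * revert L; apply cusp_limit_ext; intros; rewrite K; auto.
  - destruct (tf_one_ex _ _ _ _ _ H) as [[a [Ha E]]|[E [s [w [D [[Hw P] L]]]]]]; [left|right; split; auto].
    + exists a; split; auto; rewrite E; ring.
    + exists s, w; split; [auto|split; [split; auto|auto]].
      intros tau Ht; rewrite (P tau Ht); auto.
  - intros s D Hc; destruct (tf_cusp _ _ _ _ _ H s D Hc) as [w [[Hw P] L]].
    exists w; split; [split; auto; intros tau Ht; rewrite (P tau Ht); auto|].
    destruct L as [L|[L|L]].
    + right; left; auto.
    + left; revert L; apply cusp_limit_ext; intros; rewrite K; auto.
    + right; right; apply cusp_infinite_one_minus; auto.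
  - destruct (tf_periodic _ _ _ _ _ H) as [Hw P]; split; auto; intros tau Ht; rewrite P; auto.
  - apply cusp_infinite_one_minus, H.
  - intros T HT T0 [Y ET] E.
    (* If [T] represents [1 / (1 - y)], then [T / (T - 1)] represents [1 / y], and its derivative at
       0 vanishes with that of [T]. *)
    apply (tf_simple _ _ _ _ _ H (fun q => T q / (T q - 1))%C).
    + generalize (near_and _ _ _ HT (Ccont_neq T 0 1 (hol_cont _ _ (near_here _ _ HT))
         ltac:(rewrite T0; intros E1; symmetry in E1; apply C1_nz; auto))).
      apply near_mono; intros q [H1 H2]; apply hol_div; [auto|apply hol_minus; auto; apply hol_const|].
      apply Cminus_eq_contra; auto.
    + rewrite T0; field; intros E1; apply C1_nz; replace (RtoC 1) with (- (0 - 1))%C by ring; rewrite E1; ring.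
    + destruct (near_icusp_and _ _ (tf_infinite _ _ _ _ _ H 1) (tf_infinite _ _ _ _ _ H 1)) as [Y1 H1].
      exists (Rmax Y Y1); intros tau Ht; pose proof (Rmax_l Y Y1); pose proof (Rmax_r Y Y1).
      rewrite <- (ET tau ltac:(lra)); destruct (H1 tau ltac:(lra)) as [B _].
      assert (N0 : y tau <> 0) by (intros E0; rewrite E0, Cmod_0 in B; lra).
      assert (N1 : (1 - y tau)%C <> 0).
      { apply one_minus_neq; intros E0; rewrite E0, Cmod_1 in B; lra. }
      field; repeat split; auto.
      intros E0; apply N0; replace (y tau) with (1 - (1 - y tau))%C by ring; rewrite <- E0; ring.
    + pose proof (proj1 (hol_Cd _ _) (near_here _ _ HT)) as D; rewrite E in D.
      assert (N : (T 0 - 1)%C <> 0).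
      { rewrite T0; intros E1; apply C1_nz; replace (RtoC 1) with (- (0 - 1))%C by ring; rewrite E1; ring. }
      rewrite (Cd_C_derive _ _ _ (Cd_div _ _ _ _ _ D (Cd_minus _ _ _ _ _ D (Cd_const 1 0)) N)).
      rewrite T0 in *; field; auto.
Qed.

Section Main.
Variables (G : mat2 -> Prop) (al be ups : R) (y : C -> C).
Hypothesis H : tri_fun G al be ups y.

Definition gen (z : C) : Prop := y z <> 0 /\ y z <> 1.

Lemma y_near_hol (a : C) : inH a -> near a (holomorphic_at y).
Proof.
  intros Ha; generalize (inH_near a Ha); apply near_mono; intros z Hz; apply (tf_hol _ _ _ _ _ H); auto.
Qed.

Lemma y_cont (a : C) : inH a -> Ccont y a.
Proof. intros Ha; apply hol_cont, (tf_hol _ _ _ _ _ H); auto. Qed.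

Lemma gen_near (a : C) : inH a -> gen a -> near a gen.
Proof. intros Ha [N0 N1]; apply near_and; apply Ccont_neq; auto using y_cont. Qed.

Lemma gen_punctured (a : C) : inH a -> near a (fun z => z <> a -> gen z).
Proof.
  intros Ha; destruct (Ceq_dec (y a) 0) as [E0|N0]; [|destruct (Ceq_dec (y a) 1) as [E1|N1]].
  - destruct (tf_zero _ _ _ _ _ H a Ha E0) as [n [g [_ [_ [Hg [g0 Eg]]]]]].
    assert (N1 : near a (fun z => y z <> 1)).
    { apply Ccont_neq; auto using y_cont; rewrite E0; intros E; symmetry in E; apply C1_nz; auto. }
    generalize (near_and _ _ _ N1 (near_and _ _ _ Eg (Ccont_neq g a 0 (hol_cont _ _ (near_here _ _ Hg)) g0))).
    apply near_mono; intros z [K1 [K2 K3]] Nz; split; auto.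
    rewrite K2; apply Cmult_neq_0; auto; apply Cpow_nz, Cminus_eq_contra; auto.
  - destruct (tf_one _ _ _ _ _ H a Ha E1) as [n [g [_ [_ [Hg [g0 Eg]]]]]].
    assert (N1 : near a (fun z => y z <> 0)) by (apply Ccont_neq; auto using y_cont).
    generalize (near_and _ _ _ N1 (near_and _ _ _ Eg (Ccont_neq g a 0 (hol_cont _ _ (near_here _ _ Hg)) g0))).
    apply near_mono; intros z [K1 [K2 K3]] Nz; split; auto.
    intros E; rewrite E in K2; assert (K4 : (1 - 1)%C <> 0); [|apply K4; ring].
    rewrite K2; apply Cmult_neq_0; auto; apply Cpow_nz, Cminus_eq_contra; auto.
  - generalize (gen_near a Ha (conj N0 N1)); apply near_mono; auto.
Qed.

Definition U0 (z : C) : C := W (1 - be) (1 - al) y z.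

Lemma hol_W (e0 e1 : R) (f : C -> C) (z : C) : near z (holomorphic_at f) -> C_derive f z <> 0 ->
  f z <> 0 -> f z <> 1 -> holomorphic_at (W e0 e1 f) z.
Proof.
  intros Hf N1 N2 N3; pose proof (near_derive_hol _ _ Hf) as H1; pose proof (near_derive_hol _ _ H1) as H2.
  apply near_here in Hf, H1, H2; unfold W.
  apply hol_div; [|apply hol_const|intros K; apply RtoC_inj in K; lra].
  apply hol_plus; [apply hol_minus; [apply hol_div; auto|]|].
  - apply hol_mult; [apply hol_const|apply hol_div; auto].
  - apply hol_mult; [apply hol_const|apply hol_div; auto; [|apply one_minus_neq; auto]].
    apply hol_minus; auto; apply hol_const.
Qed.

Lemma ell_removable (x g : C -> C) (a : C) (n : nat) (e0 e1 : R) : (2 <= n)%nat -> e0 = 1 - / INR n ->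
  near a (holomorphic_at g) -> g a <> 0 -> near a (fun z => x z = ((z - a) ^ n * g z)%C) ->
  forall e, 0 < e -> near a (fun z => z <> a -> Cmod ((z - a) * W e0 e1 x z)%C <= e).
Proof.
  intros Hn E0 Hg g0 Ex e He.
  assert (Hn' : (0 < n)%nat) by lia.
  pose proof (ell_W x g a n Hn' Hg g0 Ex e0 e1) as EW.
  pose proof (ell_k_hol g a n Hg) as Hk; pose proof (ell_k_nz g a n Hn' g0) as k0.
  set (F := fun z => ((INR (pred n) + (z - a) * C_derive (ell_k g a n) z / ell_k g a n z
      - e0 * (ell_k g a n z / g z)
    + e1 * ((z - a) ^ n * ell_k g a n z / (1 - (z - a) ^ n * g z))) / 2)%C) in *.
  assert (Za : ((a - a) ^ n)%C = 0).
  { replace (a - a)%C with (RtoC 0) by ring; destruct n; [lia|apply pow_0_S]. }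
  assert (CF : Ccont F a).
  { pose proof (hol_cont _ _ (near_here _ _ Hg)) as Cg; pose proof (hol_cont _ _ (near_here _ _ Hk)) as Ck.
    pose proof (hol_cont _ _ (near_here _ _ (near_derive_hol _ _ Hk))) as Ck'.
    assert (Ca : Ccont (fun z => z - a)%C a) by (apply Ccont_minus; [apply Ccont_id|apply Ccont_const]).
    unfold F; apply Ccont_div; [|apply Ccont_const|intros K; apply RtoC_inj in K; lra].
    apply Ccont_plus; [apply Ccont_minus; [apply Ccont_plus; [apply Ccont_const|]|]|].
    - apply Ccont_div; auto; apply Ccont_mult; auto.
    - apply Ccont_mult; [apply Ccont_const|apply Ccont_div; auto].
    - apply Ccont_mult; [apply Ccont_const|apply Ccont_div].
      + apply Ccont_mult; auto; apply (Ccont_pow (fun z => z - a)%C); auto.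
      + apply Ccont_minus; [apply Ccont_const|]; apply Ccont_mult; auto; apply (Ccont_pow (fun z => z - a)%C); auto.
      + rewrite Za; intros K; apply C1_nz; rewrite <- K; ring. }
  assert (F0 : F a = 0).
  { unfold F; rewrite Za; replace (a - a)%C with (RtoC 0) by ring.
    assert (Ek : ell_k g a n a = (INR n * g a)%C) by (unfold ell_k; ring).
    rewrite Ek in *; rewrite E0.
    assert (Nn : RtoC (INR n) <> 0) by (apply RtoC_nz, not_0_INR; lia).
    destruct n as [|n']; [lia|]; simpl pred; rewrite RtoC_minus, RtoC_inv, S_INR, RtoC_plus in *
      by (apply not_0_INR; lia).
    field; repeat split; auto. }
  pose proof (Ccont_val F a 0 CF F0 e He) as NF.
  generalize (near_and _ _ _ EW NF); apply near_mono; intros z [K1 K2] Nz.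
  rewrite (K1 Nz); fold (F z); left; replace (F z) with (F z - 0)%C by ring; auto.
Qed.

Lemma u_exists : exists u, (forall a, inH a -> holomorphic_at u a) /\
  forall a, inH a -> gen a -> u a = U0 a.
Proof.
  destruct (glue_removable inH (fun z => inH z /\ gen z) U0) as [u [Hu Eu]].
  - intros a Ha [_ Ga]; split; [apply near_and; auto using inH_near, gen_near|].
    apply hol_W; auto using y_near_hol; try apply Ga; apply (tf_reg _ _ _ _ _ H); auto; apply Ga.
  - intros a Ha; generalize (near_and _ _ _ (inH_near a Ha) (gen_punctured a Ha)); apply near_mono.
    intros z [Hz Gz] Nz; specialize (Gz Nz); split; [split; auto|].
    apply hol_W; auto using y_near_hol; try apply Gz; apply (tf_reg _ _ _ _ _ H); auto; apply Gz.
  - intros a Ha Ng e He.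
    destruct (Ceq_dec (y a) 0) as [E0|N0]; [|destruct (Ceq_dec (y a) 1) as [E1|N1]].
    + destruct (tf_zero _ _ _ _ _ H a Ha E0) as [n [g [Hn [En [Hg [g0 Eg]]]]]].
      apply (ell_removable y g a n); auto; rewrite En; auto.
    + destruct (tf_one _ _ _ _ _ H a Ha E1) as [n [g [Hn [En [Hg [g0 Eg]]]]]].
      assert (K : near a (fun z => z <> a -> Cmod ((z - a) * W (1 - al) (1 - be) (fun z => 1 - y z) z)%C <= e)).
      { apply (ell_removable (fun z => 1 - y z)%C g a n); auto; rewrite En; auto. }
      generalize (near_and _ _ _ K (near_and _ _ _ (inH_near a Ha) (gen_punctured a Ha))); apply near_mono.
      intros z [K1 [Hz Gz]] Nz; specialize (K1 Nz); specialize (Gz Nz).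
      rewrite W_one_minus in K1; auto using y_near_hol; try apply Gz.
      apply (tf_reg _ _ _ _ _ H); auto; apply Gz.
    + exfalso; apply Ng; split; [auto|split; auto].
  - exists u; split; auto.
Qed.

Variable u : C -> C.
Hypotheses (Hu : forall a, inH a -> holomorphic_at u a) (Eu : forall a, inH a -> gen a -> u a = U0 a).

Lemma u_slash (s : mat2) (z : C) : mdet s = 1 -> inH z -> gen (mobC s z) ->
  slash2 s u z = W (1 - be) (1 - al) (fun v => y (mobC s v)) z.
Proof.
  intros D Hz Gz; pose proof (autJ_nz s z D Hz) as N; pose proof (mobC_H s z D Hz) as Hs.
  unfold slash2; rewrite Eu by auto; unfold U0.
  rewrite (W_slash _ _ s y z); auto using y_near_hol; try apply Gz.
  - field; auto.
  - apply (tf_reg _ _ _ _ _ H); auto; apply Gz.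
Qed.

(** At generic points the invariance of [y] gives it through [W_slash]; the elliptic points follow
    by continuity. *)
Lemma u_inv (g : mat2) (z : C) : G g -> inH z -> slash2 g u z = u z.
Proof.
  intros Hg Hz; pose proof (sg_det G (tf_group _ _ _ _ _ H) g Hg) as D.
  apply (cont_eq_punctured (slash2 g u) u z).
  - eapply Cd_cont, Cd_slash2; auto using autJ_nz; apply hol_Cd, Hu, mobC_H; auto.
  - apply hol_cont, Hu; auto.
  - generalize (near_and _ _ _ (near_near _ _ (inH_near z Hz)) (gen_punctured z Hz)); apply near_mono.
    intros v [Hv Gv] Nv; specialize (Gv Nv); pose proof (near_here _ _ Hv) as Hv0; simpl in Hv0.
    rewrite u_slash, Eu; auto.
    + apply W_ext; auto using y_near_hol.
      revert Hv; apply near_mono; intros t Ht; apply (tf_inv _ _ _ _ _ H); auto.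
    + unfold gen; rewrite (tf_inv _ _ _ _ _ H); auto.
Qed.

(** The added constant is [1 / rho^2], so that the Riccati equation amounts to the vanishing of
    [Rat]. *)
Definition Rat (z : C) : C := (phi u z / Qf y z + (1 - al - be) ^ 2 / 4)%C.

Lemma Qf_nz (f : C -> C) (z : C) : C_derive f z <> 0 -> f z <> 0 -> f z <> 1 -> Qf f z <> 0.
Proof.
  intros N1 N2 N3 E; unfold Qf in E.
  assert (N4 : (f z * (f z - 1))%C <> 0) by (apply Cmult_neq_0; auto; apply Cminus_eq_contra; auto).
  apply (Cpow_nz _ 2 N1); replace (C_derive f z ^ 2)%C with
    (C_derive f z ^ 2 / (f z * (f z - 1)) * (f z * (f z - 1)))%C.
  - rewrite E; ring.
  - field; split; auto; apply Cminus_eq_contra; auto.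
Qed.

Lemma Rat_slash (s : mat2) (z : C) : mdet s = 1 -> inH z -> gen (mobC s z) ->
  Rat (mobC s z) = (phi (slash2 s u) z / Qf (fun v => y (mobC s v)) z + (1 - al - be) ^ 2 / 4)%C.
Proof.
  intros D Hz Gz; pose proof (autJ_nz s z D Hz) as N; pose proof (mobC_H s z D Hz) as Hs.
  unfold Rat; rewrite phi_slash, Qf_slash; auto; try apply Gz.
  - assert (NQ : Qf y (mobC s z) <> 0).
    { apply Qf_nz; try apply Gz; apply (tf_reg _ _ _ _ _ H); auto; apply Gz. }
    f_equal; field; auto.
  - apply (tf_hol _ _ _ _ _ H); auto.
Qed.

Lemma Rat_inv (g : mat2) (z : C) : G g -> inH z -> gen z -> Rat (mobC g z) = Rat z.
Proof.
  intros Hg Hz Gz; pose proof (sg_det G (tf_group _ _ _ _ _ H) g Hg) as D.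
  assert (Ng : near z (fun v => y (mobC g v) = y v)).
  { generalize (inH_near z Hz); apply near_mono; intros; apply (tf_inv _ _ _ _ _ H); auto. }
  rewrite Rat_slash; auto.
  - unfold Rat; f_equal; f_equal.
    + apply phi_ext; auto; generalize (inH_near z Hz); apply near_mono; intros; apply u_inv; auto.
    + unfold Qf; cbv beta; rewrite (near_here _ _ Ng).
      rewrite (near_here _ _ (C_derive_near _ _ _ Ng (y_near_hol z Hz))); auto.
  - unfold gen; rewrite (tf_inv _ _ _ _ _ H); auto.
Qed.

Lemma Rat_hol (z : C) : inH z -> gen z -> holomorphic_at Rat z.
Proof.
  intros Hz Gz; assert (N : C_derive y z <> 0) by (apply (tf_reg _ _ _ _ _ H); auto; apply Gz).
  assert (Hu' : near z (holomorphic_at u)) by (generalize (inH_near z Hz); apply near_mono; auto).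
  apply hol_plus; [|apply hol_const]; apply hol_div.
  - apply hol_minus; [apply derive_hol; auto|apply hol_pow; auto].
  - unfold Qf; apply hol_div.
    + apply hol_pow, derive_hol; auto using y_near_hol.
    + apply hol_mult; [|apply hol_minus; [|apply hol_const]]; apply (tf_hol _ _ _ _ _ H); auto.
    + apply Cmult_neq_0; [apply Gz|apply Cminus_eq_contra, Gz].
  - apply Qf_nz; auto; apply Gz.
Qed.

(** A fibre of [y] is one orbit, so the chosen preimage is immaterial. Every value other than 0 and
    1 is taken, with nonzero derivative, and [quotient_hol] transports holomorphy. *)
Lemma Rat_descends : exists Rf, (forall z, inH z -> gen z -> Rf (y z) = Rat z) /\
  forall v, v <> RtoC 0 -> v <> RtoC 1 -> holomorphic_at Rf v.
Proof.
  set (sec := fun v => epsilon (inhabits (RtoC 0)) (fun a => inH a /\ y a = v)).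
  assert (E : forall z, inH z -> gen z -> Rat (sec (y z)) = Rat z).
  { intros z Hz Gz.
    destruct (epsilon_spec (inhabits (RtoC 0)) (fun a => inH a /\ y a = y z)) as [H1 H2];
      [exists z; auto|]; fold (sec (y z)) in H1, H2.
    destruct (tf_inj _ _ _ _ _ H z (sec (y z)) Hz H1 ltac:(auto)) as [g [Hg Eg]].
    rewrite <- Eg; apply Rat_inv; auto. }
  exists (fun v => Rat (sec v)); split; auto.
  intros v N0 N1; destruct (tf_surj _ _ _ _ _ H v N0 N1) as [a [Ha Ea]].
  assert (Ga : gen a) by (unfold gen; rewrite Ea; auto).
  rewrite <- Ea; eapply Cd_hol, (quotient_hol _ y Rat a).
  - apply y_near_hol; auto.
  - apply hol_Cd, (tf_hol _ _ _ _ _ H); auto.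
  - apply (tf_reg _ _ _ _ _ H); auto; apply Ga.
  - apply hol_Cd, Rat_hol; auto.
  - generalize (near_and _ _ _ (inH_near a Ha) (gen_near a Ha Ga)); apply near_mono.
    intros z [Hz Gz]; apply E; auto.
Qed.
End Main.

(** * The descended function at 0, 1 and infinity; its vanishing *)

Lemma chart_limit (w Y : R) (x : C -> C) : 0 < w ->
  (forall tau, Y < Im tau -> holomorphic_at x tau) ->
  (forall tau, Y < Im tau -> x (tau + w)%C = x tau) -> vanishes_at_icusp x ->
  (forall Y', exists tau, Y' < Im tau /\ x tau <> 0) ->
  exists (T g : C -> C) m, (0 < m)%nat /\ near 0 (holomorphic_at g) /\ g 0 <> 0 /\
    (forall q, T q = (q ^ m * g q)%C) /\ forall tau, Y < Im tau -> x tau = T (qexp w tau).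
Proof.
  intros Hw Hx Hp Hl Hn; destruct (qchart x w Y 0 Hw Hx Hp) as [T [T0 [HT ET]]].
  { intros e He; generalize (Hl e He); apply near_icusp_mono; intros z.
    replace (x z - 0)%C with (x z) by ring; auto. }
  destruct (cusp_factor T) as [m [g [Hm [Hg [g0 E]]]]]; auto.
  - exists (exp (- (2 * PI) * Y / w)); split; [apply exp_pos|].
    intros q Hq; apply HT; replace q with (q - 0)%C by ring; auto.
  - intros N; destruct (qexp_near w _ Hw N) as [Y' HY'].
    destruct (Hn (Rmax Y Y')) as [tau [Ht Nt]]; pose proof (Rmax_l Y Y'); pose proof (Rmax_r Y Y').
    apply Nt; rewrite ET by lra; apply HY'; lra.
  - exists T, g, m; repeat split; auto.
Qed.

Lemma high_point (Y : R) : exists tau, Y < Im tau /\ inH tau.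
Proof.
  exists (RtoC (Rabs Y + 1) * Ci)%C; unfold inH; rewrite im_scal_l; simpl.
  pose proof (Rle_abs Y); pose proof (Rabs_pos Y); split; lra.
Qed.

Section Limits.
Variables (G : mat2 -> Prop) (al be ups : R) (y u : C -> C).
Hypotheses (H : tri_fun G al be ups y) (Hu : forall a, inH a -> holomorphic_at u a)
  (Eu : forall a, inH a -> gen y a -> u a = U0 al be y a).

(** Nongeneric points are isolated and [mobC s] is injective, so they cannot fill a neighbourhood of
    a high point. *)
Lemma gen_somewhere (s : mat2) (Y : R) : mdet s = 1 ->
  exists tau, Y < Im tau /\ inH tau /\ gen y (mobC s tau).
Proof.
  intros D; destruct (high_point Y) as [a [HY Ha]].
  pose proof (mobC_H s a D Ha) as Hs.
  assert (Cm : Ccont (mobC s) a) by (eapply Cd_cont, Cd_mobC; auto using autJ_nz).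
  pose proof (near_comp (mobC s) a _ Cm (gen_punctured G al be ups y H _ Hs)) as N.
  destruct (near_punctured _ _ (near_and _ _ _ N (near_and _ _ _ (upper_near a Y HY) (inH_near a Ha))))
    as [z [Nz [Gz [HzY Hz]]]].
  exists z; split; [auto|split; auto]; apply Gz; intros E.
  apply Nz; pose proof (mobC_diff s z a D (autJ_nz s z D Hz) (autJ_nz s a D Ha)) as Df.
  rewrite E in Df; apply Ceq_minus.
  replace (z - a)%C with ((z - a) / (autJ s z * autJ s a) * (autJ s z * autJ s a))%C
    by (field; split; apply autJ_nz; auto).
  rewrite <- Df; ring.
Qed.

Lemma ys_hol (s : mat2) (z : C) : mdet s = 1 -> inH z -> holomorphic_at (fun v => y (mobC s v)) z.
Proof.
  intros D Hz; apply (hol_comp (mobC s) y); [eapply Cd_hol, Cd_mobC; auto using autJ_nz|].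
  apply (tf_hol _ _ _ _ _ H), mobC_H; auto.
Qed.

Lemma phi_chart (w : R) (F : C -> C) (v : C -> C) (tau : C) : 0 < w ->
  holomorphic_at F (qexp w tau) -> near tau (fun z => v z = F (qexp w z)) ->
  phi v tau = (tpi / w * (qexp w tau * C_derive F (qexp w tau)) - F (qexp w tau) ^ 2)%C.
Proof.
  intros Hw HF Hn.
  assert (D : Cd (fun z => F (qexp w z)) tau (tpi / w * (qexp w tau * C_derive F (qexp w tau)))%C).
  { apply Cd_qcomp; auto; apply hol_Cd; auto. }
  rewrite (phi_ext _ _ _ Hn) by (eapply Cd_hol; eauto).
  unfold phi; rewrite (Cd_C_derive _ _ _ D); auto.
Qed.

Variable Rf : C -> C.
Hypothesis ERf : forall z, inH z -> gen y z -> Rf (y z) = Rat al be y u z.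

(** For [v = y z] one has [v * Rf v = phi u * (y - 1) * (y / y')^2 + c * y]. At an elliptic zero
    [y / y'] tends to 0 and [phi u] stays bounded, as [u] extends. At a cusp [y / y'] has a finite
    limit, but [be = 0] makes the exponent [1 - be] equal to 1, so [u] vanishes there. In both cases
    the expression is a continuous [S] with value 0, and openness reaches all small [v]. *)
Lemma Rf_at_zero (e : R) : 0 < e -> near 0 (fun v => v <> 0 -> Cmod (v * Rf v)%C <= e).
Proof.
  intros He; set (c := ((1 - al - be) ^ 2 / 4)%C).
  destruct (tf_zero_ex _ _ _ _ _ H) as [[a [Ha E0]]|[B0 [s [w [D [[Hw P] L]]]]]].
  - destruct (tf_zero _ _ _ _ _ H a Ha E0) as [n [g [Hn [_ [Hg [g0 Eg]]]]]].
    assert (Hn' : (0 < n)%nat) by lia.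
    pose proof (ell_derive y g a n Hn' Hg Eg) as Dy.
    pose proof (ell_k_nz g a n Hn' g0) as k0.
    pose proof (hol_cont _ _ (near_here _ _ (ell_k_hol g a n Hg))) as Ck.
    pose proof (hol_cont _ _ (near_here _ _ Hg)) as Cg.
    assert (Hu' : near a (holomorphic_at u)) by (generalize (inH_near a Ha); apply near_mono; auto).
    set (S := fun z => (phi u z * (y z - 1) * ((z - a) * g z / ell_k g a n z) ^ 2 + c * y z)%C).
    assert (CS : Ccont S a).
    { pose proof (y_cont G al be ups y H a Ha) as Cy.
      apply Ccont_plus; [|apply Ccont_mult; auto; apply Ccont_const].
      apply Ccont_mult; [apply Ccont_mult; [|apply Ccont_minus; auto; apply Ccont_const]|].
      - apply Ccont_minus; [apply hol_cont, derive_hol; auto|].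
        apply Ccont_pow, hol_cont, Hu; auto.
      - apply (Ccont_pow (fun z => (z - a) * g z / ell_k g a n z)%C), Ccont_div; auto.
        apply Ccont_mult; auto; apply Ccont_minus; [apply Ccont_id|apply Ccont_const]. }
    assert (S0 : S a = 0) by (unfold S; rewrite E0; simpl; field; auto).
    destruct (near_and _ _ _ (Ccont_val S a 0 CS S0 e He) (near_and _ _ _ (near_and _ _ _ Eg Dy)
       (near_and _ _ _ (near_and _ _ _ (inH_near a Ha) (gen_punctured G al be ups y H a Ha))
        (Ccont_neq _ _ _ Ck k0)))) as [d [Hd K]].
    assert (NC : ~ near a (fun z => y z = y a)).
    { intros N; destruct (near_punctured _ _ (near_and _ _ _ N (gen_punctured G al be ups y H a Ha)))
        as [z [Nz [E1 Gz]]]; apply (proj1 (Gz Nz)); rewrite E1; auto. }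
    pose proof (open_mapping y a d (y_near_hol G al be ups y H a Ha) NC Hd) as O; rewrite E0 in O.
    revert O; apply near_mono; intros v [z [Hz Ev]] Nv.
    assert (Nz : z <> a) by (intros ->; apply Nv; rewrite <- Ev; auto).
    destruct (K z Hz) as [KS [[KE KD] [[Kh Kg] Kk]]]; specialize (Kg Nz).
    rewrite <- Ev, ERf by auto.
    replace (y z * Rat al be y u z)%C with (S z); [left; replace (S z) with (S z - 0)%C by ring; auto|].
    assert (Ny : C_derive y z <> 0) by (apply (tf_reg _ _ _ _ _ H); auto; apply Kg).
    unfold S, Rat; fold c; unfold Qf.
    assert (N1 : (y z - 1)%C <> 0) by (apply Cminus_eq_contra, Kg).
    assert (Ny0 : y z <> 0) by apply Kg.
    replace ((z - a) * g z / ell_k g a n z)%C with (y z / C_derive y z)%C.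
    + simpl; field; auto.
    + assert (Nza : (z - a)%C <> 0) by (apply Cminus_eq_contra; auto).
      rewrite (Cd_C_derive _ _ _ KD), KE.
      destruct n as [|n']; [lia|]; simpl pred in *; rewrite Cpow_S.
      field; split; [auto|apply Cpow_nz; auto].
  - set (x := fun z => y (mobC s z)) in *.
    destruct (chart_limit w 0 x Hw) as [T [g [m [Hm [Hg [g0 [ET Ex]]]]]]].
    + intros tau Ht; apply ys_hol; auto.
    + intros tau Ht; apply P; auto.
    + exact L.
    + intros Y'; destruct (gen_somewhere s Y' D) as [tau [Ht [_ Gt]]]; exists tau; split; auto; apply Gt.
    + set (A := cA g m); set (V := cU w T g m (1 - be) (1 - al)).
      pose proof (cU_hol w T g m Hm Hg g0 ET (1 - be) (1 - al)) as HV; fold V in HV.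
      pose proof (cA_hol g m Hg g0) as HA; fold A in HA.
      pose proof (cT_hol T g m Hg ET) as HT.
      assert (Nw : RtoC w <> 0) by (apply RtoC_nz; lra).
      set (S := fun q => ((T q - 1) * (tpi / w * (q * C_derive V q) - V q ^ 2) / (tpi / w * A q) ^ 2 + c * T q)%C).
      assert (A0 : A 0 = INR m) by (apply cA0; auto).
      assert (V0 : V 0 = 0).
      { unfold V; rewrite (cU0 w T g m Hw Hm g0 ET), B0, !RtoC_minus; field; auto. }
      assert (T0 : T 0 = 0) by (apply (cT0 T g m); auto).
      assert (NA0 : (tpi / w * A 0)%C <> 0).
      { rewrite A0; apply Cmult_neq_0; [apply tpi_w_nz; auto|apply INR_m_nz; auto]. }
      assert (CS : Ccont S 0).
      { pose proof (hol_cont _ _ (near_here _ _ HV)) as CV; pose proof (hol_cont _ _ (near_here _ _ HA)) as CA.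
        pose proof (hol_cont _ _ (near_here _ _ HT)) as CT.
        pose proof (hol_cont _ _ (near_here _ _ (near_derive_hol _ _ HV))) as CV'.
        apply Ccont_plus; [|apply Ccont_mult; auto; apply Ccont_const].
        apply Ccont_div; [apply Ccont_mult; [apply Ccont_minus; auto; apply Ccont_const|]| |apply Cpow_nz; auto].
        - apply Ccont_minus; [|apply Ccont_pow; auto].
          apply Ccont_mult; [apply Ccont_const|apply Ccont_mult; auto; apply Ccont_id].
        - apply (Ccont_pow (fun q => tpi / w * A q)%C), Ccont_mult; auto; apply Ccont_const. }
      assert (S0 : S 0 = 0).
      { assert (NA : A 0 <> 0) by (rewrite A0; apply INR_m_nz; auto).
        unfold S; rewrite T0, V0; simpl; field; repeat split; auto using tpi_nz. }
      destruct (qexp_near w _ Hw (near_and _ _ _ (Ccont_val S 0 0 CS S0 e He) HV)) as [Y1 K1].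
      destruct (cusp_W w 0 x T g m Hw Hm Hg g0 ET Ex (1 - be) (1 - al)) as [Y2 K2].
      generalize (cusp_hits w 0 x T g m Hw Hm Hg g0 ET Ex (Rmax Y1 Y2)); apply near_mono.
      intros v Hv Nv; destruct (Hv Nv) as [tau [Ht [Ht0 Ev]]].
      pose proof (Rmax_l Y1 Y2); pose proof (Rmax_r Y1 Y2).
      destruct (K2 tau ltac:(lra)) as [E1 [N0 [N1 [NA [ED [ND EW]]]]]].
      destruct (K1 tau ltac:(lra)) as [BS HVq].
      assert (Hs : inH (mobC s tau)) by (apply mobC_H; auto).
      assert (Gs : gen y (mobC s tau)) by (split; auto).
      rewrite <- Ev; unfold x at 1 2; rewrite ERf by auto.
      rewrite (Rat_slash G al be ups y H u Hu) by auto; fold c.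
      rewrite (phi_chart w V); auto.
      * replace (y (mobC s tau) * _)%C with (S (qexp w tau)).
        { left; replace (S (qexp w tau)) with (S (qexp w tau) - 0)%C by ring; auto. }
        unfold S, Qf; fold x; rewrite ED; change (y (mobC s tau)) with (x tau).
        assert (N1' : (x tau - 1)%C <> 0) by (apply Cminus_eq_contra; auto).
        rewrite E1 in *; unfold A in *; simpl; field; repeat split; auto using tpi_nz.
      * generalize (near_and _ _ _ (upper_near tau Y2 ltac:(lra)) (inH_near tau Ht0)); apply near_mono.
        intros z [Hz Hz0]; destruct (K2 z Hz) as [_ [M0 [M1 [_ [_ [_ EWz]]]]]].
        rewrite (u_slash G al be ups y H u Eu); auto; split; auto.
Qed.

(** At [q = 0] the quotient of [phi u] by [Qf y] is minus the square of [V 0 / (tpi / w * A 0)].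
    Here [V 0 = tpi / w * m * (1 - al - be) / 2] and [A 0 = m], so the order [m] cancels and the
    constant [c] compensates exactly; simplicity of the zero is not yet involved. *)
Lemma Rf_at_infinity (e : R) : 0 < e -> exists B, forall v, B < Cmod v -> Cmod (Rf v) <= e.
Proof.
  intros He; set (c := ((1 - al - be) ^ 2 / 4)%C).
  destruct (tf_periodic _ _ _ _ _ H) as [Hw P]; pose proof (tf_infinite _ _ _ _ _ H) as L.
  set (w := ups) in *; set (x := fun z => (/ y z)%C).
  destruct (L 1) as [Y0 HY0].
  set (Y := Rmax 0 Y0).
  assert (HY : forall tau, Y < Im tau -> inH tau /\ y tau <> 0 /\ y tau <> 1).
  { intros tau Ht; unfold Y in Ht; pose proof (Rmax_l 0 Y0); pose proof (Rmax_r 0 Y0).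
    specialize (HY0 tau ltac:(lra)); split; [unfold inH; lra|split]; intros E; rewrite E in HY0;
    [rewrite Cmod_0 in HY0|rewrite Cmod_1 in HY0]; lra. }
  destruct (chart_limit w Y x Hw) as [T [g [m [Hm [Hg [g0 [ET Ex]]]]]]].
  - intros tau Ht; destruct (HY tau Ht) as [K1 [K2 K3]]; apply hol_inv; auto; apply (tf_hol _ _ _ _ _ H); auto.
  - intros tau Ht; unfold x; rewrite P; auto; apply HY; auto.
  - intros e' He'; destruct (L (/ e')) as [Y1 HY1]; exists (Rmax Y Y1); intros tau Ht.
    pose proof (Rmax_l Y Y1); pose proof (Rmax_r Y Y1).
    destruct (HY tau ltac:(lra)) as [K1 [K2 K3]]; unfold x; rewrite Cmod_inv by auto.
    rewrite <- (Rinv_inv e'); apply Rinv_lt_contravar; [|apply HY1; lra].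
    apply Rmult_lt_0_compat; [apply Rinv_0_lt_compat; auto|apply Cmod_gt_0; auto].
  - intros Y'; destruct (high_point (Rmax Y Y')) as [tau [Ht _]]; exists tau.
    pose proof (Rmax_l Y Y'); pose proof (Rmax_r Y Y'); split; [lra|].
    destruct (HY tau ltac:(lra)) as [K1 [K2 K3]]; unfold x; intros E.
    apply C1_nz; replace (RtoC 1) with (/ y tau * y tau)%C by (field; auto); rewrite E; ring.
  - set (A := cA g m); set (V := cU w T g m (al + be) (1 - al)).
    pose proof (cU_hol w T g m Hm Hg g0 ET (al + be) (1 - al)) as HV; fold V in HV.
    pose proof (cA_hol g m Hg g0) as HA; fold A in HA.
    pose proof (cT_hol T g m Hg ET) as HT.
    assert (Nw : RtoC w <> 0) by (apply RtoC_nz; lra).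
    set (S := fun q => ((1 - T q) * (tpi / w * (q * C_derive V q) - V q ^ 2) / (tpi / w * A q) ^ 2 + c)%C).
    assert (A0 : A 0 = INR m) by (apply cA0; auto).
    assert (V0 : V 0 = (tpi / w * (INR m * (1 - al - be)) / 2)%C).
    { unfold V; rewrite (cU0 w T g m Hw Hm g0 ET), RtoC_plus; field; auto. }
    assert (T0 : T 0 = 0) by (apply (cT0 T g m); auto).
    assert (NA0 : (tpi / w * A 0)%C <> 0).
    { rewrite A0; apply Cmult_neq_0; [apply tpi_w_nz; auto|apply INR_m_nz; auto]. }
    assert (CS : Ccont S 0).
    { pose proof (hol_cont _ _ (near_here _ _ HV)) as CV; pose proof (hol_cont _ _ (near_here _ _ HA)) as CA.
      pose proof (hol_cont _ _ (near_here _ _ HT)) as CT.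
      pose proof (hol_cont _ _ (near_here _ _ (near_derive_hol _ _ HV))) as CV'.
      apply Ccont_plus; [|apply Ccont_const].
      apply Ccont_div; [apply Ccont_mult; [apply Ccont_minus; auto; apply Ccont_const|]| |apply Cpow_nz; auto].
      - apply Ccont_minus; [|apply Ccont_pow; auto].
        apply Ccont_mult; [apply Ccont_const|apply Ccont_mult; auto; apply Ccont_id].
      - apply (Ccont_pow (fun q => tpi / w * A q)%C), Ccont_mult; auto; apply Ccont_const. }
    assert (S0 : S 0 = 0).
    { unfold S, c; rewrite T0, V0, A0; simpl; field; repeat split; auto using tpi_nz.
      apply INR_m_nz; auto. }
    destruct (qexp_near w _ Hw (near_and _ _ _ (Ccont_val S 0 0 CS S0 e He) HV)) as [Y1 K1].
    destruct (cusp_W w Y x T g m Hw Hm Hg g0 ET Ex (al + be) (1 - al)) as [Y2 K2].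
    destruct (cusp_hits w Y x T g m Hw Hm Hg g0 ET Ex (Rmax Y1 Y2)) as [d [Hd KH]].
    exists (/ d); intros v Hv.
    assert (Pd : 0 < / d) by (apply Rinv_0_lt_compat; auto).
    assert (Nv : v <> 0) by (intros E; rewrite E, Cmod_0 in Hv; lra).
    assert (Niv : (/ v)%C <> 0).
    { intros E; apply C1_nz; replace (RtoC 1) with (/ v * v)%C by (field; auto); rewrite E; ring. }
    destruct (KH (/ v)%C) as [tau [Ht [HtY Ev]]]; auto.
    { replace (/ v - 0)%C with (/ v)%C by ring; rewrite Cmod_inv by auto.
      rewrite <- (Rinv_inv d); apply Rinv_lt_contravar; auto.
      apply Rmult_lt_0_compat; auto; apply Cmod_gt_0; auto. }
    pose proof (Rmax_l Y1 Y2); pose proof (Rmax_r Y1 Y2).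
    destruct (K2 tau ltac:(lra)) as [E1 [N0 [N1 [NA [ED [ND EW]]]]]].
    destruct (K1 tau ltac:(lra)) as [BS HVq].
    destruct (HY tau HtY) as [Ht0 [Ny0 Ny1]].
    assert (Ev' : v = y tau).
    { unfold x in Ev; replace v with (/ / v)%C by (field; auto); rewrite <- Ev; field; auto. }
    rewrite Ev', ERf by (auto; split; auto).
    unfold Rat; fold c; rewrite (phi_chart w V); auto.
    + replace (_ + c)%C with (S (qexp w tau)).
      { left; replace (S (qexp w tau)) with (S (qexp w tau) - 0)%C by ring; auto. }
      assert (Dy : C_derive x tau = (- C_derive y tau / (y tau * y tau))%C).
      { apply Cd_C_derive, Cd_inv; auto; apply hol_Cd, (tf_hol _ _ _ _ _ H); auto. }
      assert (Dy' : C_derive y tau = (- (tpi / w * (T (qexp w tau) * A (qexp w tau))) * (y tau * y tau))%C).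
      { unfold A; rewrite <- ED, Dy; field; auto. }
      assert (Eq : T (qexp w tau) = (/ y tau)%C) by (rewrite <- E1; auto).
      unfold S, Qf; rewrite Dy', Eq.
      assert (N1' : (y tau - 1)%C <> 0) by (apply Cminus_eq_contra; auto).
      unfold A in *; simpl; field; repeat split; auto using tpi_nz.
    + generalize (near_and _ _ _ (upper_near tau Y2 ltac:(lra)) (upper_near tau Y HtY)); apply near_mono.
      intros z [Hz HzY]; destruct (HY z HzY) as [Hz0 [M0 M1]]; destruct (K2 z Hz) as [_ [_ [_ [_ [_ [_ EWz]]]]]].
      rewrite Eu by (auto; split; auto).
      unfold U0, V; rewrite <- EWz; unfold x; rewrite W_inv.
      * replace (2 - (al + be) - (1 - al)) with (1 - be) by ring; auto.
      * apply (y_near_hol G al be ups y H); auto.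
      * apply (tf_reg _ _ _ _ _ H); auto.
      * auto.
      * auto.
Qed.
End Limits.

Lemma U0_sym (G : mat2 -> Prop) (al be ups : R) (y : C -> C) (z : C) : tri_fun G al be ups y ->
  inH z -> gen y z -> U0 be al (fun v => 1 - y v)%C z = U0 al be y z.
Proof.
  intros H Hz Gz; unfold U0; rewrite W_one_minus; auto; try apply Gz.
  - apply (y_near_hol G al be ups y H); auto.
  - apply (tf_reg _ _ _ _ _ H); auto; apply Gz.
Qed.

Lemma gen_sym (y : C -> C) (z : C) : gen (fun v => 1 - y v)%C z <-> gen y z.
Proof.
  unfold gen; split; intros [A B]; split; intros E.
  - apply B; rewrite E; ring.
  - apply A; rewrite E; ring.
  - apply B; replace (y z) with (1 - (1 - y z))%C by ring; rewrite E; ring.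
  - apply A; replace (y z) with (1 - (1 - y z))%C by ring; rewrite E; ring.
Qed.

Lemma Rat_sym (G : mat2 -> Prop) (al be ups : R) (y u : C -> C) (z : C) : tri_fun G al be ups y ->
  inH z -> gen y z -> Rat be al (fun v => 1 - y v)%C u z = Rat al be y u z.
Proof.
  intros H Hz Gz; unfold Rat, Qf.
  assert (D : C_derive (fun v => 1 - y v)%C z = (- C_derive y z)%C).
  { apply Cd_C_derive; eapply Cd_eqn; [apply Cd_minus; [apply Cd_const|]|].
    - apply hol_Cd, (tf_hol _ _ _ _ _ H); auto.
    - ring. }
  rewrite D; destruct Gz as [N0 N1].
  assert (Ny : C_derive y z <> 0) by (apply (tf_reg _ _ _ _ _ H); auto).
  pose proof (one_minus_neq _ N1); assert ((y z - 1)%C <> 0) by (apply Cminus_eq_contra; auto).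
  assert ((1 - y z - 1)%C <> 0).
  { intros E; apply N0; replace (y z) with (- (1 - y z - 1))%C by ring; rewrite E; ring. }
  simpl; field; repeat split; auto.
Qed.

Theorem Rat_zero (G : mat2 -> Prop) (al be ups : R) (y u : C -> C) : tri_fun G al be ups y ->
  (forall a, inH a -> holomorphic_at u a) -> (forall a, inH a -> gen y a -> u a = U0 al be y a) ->
  forall z, inH z -> gen y z -> Rat al be y u z = 0.
Proof.
  intros H Hu Eu.
  destruct (Rat_descends G al be ups y H u Hu Eu) as [Rf [ER HR]].
  assert (Z0 : forall e, 0 < e -> near 0 (fun v => v <> 0 -> Cmod (v * Rf v)%C <= e)).
  { exact (Rf_at_zero G al be ups y u H Hu Eu Rf ER). }
  assert (Z1 : forall e, 0 < e -> near 1 (fun v => v <> 1 -> Cmod ((v - 1) * Rf v)%C <= e)).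
  { intros e He.
    pose proof (Rf_at_zero G be al ups (fun v => 1 - y v)%C u (tri_fun_sym _ _ _ _ _ H) Hu) as K.
    assert (K1 : forall a, inH a -> gen (fun v => 1 - y v)%C a -> u a = U0 be al (fun v => 1 - y v)%C a).
    { intros a Ha Ga; apply (proj1 (gen_sym y a)) in Ga; rewrite (U0_sym G al be ups y); auto. }
    specialize (K K1 (fun v => Rf (1 - v)%C)).
    assert (K2 : forall z, inH z -> gen (fun v => 1 - y v)%C z ->
        Rf (1 - (1 - y z))%C = Rat be al (fun v => 1 - y v)%C u z).
    { intros z Hz Gz; apply (proj1 (gen_sym y z)) in Gz; rewrite (Rat_sym G al be ups y) by auto.
      replace (1 - (1 - y z))%C with (y z) by ring; auto. }
    destruct (K K2 e He) as [d [Hd Kd]]; exists d; split; auto; intros v Hv Nv.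
    specialize (Kd (1 - v)%C); replace (1 - (1 - v))%C with v in Kd by ring.
    replace (1 - v - 0)%C with (- (v - 1))%C in Kd by ring; rewrite Cmod_opp in Kd.
    specialize (Kd Hv (one_minus_neq v Nv)).
    replace ((1 - v) * Rf v)%C with (- ((v - 1) * Rf v))%C in Kd by ring; rewrite Cmod_opp in Kd; auto. }
  assert (Nn : forall v, v <> RtoC 1 -> near v (fun z => z <> RtoC 1))
    by (intros v N; apply (Ccont_neq (fun z => z)); auto; apply Ccont_id).
  assert (Nz : forall v, v <> RtoC 0 -> near v (fun z => z <> RtoC 0))
    by (intros v N; apply (Ccont_neq (fun z => z)); auto; apply Ccont_id).
  destruct (removable Rf 0) as [l0 Hl0].
  { generalize (Nn 0 ltac:(intros E; symmetry in E; apply C1_nz; auto)); apply near_mono; intros; apply HR; auto. }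
  { intros e He; generalize (Z0 e He); apply near_mono; intros v Hv.
    destruct (Ceq_dec v 0) as [->|N].
    - replace ((0 - 0) * Rf 0)%C with (RtoC 0) by ring; rewrite Cmod_0; lra.
    - replace (v - 0)%C with v by ring; auto. }
  destruct (removable Rf 1) as [l1 Hl1].
  { generalize (Nz 1 C1_nz); apply near_mono; intros; apply HR; auto. }
  { intros e He; generalize (Z1 e He); apply near_mono; intros v Hv.
    destruct (Ceq_dec v 1) as [->|N]; auto.
    replace ((1 - 1) * Rf 1)%C with (RtoC 0) by ring; rewrite Cmod_0; lra. }
  set (F := fun v => if Ceq_dec v 0 then l0 else if Ceq_dec v 1 then l1 else Rf v).
  assert (HF : forall v, holomorphic_at F v).
  { intros v; destruct (Ceq_dec v 0) as [->|N0]; [|destruct (Ceq_dec v 1) as [->|N1]].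
    - apply (hol_ext_near _ _ _) with (2 := Hl0).
      generalize (Nn 0 ltac:(intros E; symmetry in E; apply C1_nz; auto)); apply near_mono; intros v Hv.
      unfold F; destruct (Ceq_dec v 0); auto; destruct (Ceq_dec v 1); [contradiction|auto].
    - apply (hol_ext_near _ _ _) with (2 := Hl1).
      generalize (Nz 1 C1_nz); apply near_mono; intros v Hv.
      unfold F; destruct (Ceq_dec v 0); [contradiction|]; destruct (Ceq_dec v 1); auto.
    - apply (hol_ext_near Rf); auto.
      generalize (near_and _ _ _ (Nn v N1) (Nz v N0)); apply near_mono; intros t [T1 T0].
      unfold F; destruct (Ceq_dec t 0); [contradiction|]; destruct (Ceq_dec t 1); [contradiction|auto]. }
  assert (F0 : forall v, F v = 0).
  { apply Liouville_zero; auto; intros e He.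
    destruct (Rf_at_infinity G al be ups y u H Eu Rf ER e He) as [B HB].
    exists (Rmax 1 B); intros v Hv; pose proof (Rmax_l 1 B); pose proof (Rmax_r 1 B).
    unfold F; destruct (Ceq_dec v 0) as [->|]; [rewrite Cmod_0 in Hv; lra|].
    destruct (Ceq_dec v 1) as [->|]; [rewrite Cmod_1 in Hv; lra|apply HB; lra]. }
  intros z Hz Gz; rewrite <- ER by auto; rewrite <- (F0 (y z)).
  unfold F; destruct (Ceq_dec (y z) 0) as [E|]; [destruct Gz; contradiction|].
  destruct (Ceq_dec (y z) 1) as [E|]; [destruct Gz; contradiction|auto].
Qed.

(** * Holomorphic roots *)

Definition zero_order (x : C -> C) (n : nat) (a : C) : Prop :=
  exists g, near a (holomorphic_at g) /\ g a <> 0 /\ near a (fun z => x z = ((z - a) ^ n * g z)%C).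

(** Induction on a list containing the zeros: dividing by [(z - a)^n] removes one of them and keeps
    the others of order [n]. Without zeros a logarithm exists. *)
Lemma root_finite (n : nat) (U : C -> Prop) : (0 < n)%nat -> convex U -> opn U ->
  forall (l : list C) (x : C -> C), (forall z, U z -> holomorphic_at x z) ->
  (forall a, U a -> x a = 0 -> In a l /\ zero_order x n a) ->
  exists g, (forall z, U z -> holomorphic_at g z) /\ forall z, U z -> (g z ^ n)%C = x z.
Proof.
  intros Hn HU Uo; induction l as [|a l IH]; intros x Hx Hz.
  - destruct (log_exists U x HU Uo Hx) as [L HL].
    { intros z Uz E; destruct (Hz z Uz E) as [[] _]. }
    assert (Nn : RtoC (INR n) <> 0) by (apply RtoC_nz, not_0_INR; lia).
    exists (fun z => Cexp (L z / INR n)); split; intros z Uz.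
    + apply hol_exp, hol_div; [eapply Cd_hol, HL, Uz|apply hol_const|auto].
    + rewrite <- Cexp_nat; replace (INR n * (L z / INR n))%C with (L z) by (field; auto).
      apply HL, Uz.
  - destruct (classic (U a /\ x a = 0)) as [[Ua Xa]|N].
    2:{ apply IH; auto; intros b Ub Xb; destruct (Hz b Ub Xb) as [[<-|I] O]; auto.
        exfalso; apply N; auto. }
    destruct (Hz a Ua Xa) as [_ [g [Hg [g0 Eg]]]].
    set (x1 := pdiv x a (g a) n).
    assert (E1 : near a (fun z => x1 z = g z)).
    { revert Eg; apply near_mono; intros z Ez; unfold x1, pdiv.
      destruct (Ceq_dec z a) as [->|Nz]; auto; rewrite Ez.
      assert ((z - a)%C <> 0) by (apply Cminus_eq_contra; auto); field; apply Cpow_nz; auto. }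
    assert (Ex : forall z, x z = ((z - a) ^ n * x1 z)%C).
    { intros z; unfold x1, pdiv; destruct (Ceq_dec z a) as [->|Nz].
      - replace (a - a)%C with (RtoC 0) by ring; destruct n; [lia|].
        rewrite pow_0_S, Xa; ring.
      - assert ((z - a)%C <> 0) by (apply Cminus_eq_contra; auto); field; apply Cpow_nz; auto. }
    destruct (IH x1) as [G [HG EG]].
    + intros z Uz; destruct (Ceq_dec z a) as [->|Nz]; [|apply pdiv_off; auto].
      apply (hol_ext_near g); [|apply (near_here _ _ Hg)].
      revert E1; apply near_mono; intros; auto.
    + intros b Ub Xb.
      assert (Nb : b <> a).
      { intros ->; apply g0; rewrite <- (near_here _ _ E1); auto. }
      destruct (Hz b Ub) as [I [h [Hh [h0 Eh]]]]; [rewrite Ex, Xb; ring|].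
      split; [destruct I; [congruence|auto]|].
      assert (Nba : near b (fun z => z <> a)) by (apply (Ccont_neq (fun z => z)); auto; apply Ccont_id).
      assert (Hs : forall z, z <> a -> ((z - a) ^ n)%C <> 0)
        by (intros z Nz; apply Cpow_nz, Cminus_eq_contra; auto).
      exists (fun z => h z / (z - a) ^ n)%C; split; [|split].
      * generalize (near_and _ _ _ Hh Nba); apply near_mono; intros z [K1 K2].
        apply hol_div; auto; apply (hol_pow (fun z => z - a)%C), hol_minus; [apply hol_id|apply hol_const].
      * intros E; apply h0; replace (h b) with (h b / (b - a) ^ n * (b - a) ^ n)%C by (field; auto).
        rewrite E; ring.
      * generalize (near_and _ _ _ Eh Nba); apply near_mono; intros z [K1 K2].
        replace (x1 z) with (x z / (z - a) ^ n)%C by (rewrite Ex; field; auto).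
        rewrite K1; field; auto.
    + exists (fun z => (z - a) * G z)%C; split; intros z Uz.
      * apply hol_mult; auto; apply hol_minus; [apply hol_id|apply hol_const].
      * rewrite Cpow_mult_l, EG, Ex; auto.
Qed.

(** An exhaustion of the upper half plane by open convex sets with compact closure in it: convexity
    serves the logarithm, compactness the finiteness of zeros. *)
Definition rect (N : nat) (z : C) : Prop :=
  - (INR N + 1) < Re z < INR N + 1 /\ invn N < Im z < INR N + 1.

Lemma rect_convex (N : nat) : convex (rect N).
Proof.
  intros a b [A1 A2] [B1 B2] s Hs.
  assert (L : forall lo hi p q, lo < p < hi -> lo < q < hi -> lo < p + s * (q - p) < hi).
  { intros lo hi p q Hp Hq; destruct (Rle_dec p q).
    - split; nra.
    - assert (0 <= s * (p - q) <= p - q) by nra; lra. }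
  unfold rect, seg, Cminus; rewrite re_plus, im_plus, re_scal_l, im_scal_l, re_plus, im_plus, re_opp, im_opp.
  split; apply L; auto.
Qed.

Lemma rect_opn (N : nat) : opn (rect N).
Proof.
  intros z [A B]; set (d := Rmin (Rmin (Re z + (INR N + 1)) (INR N + 1 - Re z)) (Rmin (Im z - invn N) (INR N + 1 - Im z))).
  assert (Hd : 0 < d) by (unfold d; repeat apply Rmin_pos; lra).
  exists d; split; auto; intros w Hw.
  pose proof (Cmod_Re (w - z)) as K1; pose proof (Cmod_Im (w - z)) as K2.
  unfold Cminus in K1, K2; rewrite re_plus, re_opp in K1; rewrite im_plus, im_opp in K2.
  fold (Cminus w z) in K1, K2.
  apply Rabs_le_between in K1, K2.
  assert (d <= Re z + (INR N + 1) /\ d <= INR N + 1 - Re z /\ d <= Im z - invn N /\ d <= INR N + 1 - Im z).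
  { unfold d; pose proof (Rmin_l (Rmin (Re z + (INR N + 1)) (INR N + 1 - Re z)) (Rmin (Im z - invn N) (INR N + 1 - Im z)));
    pose proof (Rmin_r (Rmin (Re z + (INR N + 1)) (INR N + 1 - Re z)) (Rmin (Im z - invn N) (INR N + 1 - Im z))).
    pose proof (Rmin_l (Re z + (INR N + 1)) (INR N + 1 - Re z)); pose proof (Rmin_r (Re z + (INR N + 1)) (INR N + 1 - Re z)).
    pose proof (Rmin_l (Im z - invn N) (INR N + 1 - Im z)); pose proof (Rmin_r (Im z - invn N) (INR N + 1 - Im z)). lra. }
  unfold rect; lra.
Qed.

Lemma rect_inH (N : nat) (z : C) : rect N z -> inH z.
Proof. intros [_ B]; unfold inH; pose proof (invn_pos N); lra. Qed.

Lemma rect_mono (M N : nat) (z : C) : (M <= N)%nat -> rect M z -> rect N z.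
Proof.
  intros L [A B]; pose proof (le_INR _ _ L); pose proof (pos_INR M).
  assert (invn N <= invn M) by (apply Rinv_le_contravar; lra).
  unfold rect; lra.
Qed.

Lemma rect_exhaust (z : C) : inH z -> exists N, rect N z.
Proof.
  intros Hz; destruct (INR_unbounded (Rabs (Re z) + Rabs (Im z))) as [N1 H1].
  destruct (invn_small (Im z) Hz) as [N2 H2].
  exists (max N1 N2); specialize (H2 (max N1 N2) ltac:(lia)).
  assert (INR N1 <= INR (max N1 N2)) by (apply le_INR; lia).
  pose proof (Rabs_pos (Re z)); pose proof (Rabs_pos (Im z)); pose proof (Rle_abs (Im z)).
  assert (K : Rabs (Re z) < INR (max N1 N2) + 1) by lra; apply Rabs_def2 in K.
  unfold rect; lra.
Qed.

Lemma rect_zeros_finite (x : C -> C) (N : nat) :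
  (forall a, inH a -> near a (fun z => z <> a -> x z <> 0)) ->
  exists l, forall a, rect N a -> x a = 0 -> In a l.
Proof.
  intros Hx.
  set (pt := fun t : Compactness.Tn 2 R => (fst t, fst (snd t)) : C).
  (* The factor 2 compares [Cmod] with the coordinatewise distance of the covering lemma. Each
     covering ball then contains at most its own centre as a zero. *)
  assert (Hd : forall t, exists d : posreal, inH (pt t) ->
     forall z, Cmod (z - pt t)%C < 2 * d -> z <> pt t -> x z <> 0).
  { intros t; destruct (classic (inH (pt t))) as [Ht|Ht].
    - destruct (Hx _ Ht) as [d [Pd Kd]]; assert (P2 : 0 < d / 2) by lra.
      exists (mkposreal _ P2); intros _ z Hz; apply Kd; simpl in Hz; lra.
    - exists (mkposreal 1 Rlt_0_1); intros; contradiction. }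
  set (delta := fun t => proj1_sig (constructive_indefinite_description _ (Hd t))).
  assert (Dd : forall t, inH (pt t) -> forall z, Cmod (z - pt t)%C < 2 * delta t -> z <> pt t -> x z <> 0).
  { intros t; unfold delta; exact (proj2_sig (constructive_indefinite_description _ (Hd t))). }
  pose proof (NNPP _ (compactness_list 2 (- (INR N + 1), (invn N, tt)) (INR N + 1, (INR N + 1, tt)) delta)) as [l Hl].
  exists (map pt l); intros a [A B] Xa.
  destruct (Hl (Re a, (Im a, tt))) as [t [It [Bt Ct]]].
  - simpl; repeat split; lra.
  - destruct t as [t1 [t2 []]]; simpl in Bt, Ct; destruct Bt as [_ [Bt _]], Ct as [C1 [C2 _]].
    apply in_map_iff; exists (t1, (t2, tt)); split; auto; unfold pt; simpl.
    apply NNPP; intros Ne; apply (Dd (t1, (t2, tt))) with (z := a); auto.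
    + unfold pt, inH; simpl; pose proof (invn_pos N); lra.
    + unfold pt; simpl fst; simpl snd.
      replace (a - (t1, t2))%C with (Re a - t1, Im a - t2) by (destruct a; reflexivity).
      eapply Rle_lt_trans; [apply Cmod_le_sum|]; lra.
Qed.

(** Where [x] is nonzero both roots have logarithmic derivative [x' / (n * x)], so their quotient is
    constant near [z0]; the identity theorem passes over the zeros of [x]. *)
Lemma root_unique (n : nat) (U : C -> Prop) (x f1 f2 : C -> C) (z0 z : C) : (0 < n)%nat ->
  convex U -> opn U -> (forall z, U z -> holomorphic_at f1 z) -> (forall z, U z -> holomorphic_at f2 z) ->
  (forall z, U z -> (f1 z ^ n)%C = x z) -> (forall z, U z -> (f2 z ^ n)%C = x z) ->
  U z0 -> x z0 <> 0 -> f1 z0 = f2 z0 -> U z -> f1 z = f2 z.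
Proof.
  intros Hn HU Uo H1 H2 E1 E2 U0 X0 E0 Uz.
  assert (Nn : RtoC (INR n) <> 0) by (apply RtoC_nz, not_0_INR; lia).
  assert (Nz : forall f z, (f ^ n)%C = x z -> x z <> 0 -> f <> 0).
  { intros f v Ef Nx ->; apply Nx; rewrite <- Ef; destruct n; [lia|apply pow_0_S]. }
  assert (Hx : forall z, U z -> holomorphic_at x z).
  { intros v Uv; apply (hol_ext_near (fun z => f1 z ^ n)%C); [|apply hol_pow; auto].
    generalize (Uo v Uv); apply near_mono; auto. }
  assert (Dl : forall f, (forall z, U z -> holomorphic_at f z) -> (forall z, U z -> (f z ^ n)%C = x z) ->
     forall z, U z -> x z <> 0 -> Cd f z (C_derive x z * f z / (INR n * x z))%C).
  { intros f Hf Ef v Uv Nx; pose proof (proj1 (hol_Cd _ _) (Hf v Uv)) as Df.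
    assert (Ed : C_derive x v = (INR n * f v ^ pred n * C_derive f v)%C).
    { symmetry; apply (Cd_unique (fun z => f z ^ n)%C v); [apply Cd_pow; auto|].
      apply (Cd_ext_near x); [|apply hol_Cd; auto].
      generalize (Uo v Uv); apply near_mono; intros; symmetry; auto. }
    eapply Cd_eqn; [exact Df|]; rewrite Ed, <- (Ef v Uv).
    pose proof (Nz (f v) v (Ef v Uv) Nx) as Nf.
    destruct n as [|n']; [lia|]; simpl pred; rewrite Cpow_S; field; repeat split; auto; apply Cpow_nz; auto. }
  apply Ceq_minus, (identity_theorem U (fun z => f1 z - f2 z)%C z0 z HU Uo); auto.
  { intros v Uv; apply hol_minus; auto. }
  destruct (near_and _ _ _ (Uo z0 U0) (Ccont_neq x z0 0 (hol_cont _ _ (Hx z0 U0)) X0)) as [d [Hd K]].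
  exists d; split; auto; intros v Hv; destruct (K v Hv) as [Uv Xv].
  assert (Q : (f1 v / f2 v)%C = (f1 z0 / f2 z0)%C).
  { apply (Cd_zero_const (Cdisc z0 d) (fun z => f1 z / f2 z)%C); auto using Cdisc_convex.
    - intros t Ht; destruct (K t Ht) as [Ut Xt].
      pose proof (Nz (f2 t) t (E2 t Ut) Xt) as N2.
      eapply Cd_eqn; [apply Cd_div; [apply Dl; eauto|apply Dl; eauto|auto]|]; field; auto.
    - unfold Cdisc; rewrite Cmod_m_0; auto. }
  pose proof (Nz (f2 v) v (E2 v Uv) Xv) as N2; pose proof (Nz (f2 z0) z0 (E2 z0 U0) X0) as N20.
  replace (f1 v) with (f1 v / f2 v * f2 v)%C by (field; auto); rewrite Q, E0; field; auto.
Qed.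

(** The roots on the rectangles are normalised to one value [r0] at a common point [z0] where [x] is
    nonzero. By uniqueness they agree on smaller rectangles and glue. *)
Theorem root_H (n : nat) (x : C -> C) : (0 < n)%nat -> (forall z, inH z -> holomorphic_at x z) ->
  (forall a, inH a -> x a = 0 -> zero_order x n a) ->
  exists g, (forall z, inH z -> holomorphic_at g z) /\ forall z, inH z -> (g z ^ n)%C = x z.
Proof.
  intros Hn Hx Hz.
  assert (Iso : forall a, inH a -> near a (fun z => z <> a -> x z <> 0)).
  { intros a Ha; destruct (Ceq_dec (x a) 0) as [E|N].
    - destruct (Hz a Ha E) as [g [Hg [g0 Eg]]].
      generalize (near_and _ _ _ Eg (Ccont_neq g a 0 (hol_cont _ _ (near_here _ _ Hg)) g0)); apply near_mono.
      intros z [K1 K2] Nz; rewrite K1; apply Cmult_neq_0; auto; apply Cpow_nz, Cminus_eq_contra; auto.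
    - generalize (Ccont_neq x a 0 (hol_cont _ _ (Hx a Ha)) N); apply near_mono; auto. }
  assert (Hi : inH Ci) by (unfold inH; simpl; lra).
  destruct (near_punctured _ _ (near_and _ _ _ (inH_near Ci Hi) (Iso Ci Hi))) as [z0 [N0 [Hz0 X0']]].
  pose proof (X0' N0) as X0.
  destruct (rect_exhaust z0 Hz0) as [N1 HN1].
  assert (R0 : forall N, exists g, (forall z, rect N z -> holomorphic_at g z) /\
     forall z, rect N z -> (g z ^ n)%C = x z).
  { intros N; destruct (rect_zeros_finite x N Iso) as [l Hl].
    apply (root_finite n (rect N) Hn (rect_convex N) (rect_opn N) l x).
    - intros z Hr; apply Hx, (rect_inH N); auto.
    - intros a Ra Xa; split; auto; apply Hz; auto; apply (rect_inH N); auto. }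
  destruct (R0 N1) as [gb [_ Eb]]; set (r0 := gb z0).
  assert (Er0 : (r0 ^ n)%C = x z0) by (apply Eb; auto).
  assert (R1 : forall N, exists g, (N1 <= N)%nat -> (forall z, rect N z -> holomorphic_at g z) /\
     (forall z, rect N z -> (g z ^ n)%C = x z) /\ g z0 = r0).
  { intros N; destruct (R0 N) as [g [Hg Eg]].
    exists (fun z => g z * (r0 / g z0))%C; intros L.
    assert (Rz0 : rect N z0) by (apply (rect_mono N1 N); auto).
    assert (Ng : g z0 <> 0).
    { intros E; apply X0; rewrite <- (Eg z0 Rz0), E; destruct n; [lia|apply pow_0_S]. }
    split; [|split].
    - intros z Rz; apply hol_mult; auto; apply hol_const.
    - intros z Rz; unfold Cdiv; rewrite !Cpow_mult_l, Cpow_inv by auto.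
      rewrite (Eg z Rz), (Eg z0 Rz0), Er0; field; auto.
    - field; auto. }
  destruct (choice_fun _ _ R1) as [gs Hgs].
  assert (Comp : forall M N z, (N1 <= M)%nat -> (M <= N)%nat -> rect M z -> gs M z = gs N z).
  { intros M N z L1 L2 Rz; destruct (Hgs M L1) as [A1 [A2 A3]]; destruct (Hgs N ltac:(lia)) as [B1 [B2 B3]].
    apply (root_unique n (rect M) x (gs M) (gs N) z0 z); auto using rect_convex, rect_opn.
    - intros v Rv; apply B1, (rect_mono M); auto.
    - intros v Rv; apply B2, (rect_mono M); auto.
    - apply (rect_mono N1); auto.
    - congruence. }
  set (idx := fun z => epsilon (inhabits O) (fun N => (N1 <= N)%nat /\ rect N z)).
  assert (Hidx : forall z, inH z -> (N1 <= idx z)%nat /\ rect (idx z) z).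
  { intros z Hh; unfold idx; apply (epsilon_spec (inhabits O) (fun N => (N1 <= N)%nat /\ rect N z)).
    destruct (rect_exhaust z Hh) as [N HN]; exists (max N1 N); split; [lia|].
    apply (rect_mono N); auto; lia. }
  assert (Eg : forall N z, (N1 <= N)%nat -> rect N z -> gs (idx z) z = gs N z).
  { intros N z L Rz; destruct (Hidx z (rect_inH N z Rz)) as [L' R'].
    destruct (Nat.le_ge_cases (idx z) N); [apply Comp; auto|symmetry; apply Comp; auto]. }
  exists (fun z => gs (idx z) z); split; intros z Hh; destruct (Hidx z Hh) as [L R'].
  - apply (hol_ext_near (gs (idx z))).
    + generalize (rect_opn (idx z) z R'); apply near_mono; intros v Rv; symmetry; apply Eg; auto.
    + apply (Hgs (idx z)); auto.
  - apply (Hgs (idx z)); auto.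
Qed.

(** * The hypergeometric equation *)

Definition psum (c : nat -> C) (v : C) (n : nat) : C := csum (fun k => c k * v ^ k)%C n.

Lemma psum_S (c : nat -> C) (v : C) (n : nat) : psum c v (S n) = (psum c v n + c n * v ^ n)%C.
Proof. reflexivity. Qed.

(** Asymptotic expansion at 0 to every order, with no convergence required. It determines its
    coefficients and is stable under the operations occurring in a differential equation, so
    recursions can be read off termwise. *)
Definition expands (f : C -> C) (c : nat -> C) : Prop :=
  forall n, exists K, 0 <= K /\ near 0 (fun v => Cmod (f v - psum c v n)%C <= K * Cmod v ^ n).

Lemma expands_unique (f : C -> C) (c c' : nat -> C) : expands f c -> expands f c' -> forall n, c n = c' n.
Proof.
  intros E E' n; induction n as [n IH] using lt_wf_ind.
  destruct (E (S n)) as [K [HK N1]]; destruct (E' (S n)) as [K' [HK' N2]].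
  apply Ceq_minus, Cmod_small_0; intros e He.
  assert (Small : near 0 (fun v => Cmod v < e / (K + K' + 1))).
  { exists (e / (K + K' + 1)); split; [apply Rdiv_lt_0_compat; lra|].
    intros v Hv; replace v with (v - 0)%C by ring; auto. }
  destruct (near_punctured _ _ (near_and _ _ _ N1 (near_and _ _ _ N2 Small))) as [v [Nv [B1 [B2 B3]]]].
  assert (Pv : 0 < Cmod v) by (apply Cmod_gt_0; auto).
  assert (Eq : psum c v n = psum c' v n).
  { clear - IH; unfold psum; induction n as [|n IHn]; [reflexivity|].
    simpl; rewrite IHn, IH by (intros; try apply IH; lia); auto. }
  rewrite psum_S in B1, B2.
  assert (B : Cmod ((c n - c' n) * v ^ n)%C <= (K + K') * Cmod v ^ S n).
  { replace ((c n - c' n) * v ^ n)%C with ((f v - (psum c' v n + c' n * v ^ n)) - (f v - (psum c v n + c n * v ^ n)))%C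
      by (rewrite Eq; ring).
    eapply Rle_trans; [apply Cmod_triangle|]; rewrite Cmod_opp; lra. }
  rewrite Cmod_mult, Cmod_pow in B; simpl pow in B.
  assert (Pn : 0 < Cmod v ^ n) by (apply pow_lt; auto).
  assert (B' : Cmod (c n - c' n)%C <= (K + K') * Cmod v).
  { apply (Rmult_le_reg_r (Cmod v ^ n)); auto; lra. }
  apply Rlt_div_r in B3; [|lra].
  eapply Rle_trans; [exact B'|]; lra.
Qed.

Lemma expands_ext (f g : C -> C) (c : nat -> C) : near 0 (fun v => f v = g v) -> expands f c -> expands g c.
Proof.
  intros H E n; destruct (E n) as [K [HK N]]; exists K; split; auto.
  generalize (near_and _ _ _ H N); apply near_mono; intros v [<- B]; auto.
Qed.

Lemma expands_plus (f g : C -> C) (c d : nat -> C) : expands f c -> expands g d ->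
  expands (fun v => f v + g v)%C (fun n => c n + d n)%C.
Proof.
  intros E F n; destruct (E n) as [K [HK N]], (F n) as [L [HL M]]; exists (K + L); split; [lra|].
  generalize (near_and _ _ _ N M); apply near_mono; intros v [B1 B2].
  assert (Q : psum (fun n => c n + d n)%C v n = (psum c v n + psum d v n)%C).
  { clear; unfold psum; induction n as [|n IH]; simpl; [ring|rewrite IH; ring]. }
  rewrite Q; replace (f v + g v - (psum c v n + psum d v n))%C with ((f v - psum c v n) + (g v - psum d v n))%C by ring.
  eapply Rle_trans; [apply Cmod_triangle|]; lra.
Qed.

Lemma expands_scal (k : C) (f : C -> C) (c : nat -> C) : expands f c ->
  expands (fun v => k * f v)%C (fun n => k * c n)%C.
Proof.
  intros E n; destruct (E n) as [K [HK N]]; exists (Cmod k * K); split.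
  - apply Rmult_le_pos; auto using Cmod_ge_0.
  - revert N; apply near_mono; intros v B.
    assert (Q : psum (fun n => k * c n)%C v n = (k * psum c v n)%C).
    { clear; unfold psum; induction n as [|n IH]; simpl; [ring|rewrite IH; ring]. }
    rewrite Q; replace (k * f v - k * psum c v n)%C with (k * (f v - psum c v n))%C by ring.
    rewrite Cmod_mult, Rmult_assoc; apply Rmult_le_compat_l; auto using Cmod_ge_0.
Qed.

Definition shift (c : nat -> C) (n : nat) : C := match n with O => RtoC 0 | S k => c k end.

Lemma expands_shift (f : C -> C) (c : nat -> C) : expands f c -> expands (fun v => v * f v)%C (shift c).
Proof.
  intros E n; assert (Q : forall v m, psum (shift c) v (S m) = (v * psum c v m)%C).
  { intros v m; induction m as [|m IH]; [unfold psum; simpl; ring|].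
    rewrite psum_S, IH, psum_S; simpl; ring. }
  destruct n as [|n].
  - destruct (E O) as [K [HK N]]; exists K; split; auto.
    assert (S1 : near 0 (fun v => Cmod v < 1)).
    { exists 1; split; [lra|]; intros v Hv; replace v with (v - 0)%C by ring; auto. }
    generalize (near_and _ _ _ N S1); apply near_mono; intros v [B1 B2].
    unfold psum in *; simpl in *; replace (v * f v - 0)%C with (v * (f v - 0))%C by ring.
    rewrite Cmod_mult; pose proof (Cmod_ge_0 v); pose proof (Cmod_ge_0 (f v - 0)%C); nra.
  - destruct (E n) as [K [HK N]]; exists K; split; auto; revert N; apply near_mono; intros v B.
    rewrite Q; replace (v * f v - v * psum c v n)%C with (v * (f v - psum c v n))%C by ring.
    rewrite Cmod_mult; simpl pow; replace (K * (Cmod v * Cmod v ^ n)) with (Cmod v * (K * Cmod v ^ n)) by ring.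
    apply Rmult_le_compat_l; auto using Cmod_ge_0.
Qed.

Lemma Cd_psum (c : nat -> C) (n : nat) (v : C) :
  Cd (fun v => psum c v (S n)) v (psum (fun k => INR (S k) * c (S k))%C v n).
Proof.
  induction n as [|n IH].
  - apply (Cd_ext (fun _ => c O)); [intros; unfold psum; simpl; ring|apply Cd_const].
  - rewrite psum_S; apply (Cd_ext (fun v => psum c v (S n) + c (S n) * v ^ S n)%C); [reflexivity|].
    apply Cd_plus; auto; eapply Cd_eqn.
    + apply Cd_mult; [apply Cd_const|apply (Cd_pow (fun v => v)), Cd_id].
    + cbv beta; simpl pred; ring.
Qed.

(** On the circle of radius [|v|] about [v] the remainder after [n + 1] terms is of order
    [|v|^(n+1)]; the Cauchy estimate costs one power. The factor [2^(n+1)] arises because this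
    circle reaches out to [2 * |v|]. *)
Lemma expands_derive (f : C -> C) (c : nat -> C) : near 0 (holomorphic_at f) -> expands f c ->
  expands (C_derive f) (fun n => INR (S n) * c (S n))%C.
Proof.
  intros Hf E n; destruct (E (S n)) as [K [HK N]].
  exists (K * 2 ^ S n); split; [apply Rmult_le_pos; auto; apply pow_le; lra|].
  set (h := fun v => (f v - psum c v (S n))%C).
  assert (Pd : forall v, holomorphic_at (fun v => psum c v (S n)) v) by (intros; eapply Cd_hol, Cd_psum).
  destruct (near_and _ _ _ Hf N) as [d [Hd Kd]].
  assert (Dh : forall v, holomorphic_at f v ->
     C_derive h v = (C_derive f v - psum (fun k => INR (S k) * c (S k))%C v n)%C).
  { intros v Hv; apply Cd_C_derive, Cd_minus; [apply hol_Cd; auto|apply Cd_psum]. }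
  assert (Off : forall v : C, v <> 0 -> Cmod v < d / 3 ->
     Cmod (C_derive f v - psum (fun k => INR (S k) * c (S k)) v n)%C <= K * 2 ^ S n * Cmod v ^ n).
  { intros v Nv Hv; set (t := Cmod v) in *; assert (Pt : 0 < t) by (apply Cmod_gt_0; auto).
    assert (In : forall w, Cmod (w - v)%C < 2 * t -> Cmod (w - 0)%C < d).
    { intros w Hw; pose proof (Cmod_tri w v 0) as T.
      replace (v - 0)%C with v in T by ring; fold t in T; lra. }
    rewrite <- Dh by (apply Kd, In; rewrite Cmod_m_0; lra).
    apply Rle_trans with (K * (2 * t) ^ S n / t).
    - apply (Cauchy_estimate h v (2 * t) t); [lra| |].
      + intros w Hw; apply hol_minus; [apply Kd, In, Hw|auto].
      + intros w Hw; eapply Rle_trans; [apply Kd, In; lra|].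
        apply Rmult_le_compat_l; auto; apply pow_incr; split; [apply Cmod_ge_0|].
        pose proof (Cmod_tri_inv w v); fold t in H; lra.
    - apply Req_le; rewrite Rpow_mult_distr; simpl; field; lra. }
  exists (d / 3); split; [lra|]; intros v Hv; replace (v - 0)%C with v in Hv by ring.
  (* The circle degenerates at [v = 0]. There the order 0 bound follows by continuity of the
     derivative, and for higher orders the derivative equals the leading coefficient exactly. *)
  destruct (Ceq_dec v 0) as [->|Nv]; [|apply Off; auto].
  assert (Hf' : holomorphic_at (C_derive f) 0) by (apply derive_hol; auto).
  destruct n as [|n].
  - change (psum (fun k => INR (S k) * c (S k))%C 0 0) with (RtoC 0).
    change (2 ^ 1) with (2 * 1); change (Cmod 0 ^ 0) with 1.
    apply Rnot_lt_le; intros Lt.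
    assert (C0 : Ccont (C_derive f) 0) by (apply hol_cont; auto).
    assert (Ep : 0 < Cmod (C_derive f 0 - 0)%C - K * 2) by lra.
    destruct (C0 _ Ep) as [d' [Hd' K']].
    destruct (near_punctured 0 (fun v => Cmod (v - 0)%C < Rmin d' (d / 3))) as [v [Nv Hv']].
    { exists (Rmin d' (d / 3)); split; [apply Rmin_pos; lra|auto]. }
    pose proof (Rmin_l d' (d / 3)); pose proof (Rmin_r d' (d / 3)).
    specialize (K' v ltac:(lra)).
    assert (Hv3 : Cmod v < d / 3) by (replace v with (v - 0)%C by ring; lra).
    specialize (Off v Nv Hv3).
    change (psum (fun k => INR (S k) * c (S k))%C v 0) with (RtoC 0) in Off.
    change (2 ^ 1) with (2 * 1) in Off; change (Cmod v ^ 0) with 1 in Off.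
    pose proof (Cmod_tri_inv (C_derive f 0 - 0)%C (C_derive f v - 0)%C) as T.
    replace (C_derive f 0 - 0 - (C_derive f v - 0))%C with (- (C_derive f v - C_derive f 0))%C in T by ring.
    rewrite Cmod_opp in T; lra.
  - assert (c1 : C_derive f 0 = c 1%nat).
    { destruct (E 2%nat) as [K2 [HK2 N2]].
      apply Cd_C_derive, Cd_spec; intros e He.
      assert (f0 : f 0 = c O).
      { pose proof (near_here _ _ N2) as B; unfold psum in B; simpl in B; rewrite Cmod_0 in B.
        apply Ceq_minus, Cmod_eq_0, Rle_antisym; [|apply Cmod_ge_0].
        replace (f 0 - c O)%C with (f 0 - (0 + c O * 1 + c 1%nat * (0 * 1)))%C by ring; lra. }
      assert (Sm : near 0 (fun v => Cmod v < e / (K2 + 1))).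
      { exists (e / (K2 + 1)); split; [apply Rdiv_lt_0_compat; lra|].
        intros v Hv'; replace v with (v - 0)%C by ring; auto. }
      generalize (near_and _ _ _ N2 Sm); apply near_mono; intros v [B1 B2].
      unfold psum in B1; simpl in B1; rewrite f0; replace (v - 0)%C with v by ring.
      replace (f v - c O - c 1%nat * v)%C with (f v - (0 + c O * 1 + c 1%nat * (v * 1)))%C by ring.
      eapply Rle_trans; [exact B1|].
      apply Rlt_div_r in B2; [|lra]; pose proof (Cmod_ge_0 v); nra. }
    assert (P0 : forall (b : nat -> C) m, psum b 0 (S m) = b O).
    { intros b m; induction m as [|m IH]; [unfold psum; simpl; ring|].
      rewrite psum_S, IH, pow_0_S; ring. }
    rewrite P0, c1; simpl INR; replace (c 1%nat - 1 * c 1%nat)%C with (RtoC 0) by ring.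
    rewrite Cmod_0; apply Rmult_le_pos; [apply Rmult_le_pos; auto; apply pow_le; lra|apply pow_le; lra].
Qed.

Lemma expands_zero : expands (fun _ => RtoC 0) (fun _ => RtoC 0).
Proof.
  intros n; exists 0; split; [lra|]; apply near_all; intros v.
  assert (Q : psum (fun _ => RtoC 0) v n = 0).
  { unfold psum; induction n as [|n IH]; simpl; [auto|rewrite IH; ring]. }
  rewrite Q; replace (0 - 0)%C with (RtoC 0) by ring; rewrite Cmod_0; lra.
Qed.

Section Hypergeometric.
Variables (a b : R) (f : C -> C).
Hypotheses (Hf : near 0 (holomorphic_at f)) (f0 : f 0 = 1)
  (Ode : near 0 (fun v => (v * (1 - v) * C_derive (C_derive f) v
     + (1 - (a + b + 1) * v) * C_derive f v - a * b * f v)%C = 0)).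

Lemma hyper_rec (c : nat -> C) : expands f c -> forall n,
  (INR (S n) * INR (S n) * c (S n))%C = ((INR n + a) * (INR n + b) * c n)%C.
Proof.
  intros E n.
  pose proof (expands_derive f c Hf E) as E1.
  pose proof (expands_derive _ _ (near_derive_hol _ _ Hf) E1) as E2.
  set (c1 := fun n => (INR (S n) * c (S n))%C) in *.
  set (c2 := fun n => (INR (S n) * c1 (S n))%C) in *.
  pose proof (expands_plus _ _ _ _
    (expands_plus _ _ _ _ (expands_shift _ _ E2) (expands_scal (- (1)) _ _ (expands_shift _ _ (expands_shift _ _ E2))))
    (expands_plus _ _ _ _ E1 (expands_plus _ _ _ _ (expands_scal (- (a + b + 1)) _ _ (expands_shift _ _ E1))
       (expands_scal (- (a * b)) _ _ E)))) as K.
  assert (Z : expands (fun _ => RtoC 0)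
    (fun n => shift c2 n + - (1) * shift (shift c2) n + (c1 n + (- (a + b + 1) * shift c1 n + - (a * b) * c n)))%C).
  { eapply expands_ext; [|exact K]; revert Ode; apply near_mono; intros v Hv; rewrite <- Hv; ring. }
  pose proof (expands_unique _ _ _ Z expands_zero n) as R0; simpl in R0.
  replace (INR (S n) * INR (S n) * c (S n))%C with
    (INR (S n) * INR (S n) * c (S n) - (shift c2 n + - (1) * shift (shift c2) n + (c1 n + (- (a + b + 1) * shift c1 n + - (a * b) * c n))))%C
    by (rewrite R0; ring).
  unfold c2, c1; destruct n as [|[|n]]; cbv [shift];
    repeat rewrite S_INR; repeat rewrite RtoC_plus; change (INR 0) with 0; ring.
Qed.

Lemma pochhammer_one (n : nat) : pochhammer 1 n = INR (Factorial.fact n).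
Proof.
  induction n as [|n IH]; [simpl; auto|].
  change (Factorial.fact (S n)) with (S n * Factorial.fact n)%nat; rewrite mult_INR, S_INR.
  simpl; rewrite IH; ring.
Qed.

Lemma hyper_coef (c : nat -> C) : expands f c -> forall n,
  c n = RtoC (pochhammer a n * pochhammer b n / (pochhammer 1 n * INR (Factorial.fact n))).
Proof.
  intros E n; induction n as [|n IH].
  - destruct (E 1%nat) as [K [HK N]]; pose proof (near_here _ _ N) as B; unfold psum in B; simpl in B.
    rewrite Cmod_0, Rmult_0_l, Rmult_0_r in B.
    assert (Ec : (f 0 - (0 + c O * 1))%C = 0) by (apply Cmod_eq_0, Rle_antisym; [exact B|apply Cmod_ge_0]).
    simpl; replace (c O) with (f 0 - (f 0 - (0 + c O * 1)))%C by ring; rewrite Ec, f0.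
    replace (1 * 1 / (1 * 1)) with 1 by field; ring.
  - pose proof (hyper_rec c E n) as K; rewrite IH in K.
    assert (Nn : INR (S n) <> 0) by (apply not_0_INR; lia).
    assert (Nn' : RtoC (INR (S n)) <> 0) by (apply RtoC_nz; auto).
    assert (Fn : INR (Factorial.fact n) <> 0) by apply INR_fact_neq_0.
    replace (c (S n)) with (INR (S n) * INR (S n) * c (S n) / (INR (S n) * INR (S n)))%C by (field; auto).
    rewrite K, <- !RtoC_plus, <- !RtoC_mult, <- RtoC_div by (apply Rmult_integral_contrapositive; auto).
    f_equal; rewrite !pochhammer_one.
    change (Factorial.fact (S n)) with (S n * Factorial.fact n)%nat; rewrite mult_INR.
    simpl pochhammer; field; auto.
Qed.

Lemma psum_hyp (c : nat -> C) (v : C) (n : nat) :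
  (forall n, c n = RtoC (pochhammer a n * pochhammer b n / (pochhammer 1 n * INR (Factorial.fact n)))) ->
  Re (psum c v (S n)) = sum_n (fun n => Re (hyp2F1_term a b 1 v n)) n /\
  Im (psum c v (S n)) = sum_n (fun n => Im (hyp2F1_term a b 1 v n)) n.
Proof.
  intros Ec; induction n as [|n [I1 I2]].
  - rewrite !sum_O; unfold psum, hyp2F1_term; simpl csum; rewrite Ec, Cplus_0_l; auto.
  - rewrite !sum_Sn, psum_S, re_plus, im_plus, I1, I2; unfold hyp2F1_term at 3 4; rewrite Ec; auto.
Qed.

(** With third parameter 1 both indicial exponents at 0 are 0: the factor [(n + 1)^2] in the
    recursion never vanishes, so a holomorphic solution is determined by its value at 0. The Taylor
    remainder also yields convergence of the two real series defining [hyp2F1]. *)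
Theorem hyp2F1_solution : near 0 (fun v => f v = hyp2F1 a b 1 v).
Proof.
  destruct (Taylor_local f 0 Hf) as [c [r [M [Hr [HM [_ [c0 [_ HB]]]]]]]].
  assert (E : expands f c).
  { intros n; exists (M / r ^ n); split; [apply Rdiv_le_0_compat; auto; apply pow_lt; auto|].
    exists r; split; auto; intros v Hv; specialize (HB v n ltac:(lra)).
    replace (v - 0)%C with v in HB by ring; unfold psum.
    replace (M / r ^ n * Cmod v ^ n) with (M * Cmod v ^ n / r ^ n); auto.
    field; apply pow_nonzero; lra. }
  pose proof (hyper_coef c E) as Ec.
  exists r; split; auto; intros v Hv.
  assert (Hv' : Cmod v < r) by (replace v with (v - 0)%C by ring; auto).
  assert (Lim : forall eps, 0 < eps -> exists N, forall n, (N <= n)%nat -> Cmod (f v - psum c v (S n))%C < eps).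
  { intros eps He; set (k := Cmod v / r).
    assert (Hk : 0 <= k < 1).
    { unfold k; split; [apply Rdiv_le_0_compat; auto using Cmod_ge_0|apply Rlt_div_l; lra]. }
    destruct (geom_small k M eps Hk HM He) as [N HN]; exists N; intros n Ln.
    specialize (HB v (S n) ltac:(lra)); replace (v - 0)%C with v in HB by ring.
    eapply Rle_lt_trans; [exact HB|]; eapply Rle_lt_trans; [|exact HN].
    replace (M * Cmod v ^ S n / r ^ S n) with (M * k ^ S n)
      by (unfold k, Rdiv; rewrite Rpow_mult_distr, pow_inv; ring).
    apply Rmult_le_compat_l; auto.
    replace (S n) with (N + (S n - N))%nat by lia; rewrite pow_add.
    rewrite <- (Rmult_1_r (k ^ N)) at 2; apply Rmult_le_compat_l; [apply pow_le; lra|].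
    clear - Hk; induction (S n - N)%nat as [|j IH]; simpl; [lra|].
    assert (0 <= k ^ j) by (apply pow_le; lra); nra. }
  unfold hyp2F1.
  assert (S1 : is_series (fun n => Re (hyp2F1_term a b 1 v n)) (Re (f v))).
  { change (is_lim_seq (sum_n (fun n => Re (hyp2F1_term a b 1 v n))) (Finite (Re (f v)))).
    apply is_lim_seq_spec; intros eps; destruct (Lim eps (cond_pos eps)) as [N HN]; exists N; intros n Ln.
    specialize (HN n Ln); destruct (psum_hyp c v n Ec) as [P1 _].
    change (Rabs (sum_n (fun n => Re (hyp2F1_term a b 1 v n)) n - Re (f v)) < eps).
    rewrite <- P1, Rabs_minus_sym; eapply Rle_lt_trans; [|exact HN].
    replace (Re (f v) - Re (psum c v (S n))) with (Re (f v - psum c v (S n))%C)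
      by (unfold Cminus; rewrite re_plus, re_opp; ring).
    apply Cmod_Re. }
  assert (S2 : is_series (fun n => Im (hyp2F1_term a b 1 v n)) (Im (f v))).
  { change (is_lim_seq (sum_n (fun n => Im (hyp2F1_term a b 1 v n))) (Finite (Im (f v)))).
    apply is_lim_seq_spec; intros eps; destruct (Lim eps (cond_pos eps)) as [N HN]; exists N; intros n Ln.
    specialize (HN n Ln); destruct (psum_hyp c v n Ec) as [_ P2].
    change (Rabs (sum_n (fun n => Im (hyp2F1_term a b 1 v n)) n - Im (f v)) < eps).
    rewrite <- P2, Rabs_minus_sym; eapply Rle_lt_trans; [|exact HN].
    replace (Im (f v) - Im (psum c v (S n))) with (Im (f v - psum c v (S n))%C)
      by (unfold Cminus; rewrite im_plus, im_opp; ring).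
    apply Cmod_Im. }
  rewrite (is_series_unique _ _ S1), (is_series_unique _ _ S2); destruct (f v); reflexivity.
Qed.
End Hypergeometric.

(** On a small disc the derivative differs from [l] by at most [|l| / 2]. Integrating [f' - l] from
    [z] to [w] bounds [|l| * |w - z|] by half of itself when [f z = f w]. *)
Lemma locally_injective (f : C -> C) (a l : C) : near a (holomorphic_at f) -> Cd f a l -> l <> 0 ->
  exists d, 0 < d /\ forall z w, Cmod (z - a)%C < d -> Cmod (w - a)%C < d -> f z = f w -> z = w.
Proof.
  intros Hf Df Nl.
  assert (Cf : Ccont (C_derive f) a) by (apply hol_cont, derive_hol; auto).
  assert (P : 0 < Cmod l / 2) by (apply Cmod_gt_0 in Nl; lra).
  pose proof (near_and _ _ _ Hf (near_and _ _ _ (Cf _ P) (near_near _ _ Hf))) as N.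
  destruct N as [d [Hd K]]; exists d; split; auto; intros z w Hz Hw E.
  rewrite (Cd_C_derive _ _ _ Df) in K.
  assert (In : forall s, 0 <= s <= 1 -> Cmod (seg z w s - a)%C < d).
  { intros s Hs; apply (Cdisc_convex a d z w); auto. }
  assert (Cs : contseg (fun v => C_derive f v - l)%C z w).
  { intros s Hs; apply Ccont_minus; [|apply Ccont_const]; apply hol_cont, derive_hol, K, In; auto. }
  assert (I : sint (fun v => C_derive f v - l)%C z w = (f w - l * w - (f z - l * z))%C).
  { apply (sint_FTC (fun v => f v - l * v)%C); auto; intros s Hs.
    apply Cd_minus; [apply hol_Cd, K, In; auto|].
    eapply Cd_eqn; [apply Cd_mult; [apply Cd_const|apply Cd_id]|]; cbv beta; ring. }
  pose proof (sint_bound _ z w (Cmod l / 2) Cs) as B; rewrite I, E in B.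
  replace (f w - l * w - (f w - l * z))%C with (- (l * (w - z)))%C in B by ring.
  rewrite Cmod_opp, Cmod_mult in B.
  assert (B' : Cmod l * Cmod (w - z)%C <= Cmod (w - z)%C * (Cmod l / 2)).
  { apply B; intros s Hs; left; apply K, In; auto. }
  symmetry; apply Ceq_minus, Cmod_eq_0; pose proof (Cmod_ge_0 (w - z)%C); nra.
Qed.

(** * Identification of the hypergeometric series near the infinite cusp *)

Section Infinity.
Variables (G : mat2 -> Prop) (al be ups : R) (y u : C -> C).
Hypotheses (H : tri_fun G al be ups y) (Hu : forall a, inH a -> holomorphic_at u a)
  (Eu : forall a, inH a -> gen y a -> u a = U0 al be y a).

Lemma y_large : exists Y, 0 < Y /\ forall tau, Y < Im tau -> inH tau /\ gen y tau.
Proof.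
  destruct (upper_near_icusp _ (tf_infinite _ _ _ _ _ H 1)) as [Y [PY HY]].
  exists Y; split; auto; intros tau Ht; specialize (HY tau Ht).
  split; [unfold inH; lra|split]; intros E; rewrite E in HY;
    [rewrite Cmod_0 in HY|rewrite Cmod_1 in HY]; lra.
Qed.

Lemma W_Z (z : C) : inH z -> gen y z -> u z = W (al + be) (1 - al) (fun v => / y v)%C z.
Proof.
  intros Hz Gz; rewrite Eu by auto; unfold U0; rewrite W_inv; try apply Gz.
  - replace (2 - (al + be) - (1 - al)) with (1 - be) by ring; auto.
  - apply (y_near_hol G al be ups y H); auto.
  - apply (tf_reg _ _ _ _ _ H); auto; apply Gz.
Qed.

Lemma Z_derive (z : C) : inH z -> gen y z ->
  C_derive (fun v => / y v)%C z = (- C_derive y z / (y z * y z))%C.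
Proof.
  intros Hz Gz; apply Cd_C_derive, Cd_inv; [|apply Gz]; apply hol_Cd, (tf_hol _ _ _ _ _ H); auto.
Qed.

(** Here the order of [1 / y] in [q] is reduced to 1 by [tf_simple]: an exponent of 2 or more would
    make the derivative of [T] at 0 vanish. *)
Lemma inf_chart : exists (T g : C -> C) (Y : R), near 0 (holomorphic_at g) /\ g 0 <> 0 /\
  (forall q, T q = (q ^ 1 * g q)%C) /\
  (forall tau, Y < Im tau -> inH tau /\ gen y tau /\ (/ y tau)%C = T (qexp ups tau) /\
     C_derive (fun v => / y v)%C tau = (tpi / ups * (T (qexp ups tau) * cA g 1 (qexp ups tau)))%C /\
     u tau = cU ups T g 1 (al + be) (1 - al) (qexp ups tau)) /\
  forall Y', near 0 (fun v => v <> 0 -> exists tau, Y' < Im tau /\ (/ y tau)%C = v).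
Proof.
  destruct (tf_periodic _ _ _ _ _ H) as [Hw P]; pose proof (tf_infinite _ _ _ _ _ H) as L.
  destruct y_large as [Y [PY HY]].
  destruct (chart_limit ups Y (fun v => / y v)%C Hw) as [T [g [m [Hm [Hg [g0 [ET Ex]]]]]]].
  - intros tau Ht; destruct (HY tau Ht) as [K1 [K2 K3]]; apply hol_inv; auto; apply (tf_hol _ _ _ _ _ H); auto.
  - intros tau Ht; rewrite P; auto; apply HY; auto.
  - intros e' He'; destruct (L (/ e')) as [Y1 HY1]; exists (Rmax Y Y1); intros tau Ht.
    pose proof (Rmax_l Y Y1); pose proof (Rmax_r Y Y1).
    destruct (HY tau ltac:(lra)) as [K1 [K2 K3]]; rewrite Cmod_inv by auto.
    rewrite <- (Rinv_inv e'); apply Rinv_lt_contravar; [|apply HY1; lra].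
    apply Rmult_lt_0_compat; [apply Rinv_0_lt_compat; auto|apply Cmod_gt_0; auto].
  - intros Y'; destruct (high_point (Rmax Y Y')) as [tau [Ht _]]; exists tau.
    pose proof (Rmax_l Y Y'); pose proof (Rmax_r Y Y'); split; [lra|].
    destruct (HY tau ltac:(lra)) as [K1 [K2 K3]]; intros E.
    apply C1_nz; replace (RtoC 1) with (/ y tau * y tau)%C by (field; auto); rewrite E; ring.
  - assert (HT : near 0 (holomorphic_at T)) by (apply (cT_hol T g m); auto).
    assert (T0 : T 0 = 0) by (apply (cT0 T g m); auto).
    assert (m1 : m = 1%nat).
    { pose proof (tf_simple _ _ _ _ _ H T HT T0 (ex_intro _ Y Ex)) as S1.
      destruct m as [|[|m]]; [lia|auto|exfalso; apply S1].
      apply Cd_C_derive, (Cd_ext (fun q => q ^ (S (S m)) * g q)%C); [intros; auto|].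
      eapply Cd_eqn.
      - apply Cd_mult; [apply (Cd_pow (fun q => q)), Cd_id|apply hol_Cd, (near_here _ _ Hg)].
      - cbv beta; simpl pred; rewrite !pow_0_S; ring. }
    subst m.
    destruct (cusp_W ups Y _ T g 1 Hw Hm Hg g0 ET Ex (al + be) (1 - al)) as [Y2 K2].
    exists T, g, (Rmax Y Y2); split; [auto|split; [auto|split; [auto|split]]].
    + intros tau Ht; pose proof (Rmax_l Y Y2); pose proof (Rmax_r Y Y2).
      destruct (HY tau ltac:(lra)) as [Hh Gh]; destruct (K2 tau ltac:(lra)) as [E1 [_ [_ [_ [E2 [_ E3]]]]]].
      repeat split; auto; try apply Gh; rewrite W_Z; auto.
    + intros Y'; generalize (cusp_hits ups Y _ T g 1 Hw Hm Hg g0 ET Ex Y'); apply near_mono.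
      intros v K Nv; destruct (K Nv) as [tau [K1 [_ K3]]]; eauto.
Qed.

Lemma u_riccati (z : C) : inH z -> gen y z ->
  C_derive u z = (u z ^ 2 - (1 - al - be) ^ 2 / 4 * Qf y z)%C.
Proof.
  intros Hz Gz; pose proof (Rat_zero G al be ups y u H Hu Eu z Hz Gz) as K; unfold Rat, phi in K.
  assert (NQ : Qf y z <> 0).
  { apply Qf_nz; try apply Gz; apply (tf_reg _ _ _ _ _ H); auto; apply Gz. }
  replace (C_derive u z) with
    ((((C_derive u z - u z ^ 2) / Qf y z + (1 - al - be) ^ 2 / 4) * Qf y z) + u z ^ 2 - (1 - al - be) ^ 2 / 4 * Qf y z)%C
    by (field; auto).
  rewrite K; ring.
Qed.

Local Notation a := ((1 - al - be) / 2)%R.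
Local Notation b := ((1 - al + be) / 2)%R.

(** The change of variable from [tau] to [Z = 1 / y] as pure algebra. [D] is the logarithmic
    derivative of the form [B] in [tau], [Up] is the Riccati equation for [u], [pp] is the second
    derivative of [Z] obtained from the definition of [u], and [f1], [f2] are the derivatives of [B]
    with respect to [Z]. *)
Lemma hyper_ode_algebra (B U Z p : C) : Z <> 0 -> p <> 0 -> (1 - Z)%C <> 0 ->
  let D := (U - a * (p / Z))%C in
  let Up := (U ^ 2 - a ^ 2 * (p ^ 2 / (Z ^ 2 * (1 - Z))))%C in
  let pp := (p * (2 * U + (al + be) * (p / Z) - (1 - al) * (p / (1 - Z))))%C in
  let Dp := (Up - a * ((pp * Z - p * p) / (Z * Z)))%C in
  let f1 := (B * D / p)%C in
  let f2 := (((B * D * D + B * Dp) * p - B * D * pp) / (p * p) / p)%C in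
  (Z * (1 - Z) * f2 + (1 - (a + b + 1) * Z) * f1 - a * b * B)%C = 0.
Proof.
  intros NZ Np N1; cbv zeta.
  rewrite !RtoC_div, !RtoC_plus, !RtoC_minus by lra.
  field; auto.
Qed.

(** The logarithm is constructed first, by integrating the expected logarithmic derivative in [q]
    from the cusp, and only then is its exponential recognised as the series. The normalisation at
    the cusp, the branch and the initial value 1 thus come together. *)
Theorem calB_log : exists lB,
  near_icusp (fun tau => Cd lB tau (u tau + a * (C_derive y tau / y tau))%C /\
    Cexp (lB tau) = hyp2F1 a b 1 (/ y tau)%C) /\ vanishes_at_icusp lB.
Proof.
  destruct (tf_periodic _ _ _ _ _ H) as [Hw _].
  destruct inf_chart as [T [g [Y [Hg [g0 [ET [Ex Hits]]]]]]].
  assert (Hm : (0 < 1)%nat) by lia.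
  set (A := cA g 1) in *; set (V := cU ups T g 1 (al + be) (1 - al)) in *.
  pose proof (cU_hol ups T g 1 Hm Hg g0 ET (al + be) (1 - al)) as HV; fold V in HV.
  pose proof (cA_hol g 1 Hg g0) as HA; fold A in HA.
  pose proof (cT_hol T g 1 Hg ET) as HT.
  pose proof (cA_nz g 1 Hm Hg g0) as NA; fold A in NA.
  assert (T0 : T 0 = 0) by (apply (cT0 T g 1); auto).
  assert (A0 : A 0 = 1) by (unfold A; rewrite cA0; auto).
  assert (Nw : RtoC ups <> 0) by (apply RtoC_nz; lra).
  set (kap := (tpi / ups)%C) in *.
  assert (Nk : kap <> 0) by (apply tpi_w_nz; auto).
  assert (V0 : V 0 = (kap * a)%C).
  { unfold V; rewrite (cU0 ups T g 1 Hw Hm g0 ET); fold kap.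
    rewrite RtoC_div, !RtoC_minus, RtoC_plus by lra; simpl INR; field. }
  (* [kap * Nq] is the expected logarithmic derivative as a function of [q]. It vanishes at 0 since
     [V 0 = kap * a] and [A 0 = 1], so dividing by [q], as [d tau = dq / (kap * q)] requires, leaves
     a holomorphic integrand. *)
  set (Nq := fun q => (V q / kap - a * A q)%C).
  assert (HN : near 0 (holomorphic_at Nq)).
  { generalize (near_and _ _ _ HV HA); apply near_mono; intros q [H1 H2].
    apply hol_minus; [apply hol_div; auto; apply hol_const|apply hol_mult; auto; apply hol_const]. }
  assert (N0 : Nq 0 = 0) by (unfold Nq; rewrite V0, A0; field; auto).
  assert (Hb : near 0 (holomorphic_at (dq Nq 0))).
  { generalize HN; apply near_mono; intros q Hq; apply dq_hol; auto. }
  assert (Eb : forall q, Nq q = (dq Nq 0 q * q)%C).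
  { intros q; rewrite (dq_eq Nq 0 q) at 1; rewrite N0; ring. }
  destruct Hb as [d0 [Hd0 Hb]].
  destruct (primitive (Cdisc 0 d0) (dq Nq 0) (Cdisc_convex 0 d0) (Cdisc_opn 0 d0)) as [b0 Hb0].
  { intros z Hz; apply Hb, Hz. }
  set (bh := fun q => (b0 q - b0 0)%C).
  assert (Dbh : forall q, Cmod (q - 0)%C < d0 -> Cd bh q (dq Nq 0 q)).
  { intros q Hq; eapply Cd_eqn; [apply Cd_minus; [apply Hb0; exact Hq|apply Cd_const]|ring]. }
  assert (bh0 : bh 0 = 0) by (unfold bh; ring).
  set (F := fun q => Cexp (bh q)).
  assert (DF : forall q, Cmod (q - 0)%C < d0 -> Cd F q (F q * dq Nq 0 q)%C).
  { intros q Hq; apply Cd_exp; auto. }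
  (* the inverse of the chart [T] *)
  assert (DT0 : Cd T 0 (g 0)).
  { apply (Cd_ext (fun q => q ^ 1 * g q)%C); [intros; auto|]; eapply Cd_eqn.
    - apply Cd_mult; [apply (Cd_pow (fun q => q)), Cd_id|apply hol_Cd, (near_here _ _ Hg)].
    - cbv beta; simpl; ring. }
  destruct (locally_injective T 0 (g 0) HT DT0 g0) as [d1 [Hd1 Inj]].
  assert (NT' : near 0 (fun q => C_derive T q <> 0)).
  { apply Ccont_neq; [apply hol_cont, derive_hol; auto|rewrite (Cd_C_derive _ _ _ DT0); auto]. }
  destruct (near_gt _ _ (Rmin d0 d1) (near_and _ _ _ HT NT') (Rmin_pos _ _ Hd0 Hd1)) as [d [Hd Kd]].
  pose proof (Rmin_l d0 d1); pose proof (Rmin_r d0 d1).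
  set (sec := fun v => epsilon (inhabits (RtoC 0)) (fun q => Cmod (q - 0)%C < d /\ T q = v)).
  set (f := fun v => F (sec v)).
  assert (Ef : forall q, Cmod (q - 0)%C < d -> f (T q) = F q).
  { intros q Hq; unfold f; f_equal.
    destruct (epsilon_spec (inhabits (RtoC 0)) (fun q' => Cmod (q' - 0)%C < d /\ T q' = T q)) as [S1 S2];
      [exists q; auto|]; fold (sec (T q)) in S1, S2.
    apply Inj; auto; lra. }
  assert (Hf : near 0 (holomorphic_at f)).
  { pose proof (open_mapping T 0 d HT (nonconst_derive _ _ _ DT0 g0) (proj1 Hd)) as O; rewrite T0 in O.
    revert O; apply near_mono; intros v [q [Hq <-]]; destruct (Kd q Hq) as [K1 K2].
    eapply Cd_hol, (quotient_hol f T F q).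
    - exists (d - Cmod (q - 0)%C); split; [lra|]; intros t Ht; apply Kd.
      pose proof (Cmod_tri t q 0); lra.
    - apply hol_Cd; auto.
    - auto.
    - apply DF; lra.
    - exists (d - Cmod (q - 0)%C); split; [lra|]; intros t Ht; apply Ef.
      pose proof (Cmod_tri t q 0); lra. }
  assert (f0 : f 0 = 1).
  { rewrite <- T0, Ef by (rewrite Cmod_m_0; lra); unfold F; rewrite bh0; apply Cexp_0. }
  assert (Hfq : near 0 (fun q => holomorphic_at f (T q))).
  { apply (near_comp T 0 (holomorphic_at f)); [apply hol_cont, (near_here _ _ HT)|rewrite T0; auto]. }
  assert (Nd : near 0 (fun q => Cmod (q - 0)%C < d)) by (exists d; split; [lra|auto]).
  destruct (qexp_near ups _ Hw (near_and _ _ _ Hfq (near_near _ _ (near_and _ _ _ NA Nd)))) as [Y1 K1].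
  set (lB := fun tau => bh (qexp ups tau)).
  set (Y2 := Rmax Y Y1).
  assert (K : forall tau, Y2 < Im tau -> inH tau /\ gen y tau /\ (/ y tau)%C = T (qexp ups tau) /\
     C_derive (fun v => / y v)%C tau = (kap * (T (qexp ups tau) * A (qexp ups tau)))%C /\
     u tau = V (qexp ups tau) /\ A (qexp ups tau) <> 0 /\ Cmod (qexp ups tau - 0)%C < d /\
     holomorphic_at f (/ y tau)%C).
  { intros tau Ht; pose proof (Rmax_l Y Y1); pose proof (Rmax_r Y Y1); unfold Y2 in Ht.
    destruct (Ex tau ltac:(lra)) as [E1 [E2 [E3 [E4 E5]]]]; destruct (K1 tau ltac:(lra)) as [F1 F2].
    apply near_here in F2; destruct F2 as [F2 F3].
    repeat split; auto; try apply E2; rewrite E3; auto. }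
  assert (DlB : forall tau, Y2 < Im tau ->
     Cd lB tau (u tau - a * (C_derive (fun v => / y v)%C tau / (/ y tau)))%C).
  { intros tau Ht; destruct (K tau Ht) as [_ [Gt [E3 [E4 [E5 [E6 [E7 _]]]]]]].
    eapply Cd_eqn; [apply Cd_qcomp; auto; apply Dbh; lra|].
    rewrite E4, E3, E5; fold kap.
    assert (NT : T (qexp ups tau) <> 0).
    { rewrite <- E3; intros E; apply C1_nz; replace (RtoC 1) with (/ y tau * y tau)%C by (field; apply Gt).
      rewrite E; ring. }
    replace (qexp ups tau * dq Nq 0 (qexp ups tau))%C with (Nq (qexp ups tau)) by (rewrite Eb; ring).
    unfold Nq; field; auto. }
  assert (EB : forall tau, Y2 < Im tau -> f (/ y tau)%C = Cexp (lB tau)).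
  { intros tau Ht; destruct (K tau Ht) as [_ [_ [E3 [_ [_ [_ [E7 _]]]]]]]; rewrite E3, Ef; auto. }
  set (Z := fun v => (/ y v)%C) in *.
  assert (ZH : forall tau, inH tau -> gen y tau -> near tau (holomorphic_at Z)).
  { intros tau Hh Gh; generalize (near_and _ _ _ (inH_near tau Hh) (gen_near G al be ups y H tau Hh Gh)); apply near_mono.
    intros t [T1 T2]; apply hol_inv; [apply (tf_hol _ _ _ _ _ H); auto|apply T2]. }
  assert (Zfacts : forall tau, Y2 < Im tau -> Z tau <> 0 /\ (1 - Z tau)%C <> 0 /\ C_derive Z tau <> 0).
  { intros tau Ht; destruct (K tau Ht) as [Hh [Gt _]].
    assert (Ny := tf_reg _ _ _ _ _ H tau Hh (proj1 Gt) (proj2 Gt)).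
    assert (Nz : Z tau <> 0).
    { unfold Z; intros E; apply C1_nz; replace (RtoC 1) with (/ y tau * y tau)%C by (field; apply Gt).
      rewrite E; ring. }
    split; [auto|split].
    - apply one_minus_neq; intros E; apply Gt; unfold Z in E.
      replace (y tau) with (/ / y tau)%C by (field; apply Gt); rewrite E; field; apply C1_nz.
    - unfold Z; rewrite Z_derive by auto; intros E; apply Ny.
      replace (C_derive y tau) with (- (- C_derive y tau / (y tau * y tau)) * (y tau * y tau))%C by (field; apply Gt).
      rewrite E; ring. }
  assert (D1 : forall tau, Y2 < Im tau ->
     C_derive f (Z tau) = (Cexp (lB tau) * (u tau - a * (C_derive Z tau / Z tau)) / C_derive Z tau)%C).
  { intros tau Ht; destruct (K tau Ht) as [Hh [Gt [_ [_ [_ [_ [_ E8]]]]]]].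
    destruct (Zfacts tau Ht) as [Z1 [Z2 Z3]].
    assert (E : (C_derive f (Z tau) * C_derive Z tau)%C = (Cexp (lB tau) * (u tau - a * (C_derive Z tau / Z tau)))%C).
    { apply (Cd_unique (fun t => f (Z t)) tau).
      - apply (Cd_comp Z f); [apply hol_Cd, (near_here _ _ (ZH tau Hh Gt))|apply hol_Cd; exact E8].
      - apply (Cd_ext_near (fun t => Cexp (lB t))).
        + generalize (upper_near tau Y2 Ht); apply near_mono; intros t Tt; symmetry; apply EB; auto.
        + apply Cd_exp, DlB; auto. }
    rewrite <- E; field; auto. }
  assert (Ode : forall tau, Y2 < Im tau -> near (Z tau) (holomorphic_at f) ->
    (Z tau * (1 - Z tau) * C_derive (C_derive f) (Z tau)
     + (1 - (a + b + 1) * Z tau) * C_derive f (Z tau) - a * b * f (Z tau))%C = 0).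
  { intros tau Ht Hfz; destruct (K tau Ht) as [Hh [Gt _]]; destruct (Zfacts tau Ht) as [Z1 [Z2 Z3]].
    set (p := C_derive Z tau) in *; set (pp := C_derive (C_derive Z) tau).
    (* The definition of [u] in the coordinate [Z], solved for the second derivative of [Z]. *)
    assert (Epp : pp = (p * (2 * u tau + (al + be) * (p / Z tau) - (1 - al) * (p / (1 - Z tau))))%C).
    { pose proof (W_Z tau Hh Gt) as EW; fold Z in EW; unfold W in EW; fold pp p in EW.
      rewrite EW, RtoC_plus, RtoC_minus; field; auto. }
    assert (Eup : C_derive u tau = (u tau ^ 2 - a ^ 2 * (p ^ 2 / (Z tau ^ 2 * (1 - Z tau))))%C).
    { rewrite u_riccati by auto; unfold Qf, p; unfold Z at 1; rewrite Z_derive by auto; unfold Z.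
      assert (N1 : (y tau - 1)%C <> 0) by (apply Cminus_eq_contra, Gt).
      assert (N0' : y tau <> 0) by apply Gt.
      rewrite RtoC_div, !RtoC_minus by lra; simpl; field; repeat split; auto. }
    assert (DZ' : Cd (C_derive Z) tau pp) by (apply hol_Cd, derive_hol; auto).
    assert (DZ : Cd Z tau p) by (apply hol_Cd, (near_here _ _ (ZH tau Hh Gt))).
    set (D := (u tau - a * (p / Z tau))%C).
    assert (D2 : (C_derive (C_derive f) (Z tau) * p)%C =
      (((Cexp (lB tau) * D * D + Cexp (lB tau) * (C_derive u tau - a * ((pp * Z tau - p * p) / (Z tau * Z tau)))) * p
        - Cexp (lB tau) * D * pp) / (p * p))%C).
    { apply (Cd_unique (fun t => C_derive f (Z t)) tau).
      - apply (Cd_comp Z (C_derive f)); auto; apply hol_Cd, derive_hol; auto.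
      - apply (Cd_ext_near (fun t => Cexp (lB t) * (u t - a * (C_derive Z t / Z t)) / C_derive Z t)%C).
        + generalize (upper_near tau Y2 Ht); apply near_mono; intros t Tt; symmetry; apply D1; auto.
        + eapply Cd_eqn.
          * apply Cd_div; [|exact DZ'|auto].
            apply Cd_mult; [apply Cd_exp, DlB; auto|].
            apply Cd_minus; [apply hol_Cd, Hu; auto|].
            apply Cd_mult; [apply Cd_const|apply Cd_div; [exact DZ'|exact DZ|auto]].
          * cbv beta; fold p; fold D; change (/ y tau)%C with (Z tau); fold p; fold D; field; auto. }
    pose proof (hyper_ode_algebra (Cexp (lB tau)) (u tau) (Z tau) p Z1 Z3 Z2) as AL; cbv zeta in AL.
    replace (C_derive (C_derive f) (Z tau)) with (C_derive (C_derive f) (Z tau) * p / p)%C by (field; auto).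
    rewrite D2, D1 by auto; change (f (Z tau)) with (f (/ y tau)%C); rewrite EB, Eup, Epp by auto.
    fold p; fold D; fold D in AL; exact AL. }
  assert (Ode0 : near 0 (fun v => (v * (1 - v) * C_derive (C_derive f) v
     + (1 - (a + b + 1) * v) * C_derive f v - a * b * f v)%C = 0)).
  { set (P := fun v => (v * (1 - v) * C_derive (C_derive f) v
     + (1 - (a + b + 1) * v) * C_derive f v - a * b * f v)%C).
    assert (NP : near 0 (fun v => v <> 0 -> P v = 0)).
    { generalize (near_and _ _ _ (near_near _ _ Hf) (Hits Y2)); apply near_mono; intros v [Hv1 Hv2] Nv.
      destruct (Hv2 Nv) as [tau [Ht Et]]; fold (Z tau) in Et; rewrite <- Et; apply Ode; auto.
      rewrite Et; auto. }
    (* The value [v = 0] of [1 / y] is attained only at the cusp itself, so the equation is carried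
       there by continuity. *)
    assert (P0 : P 0 = 0).
    { apply (cont_eq_punctured P (fun _ => RtoC 0)); auto; [|apply Ccont_const].
      pose proof (near_derive_hol _ _ Hf) as Hf1; pose proof (near_derive_hol _ _ Hf1) as Hf2.
      apply near_here in Hf1, Hf2; pose proof (near_here _ _ Hf) as Hf0.
      apply hol_cont, hol_minus; [apply hol_plus|].
      - apply hol_mult; auto; apply hol_mult; [apply hol_id|apply hol_minus; [apply hol_const|apply hol_id]].
      - apply hol_mult; auto; apply hol_minus; [apply hol_const|].
        apply hol_mult; [apply hol_const|apply hol_id].
      - apply hol_mult; auto; apply hol_const. }
    revert NP; apply near_mono; intros v Hv; destruct (Ceq_dec v 0) as [->|N]; auto. }
  pose proof (hyp2F1_solution a b f Hf f0 Ode0) as Sol.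
  assert (Solq : near 0 (fun q => f (T q) = hyp2F1 a b 1 (T q))).
  { apply (near_comp T 0 (fun v => f v = hyp2F1 a b 1 v)); [apply hol_cont, (near_here _ _ HT)|rewrite T0; auto]. }
  destruct (qexp_near ups _ Hw Solq) as [Y3 K3].
  exists lB; split.
  - exists (Rmax Y2 Y3); intros tau Ht; pose proof (Rmax_l Y2 Y3); pose proof (Rmax_r Y2 Y3).
    destruct (K tau ltac:(lra)) as [Hh [Gt [E3 _]]]; split.
    + eapply Cd_eqn; [apply DlB; lra|].
      unfold Z; rewrite Z_derive by auto; field; apply Gt.
    + rewrite <- EB by lra; unfold Z; rewrite E3; apply K3; lra.
  - intros eps He.
    assert (Cb : Ccont bh 0) by (eapply Cd_cont, Dbh; rewrite Cmod_m_0; auto).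
    destruct (qexp_near ups _ Hw (Ccont_val bh 0 0 Cb bh0 eps He)) as [Y4 K4].
    exists Y4; intros tau Ht; replace (lB tau) with (lB tau - 0)%C by ring; apply K4; auto.
Qed.
End Infinity.

(** * The Hauptmodul *)

Lemma locally_near (z : C) (P : C -> Prop) : locally (T := C_UniformSpace) z P -> near z P.
Proof.
  intros [eps H]; exists eps; split; [apply cond_pos|]; intros w Hw; apply H.
  apply C_NormedModule_mixin_compat1; exact Hw.
Qed.

(** The interval starts at 1 so that two diagonal entries moved into it have product at least 1. *)
Lemma shift_into_interval (x r : R) : x <> 0 -> exists k : Z, 1 <= r + IZR k * x <= 1 + Rabs x.
Proof.
  intros Nx; assert (P : 0 < Rabs x) by (apply Rabs_pos_lt; auto).
  destruct (archimed ((1 - r) / Rabs x)) as [A1 A2]; set (k := up ((1 - r) / Rabs x)) in *.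
  assert (B1 : 1 - r < IZR k * Rabs x) by (apply Rlt_div_l in A1; auto).
  assert (B2 : IZR k * Rabs x <= 1 - r + Rabs x).
  { assert (IZR k <= (1 - r) / Rabs x + 1) by lra.
    replace (1 - r + Rabs x) with (((1 - r) / Rabs x + 1) * Rabs x) by (field; lra).
    apply Rmult_le_compat_r; lra. }
  destruct (Rle_lt_dec 0 x) as [L|L].
  - rewrite (Rabs_pos_eq x) in * by auto; exists k; lra.
  - rewrite (Rabs_left x) in * by auto; exists (- k)%Z; rewrite opp_IZR; lra.
Qed.

(** Multiplication by translations on both sides keeps [c] and brings [a] and [d] into
    [[1, 1 + |c| * w]]. Then [|b| * |c| = a * d - 1] is of order [|c|], so [b] stays bounded as [c]
    tends to 0. Discreteness makes one such matrix recur, although its fixed nonzero [c] would have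
    to be arbitrarily small. *)
Lemma lower_left_bounded_below (G : mat2 -> Prop) (w : R) : PSL2R_subgroup G -> discrete_group G -> 0 < w ->
  (forall k : Z, G (Mat2 1 (IZR k * w) 0 1)) ->
  exists eps, 0 < eps /\ forall g, G g -> mc g <> 0 -> eps <= Rabs (mc g).
Proof.
  intros HG HD Hw Htr; apply NNPP; intros N.
  assert (S : forall n, exists g, G g /\ mc g <> 0 /\ Rabs (mc g) < invn n /\
     1 <= ma g <= 1 + Rabs (mc g) * w /\ 1 <= md g <= 1 + Rabs (mc g) * w).
  { intros n; apply NNPP; intros N1; apply N; exists (invn n); split; [apply invn_pos|].
    intros g Gg Ng; apply Rnot_lt_le; intros Lt; apply N1.
    assert (Nx : mc g * w <> 0) by (apply Rmult_integral_contrapositive; split; [auto|lra]).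
    destruct (shift_into_interval _ (ma g) Nx) as [k Hk]; destruct (shift_into_interval _ (md g) Nx) as [l Hl].
    rewrite Rabs_mult, (Rabs_pos_eq w) in Hk, Hl by lra.
    exists (mmul (Mat2 1 (IZR k * w) 0 1) (mmul g (Mat2 1 (IZR l * w) 0 1))).
    assert (Ec : mc (mmul (Mat2 1 (IZR k * w) 0 1) (mmul g (Mat2 1 (IZR l * w) 0 1))) = mc g) by (simpl; ring).
    rewrite Ec; split; [repeat apply (sg_mul G HG); auto|split; [auto|split; [auto|split]]].
    - replace (ma (mmul (Mat2 1 (IZR k * w) 0 1) (mmul g (Mat2 1 (IZR l * w) 0 1)))) with
        (ma g + IZR k * (mc g * w)) by (simpl; ring); auto.
    - replace (md (mmul (Mat2 1 (IZR k * w) 0 1) (mmul g (Mat2 1 (IZR l * w) 0 1)))) with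
        (md g + IZR l * (mc g * w)) by (simpl; ring); auto. }
  destruct (choice_fun _ _ S) as [gs Hgs].
  destruct (discrete_subsequence G gs (1 + 2 * w + w * w) (fun _ => True) HG HD) as [g [Gg O]].
  - intros M; exists M; auto.
  - intros k _; destruct (Hgs k) as [Gk [Nk [Lk [Ak Dk]]]]; split; auto.
    assert (i1 : invn k <= 1).
    { unfold invn; rewrite <- Rinv_1; apply Rinv_le_contravar; [lra|]; pose proof (pos_INR k); lra. }
    pose proof (Rabs_pos_lt _ Nk) as Pk; set (c := Rabs (mc (gs k))) in *.
    assert (cw : c * w <= w) by nra.
    pose proof (sg_det G HG _ Gk) as Dt; unfold mdet in Dt.
    rewrite (Rabs_pos_eq (ma (gs k))), (Rabs_pos_eq (md (gs k))) by lra.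
    repeat split; try nra.
    assert (E : Rabs (mb (gs k)) * c = ma (gs k) * md (gs k) - 1).
    { unfold c; rewrite <- Rabs_mult; replace (mb (gs k) * mc (gs k)) with (ma (gs k) * md (gs k) - 1) by lra.
      apply Rabs_pos_eq; nra. }
    assert (ma (gs k) * md (gs k) <= (1 + c * w) * (1 + c * w)) by (apply Rmult_le_compat; lra).
    assert (Rabs (mb (gs k)) * c <= (2 * w + c * w * w) * c) by lra.
    assert (Rabs (mb (gs k)) <= 2 * w + c * w * w) by (apply (Rmult_le_reg_r c); auto).
    nra.
  - assert (Ng : mc g <> 0) by (destruct (O 0%nat) as [k [_ [_ <-]]]; apply Hgs).
    destruct (invn_small (Rabs (mc g)) (Rabs_pos_lt _ Ng)) as [N0 HN].
    destruct (O N0) as [k [Lk [_ Ek]]]; specialize (HN k Lk); destruct (Hgs k) as [_ [_ [Lt _]]].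
    rewrite Ek in Lt; lra.
Qed.

(** The quadratic equation for the fixed points has discriminant [trace^2 - 4 = 0]; a nonreal
    solution forces [c = 0], and then [g] is plus or minus the identity. *)
Lemma parabolic_fixed_real (g : mat2) (z : C) : mdet g = 1 -> parabolic g -> mob g (Some z) = Some z -> Im z = 0.
Proof.
  intros D [Tr [N1 N2]] F; unfold mob in F; destruct (Ceq_dec (autJ g z) 0) as [|Nj]; [discriminate|].
  injection F as F; apply NNPP; intros Ny.
  assert (E : (ma g * z + mb g)%C = (z * autJ g z)%C) by (rewrite <- F at 2; unfold mobC; field; auto).
  pose proof (f_equal Re E) as ER; pose proof (f_equal Im E) as EI.
  rewrite re_plus, re_scal_l, re_RtoC, re_mult, autJ_re, autJ_im in ER.
  rewrite im_plus, im_scal_l, im_RtoC, im_mult, autJ_re, autJ_im in EI.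
  destruct g as [p q r s]; unfold mdet in D; simpl in *; set (x := Re z) in *; set (v := Im z) in *.
  assert (E1 : p - s = 2 * r * x).
  { apply (Rmult_eq_reg_r v); auto; lra. }
  assert (E2 : q = - r * (x * x + v * v)) by nra.
  assert (E3 : r * v = 0).
  { assert ((r * v) * (r * v) = 0).
    { assert ((p - s) * (p - s) + 4 * q * r = 0) by (simpl in Tr; lra).
      rewrite E1, E2 in H; nra. }
    nra. }
  assert (r = 0) by (apply Rmult_integral in E3; destruct E3; auto; contradiction).
  subst r; assert (q = 0) by lra; assert (p = s) by lra; subst q s.
  assert (H1 : (p - 1) * (p + 1) = 0) by lra.
  apply Rmult_integral in H1; destruct H1.
  - apply N1, mat2_ext; simpl; lra.
  - apply N2, mat2_ext; simpl; lra.
Qed.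

(** Conjugated by [s], the parabolic element fixes infinity and has trace plus or minus 2, hence
    acts as a translation; its inverse is taken if it moves to the left. The number [w] is some
    period at the cusp, possibly a multiple of the width. *)
Lemma cusp_translation (G : mat2 -> Prop) (s : mat2) : PSL2R_subgroup G -> mdet s = 1 ->
  cusp G (mob s None) -> exists (g : mat2) (w : R), G g /\ 0 < w /\
    forall z, inH z -> mobC s (z + w)%C = mobC g (mobC s z).
Proof.
  intros HG D [g [Gg [Pg Fg]]].
  pose proof (sg_det G HG g Gg) as Dg.
  set (h := mmul (madj s) (mmul g s)).
  assert (Dh : mdet h = 1) by (unfold h; rewrite !mdet_mul, mdet_adj, D, Dg; ring).
  assert (Eh : mmul s h = mmul g s).
  { unfold h; unfold mdet in D; apply mat2_ext; simpl.
    - transitivity ((ma s * md s - mb s * mc s) * (ma g * ma s + mb g * mc s)); [ring|rewrite D; ring].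
    - transitivity ((ma s * md s - mb s * mc s) * (ma g * mb s + mb g * md s)); [ring|rewrite D; ring].
    - transitivity ((ma s * md s - mb s * mc s) * (mc g * ma s + md g * mc s)); [ring|rewrite D; ring].
    - transitivity ((ma s * md s - mb s * mc s) * (mc g * mb s + md g * md s)); [ring|rewrite D; ring]. }
  assert (Hc : mc h = 0).
  { assert (K : mc s * (ma g * ma s + mb g * mc s) = ma s * (mc g * ma s + md g * mc s)).
    { unfold mob in Fg at 2; destruct (Req_EM_T (mc s) 0) as [E|N].
      - simpl in Fg; destruct (Req_EM_T (mc s) 0); [|contradiction].
        simpl in Fg; destruct (Req_EM_T (mc g) 0) as [E'|]; [|discriminate].
        rewrite E, E'; ring.
      - simpl mob at 2 in Fg; destruct (Req_EM_T (mc s) 0); [contradiction|].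
        unfold mob in Fg; destruct (Ceq_dec (autJ g (RtoC (ma s / mc s))) 0) as [|Nj]; [discriminate|].
        assert (Fg' : mobC g (RtoC (ma s / mc s)) = RtoC (ma s / mc s)) by congruence; unfold mobC in Fg'.
        assert (E : (ma g * RtoC (ma s / mc s) + mb g)%C = (RtoC (ma s / mc s) * autJ g (RtoC (ma s / mc s)))%C)
          by (rewrite <- (f_equal (fun w => (w * autJ g (RtoC (ma s / mc s)))%C) Fg'); field; auto).
        unfold autJ in E; rewrite <- !RtoC_mult, <- !RtoC_plus, <- RtoC_mult in E; apply RtoC_inj in E.
        replace (mc s * (ma g * ma s + mb g * mc s)) with (mc s * mc s * (ma g * (ma s / mc s) + mb g)) by (field; auto).
        rewrite E; field; auto. }
    unfold h; simpl; lra. }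
  assert (Tr : ma h + md h = ma g + md g).
  { unfold h; simpl; unfold mdet in D.
    transitivity ((ma s * md s - mb s * mc s) * (ma g + md g)); [ring|rewrite D; ring]. }
  clearbody h; destruct Pg as [T4 [N1 N2]].
  assert (Ead : ma h * md h = 1) by (unfold mdet in Dh; rewrite Hc in Dh; lra).
  assert (Eq : ma h = md h).
  { assert (K : (ma h - md h) * (ma h - md h) = 0) by (rewrite <- Tr in T4; lra).
    apply Rmult_integral in K; destruct K; lra. }
  assert (E2 : ma h * ma h = 1) by (rewrite Eq at 2; auto).
  (* Without a translation part [h] would be plus or minus the identity, and so would its conjugate
     [g]. *)
  assert (Nb : mb h <> 0).
  { intros E0.
    assert (Eg : forall e, ma h = e -> g = Mat2 e 0 0 e).
    { intros e He.
      assert (Hh : h = Mat2 e 0 0 e) by (apply mat2_ext; simpl; congruence).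
      rewrite Hh in Eh; pose proof (f_equal ma Eh) as F1; pose proof (f_equal mb Eh) as F2;
      pose proof (f_equal mc Eh) as F3; pose proof (f_equal md Eh) as F4; simpl in F1, F2, F3, F4.
      unfold mdet in D; clear - D F1 F2 F3 F4; destruct g as [p q r t], s as [x y v z]; simpl in *.
      f_equal.
      - transitivity (p * (x * z - y * v)); [rewrite D; ring|].
        transitivity ((p * x + q * v) * z - (p * y + q * z) * v); [ring|rewrite <- F1, <- F2].
        transitivity (e * (x * z - y * v)); [ring|rewrite D; ring].
      - transitivity (q * (x * z - y * v)); [rewrite D; ring|].
        transitivity ((p * y + q * z) * x - (p * x + q * v) * y); [ring|rewrite <- F1, <- F2; ring].
      - transitivity (r * (x * z - y * v)); [rewrite D; ring|].
        transitivity ((r * x + t * v) * z - (r * y + t * z) * v); [ring|rewrite <- F3, <- F4; ring].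
      - transitivity (t * (x * z - y * v)); [rewrite D; ring|].
        transitivity ((r * y + t * z) * x - (r * x + t * v) * y); [ring|rewrite <- F3, <- F4].
        transitivity (e * (x * z - y * v)); [ring|rewrite D; ring]. }
    assert (E3 : (ma h - 1) * (ma h + 1) = 0) by lra.
    apply Rmult_integral in E3; destruct E3 as [E3|E3].
    - apply N1; rewrite (Eg 1) by lra; reflexivity.
    - apply N2; rewrite (Eg (-1)) by lra; unfold mopp, mid; simpl; f_equal; ring. }
  assert (Eh2 : forall z, mobC h z = (z + RtoC (mb h / ma h))%C).
  { intros z; assert (Na : ma h <> 0) by (intros E0; rewrite E0 in E2; lra).
    unfold mobC, autJ; rewrite Hc, <- Eq, RtoC_div by auto; field.
    apply RtoC_nz; auto. }
  assert (Sh : forall z, inH z -> mobC s (z + RtoC (mb h / ma h))%C = mobC g (mobC s z)).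
  { intros z Hz; rewrite <- Eh2, <- !mobC_mul, Eh; auto using autJ_nz, mobC_H. }
  assert (Nab : mb h / ma h <> 0).
  { intros E0; apply Nb; replace (mb h) with (mb h / ma h * ma h); [rewrite E0; ring|].
    field; intros E1; rewrite E1 in E2; lra. }
  destruct (Rle_lt_dec 0 (mb h / ma h)) as [L|L].
  - exists g, (mb h / ma h); split; [auto|split; [lra|auto]].
  - exists (madj g), (- (mb h / ma h)); split; [apply (sg_inv G HG); auto|split; [lra|]].
    intros z Hz; set (z' := (z + RtoC (- (mb h / ma h)))%C).
    assert (Hz' : inH z') by (unfold inH, z'; rewrite Im_plus_R; auto).
    pose proof (Sh z' Hz') as K.
    replace (z' + RtoC (mb h / ma h))%C with z in K by (unfold z'; rewrite RtoC_opp; ring).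
    rewrite K, mobC_adj; auto using mobC_H.
Qed.

(** The height of [mobC s z] at the image of infinity is [Im z] up to a positive constant, so [s]
    carries high half planes into horoballs. *)
Lemma height_high (s : mat2) (M : R) : mdet s = 1 ->
  exists Y, 0 < Y /\ forall z, Y < Im z -> M < height (mob s None) (mobC s z).
Proof.
  intros D; unfold mob; destruct (Req_EM_T (mc s) 0) as [E|N].
  - assert (Ead : ma s * md s = 1) by (unfold mdet in D; rewrite E in D; lra).
    assert (Nd : md s <> 0) by (intros E0; rewrite E0 in Ead; lra).
    exists (Rmax 1 (M * (md s * md s))); split; [pose proof (Rmax_l 1 (M * (md s * md s))); lra|].
    intros z Hz; pose proof (Rmax_l 1 (M * (md s * md s))); pose proof (Rmax_r 1 (M * (md s * md s))).
    unfold height; rewrite Im_mobC by (auto; unfold inH; lra).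
    rewrite Cmod2_alt, autJ_re, autJ_im, E.
    replace ((0 * Re z + md s) ^ 2 + (0 * Im z) ^ 2) with (md s * md s) by ring.
    apply Rlt_div_r; [nra|lra].
  - exists (Rmax 1 (M / (mc s * mc s))); split; [pose proof (Rmax_l 1 (M / (mc s * mc s))); lra|].
    intros z Hz; pose proof (Rmax_l 1 (M / (mc s * mc s))); pose proof (Rmax_r 1 (M / (mc s * mc s))).
    assert (Hh : inH z) by (unfold inH; lra).
    unfold height; rewrite Im_mobC by auto.
    pose proof (autJ_nz s z D Hh) as Nj.
    assert (Nc : RtoC (mc s) <> 0) by (apply RtoC_nz; auto).
    assert (E : (mobC s z - RtoC (ma s / mc s))%C = (- / (mc s * autJ s z))%C).
    { pose proof (det_C s D) as Dc; rewrite RtoC_div by auto; unfold mobC.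
      transitivity (- (ma s * md s - mb s * mc s) / (mc s * autJ s z))%C.
      - unfold autJ in *; field; auto.
      - rewrite Dc; field; auto. }
    rewrite E, Cmod_opp, Cmod_inv, Cmod_mult, Cmod_R by (apply Cmult_neq_0; auto).
    assert (Pj : 0 < Cmod (autJ s z)) by (apply Cmod_gt_0; auto).
    assert (Pc : 0 < Rabs (mc s)) by (apply Rabs_pos_lt; auto).
    replace (Im z / Cmod (autJ s z) ^ 2 / (/ (Rabs (mc s) * Cmod (autJ s z))) ^ 2)
      with (Im z * (Rabs (mc s) * Rabs (mc s))) by (field; lra).
    rewrite <- Rabs_mult, Rabs_pos_eq by nra.
    assert (L : M / (mc s * mc s) < Im z) by lra.
    apply Rlt_div_l in L; [lra|nra].
Qed.

Section FromHauptmodul.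
Variables (G : mat2 -> Prop) (vA vB vC : P1) (nA nB nC : option nat) (ups : R) (t : P1 -> P1) (tstar : C).
Hypotheses (HT : triangle_group G vA vB vC nA nB nC) (Hinf : equiv G vC None)
  (Hwid : cusp_width_infty G ups) (Hh : hauptmodul G t) (tC : t vC = Some (RtoC 0))
  (Nst : tstar <> RtoC 0) (tA : t vA = Some tstar) (tB : t vB = None).

(** The value 0 of [t] belongs to the class of the infinite cusp and is not taken in the upper half
    plane, so this quotient is finite there. Poles of [t] become zeros through [inv_part], and class
    B is treated without a chart at infinity. *)
Definition yt (tau : C) : C := (tstar * inv_part (t (Some tau)))%C.

Let HG : PSL2R_subgroup G := tg_group _ _ _ _ _ _ _ HT.
Let HD : discrete_group G := tg_discrete _ _ _ _ _ _ _ HT.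

Lemma t_None : t None = Some (RtoC 0).
Proof.
  destruct Hinf as [g [Gg E]]; rewrite <- E, (hm_inv _ _ Hh); auto.
  apply (tg_fixC _ _ _ _ _ _ _ HT).
Qed.

Lemma translations (k : Z) : G (Mat2 1 (IZR k * ups) 0 1).
Proof. apply (proj2 Hwid (Mat2 1 (IZR k * ups) 0 1)); exists k; auto. Qed.

Lemma ups_pos : 0 < ups.
Proof. apply Hwid. Qed.

Lemma mob_None_mid : mob mid None = None.
Proof. simpl; destruct (Req_EM_T 0 0); congruence. Qed.

Lemma cusp_None : cusp G None.
Proof.
  exists (Mat2 1 (IZR 1 * ups) 0 1); split; [apply translations|split; [split; [|split]|]].
  - simpl; ring.
  - intros E; apply (f_equal mb) in E; simpl in E; pose proof ups_pos; lra.
  - intros E; apply (f_equal ma) in E; simpl in E; lra.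
  - simpl; destruct (Req_EM_T 0 0); congruence.
Qed.

Lemma cusp_not_inH (s : P1) : cusp G s -> ~ inH_pt s.
Proof.
  intros [g [Gg [Pg Fg]]]; destruct s as [z|]; simpl; auto; unfold inH.
  rewrite (parabolic_fixed_real g z); auto; [lra|apply (sg_det G HG); auto].
Qed.

Lemma mob_inH (g : mat2) (s : P1) : G g -> inH_pt s -> inH_pt (mob g s).
Proof.
  intros Gg Hs; destruct s as [z|]; [|destruct Hs].
  pose proof (sg_det G HG g Gg); rewrite mob_H by auto; apply mobC_H; auto.
Qed.

Lemma Hstar_H (a : C) : inH a -> Hstar G (Some a).
Proof. left; auto. Qed.

Lemma t_nz (a : C) : inH a -> t (Some a) <> Some (RtoC 0).
Proof.
  intros Ha E; destruct (hm_inj _ _ Hh (Some a) None) as [g [Gg Eg]].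
  - apply Hstar_H; auto.
  - right; apply cusp_None.
  - rewrite E, t_None; auto.
  - rewrite mob_H in Eg by (auto; apply (sg_det G HG); auto); discriminate.
Qed.

Lemma yt_val (a : C) : inH a ->
  (t (Some a) = None /\ yt a = 0) \/ exists v, t (Some a) = Some v /\ v <> 0 /\ yt a = (tstar / v)%C.
Proof.
  intros Ha; pose proof (t_nz a Ha) as N; unfold yt; destruct (t (Some a)) as [v|]; simpl.
  - right; exists v; split; auto; split; [congruence|reflexivity].
  - left; split; auto; ring.
Qed.

Lemma yt_zero (a : C) : inH a -> yt a = 0 -> t (Some a) = None.
Proof.
  intros Ha E; destruct (yt_val a Ha) as [[E1 _]|[v [_ [Nv Ev]]]]; auto.
  exfalso; apply Nst; replace tstar with (tstar / v * v)%C by (field; auto); rewrite <- Ev, E; ring.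
Qed.

Lemma yt_one (a : C) : inH a -> yt a = 1 -> t (Some a) = Some tstar.
Proof.
  intros Ha E; destruct (yt_val a Ha) as [[_ E1]|[v [E1 [Nv Ev]]]].
  - exfalso; apply C1_nz; congruence.
  - rewrite E1; f_equal; replace v with (yt a * v)%C by (rewrite E; ring); rewrite Ev; field; auto.
Qed.

Lemma yt_eq (a b : C) : inH a -> inH b -> yt a = yt b -> t (Some a) = t (Some b).
Proof.
  intros Ha Hb E; destruct (yt_val a Ha) as [[E1 E2]|[v [E1 [Nv E2]]]].
  - rewrite E1; symmetry; apply yt_zero; auto; congruence.
  - destruct (yt_val b Hb) as [[E3 E4]|[v' [E3 [Nv' E4]]]].
    + rewrite E3; apply yt_zero; auto; congruence.
    + rewrite E1, E3; f_equal.
      replace v with (tstar / (tstar / v))%C by (field; auto).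
      rewrite <- E2, E, E4; field; auto.
Qed.

Lemma yt_hol (a : C) : inH a -> holomorphic_at yt a.
Proof.
  intros Ha; apply hol_mult; [apply hol_const|].
  destruct (hm_mero _ _ Hh a Ha) as [H1 H2]; destruct (t (Some a)) as [v|] eqn:E.
  - destruct (H1 ltac:(discriminate)) as [L Hf]; apply locally_near in L.
    apply (hol_ext_near (fun z => / fin_part (t (Some z)))%C).
    + revert L; apply near_mono; intros z Hz; destruct (t (@Some C z)) eqn:Ez; [reflexivity|contradiction (Hz Ez)].
    + apply hol_inv; auto; rewrite E; simpl; pose proof (t_nz a Ha); congruence.
  - apply H2; auto.
Qed.

Lemma yt_inv (g : mat2) (a : C) : G g -> inH a -> yt (mobC g a) = yt a.
Proof.
  intros Gg Ha; unfold yt; rewrite <- mob_H by (auto; apply (sg_det G HG); auto).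
  rewrite (hm_inv _ _ Hh); auto using Hstar_H.
Qed.

Lemma equiv_mobC (a b : C) : inH a -> equiv G (Some a) (Some b) -> exists g, G g /\ mobC g a = b.
Proof.
  intros Ha [g [Gg E]]; exists g; split; auto.
  rewrite mob_H in E by (auto; apply (sg_det G HG); auto); congruence.
Qed.

Lemma yt_inj (a b : C) : inH a -> inH b -> yt a = yt b -> exists g, G g /\ mobC g a = b.
Proof.
  intros Ha Hb E; apply equiv_mobC; auto; apply (hm_inj _ _ Hh); auto using Hstar_H, yt_eq.
Qed.

Lemma t_equiv (s s' : P1) : Hstar G s -> equiv G s s' -> t s' = t s.
Proof. intros Hs [g [Gg <-]]; apply (hm_inv _ _ Hh); auto. Qed.

Lemma vertex_order (v : P1) (n : option nat) : stabilizer_order G v n -> inH_pt v -> exists m, n = Some m.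
Proof.
  intros S Hv; destruct n as [m|]; [eauto|]; exfalso; apply (cusp_not_inH v); auto.
Qed.

Lemma vertex_cusp (v s : P1) (n : option nat) : stabilizer_order G v n -> equiv G v s -> cusp G s -> n = None.
Proof.
  intros S [g [Gg E]] Cs; destruct n as [m|]; auto; exfalso.
  destruct S as [_ [Hv _]]; apply (cusp_not_inH s); auto; rewrite <- E; apply mob_inH; auto.
Qed.

Lemma fixed_values (s : P1) : fixed_point G s ->
  (t s = Some tstar /\ equiv G vA s) \/ (t s = None /\ equiv G vB s) \/ t s = Some (RtoC 0).
Proof.
  intros F; destruct (tg_classes _ _ _ _ _ _ _ HT s F) as [E|[E|E]].
  - left; split; auto; rewrite (t_equiv vA); auto; apply (tg_fixA _ _ _ _ _ _ _ HT).
  - right; left; split; auto; rewrite (t_equiv vB); auto; apply (tg_fixB _ _ _ _ _ _ _ HT).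
  - right; right; rewrite (t_equiv vC); auto; apply (tg_fixC _ _ _ _ _ _ _ HT).
Qed.

Lemma cusp_fixed (s : P1) : cusp G s -> fixed_point G s.
Proof.
  intros Cs; split; [right; auto|]; destruct Cs as [g [Gg [[_ [N1 N2]] Fg]]]; exists g; auto.
Qed.

Lemma cusp_values (s : P1) : cusp G s ->
  (t s = Some tstar /\ nA = None) \/ (t s = None /\ nB = None) \/ t s = Some (RtoC 0).
Proof.
  intros Cs; destruct (fixed_values s (cusp_fixed s Cs)) as [[E F]|[[E F]|E]]; auto.
  - left; split; auto; apply (vertex_cusp vA s); auto; apply (tg_ordA _ _ _ _ _ _ _ HT).
  - right; left; split; auto; apply (vertex_cusp vB s); auto; apply (tg_ordB _ _ _ _ _ _ _ HT).
Qed.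

(** A cusp is a fixed point, so it lies in one of the three classes and [t] takes there a special
    value; any other value must come from the upper half plane. *)
Lemma yt_surj (v : C) : v <> 0 -> v <> 1 -> exists a, inH a /\ yt a = v.
Proof.
  intros N0 N1; destruct (hm_surj _ _ Hh (Some (tstar / v)%C)) as [s [Hs E]].
  assert (Nv : (tstar / v)%C <> 0).
  { intros K; apply Nst; replace tstar with (tstar / v * v)%C by (field; auto); rewrite K; ring. }
  destruct Hs as [Hs|Cs].
  - destruct s as [a|]; [|destruct Hs]; exists a; split; auto.
    unfold yt; rewrite E; simpl; field; auto.
  - exfalso; destruct (cusp_values s Cs) as [[K _]|[[K _]|K]]; rewrite E in K; try discriminate.
    + apply N1; assert (K' : (tstar / v)%C = tstar) by congruence; replace v with (tstar / (tstar / v))%C by (field; auto).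
      rewrite K'; field; auto.
    + apply Nv; congruence.
Qed.

Lemma yt_factor (a : C) : inH a -> exists m g, (0 < m)%nat /\ near a (holomorphic_at g) /\ g a <> 0 /\
  near a (fun z => (yt z - yt a)%C = ((z - a) ^ m * g z)%C).
Proof.
  intros Ha; set (f := fun z => (yt z - yt a)%C).
  assert (Hf : forall z, inH z -> holomorphic_at f z).
  { intros z Hz; apply hol_minus; [apply yt_hol; auto|apply hol_const]. }
  destruct (order_dichotomy f a) as [Z|[m [g [Hg [g0 E]]]]].
  - generalize (inH_near a Ha); apply near_mono; auto.
  - exfalso.
    assert (K : forall z, inH z -> yt z = yt a).
    { intros z Hz; apply Ceq_minus; exact (identity_theorem inH f a z inH_convex inH_opn Hf Ha Z Hz). }
    (* Local constancy would spread over the whole half plane, contradicting that 2 and 3 are both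
       values. *)
    destruct (yt_surj 2) as [z2 [H2 E2]]; try (intros E; apply RtoC_inj in E; lra).
    destruct (yt_surj 3) as [z3 [H3 E3]]; try (intros E; apply RtoC_inj in E; lra).
    rewrite K in E2, E3 by auto; rewrite E2 in E3; apply RtoC_inj in E3; lra.
  - exists m, g; split; [|split; [auto|split; [auto|apply near_all; auto]]].
    destruct m; [|lia]; exfalso; apply g0; pose proof (E a) as K; unfold f in K; simpl in K.
    rewrite Cmult_1_l in K; rewrite <- K; ring.
Qed.

Lemma stab_trivial (a : C) : inH a -> yt a <> 0 -> yt a <> 1 ->
  forall h, G h -> mobC h a = a -> h = mid \/ h = mopp mid.
Proof.
  intros Ha N0 N1 h Gh Fh; apply NNPP; intros K; apply not_or_and in K; destruct K as [K1 K2].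
  assert (F : fixed_point G (Some a)).
  { split; [apply Hstar_H; auto|]; exists h; repeat split; auto.
    rewrite mob_H by (auto; apply (sg_det G HG); auto); congruence. }
  destruct (fixed_values _ F) as [[E _]|[[E _]|E]].
  - apply N1; unfold yt; rewrite E; simpl; field; auto.
  - apply N0; unfold yt; rewrite E; simpl; ring.
  - apply (t_nz a Ha); auto.
Qed.

Lemma yt_reg (a : C) : inH a -> yt a <> 0 -> yt a <> 1 -> C_derive yt a <> 0.
Proof.
  intros Ha N0 N1; destruct (yt_factor a Ha) as [m [g [Hm [Hg [g0 E]]]]].
  (* The stabiliser in SL(2,R) is just [mid] and [mopp mid], that is [2 * 1] matrices. *)
  assert (m1 : m = 1%nat).
  { apply (ramification_order G yt a m 1 g (mid :: mopp mid :: nil)); auto.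
    - intros; apply yt_inv; auto.
    - intros; apply yt_inj; auto.
    - repeat constructor; simpl; [intros [K|[]]|auto]; apply (f_equal ma) in K; simpl in K; lra.
    - intros h; simpl; split.
      + intros [<-|[<-|[]]].
        * split; [apply (sg_one G HG)|unfold mobC, autJ, mid; simpl; field].
        * split; [apply (sg_opp G HG), (sg_one G HG)|].
          unfold mobC, autJ, mid; simpl; rewrite Ropp_0; field.
          intros K; apply RtoC_inj in K; lra.
      + intros [Gh Fh]; destruct (stab_trivial a Ha N0 N1 h Gh Fh); auto. }
  subst m; assert (D : Cd yt a (g a)).
  { apply (Cd_ext_near (fun z => (z - a) ^ 1 * g z + yt a)%C).
    - revert E; apply near_mono; intros z Ez; rewrite <- Ez; ring.
    - eapply Cd_eqn.
      + apply Cd_plus; [|apply Cd_const]; apply Cd_mult; [|apply hol_Cd, (near_here _ _ Hg)].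
        apply (Cd_pow (fun z => z - a)%C), Cd_minus; [apply Cd_id|apply Cd_const].
      + cbv beta; simpl; ring. }
  rewrite (Cd_C_derive _ _ _ D); auto.
Qed.

(** The order of the stabiliser is given at the representative [a0]. The expansion there is pulled
    back along [g0], where [mobC_diff] contributes the nonvanishing factor
    [(autJ g0 z * autJ g0 a)^n]. *)
Lemma yt_elliptic (a a0 : C) (n : nat) (g0 : mat2) : inH a -> inH a0 -> G g0 -> mobC g0 a = a0 ->
  stabilizer_order G (Some a0) (Some n) -> exists g, (2 <= n)%nat /\ near a (holomorphic_at g) /\ g a <> 0 /\
    near a (fun z => (yt z - yt a)%C = ((z - a) ^ n * g z)%C).
Proof.
  intros Ha Ha0 G0 E0 [Hn [_ [l [Nl [Ll Hl]]]]].
  pose proof (sg_det G HG g0 G0) as D0.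
  destruct (yt_factor a0 Ha0) as [m [g [Hm [Hg [gn0 E]]]]].
  assert (mn : m = n).
  { apply (ramification_order G yt a0 m n g l); auto.
    - intros; apply yt_inv; auto.
    - intros; apply yt_inj; auto.
    - intros h; rewrite Hl; split; intros [Gh Fh]; split; auto.
      + rewrite mob_H in Fh by (auto; apply (sg_det G HG); auto); congruence.
      + rewrite mob_H by (auto; apply (sg_det G HG); auto); congruence. }
  subst m; pose proof (autJ_nz g0 a D0 Ha) as Na.
  assert (Cm : Ccont (mobC g0) a) by (eapply Cd_cont, Cd_mobC; auto).
  exists (fun z => g (mobC g0 z) / (autJ g0 z * autJ g0 a) ^ n)%C; split; [auto|split; [|split]].
  - assert (N1 : near a (fun z => holomorphic_at g (mobC g0 z)))
      by (apply (near_comp (mobC g0) a (holomorphic_at g)); auto; rewrite E0; auto).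
    generalize (near_and _ _ _ N1 (inH_near a Ha)); apply near_mono; intros z [H1 H2].
    pose proof (autJ_nz g0 z D0 H2) as Nz.
    apply hol_div.
    + apply (hol_comp (mobC g0) g); auto; eapply Cd_hol, Cd_mobC; auto.
    + apply (hol_pow (fun z => autJ g0 z * autJ g0 a)%C), hol_mult; [eapply Cd_hol, Cd_autJ|apply hol_const].
    + apply Cpow_nz, Cmult_neq_0; auto.
  - rewrite E0; intros K; apply gn0.
    assert (Np : ((autJ g0 a * autJ g0 a) ^ n)%C <> 0) by (apply Cpow_nz, Cmult_neq_0; auto).
    replace (g a0) with (g a0 / (autJ g0 a * autJ g0 a) ^ n * (autJ g0 a * autJ g0 a) ^ n)%C by (field; auto).
    rewrite K; ring.
  - assert (N2 : near a (fun z => (yt (mobC g0 z) - yt a0)%C = ((mobC g0 z - a0) ^ n * g (mobC g0 z))%C)).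
    { apply (near_comp (mobC g0) a (fun z => (yt z - yt a0)%C = ((z - a0) ^ n * g z)%C)); auto; rewrite E0; auto. }
    generalize (near_and _ _ _ N2 (inH_near a Ha)); apply near_mono; intros z [H1 H2].
    pose proof (autJ_nz g0 z D0 H2) as Nz.
    rewrite <- E0 in H1; rewrite !yt_inv in H1 by auto.
    rewrite H1, mobC_diff by auto.
    assert (Np : ((autJ g0 z * autJ g0 a) ^ n)%C <> 0) by (apply Cpow_nz, Cmult_neq_0; auto).
    unfold Cdiv; rewrite !Cpow_mult_l, Cpow_inv by (apply Cmult_neq_0; auto).
    rewrite <- Cpow_mult_l; field; auto.
Qed.

Lemma vertex_point (v : P1) (a : C) (n : option nat) : inH a -> Hstar G v -> stabilizer_order G v n ->
  t (Some a) = t v -> exists m a0 g0, n = Some m /\ v = Some a0 /\ inH a0 /\ G g0 /\ mobC g0 a = a0.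
Proof.
  intros Ha Hv S E; destruct (hm_inj _ _ Hh (Some a) v (Hstar_H a Ha) Hv E) as [g0 [G0 E0]].
  pose proof (sg_det G HG g0 G0) as D0; rewrite mob_H in E0 by auto.
  assert (Ha0 : inH (mobC g0 a)) by (apply mobC_H; auto).
  destruct (vertex_order v n S) as [m Em]; [rewrite <- E0; auto|].
  exists m, (mobC g0 a), g0; auto.
Qed.

Lemma cusp_behaviour (s : mat2) : mdet s = 1 -> cusp G (mob s None) ->
  (t (mob s None) = Some tstar -> vanishes_at_icusp (fun z => 1 - yt (mobC s z))%C) /\
  (t (mob s None) = None -> vanishes_at_icusp (fun z => yt (mobC s z))) /\
  (t (mob s None) = Some (RtoC 0) -> cusp_infinite (fun z => yt (mobC s z))).
Proof.
  intros D Cs; pose proof (hm_cusp _ _ Hh _ Cs) as K.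
  assert (Pst : 0 < Cmod tstar) by (apply Cmod_gt_0; auto).
  assert (K' : forall eps, 0 < eps -> exists Y, forall z, Y < Im z ->
     inH (mobC s z) /\ P1_ball (t (mob s None)) eps (t (Some (mobC s z)))).
  { intros eps He; destruct (K eps He) as [M HM]; destruct (height_high s M D) as [Y [PY HY]].
    exists Y; intros z Hz; assert (Hm : inH (mobC s z)) by (apply mobC_H; auto; unfold inH; lra).
    split; auto. }
  split; [|split]; intros Et; rewrite Et in K'.
  - intros e He; destruct (K' (Rmin (Cmod tstar / 2) (e * (Cmod tstar / 2)))) as [Y HY].
    { apply Rmin_pos; [lra|apply Rmult_lt_0_compat; lra]. }
    exists Y; intros z Hz; destruct (HY z Hz) as [Hm B].
    pose proof (Rmin_l (Cmod tstar / 2) (e * (Cmod tstar / 2))).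
    pose proof (Rmin_r (Cmod tstar / 2) (e * (Cmod tstar / 2))).
    destruct (yt_val _ Hm) as [[E1 _]|[v [E1 [Nv E2]]]]; rewrite E1 in B; simpl in B; [contradiction|].
    rewrite E2; replace (1 - tstar / v)%C with ((v - tstar) / v)%C by (field; auto).
    rewrite Cmod_div by auto.
    assert (Bv : Cmod tstar / 2 <= Cmod v).
    { pose proof (Cmod_tri_inv tstar v) as T; rewrite Cmod_m_sym in T; lra. }
    apply Rlt_div_l; [lra|].
    apply Rlt_le_trans with (e * (Cmod tstar / 2)); [lra|apply Rmult_le_compat_l; lra].
  - intros e He; destruct (K' (e / Cmod tstar)) as [Y HY]; [apply Rdiv_lt_0_compat; auto|].
    exists Y; intros z Hz; destruct (HY z Hz) as [Hm B].
    destruct (yt_val _ Hm) as [[E1 E2]|[v [E1 [Nv E2]]]]; rewrite E1 in B; simpl in B; rewrite E2.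
    + rewrite Cmod_0; auto.
    + rewrite Cmod_div by auto; assert (Pv : 0 < Cmod v) by (apply Cmod_gt_0; auto).
      apply Rlt_div_l; auto.
      replace (/ (e / Cmod tstar)) with (Cmod tstar / e) in B by (field; lra).
      apply Rlt_div_l in B; auto; lra.
  - intros M; set (M' := Rabs M + 1); assert (PM : 0 < M') by (pose proof (Rabs_pos M); unfold M'; lra).
    destruct (K' (Cmod tstar / M')) as [Y HY]; [apply Rdiv_lt_0_compat; auto|].
    exists Y; intros z Hz; destruct (HY z Hz) as [Hm B].
    destruct (yt_val _ Hm) as [[E1 _]|[v [E1 [Nv E2]]]]; rewrite E1 in B; simpl in B; [contradiction|].
    replace (v - 0)%C with v in B by ring.
    rewrite E2, Cmod_div by auto; assert (Pv : 0 < Cmod v) by (apply Cmod_gt_0; auto).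
    apply Rlt_div_r in B; auto.
    apply Rlt_le_trans with M'; [pose proof (Rle_abs M); unfold M'; lra|].
    apply Rle_div_r; auto; lra.
Qed.

Lemma cusp_periodic (s : mat2) : mdet s = 1 -> cusp G (mob s None) ->
  exists w, periodic w (fun z => yt (mobC s z)).
Proof.
  intros D Cs; destruct (cusp_translation G s HG D Cs) as [g [w [Gg [Hw E]]]].
  exists w; split; auto; intros z Hz; rewrite E by auto; apply yt_inv; auto; apply mobC_H; auto.
Qed.

Lemma cusp_matrix (v : P1) : cusp G v -> exists s, mdet s = 1 /\ mob s None = v.
Proof.
  intros Cv; destruct v as [z|].
  - destruct Cv as [g [Gg [Pg Fg]]].
    pose proof (parabolic_fixed_real g z (sg_det G HG g Gg) Pg Fg) as Iz.
    exists (Mat2 (Re z) (-1) 1 0); split; [unfold mdet; simpl; ring|].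
    simpl; destruct (Req_EM_T 1 0); [lra|]; f_equal; destruct z as [x v]; simpl in *; subst.
    unfold RtoC; f_equal; field.
  - exists mid; split; [unfold mdet, mid; simpl; ring|apply mob_None_mid].
Qed.

Lemma mobC_mid (z : C) : mobC mid z = z.
Proof. unfold mobC, autJ, mid; simpl; field. Qed.

Lemma yt_infinite : cusp_infinite yt.
Proof.
  destruct (cusp_behaviour mid) as [_ [_ K]].
  - unfold mdet, mid; simpl; ring.
  - rewrite mob_None_mid; apply cusp_None.
  - rewrite mob_None_mid in K; intros M; generalize (K t_None M); apply near_icusp_mono.
    intros z; rewrite mobC_mid; auto.
Qed.

(** Suppose [1 / y] had order at least 2 in [q]. Twisting by a primitive root of unity gives two
    arbitrarily high points with equal [y] and different [q]. The group element relating them cannot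
    be a translation, since [q] would be preserved; and with [c] nonzero it cannot join two high
    points, as [|c|] is bounded below. *)
Lemma yt_simple (T : C -> C) : near 0 (holomorphic_at T) -> T 0 = 0 ->
  (exists Y, forall tau, Y < Im tau -> (/ yt tau)%C = T (qexp ups tau)) -> C_derive T 0 <> 0.
Proof.
  intros HT0 T0 [Y ET].
  pose proof ups_pos as Hw; assert (Nw : RtoC ups <> 0) by (apply RtoC_nz; lra).
  destruct (upper_near_icusp _ (yt_infinite 0)) as [Y0 [PY0 HY0]].
  set (Y1 := Rmax Y Y0).
  assert (High : forall tau, Y1 < Im tau -> inH tau /\ yt tau <> 0 /\ (/ yt tau)%C = T (qexp ups tau)).
  { intros tau Ht; unfold Y1 in Ht; pose proof (Rmax_l Y Y0); pose proof (Rmax_r Y Y0).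
    specialize (HY0 tau ltac:(lra)); repeat split; [unfold inH; lra| |apply ET; lra].
    apply Cmod_gt_0; auto. }
  destruct (cusp_factor T HT0 T0) as [m [g [Hm [Hg [g0 Eg]]]]].
  { intros N; destruct (qexp_near ups _ Hw N) as [Y2 K2]; destruct (high_point (Rmax Y1 Y2)) as [tau [Ht _]].
    pose proof (Rmax_l Y1 Y2); pose proof (Rmax_r Y1 Y2).
    destruct (High tau ltac:(lra)) as [_ [Ny E]]; rewrite K2 in E by lra.
    apply C1_nz; replace (RtoC 1) with (/ yt tau * yt tau)%C by (field; auto); rewrite E; ring. }
  destruct (Nat.eq_dec m 1) as [->|Nm].
  { assert (D : Cd T 0 (g 0)).
    { apply (Cd_ext (fun q => q ^ 1 * g q)%C); [intros; auto|]; eapply Cd_eqn.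
      - apply Cd_mult; [apply (Cd_pow (fun q => q)), Cd_id|apply hol_Cd, (near_here _ _ Hg)].
      - cbv beta; simpl; ring. }
    rewrite (Cd_C_derive _ _ _ D); auto. }
  exfalso.
  set (zeta := Cexp (tpi * INR 1 / INR m)%C).
  assert (Zm : (zeta ^ m)%C = 1) by (apply root_of_unity_pow; lia).
  assert (Z1 : zeta <> 1).
  { intros E; assert (1%nat = 0%nat); [|lia]; apply (root_of_unity_inj m); try lia.
    change (zeta = Cexp (tpi * INR 0 / INR m)%C).
    replace (tpi * INR 0 / INR m)%C with (RtoC 0); [rewrite Cexp_0; auto|].
    simpl; field; apply RtoC_nz, not_0_INR; lia. }
  assert (Eg' : near 0 (fun z => T z = ((z - 0) ^ m * g z)%C)).
  { apply near_all; intros z; rewrite Eg; replace (z - 0)%C with z by ring; auto. }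
  destruct (twist T g 0 zeta m Hm Hg g0 Eg' Zm) as [w [v [Gr [_ [_ Hn]]]]].
  destruct (lower_left_bounded_below G ups HG HD Hw translations) as [eps [He Heps]].
  (* If [|c| >= eps], the heights satisfy [Im tau * Im tau' <= 1 / eps^2]; heights above [2 / eps]
     violate this. *)
  set (Y2 := Rmax (Rmax Y1 1) (2 / eps)).
  pose proof (Rmax_l (Rmax Y1 1) (2 / eps)); pose proof (Rmax_r (Rmax Y1 1) (2 / eps)).
  pose proof (Rmax_l Y1 1); pose proof (Rmax_r Y1 1); fold Y2 in H, H0.
  destruct (invn_small (exp (- (2 * PI) * Y2 / ups)) (exp_pos _)) as [N HN].
  specialize (HN N (le_n _)); destruct (Hn N) as [B1 [B2 [Nz [NGr [Ex Ek]]]]].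
  replace (w N - 0)%C with (w N) in * by ring; replace (v N - 0)%C with (v N) in * by ring.
  assert (Nzeta : zeta <> 0) by apply Cexp_nz.
  assert (Nv : v N <> 0).
  { intros E; rewrite E in Ek; apply (Cmult_neq_0 zeta (w N * Gr (w N))%C); auto.
    - apply Cmult_neq_0; auto.
    - rewrite <- Ek; ring. }
  destruct (qexp_surj ups (w N) ltac:(lra) Nz) as [tau Et]; destruct (qexp_surj ups (v N) ltac:(lra) Nv) as [tau' Et'].
  assert (Ht : Y2 < Im tau) by (apply (qexp_lt ups); auto; rewrite Et; lra).
  assert (Ht' : Y2 < Im tau') by (apply (qexp_lt ups); auto; rewrite Et'; lra).
  destruct (High tau ltac:(lra)) as [Hh1 [Ny1 E1]]; destruct (High tau' ltac:(lra)) as [Hh2 [Ny2 E2]].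
  assert (Ey : yt tau = yt tau').
  { rewrite Et in E1; rewrite Et', Ex, <- E1 in E2.
    replace (yt tau) with (/ / yt tau)%C by (field; auto); rewrite <- E2; field; auto. }
  destruct (yt_inj tau tau' Hh1 Hh2 Ey) as [h [Gh Eh]].
  destruct (Req_dec (mc h) 0) as [Ec|Nc].
  - assert (Fh : G h /\ mob h None = None).
    { split; auto; simpl; destruct (Req_EM_T (mc h) 0); congruence. }
    apply (proj2 Hwid) in Fh; destruct Fh as [k Hk].
    assert (Eshift : tau' = (tau + IZR k * ups)%C).
    { rewrite <- Eh; destruct Hk as [->| ->].
      - unfold mobC, autJ; simpl; rewrite RtoC_mult; field.
      - rewrite mobC_opp; unfold mobC, autJ; simpl.
        + rewrite RtoC_mult; field.
        + replace (0 * tau + 1)%C with (RtoC 1) by ring; apply C1_nz. }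
    assert (Ewv : w N = v N).
    { rewrite <- Et, <- Et', Eshift.
      rewrite (periodic_Z (qexp ups) ups 0); auto.
      - intros z _; unfold qexp; replace (tpi * (z + ups) / ups)%C with (tpi * z / ups + tpi)%C by (field; auto).
        apply Cexp_period. }
    rewrite <- Ewv in Ek; apply Z1.
    replace zeta with (zeta * (w N * Gr (w N)) / (w N * Gr (w N)))%C by (field; auto).
    rewrite <- Ek; field; auto.
  - specialize (Heps h Gh Nc).
    pose proof (sg_det G HG h Gh) as Dh.
    pose proof (Im_mobC h tau Dh Hh1) as I1; rewrite Eh in I1.
    pose proof (autJ_nz h tau Dh Hh1) as Nj.
    assert (J2 : (mc h * Im tau) ^ 2 <= Cmod (autJ h tau) ^ 2).
    { rewrite (Cmod2_alt (autJ h tau)), autJ_im; pose proof (pow2_ge_0 (Re (autJ h tau))); lra. }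
    assert (Pj : 0 < Cmod (autJ h tau) ^ 2) by (apply pow_lt, Cmod_gt_0; auto).
    assert (I2 : Im tau' * Cmod (autJ h tau) ^ 2 = Im tau) by (rewrite I1; field; intros K0; rewrite K0 in Pj; lra).
    assert (c2 : eps * eps <= mc h * mc h).
    { replace (mc h * mc h) with (Rabs (mc h) * Rabs (mc h)); [apply Rmult_le_compat; lra|].
      rewrite <- Rabs_mult; apply Rabs_pos_eq; nra. }
    assert (Q : 2 / eps < Im tau) by lra; apply Rlt_div_l in Q; auto.
    assert (Q' : 2 / eps < Im tau') by lra; apply Rlt_div_l in Q'; auto.
    assert (P1' : 0 < Im tau) by exact Hh1.
    assert (L1 : Im tau' * (mc h * Im tau) ^ 2 <= Im tau) 
      by (rewrite <- I2 at 2; apply Rmult_le_compat_l; [lra|auto]).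
    assert (L2 : Im tau' * (eps * eps) * Im tau * Im tau <= Im tau).
    { eapply Rle_trans; [|exact L1].
      replace (Im tau' * (mc h * Im tau) ^ 2) with (Im tau' * (mc h * mc h) * Im tau * Im tau) by ring.
      repeat apply Rmult_le_compat_r; try lra.
      apply Rmult_le_compat_l; lra. }
    assert (4 < Im tau' * eps * (Im tau * eps)) by nra.
    nra.
Qed.

Theorem tri_fun_of_hauptmodul : tri_fun G (inv_order nA) (inv_order nB) ups yt.
Proof.
  constructor.
  - exact HG.
  - exact yt_hol.
  - exact yt_inv.
  - exact yt_inj.
  - exact yt_surj.
  - exact yt_reg.
  - intros a Ha E.
    destruct (vertex_point vA a nA Ha) as [m [a0 [g0 [Em [Ev [Ha0 [G0 E0]]]]]]].
    + apply (tg_fixA _ _ _ _ _ _ _ HT).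
    + apply (tg_ordA _ _ _ _ _ _ _ HT).
    + rewrite tA; apply yt_one; auto.
    + pose proof (tg_ordA _ _ _ _ _ _ _ HT) as S; rewrite Em, Ev in S.
      destruct (yt_elliptic a a0 m g0 Ha Ha0 G0 E0 S) as [g [Hm [Hg [gn Eg]]]].
      exists m, (fun z => - g z)%C; rewrite Em; repeat split; auto.
      * revert Hg; apply near_mono; intros; apply hol_opp; auto.
      * intros K; apply gn; replace (g a) with (- - g a)%C by ring; rewrite K; ring.
      * revert Eg; apply near_mono; intros z Ez; rewrite E in Ez.
        replace (1 - yt z)%C with (- (yt z - 1))%C by ring; rewrite Ez; ring.
  - intros a Ha E.
    destruct (vertex_point vB a nB Ha) as [m [a0 [g0 [Em [Ev [Ha0 [G0 E0]]]]]]].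
    + apply (tg_fixB _ _ _ _ _ _ _ HT).
    + apply (tg_ordB _ _ _ _ _ _ _ HT).
    + rewrite tB; apply yt_zero; auto.
    + pose proof (tg_ordB _ _ _ _ _ _ _ HT) as S; rewrite Em, Ev in S.
      destruct (yt_elliptic a a0 m g0 Ha Ha0 G0 E0 S) as [g [Hm [Hg [gn Eg]]]].
      exists m, g; rewrite Em; repeat split; auto.
      revert Eg; apply near_mono; intros z Ez; rewrite E in Ez; rewrite <- Ez; ring.
  - generalize (tg_ordA _ _ _ _ _ _ _ HT); generalize nA; intros [m|] S; [left|right; split; auto].
    + destruct S as [_ [Hv _]]; destruct vA as [a|]; [|destruct Hv]; exists a; split; auto.
      unfold yt; rewrite tA; simpl; field; auto.
    + destruct (cusp_matrix vA S) as [s [D Es]].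
      destruct (cusp_periodic s D) as [w Hw]; [rewrite Es; auto|].
      exists s, w; split; [auto|split; auto].
      apply cusp_behaviour; auto; rewrite Es; auto.
  - generalize (tg_ordB _ _ _ _ _ _ _ HT); generalize nB; intros [m|] S; [left|right; split; auto].
    + destruct S as [_ [Hv _]]; destruct vB as [a|]; [|destruct Hv]; exists a; split; auto.
      unfold yt; rewrite tB; simpl; ring.
    + destruct (cusp_matrix vB S) as [s [D Es]].
      destruct (cusp_periodic s D) as [w Hw]; [rewrite Es; auto|].
      exists s, w; split; [auto|split; auto].
      apply cusp_behaviour; auto; rewrite Es; auto.
  - intros s D Cs; destruct (cusp_periodic s D Cs) as [w Hw]; exists w; split; auto.
    destruct (cusp_behaviour s D Cs) as [K1 [K2 K3]].
    destruct (cusp_values _ Cs) as [[E _]|[[E _]|E]]; auto.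
  - split; [apply ups_pos|]; intros z Hz.
    replace (z + ups)%C with (mobC (Mat2 1 (IZR 1 * ups) 0 1) z).
    + apply yt_inv; auto; apply translations.
    + unfold mobC, autJ; simpl; rewrite RtoC_mult; field.
  - exact yt_infinite.
  - exact yt_simple.
Qed.
End FromHauptmodul.

(** * Continuation of the formal forms *)

Lemma eq_on_H (f g : C -> C) : holomorphic_H f -> holomorphic_H g -> near_icusp (fun z => f z = g z) ->
  forall z, inH z -> f z = g z.
Proof.
  intros Hf Hg [Y E] z Hz; destruct (high_point Y) as [z0 [H0 K0]].
  apply Ceq_minus, (identity_theorem inH (fun z => f z - g z)%C z0 z inH_convex inH_opn); auto.
  - intros v Hv; apply hol_minus; auto.
  - generalize (upper_near z0 Y H0); apply near_mono; intros v Hv; rewrite E by auto; ring.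
Qed.

(** Their difference is a multiple of [tpi], while its modulus is below 2 near the cusp. *)
Lemma log_unique (l1 l2 : C -> C) : near_icusp (fun z => Cexp (l1 z) = Cexp (l2 z)) ->
  vanishes_at_icusp l1 -> vanishes_at_icusp l2 -> near_icusp (fun z => l1 z = l2 z).
Proof.
  intros E V1 V2.
  generalize (near_icusp_and _ _ E (near_icusp_and _ _ (V1 1 Rlt_0_1) (V2 1 Rlt_0_1))).
  apply near_icusp_mono; intros z [H [H1 H2]].
  destruct (Cexp_eq_1 (l1 z - l2 z)%C) as [k Hk].
  { rewrite Cexp_minus, H; field; apply Cexp_nz. }
  apply Ceq_minus; rewrite Hk; destruct (Z.eq_dec k 0) as [->|Nk]; [ring|exfalso].
  assert (L : Cmod (l1 z - l2 z)%C < 2).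
  { replace (l1 z - l2 z)%C with (l1 z + - l2 z)%C by ring.
    eapply Rle_lt_trans; [apply Cmod_triangle|rewrite Cmod_opp; lra]. }
  assert (K : 1 <= Rabs (IZR k)) by (rewrite <- abs_IZR; apply IZR_le; lia).
  assert (P3 : 3 < PI) by (pose proof PI2_3_2; lra).
  rewrite Hk, Cmod_mult, Cmod_R in L.
  assert (Et : Cmod tpi = 2 * PI).
  { unfold tpi; rewrite !Cmod_mult, !Cmod_R, Cmod_Ci, !Rabs_pos_eq by lra; ring. }
  rewrite Et in L; nra.
Qed.

Definition tends (f : C -> C) (c : C) : Prop := vanishes_at_icusp (fun z => f z - c)%C.

Lemma tends_comp (F f : C -> C) (c : C) : tends f c -> Ccont F c -> tends (fun z => F (f z)) (F c).
Proof.
  intros Hf HF e He; destruct (HF e He) as [d [Hd K]].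
  generalize (Hf d Hd); apply near_icusp_mono; intros z Hz; apply K; auto.
Qed.

Lemma tends_mult (f g : C -> C) : tends f 1 -> tends g 1 -> tends (fun z => f z * g z)%C 1.
Proof.
  intros Hf Hg e He; set (d := Rmin 1 (e / 3)).
  assert (Pd : 0 < d) by (apply Rmin_pos; lra).
  pose proof (Rmin_l 1 (e / 3)); pose proof (Rmin_r 1 (e / 3)).
  generalize (near_icusp_and _ _ (Hf d Pd) (Hg d Pd)); apply near_icusp_mono; intros z [H1 H2].
  replace (f z * g z - 1)%C with ((f z - 1) * (g z - 1) + ((f z - 1) + (g z - 1)))%C by ring.
  pose proof (Cmod_triangle ((f z - 1) * (g z - 1)) ((f z - 1) + (g z - 1))).
  pose proof (Cmod_triangle (f z - 1) (g z - 1)); rewrite Cmod_mult in H3.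
  pose proof (Cmod_ge_0 (f z - 1)); pose proof (Cmod_ge_0 (g z - 1)).
  fold d in H, H0; assert (Cmod (f z - 1)%C * Cmod (g z - 1)%C <= d) by nra.
  lra.
Qed.

Lemma tends_ext (f g : C -> C) (c : C) : near_icusp (fun z => f z = g z) -> tends g c -> tends f c.
Proof.
  intros E Hg e He; generalize (near_icusp_and _ _ E (Hg e He)); apply near_icusp_mono.
  intros z [-> Hz]; auto.
Qed.

Lemma tends_qexp (F : C -> C) (w : R) (c : C) : 0 < w -> Ccont F 0 -> F 0 = c -> tends (fun z => F (qexp w z)) c.
Proof. intros Hw HF E e He; apply (qexp_near w (fun q => Cmod (F q - c)%C < e) Hw), (Ccont_val F 0 c HF E e He). Qed.

Lemma tends_exp (l : C -> C) (c : R) : vanishes_at_icusp l -> tends (fun z => Cexp (c * l z)%C) 1.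
Proof.
  intros V; replace (RtoC 1) with (Cexp (c * 0)%C) by (rewrite Cmult_0_r; apply Cexp_0).
  apply (tends_comp (fun v => Cexp (c * v)%C) l 0).
  - intros e He; generalize (V e He); apply near_icusp_mono; intros z Hz.
    replace (l z - 0)%C with (l z) by ring; auto.
  - apply (Ccont_exp (fun v => c * v)%C), Ccont_mult; [apply Ccont_const|apply Ccont_id].
Qed.

(** The quotient is constant on a high half plane, and its limit identifies the constant. This
    replaces any comparison of branches between products of fractional powers. *)
Lemma same_log_derivative (f g d : C -> C) :
  near_icusp (fun z => g z <> 0 /\ Cd f z (f z * d z)%C /\ Cd g z (g z * d z)%C) ->
  tends (fun z => f z / g z)%C 1 -> near_icusp (fun z => f z = g z).
Proof.
  intros [Y K] L; exists Y; intros z Hz; destruct (K z Hz) as [Ng _].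
  assert (Q : forall z', Y < Im z' -> (f z' / g z')%C = (f z / g z)%C).
  { intros z' Hz'; apply (Cd_zero_const (fun v => Y < Im v) (fun v => f v / g v)%C); auto using upper_convex.
    intros v Hv; destruct (K v Hv) as [Nv [D1 D2]].
    eapply Cd_eqn; [apply Cd_div; [exact D1|exact D2|auto]|cbv beta; field; auto]. }
  assert (E : (f z / g z)%C = 1).
  { apply Ceq_minus, Cmod_small_0; intros e He; destruct (L e He) as [Y1 K1].
    destruct (high_point (Rmax Y Y1)) as [z' [Hz' _]].
    pose proof (Rmax_l Y Y1); pose proof (Rmax_r Y Y1).
    rewrite <- (Q z') by lra; left; apply K1; lra. }
  replace (f z) with (f z / g z * g z)%C by (field; auto); rewrite E; ring.
Qed.

(* At a zero of [x] the order is [1 / al], so [x] has a holomorphic root of that order and the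
   exponents [1 - al], [1 - 2 al] become the integral powers [n - 1], [n - 2] of that root. *)
Lemma fractional_powers (x l : C -> C) (rho al : R) : holomorphic_H x ->
  (forall a, inH a -> x a = 0 -> exists n, (2 <= n)%nat /\ al = / INR n /\ zero_order x n a) ->
  (exists a, inH a /\ x a = 0) \/ al = 0 ->
  near_icusp (fun z => holomorphic_at l z /\ x z = Cexp (rho * l z)%C) ->
  exists x1 x2, continued_power l (rho * (1 - al)) x1 /\ continued_power l (rho * (1 - 2 * al)) x2.
Proof.
  intros Hx Hz Ha Hl; destruct Ha as [[a [Ha Ea]]| ->].
  2:{ exists x, x; split; (split; [auto|]); generalize Hl; apply near_icusp_mono; intros z [_ E].
    - replace (rho * (1 - 0)) with rho by ring; auto.
    - replace (rho * (1 - 2 * 0)) with rho by ring; auto. }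
  destruct (Hz a Ha Ea) as [n [Hn [En _]]].
  assert (In : INR n <> 0) by (apply not_0_INR; lia).
  assert (In' : RtoC (INR n) <> 0) by (apply RtoC_nz; auto).
  destruct (root_H n x) as [g [Hg Eg]]; [lia|auto| |].
  { intros b Hb Eb; destruct (Hz b Hb Eb) as [m [Hm [Em Z]]].
    replace n with m; auto; apply INR_eq; rewrite En in Em; rewrite <- (Rinv_inv (INR n)), Em, Rinv_inv; auto. }
  destruct (upper_near_icusp _ Hl) as [Y [PY K]].
  destruct (high_point Y) as [z0 [H0 I0]].
  set (e := fun z => Cexp (rho / INR n * l z)%C).
  assert (Ee : forall z, Y < Im z -> (e z ^ n)%C = x z).
  { intros z Hh; destruct (K z Hh) as [_ ->]; unfold e; rewrite <- Cexp_nat; f_equal; field; auto. }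
  assert (X0 : x z0 <> 0) by (destruct (K z0 H0) as [_ ->]; apply Cexp_nz).
  assert (G0 : g z0 <> 0).
  { intros E; apply X0; rewrite <- Eg, E by auto; destruct n; [lia|apply pow_0_S]. }
  (* The global root [g] and the branch [e] prescribed by [l] are both [n]-th roots of [x]; the root
     of unity between them is read off at one point. *)
  set (zeta := (e z0 / g z0)%C).
  assert (Zn : (zeta ^ n)%C = 1).
  { unfold zeta, Cdiv; rewrite Cpow_mult_l, Cpow_inv, Ee, Eg by auto; field; auto. }
  set (h := fun z => (zeta * g z)%C).
  assert (Hh : holomorphic_H h) by (intros z Iz; apply hol_mult; [apply hol_const|auto]).
  assert (Eh : forall z, Y < Im z -> h z = e z).
  { intros z Iz; apply (root_unique n (fun z => Y < Im z) x h e z0 z); auto using upper_convex, upper_opn.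
    - lia.
    - intros v Hv; apply Hh; unfold inH; lra.
    - intros v Hv; apply (hol_exp (fun v => rho / INR n * l v)%C), hol_mult; [apply hol_const|apply K; auto].
    - intros v Hv; unfold h; rewrite Cpow_mult_l, Zn, Eg by (unfold inH; lra); ring.
    - unfold h, zeta; field; auto. }
  (* The truncated subtractions are exact because [2 <= n]; in particular the second exponent is
     never negative. *)
  exists (fun z => h z ^ (n - 1))%C, (fun z => h z ^ (n - 2))%C; split; (split; [intros z Iz; apply hol_pow; auto|]);
    exists Y; intros z Iz; rewrite Eh by auto; unfold e; rewrite <- Cexp_nat; f_equal;
    rewrite minus_INR by lia; rewrite En.
  - rewrite RtoC_mult, !RtoC_minus, RtoC_inv by auto; simpl; field; auto.
  - rewrite RtoC_mult, !RtoC_minus, RtoC_mult, RtoC_inv by auto; simpl; rewrite RtoC_plus; field; auto.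
Qed.

(** In the coordinate [q] the function [W] is [cU], which is continuous at 0. *)
Lemma W_bounded (e0 e1 w Y : R) (x : C -> C) : 0 < w -> (forall z, Y < Im z -> holomorphic_at x z) ->
  (forall z, Y < Im z -> x (z + w)%C = x z) -> vanishes_at_icusp x ->
  (forall Y', exists z, Y' < Im z /\ x z <> 0) ->
  exists M, near_icusp (fun z => x z <> 0 /\ x z <> 1 /\ Cmod (W e0 e1 x z) <= M).
Proof.
  intros Hw Hx P L N; destruct (chart_limit w Y x Hw Hx P L N) as [T [g [m [Hm [Hg [g0 [ET Ex]]]]]]].
  destruct (cusp_W w Y x T g m Hw Hm Hg g0 ET Ex e0 e1) as [Y1 K1].
  pose proof (hol_cont _ _ (near_here _ _ (cU_hol w T g m Hm Hg g0 ET e0 e1))) as CU.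
  destruct (qexp_near w _ Hw (CU 1 Rlt_0_1)) as [Y2 K2].
  exists (Cmod (cU w T g m e0 e1 0) + 1), (Rmax Y1 Y2); intros z Hz.
  pose proof (Rmax_l Y1 Y2); pose proof (Rmax_r Y1 Y2).
  destruct (K1 z ltac:(lra)) as [_ [A1 [A2 [_ [_ [_ ->]]]]]]; repeat split; auto.
  specialize (K2 z ltac:(lra)); cbv beta in K2.
  set (v := cU w T g m e0 e1 (qexp w z)) in *; set (v0 := cU w T g m e0 e1 0) in *.
  replace v with (v0 + (v - v0))%C by ring; pose proof (Cmod_triangle v0 (v - v0)); lra.
Qed.

(** * The Chazy equation *)

Lemma near_icusp_near (P : C -> Prop) : near_icusp P -> near_icusp (fun z => near z P).
Proof.
  intros [Y K]; exists Y; intros z Hz; generalize (upper_near z Y Hz); apply near_mono; auto.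
Qed.

Lemma derive_hol_H (f : C -> C) : holomorphic_H f -> holomorphic_H (C_derive f).
Proof. intros Hf z Hz; apply derive_hol; generalize (inH_near z Hz); apply near_mono; auto. Qed.

Lemma chazy_next_hol (k : nat) (u v : C -> C) : holomorphic_H u -> holomorphic_H v -> holomorphic_H (chazy_next k u v).
Proof.
  intros Hu Hv z Hz; apply hol_minus; [apply derive_hol_H; auto|].
  apply hol_mult; auto; apply hol_mult; [apply hol_const|auto].
Qed.

Lemma chazy_u4_hol (u : C -> C) : holomorphic_H u -> holomorphic_H (chazy_u4 u).
Proof. intros Hu z Hz; apply hol_minus; [apply derive_hol_H; auto|apply hol_pow; auto]. Qed.

Section Chazy.
Variables (G : mat2 -> Prop) (al be ups : R) (y u : C -> C).
Hypotheses (H : tri_fun G al be ups y) (Hu : forall a, inH a -> holomorphic_at u a)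
  (Eu : forall a, inH a -> gen y a -> u a = U0 al be y a).

Lemma gen_icusp : near_icusp (fun z => inH z /\ gen y z).
Proof. destruct (y_large G al be ups y H) as [Y [_ K]]; exists Y; auto. Qed.

Lemma y_second (z : C) : inH z -> gen y z -> Cd (C_derive y) z
  (C_derive y z * (2 * u z + (1 - be)%R * (C_derive y z / y z) - (1 - al)%R * (C_derive y z / (1 - y z))))%C.
Proof.
  intros Hz Gz; pose proof (Eu z Hz Gz) as E; unfold U0, W in E.
  assert (Np : C_derive y z <> 0) by (apply (tf_reg _ _ _ _ _ H); auto; apply Gz).
  assert (N1 : (1 - y z)%C <> 0) by (apply one_minus_neq, Gz).
  eapply Cd_eqn; [apply hol_Cd, (derive_hol_H y (tf_hol _ _ _ _ _ H)); auto|].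
  rewrite E; field; repeat split; auto; apply Gz.
Qed.

Lemma y_first (z : C) : inH z -> Cd y z (C_derive y z).
Proof. intros Hz; apply hol_Cd, (tf_hol _ _ _ _ _ H); auto. Qed.

Local Notation k := ((1 - al - be) ^ 2 / 4)%C.
Local Notation p z := (C_derive y z).
Let N4 (v : C) : C := (v * (v - 1))%C.
(** With [y''] expressed by [y], [y'] and [u], the terms in [u] cancel in each step from one [u_k]
    to the next. So [u_k] is [(y')^(k/2)] times a rational function of [y], whose numerator for
    [k = 6], apart from the factor [- k] of the local notation, is this polynomial. *)
Let L6 (v : C) : C := (2 * (1 - be) * (v - 1) + 2 * (1 - al) * v - 2 * v + 1)%C.

Lemma near_gen (z : C) : inH z -> gen y z -> near z (fun v => inH v /\ gen y v).
Proof. intros Hz Gz; apply near_and; [apply inH_near; auto|apply (gen_near G al be ups y H); auto]. Qed.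

Lemma u4_eq (z : C) : inH z -> gen y z -> chazy_u4 u z = (- k * (p z ^ 2 / (y z * (y z - 1))))%C.
Proof.
  intros Hz Gz; unfold chazy_u4; rewrite (u_riccati G al be ups y u H Hu Eu z Hz Gz); unfold Qf; ring.
Qed.

Lemma u6_eq (z : C) : inH z -> gen y z ->
  chazy_u6 u z = (- k * (p z ^ 3 * L6 (y z) / (y z * (y z - 1)) ^ 2))%C.
Proof.
  intros Hz Gz; assert (N0 : y z <> 0) by apply Gz; assert (N1 : (y z - 1)%C <> 0) by (apply Cminus_eq_contra, Gz).
  assert (N2 : (1 - y z)%C <> 0) by (apply one_minus_neq, Gz).
  unfold chazy_u6, chazy_next; rewrite u4_eq by auto.
  erewrite (Cd_C_derive (chazy_u4 u) z).
  2:{ apply (Cd_ext_near (fun v => - k * (p v ^ 2 / (y v * (y v - 1))))%C).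
      - generalize (near_gen z Hz Gz); apply near_mono; intros v [Hv Gv]; symmetry; apply u4_eq; auto.
      - apply Cd_mult; [apply Cd_const|apply Cd_div; [|apply Cd_mult; [|apply Cd_minus; [|apply Cd_const]]|]].
        + apply (Cd_pow (C_derive y)), y_second; auto.
        + apply y_first; auto.
        + apply y_first; auto.
        + apply Cmult_neq_0; auto. }
  unfold L6; cbv beta; rewrite !RtoC_minus; simpl INR; simpl pred; simpl Cpow.
  rewrite !RtoC_plus; field; auto.
Qed.

Let L8 (v : C) : C := (3 * L6 v * ((1 - be) * (v - 1) + (1 - al) * v)
  + (2 * (1 - be) + 2 * (1 - al) - 2) * (v * (v - 1)) - 2 * L6 v * (2 * v - 1))%C.

Lemma u8_eq (z : C) : inH z -> gen y z ->
  chazy_u8 u z = (- k * (p z ^ 4 * L8 (y z) / (y z * (y z - 1)) ^ 3))%C.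
Proof.
  intros Hz Gz; assert (N0 : y z <> 0) by apply Gz; assert (N1 : (y z - 1)%C <> 0) by (apply Cminus_eq_contra, Gz).
  assert (N2 : (1 - y z)%C <> 0) by (apply one_minus_neq, Gz).
  unfold chazy_u8; unfold chazy_next at 1; rewrite u6_eq by auto.
  erewrite (Cd_C_derive (chazy_u6 u) z).
  2:{ apply (Cd_ext_near (fun v => - k * (p v ^ 3 * L6 (y v) / (y v * (y v - 1)) ^ 2))%C).
      - generalize (near_gen z Hz Gz); apply near_mono; intros v [Hv Gv]; symmetry; apply u6_eq; auto.
      - apply Cd_mult; [apply Cd_const|apply Cd_div].
        + apply Cd_mult; [apply (Cd_pow (C_derive y)), y_second; auto|].
          apply (Cd_comp y L6); [apply y_first; auto|].
          apply Cd_plus; [apply Cd_minus; [apply Cd_plus|]|apply Cd_const].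
          * apply Cd_mult; [apply Cd_const|apply Cd_minus; [apply Cd_id|apply Cd_const]].
          * apply Cd_mult; [apply Cd_const|apply Cd_id].
          * apply Cd_mult; [apply Cd_const|apply Cd_id].
        + apply (Cd_pow (fun v => y v * (y v - 1))%C), Cd_mult; [apply y_first; auto|].
          apply Cd_minus; [apply y_first; auto|apply Cd_const].
        + apply Cpow_nz, Cmult_neq_0; auto. }
  unfold L8, L6; cbv beta; rewrite !RtoC_minus; simpl INR; simpl pred; simpl Cpow.
  rewrite !RtoC_plus; field; auto.
Qed.

(** All six monomials have weight 24, so each contains the twelfth power of [y']; after this factor
    is removed a rational identity in [y], [al], [be] remains. *)
Lemma chazy_gen (z : C) : inH z -> gen y z -> gen_chazy al be u z.
Proof.
  intros Hz Gz; assert (N0 : y z <> 0) by apply Gz; assert (N1 : (y z - 1)%C <> 0) by (apply Cminus_eq_contra, Gz).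
  unfold gen_chazy; rewrite u4_eq, u6_eq, u8_eq by auto.
  unfold C88, C86, C84, C66, C64, C44, L8, L6.
  repeat rewrite ?RtoC_plus, ?RtoC_minus, ?RtoC_mult, ?RtoC_opp, ?RtoC_pow.
  simpl Cpow; field; auto.
Qed.

Lemma chazy_H (z : C) : inH z -> gen_chazy al be u z.
Proof.
  revert z; unfold gen_chazy; cbv zeta.
  pose proof (chazy_u4_hol u Hu) as H4; pose proof (chazy_next_hol 4 u _ Hu H4 : holomorphic_H (chazy_u6 u)) as H6.
  pose proof (chazy_next_hol 6 u _ Hu H6 : holomorphic_H (chazy_u8 u)) as H8.
  apply eq_on_H.
  - intros z Hz; specialize (H4 z Hz); specialize (H6 z Hz); specialize (H8 z Hz).
    (* The three functions are made opaque, so that holomorphy follows from the polynomial shape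
       alone. *)
    revert H4 H6 H8; generalize (chazy_u4 u) (chazy_u6 u) (chazy_u8 u); intros f4 f6 f8 H4 H6 H8.
    assert (P : forall f n, holomorphic_at f z -> holomorphic_at (fun v => f v ^ n)%C z) by (intros; apply hol_pow; auto).
    repeat lazymatch goal with
    | |- holomorphic_at (fun v => Cplus (@?f v) (@?g v)) _ => apply (hol_plus f g)
    | |- holomorphic_at (fun v => Cmult (@?f v) (@?g v)) _ => apply (hol_mult f g)
    | |- holomorphic_at (fun v => Cpow (@?f v) ?n) _ => apply (P f n)
    | |- holomorphic_at (fun _ => RtoC _) _ => apply hol_const
    | _ => auto
    end.
  - intros z _; apply hol_const.
  - generalize gen_icusp; apply near_icusp_mono; intros z [Hz Gz]; apply (chazy_gen z Hz Gz).
Qed.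
End Chazy.

(** * Quasi-modularity *)

Lemma Cinv_nz (v : C) : v <> 0 -> (/ v)%C <> 0.
Proof.
  intros N E; apply C1_nz; replace (RtoC 1) with (/ v * v)%C by (field; auto); rewrite E; ring.
Qed.

Section QuasiModular.
Variables (G : mat2 -> Prop) (al be ups : R) (y u : C -> C).
Hypotheses (H : tri_fun G al be ups y) (Hu : forall a, inH a -> holomorphic_at u a)
  (Eu : forall a, inH a -> gen y a -> u a = U0 al be y a).

(** At a cusp [y] tends to 1, 0 or infinity. The coordinate [1 - y], [y] or [1 / y] vanishes there,
    and the slashed [u] is [W] of that coordinate with the exponents permuted accordingly. *)
Lemma slash_bounded (s : mat2) : mdet s = 1 -> cusp G (mob s None) ->
  exists M, near_icusp (fun z => Cmod (slash2 s u z) <= M).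
Proof.
  intros D Cs; set (x := fun z => y (mobC s z)).
  assert (Hx : holomorphic_H x) by (intros z Hz; apply (ys_hol G al be ups y H); auto).
  assert (HxN : forall z, inH z -> near z (holomorphic_at x)).
  { intros z Hz; generalize (inH_near z Hz); apply near_mono; auto. }
  assert (Dx : forall z, inH z -> gen x z -> C_derive x z <> 0).
  { intros z Hz Gz; pose proof (autJ_nz s z D Hz) as N; pose proof (mobC_H s z D Hz) as Hs.
    rewrite (Cd_C_derive x z (C_derive y (mobC s z) * / (autJ s z * autJ s z))%C).
    - apply Cmult_neq_0; [apply (tf_reg _ _ _ _ _ H); auto; apply Gz|].
      apply Cinv_nz, Cmult_neq_0; auto.
    - apply (Cd_comp (mobC s) y); [apply Cd_mobC; auto|].
      apply hol_Cd, (tf_hol _ _ _ _ _ H); auto. }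
  assert (Us : forall z, inH z -> gen x z -> slash2 s u z = W (1 - be) (1 - al) x z).
  { intros z Hz Gz; apply (u_slash G al be ups y H u); auto. }
  assert (IH : near_icusp inH) by (exists 0; auto).
  assert (So : forall Y, exists z, Y < Im z /\ inH z /\ gen x z).
  { intros Y; apply (gen_somewhere G al be ups y H s Y D). }
  destruct (tf_cusp _ _ _ _ _ H s D Cs) as [w [[Hw P] L]]; fold x in L.
  assert (Px : forall z, inH z -> x (z + w)%C = x z) by exact P; clear P.
  destruct L as [L|[L|L]].
  - destruct (W_bounded (1 - al) (1 - be) w 0 (fun z => 1 - x z)%C) as [M K]; auto.
    + intros z Hz; apply hol_minus; auto; apply hol_const.
    + intros z Hz; cbv beta; rewrite Px; auto.
    + intros Y; destruct (So Y) as [z [Hz [_ Gz]]]; exists z; split; auto; apply one_minus_neq, Gz.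
    + exists M; generalize (near_icusp_and _ _ IH K); apply near_icusp_mono; intros z [Hz [N1 [N2 B]]].
      assert (Gz : gen x z) by (apply gen_sym; split; auto).
      rewrite Us by auto; rewrite <- W_one_minus; auto; apply Gz.
  - destruct (W_bounded (1 - be) (1 - al) w 0 x) as [M K]; auto.
    + intros Y; destruct (So Y) as [z [Hz [_ Gz]]]; exists z; split; auto; apply Gz.
    + exists M; generalize (near_icusp_and _ _ IH K); apply near_icusp_mono; intros z [Hz [N1 [N2 B]]].
      rewrite Us by (auto; split; auto); auto.
  - destruct (upper_near_icusp _ (L 1)) as [Y1 [PY1 K1]].
    assert (G1 : forall z, Y1 < Im z -> inH z /\ gen x z).
    { intros z Hz; specialize (K1 z Hz); split; [unfold inH; lra|split]; intros E; rewrite E in K1;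
        [rewrite Cmod_0 in K1|rewrite Cmod_1 in K1]; lra. }
    destruct (W_bounded (al + be) (1 - al) w Y1 (fun z => / x z)%C Hw) as [M K].
    + intros z Hz; destruct (G1 z Hz) as [Hh Gz]; apply hol_inv; auto; apply Gz.
    + intros z Hz; cbv beta; rewrite Px; auto; apply G1; auto.
    + intros e He; generalize (near_icusp_and _ _ (L (/ e)) (ex_intro _ Y1 G1 : near_icusp _)).
      apply near_icusp_mono; intros z [B [_ Gz]]; rewrite Cmod_inv by apply Gz.
      rewrite <- (Rinv_inv e); apply Rinv_lt_contravar; auto.
      apply Rmult_lt_0_compat; [apply Rinv_0_lt_compat; auto|apply Cmod_gt_0, Gz].
    + intros Y'; destruct (high_point (Rmax Y1 Y')) as [z [Hz _]]; exists z.
      pose proof (Rmax_l Y1 Y'); pose proof (Rmax_r Y1 Y'); split; [lra|].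
      apply Cinv_nz, G1; lra.
    + exists M; generalize (near_icusp_and _ _ K (ex_intro _ Y1 G1 : near_icusp _)); apply near_icusp_mono.
      intros z [[_ [_ B]] [Hz Gz]]; rewrite W_inv in B; auto; try apply Gz.
      replace (2 - (al + be) - (1 - al)) with (1 - be) in B by ring.
      rewrite Us; auto.
Qed.

Lemma unslash (s : mat2) (z : C) : autJ s z <> 0 ->
  u (mobC s z) = (autJ s z ^ 2 * slash2 s u z + mc s * autJ s z)%C.
Proof. intros N; unfold slash2; field; auto. Qed.

Lemma quasi_modular_u (c : C) (E : C -> C) : (forall z, inH z -> E z = (c * u z)%C) -> quasi_modular G 2 1 E.
Proof.
  intros EE.
  assert (HE : holomorphic_H E).
  { intros z Hz; apply (hol_ext_near (fun v => c * u v)%C).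
    - generalize (inH_near z Hz); apply near_mono; intros v Hv; symmetry; auto.
    - apply hol_mult; [apply hol_const|auto]. }
  split; [exact HE|split].
  (* The depth 1 coefficient is the constant [c], because the anomaly of [u] is exactly
     [mc g * autJ g z]. *)
  - exists (fun r => match r with O => E | _ => fun _ => c end); split.
    + intros [|r] _; auto; intros z _; apply hol_const.
    + intros g z Gg Hz; pose proof (sg_det G (tf_group _ _ _ _ _ H) g Gg) as D.
      pose proof (autJ_nz g z D Hz) as N.
      rewrite sum_Sn, sum_O; change plus with Cplus; rewrite !EE by (auto; apply mobC_H; auto).
      rewrite unslash, (u_inv G al be ups y H u Hu Eu g z Gg Hz) by auto.
      simpl; field; auto.
  - intros s D Cs; destruct (slash_bounded s D Cs) as [M K].
    exists (Cmod c * (M + 1)); generalize (near_icusp_and _ _ K (ex_intro _ 1 (fun z Hz => Hz) : near_icusp (fun z => 1 < Im z))).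
    apply near_icusp_mono; intros z [B Iz].
    assert (Hz : inH z) by (unfold inH; lra); pose proof (autJ_nz s z D Hz) as N.
    rewrite EE, unslash by (auto; apply mobC_H; auto); rewrite Cmod_mult, Rmult_assoc.
    apply Rmult_le_compat_l; [apply Cmod_ge_0|].
    eapply Rle_trans; [apply Cmod_triangle|]; rewrite !Cmod_mult, Cmod_R, Cmod_pow.
    set (J := Cmod (autJ s z)) in *.
    assert (PJ : 0 <= J) by apply Cmod_ge_0.
    (* For [Im z > 1] this absorbs the anomaly [|mc s| * J] into [J^2], which accounts for
       [M + 1]. *)
    assert (LJ : Rabs (mc s) <= J).
    { pose proof (Cmod_Im (autJ s z)) as K1; fold J in K1; rewrite autJ_im, Rabs_mult, (Rabs_pos_eq (Im z)) in K1 by lra.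
      pose proof (Rabs_pos (mc s)); nra. }
    assert (J ^ 2 * Cmod (slash2 s u z) <= J ^ 2 * M) by (apply Rmult_le_compat_l; [apply pow_le; auto|auto]).
    nra.
Qed.
End QuasiModular.

(** * The differential system *)

Section Forms.
Variables (G : mat2 -> Prop) (al be ups rho : R) (y u lA lB lt lC : C -> C).
Hypotheses (H : tri_fun G al be ups y) (Hu : forall a, inH a -> holomorphic_at u a)
  (Eu : forall a, inH a -> gen y a -> u a = U0 al be y a)
  (Hab : al + be < 1) (Hrho : rho = 2 / (1 - al - be))
  (VA : vanishes_at_icusp lA) (VB : vanishes_at_icusp lB)
  (KA : near_icusp (fun z => Cd lA z (u z - ((1 - al - be) / 2)%R * (C_derive y z / (1 - y z)))%C))
  (KB : near_icusp (fun z => Cd lB z (u z + ((1 - al - be) / 2)%R * (C_derive y z / y z))%C))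
  (Kt : near_icusp (fun z => holomorphic_at lt z /\ Cexp (lt z) = (- / y z)%C))
  (KC : near_icusp (fun z => lC z = (lt z / rho + lB z)%C)).

Lemma rho_nz : RtoC rho <> 0.
Proof.
  apply RtoC_nz; rewrite Hrho; unfold Rdiv; apply Rmult_integral_contrapositive; split; [lra|].
  apply Rinv_neq_0_compat; lra.
Qed.

Lemma rho_inv : RtoC ((1 - al - be) / 2) = (/ rho)%C.
Proof.
  pose proof rho_nz as N; rewrite <- RtoC_inv by (intros E; apply N; rewrite E; auto).
  f_equal; rewrite Hrho; field; lra.
Qed.

Lemma yy : near_icusp (fun z => inH z /\ gen y z).
Proof. apply (gen_icusp G al be ups y H). Qed.

Lemma lt_derive : near_icusp (fun z => Cd lt z (- (C_derive y z / y z))%C).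
Proof.
  generalize (near_icusp_and _ _ yy (near_icusp_near _ Kt)); apply near_icusp_mono; intros z [[Hz Gz] N].
  pose proof (near_here _ _ N) as [Hl El]; apply hol_Cd in Hl.
  assert (E : (C_derive lt z * Cexp (lt z))%C = (C_derive y z / (y z * y z))%C).
  { apply (Cd_unique (fun v => Cexp (lt v)) z).
    - eapply Cd_eqn; [apply Cd_exp; exact Hl|ring].
    - apply (Cd_ext_near (fun v => - / y v)%C).
      + revert N; apply near_mono; intros v [_ Ev]; symmetry; auto.
      + eapply Cd_eqn; [apply Cd_opp, Cd_inv; [apply (y_first G al be ups y H); auto|apply Gz]|].
        field; apply Gz. }
  eapply Cd_eqn; [exact Hl|]; rewrite El in E.
  replace (C_derive lt z) with (C_derive lt z * - / y z * - y z)%C by (field; apply Gz).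
  rewrite E; field; apply Gz.
Qed.

Lemma lC_derive : near_icusp (fun z => Cd lC z (u z)).
Proof.
  generalize (near_icusp_and _ _ yy (near_icusp_and _ _ lt_derive (near_icusp_and _ _ KB (near_icusp_near _ KC)))).
  apply near_icusp_mono; intros z [[Hz Gz] [D1 [D2 N]]].
  apply (Cd_ext_near (fun v => lt v / rho + lB v)%C).
  - revert N; apply near_mono; intros v Ev; symmetry; auto.
  - eapply Cd_eqn; [apply Cd_plus; [apply Cd_div; [exact D1|apply Cd_const|exact rho_nz]|exact D2]|].
    rewrite rho_inv; field; split; [apply Gz|exact rho_nz].
Qed.

(** The logarithm of C is given near the cusp only, but its derivative [u] is holomorphic on the
    convex set [inH]; a primitive there, with the right constant, continues it. *)
Lemma lC_continuation : exists P, (forall z, inH z -> Cd P z (u z)) /\ near_icusp (fun z => lC z = P z).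
Proof.
  destruct (primitive inH u inH_convex inH_opn Hu) as [F HF].
  destruct (upper_near_icusp _ lC_derive) as [Y [PY K]]; destruct (high_point Y) as [z0 [H0 I0]].
  exists (fun z => F z + (lC z0 - F z0))%C; split.
  - intros z Hz; eapply Cd_eqn; [apply Cd_plus; [apply HF; auto|apply Cd_const]|ring].
  - exists Y; intros z Hz.
    assert (E : (lC z - F z)%C = (lC z0 - F z0)%C).
    { apply (Cd_zero_const (fun v => Y < Im v) (fun v => lC v - F v)%C); auto using upper_convex.
      intros v Hv; eapply Cd_eqn; [apply Cd_minus; [apply K; auto|apply HF; unfold inH; lra]|ring]. }
    rewrite <- E; ring.
Qed.

Variable P : C -> C.
Hypotheses (HP : forall z, inH z -> Cd P z (u z)) (EP : near_icusp (fun z => lC z = P z)).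

(** The three powers are global by construction from the primitive [P] of [u], and their linear
    relation is immediate. What has to be checked is that they continue the prescribed local
    powers. *)
Definition Cr (z : C) : C := Cexp (rho * P z)%C.
Definition Br (z : C) : C := (- y z * Cr z)%C.
Definition Ar (z : C) : C := ((1 - y z) * Cr z)%C.

Lemma Cr_derive (z : C) : inH z -> Cd Cr z (Cr z * (rho * u z))%C.
Proof.
  intros Hz; eapply Cd_eqn.
  - apply (Cd_exp (fun v => rho * P v)%C), Cd_mult; [apply Cd_const|apply HP; auto].
  - unfold Cr; ring.
Qed.

Lemma Ar_derive (z : C) : inH z -> Cd Ar z (rho * u z * Ar z - C_derive y z * Cr z)%C.
Proof.
  intros Hz; eapply Cd_eqn; [apply Cd_mult; [apply Cd_minus; [apply Cd_const|]|apply Cr_derive; auto]|].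
  - apply (y_first G al be ups y H); auto.
  - unfold Ar; ring.
Qed.

Lemma Br_derive (z : C) : inH z -> Cd Br z (rho * u z * Br z - C_derive y z * Cr z)%C.
Proof.
  intros Hz; eapply Cd_eqn; [apply Cd_mult; [apply Cd_opp|apply Cr_derive; auto]|].
  - apply (y_first G al be ups y H); auto.
  - unfold Br; ring.
Qed.

Lemma Cr_power : near_icusp (fun z => Cr z = Cexp (rho * lC z)%C).
Proof. generalize EP; apply near_icusp_mono; intros z ->; auto. Qed.

Lemma Br_power : near_icusp (fun z => Br z = Cexp (rho * lB z)%C).
Proof.
  generalize (near_icusp_and _ _ yy (near_icusp_and _ _ Cr_power (near_icusp_and _ _ Kt KC))).
  apply near_icusp_mono; intros z [[Hz Gz] [E1 [[_ E2] E3]]]; unfold Br; rewrite E1, E3.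
  replace (rho * (lt z / rho + lB z))%C with (lt z + rho * lB z)%C by (field; exact rho_nz).
  rewrite Cexp_plus, E2; field; apply Gz.
Qed.

(* With the local parameter [q] at the cusp, [1 / y] vanishes to the first order in [q]. *)
Lemma y_asymptotic : tends (fun z => / y z)%C 0 /\
  tends (fun z => - (ups / tpi) * (C_derive y z / y z))%C 1.
Proof.
  destruct (tf_periodic _ _ _ _ _ H) as [Hw _]; assert (Nw : RtoC ups <> 0) by (apply RtoC_nz; lra).
  destruct (inf_chart G al be ups y u H Eu) as [T [g [Y [Hg [g0 [ET [Ex _]]]]]]].
  split.
  - apply (tends_ext _ (fun z => T (qexp ups z))); [exists Y; intros z Hz; apply Ex; auto|].
    apply tends_qexp; auto; [|apply (cT0 T g 1); auto].
    apply hol_cont, (near_here _ _ (cT_hol T g 1 Hg ET)).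
  - apply (tends_ext _ (fun z => cA g 1 (qexp ups z))).
    + exists Y; intros z Hz; destruct (Ex z Hz) as [Hh [Gz [E1 [E2 _]]]].
      rewrite (Z_derive G al be ups y H) in E2 by auto; rewrite <- E1 in E2.
      assert (N0 : y z <> 0) by apply Gz.
      replace (C_derive y z / y z)%C with (- (- C_derive y z / (y z * y z)) * y z)%C by (field; auto).
      rewrite E2; field; repeat split; auto using tpi_nz.
    + apply tends_qexp; auto; [|rewrite cA0; auto].
      apply hol_cont, (near_here _ _ (cA_hol g 1 Hg g0)).
Qed.

(** No branch of the logarithm relates [lA] to [lC], so both sides are compared by logarithmic
    derivative. For the constant, [Ar / Br = 1 - 1 / y] tends to 1, as do the exponentials of
    [rho * lA] and [rho * lB]. *)
Lemma Ar_power : near_icusp (fun z => Ar z = Cexp (rho * lA z)%C).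
Proof.
  destruct y_asymptotic as [L _].
  cut (near_icusp (fun z => Cexp (rho * lA z)%C = Ar z)); [apply near_icusp_mono; auto|].
  apply (same_log_derivative _ _ (fun z => rho * u z - C_derive y z / (1 - y z))%C).
  - generalize (near_icusp_and _ _ yy KA); apply near_icusp_mono; intros z [[Hz Gz] D].
    assert (N1 : (1 - y z)%C <> 0) by (apply one_minus_neq, Gz).
    split; [apply Cmult_neq_0; [auto|apply Cexp_nz]|split].
    + eapply Cd_eqn; [apply (Cd_exp (fun v => rho * lA v)%C), Cd_mult; [apply Cd_const|exact D]|].
      rewrite rho_inv; cbv beta; pose proof rho_nz; field; auto.
    + eapply Cd_eqn; [apply Ar_derive; auto|]; unfold Ar; field; auto.
  - apply (tends_ext _ (fun z => Cexp (rho * lA z) * (Cexp ((- rho)%R * lB z) * (/ (1 - / y z))))%C).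
    + generalize (near_icusp_and _ _ yy Br_power); apply near_icusp_mono; intros z [[Hz Gz] E].
      assert (N0 : y z <> 0) by apply Gz.
      assert (N1 : (1 - y z)%C <> 0) by (apply one_minus_neq, Gz).
      assert (NC : Cr z <> 0) by apply Cexp_nz.
      rewrite RtoC_opp; replace (- rho * lB z)%C with (- (rho * lB z))%C by ring.
      rewrite Cexp_opp, <- E; unfold Ar, Br; field; repeat split; auto.
      intros K; apply N1; replace (1 - y z)%C with (- (y z - 1))%C by ring; rewrite K; ring.
    + apply tends_mult; [apply tends_exp; auto|apply tends_mult; [apply tends_exp; auto|]].
      pose proof (tends_comp (fun v => / (1 - v))%C _ 0 L) as K; cbv beta in K.
      replace (/ (1 - 0))%C with (RtoC 1) in K by (field; apply C1_nz); apply K.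
      apply Ccont_inv; [apply Ccont_minus; [apply Ccont_const|apply Ccont_id]|].
      replace (1 - 0)%C with (RtoC 1) by ring; apply C1_nz.
Qed.

(** Equality of logarithmic derivatives restates the definition of [u]. The factor [ups / tpi] is
    the normalisation at the cusp, where [y' / y] tends to [- tpi / ups] because [1 / y] has a
    simple zero in [q]. *)
Lemma derivative_power : near_icusp (fun z => (ups / tpi * (C_derive y z * Cr z))%C =
  (Cexp ((rho * (1 - al))%R * lA z) * Cexp ((rho * (1 - be))%R * lB z))%C).
Proof.
  destruct (tf_periodic _ _ _ _ _ H) as [Hw _]; assert (Nw : RtoC ups <> 0) by (apply RtoC_nz; lra).
  destruct y_asymptotic as [_ L].
  apply (same_log_derivative _ _ (fun z => (rho + 2) * u z + (1 - be)%R * (C_derive y z / y z)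
    - (1 - al)%R * (C_derive y z / (1 - y z)))%C).
  - generalize (near_icusp_and _ _ yy (near_icusp_and _ _ KA KB)); apply near_icusp_mono; intros z [[Hz Gz] [DA DB]].
    assert (N1 : (1 - y z)%C <> 0) by (apply one_minus_neq, Gz).
    assert (N0 : y z <> 0) by apply Gz.
    split; [apply Cmult_neq_0; apply Cexp_nz|split].
    + eapply Cd_eqn; [apply Cd_mult; [apply Cd_const|apply Cd_mult; [|apply Cr_derive; auto]]|].
      * apply (y_second G al be ups y u H Eu); auto.
      * cbv beta; field; repeat split; auto using tpi_nz.
    + eapply Cd_eqn; [apply Cd_mult; [apply (Cd_exp (fun v => (rho * (1 - al))%R * lA v)%C)|
         apply (Cd_exp (fun v => (rho * (1 - be))%R * lB v)%C)]; (apply Cd_mult; [apply Cd_const|eassumption])|].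
      cbv beta; rewrite rho_inv; rewrite !RtoC_mult.
      (* This is [rho * (1 - al - be) = 2]; it matches the total weight of the product with that of
         [y'] times [Cr]. *)
      assert (E : (rho * ((1 - al)%R + (1 - be)%R))%C = (rho + 2)%C).
      { rewrite <- !RtoC_plus, <- RtoC_mult; f_equal; rewrite Hrho; field; lra. }
      rewrite <- E; pose proof rho_nz; field; repeat split; auto.
  (* Writing [Cr] as [- Br / y] splits the quotient into [- (ups / tpi) * (y' / y)] and powers of A
     and B, each tending to 1. *)
  - apply (tends_ext _ (fun z => (- (ups / tpi) * (C_derive y z / y z)) *
      (Cexp ((- (rho * (1 - al)))%R * lA z) * Cexp ((rho * be)%R * lB z)))%C).
    + generalize (near_icusp_and _ _ yy Br_power); apply near_icusp_mono; intros z [[Hz Gz] E].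
      assert (N0 : y z <> 0) by apply Gz.
      assert (NC : Cr z <> 0) by apply Cexp_nz.
      replace (Cexp ((rho * be)%R * lB z)) with (Br z / Cexp ((rho * (1 - be))%R * lB z))%C.
      * rewrite RtoC_opp; replace (- (rho * (1 - al))%R * lA z)%C with (- ((rho * (1 - al))%R * lA z))%C by ring.
        rewrite Cexp_opp; unfold Br; field; repeat split; auto using tpi_nz, Cexp_nz.
      * rewrite E; unfold Cdiv; rewrite <- Cexp_opp, <- Cexp_plus; f_equal.
        rewrite !RtoC_mult, RtoC_minus; ring.
    + apply tends_mult; auto; apply tends_mult; apply tends_exp; auto.
Qed.

Lemma Cr_hol : holomorphic_H Cr.
Proof. intros z Hz; eapply Cd_hol, Cr_derive; auto. Qed.

Lemma Ar_hol : holomorphic_H Ar.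
Proof. intros z Hz; eapply Cd_hol, Ar_derive; auto. Qed.

Lemma Br_hol : holomorphic_H Br.
Proof. intros z Hz; eapply Cd_hol, Br_derive; auto. Qed.

Lemma Cr_near_hol (a : C) : inH a -> near a (holomorphic_at Cr).
Proof. intros Ha; generalize (inH_near a Ha); apply near_mono; exact Cr_hol. Qed.

Lemma A_powers : exists A1 A2,
  continued_power lA (rho * (1 - al)) A1 /\ continued_power lA (rho * (1 - 2 * al)) A2.
Proof.
  apply (fractional_powers Ar); [exact Ar_hol| | |].
  - intros a Ha E; assert (Ea : y a = 1).
    { apply NNPP; intros N; apply (Cmult_neq_0 (1 - y a) (Cr a)); auto using one_minus_neq.
      apply Cexp_nz. }
    destruct (tf_one _ _ _ _ _ H a Ha Ea) as [n [g [Hn [En [Hg [g0 Eg]]]]]].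
    exists n; split; [auto|split; [auto|exists (fun z => g z * Cr z)%C; split; [|split]]].
    + generalize (near_and _ _ _ Hg (Cr_near_hol a Ha)); apply near_mono; intros z [H1 H2]; apply hol_mult; auto.
    + apply Cmult_neq_0; [auto|apply Cexp_nz].
    + revert Eg; apply near_mono; intros z Ez; unfold Ar; rewrite Ez; ring.
  - destruct (tf_one_ex _ _ _ _ _ H) as [[a [Ha Ea]]|[Ea _]]; auto.
    left; exists a; split; auto; unfold Ar; rewrite Ea; ring.
  - generalize (near_icusp_and _ _ KA Ar_power); apply near_icusp_mono; intros z [D E]; split; auto.
    eapply Cd_hol; eauto.
Qed.

Lemma B_powers : exists B1 B2,
  continued_power lB (rho * (1 - be)) B1 /\ continued_power lB (rho * (1 - 2 * be)) B2.
Proof.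
  apply (fractional_powers Br); [exact Br_hol| | |].
  - intros a Ha E; assert (Ea : y a = 0).
    { apply NNPP; intros N; apply (Cmult_neq_0 (y a) (Cr a)); auto; [apply Cexp_nz|].
      replace (y a * Cr a)%C with (- Br a)%C by (unfold Br; ring); rewrite E; ring. }
    destruct (tf_zero _ _ _ _ _ H a Ha Ea) as [n [g [Hn [En [Hg [g0 Eg]]]]]].
    exists n; split; [auto|split; [auto|exists (fun z => g z * - Cr z)%C; split; [|split]]].
    + generalize (near_and _ _ _ Hg (Cr_near_hol a Ha)); apply near_mono; intros z [H1 H2].
      apply hol_mult; auto; apply hol_opp; auto.
    + apply Cmult_neq_0; [auto|intros K; apply (Cexp_nz (rho * P a)%C)].
      fold (Cr a); replace (Cr a) with (- - Cr a)%C by ring; rewrite K; ring.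
    + revert Eg; apply near_mono; intros z Ez; unfold Br; rewrite Ez; ring.
  - destruct (tf_zero_ex _ _ _ _ _ H) as [[a [Ha Ea]]|[Ea _]]; auto.
    left; exists a; split; auto; unfold Br; rewrite Ea; ring.
  - generalize (near_icusp_and _ _ KB Br_power); apply near_icusp_mono; intros z [D E]; split; auto.
    eapply Cd_hol; eauto.
Qed.

Lemma product_first (A1 B1 : C -> C) : continued_power lA (rho * (1 - al)) A1 ->
  continued_power lB (rho * (1 - be)) B1 ->
  forall z, inH z -> (A1 z * B1 z)%C = (ups / tpi * (C_derive y z * Cr z))%C.
Proof.
  intros [HA EA] [HB EB]; apply eq_on_H.
  - intros z Hz; apply hol_mult; auto.
  - intros z Hz; apply hol_mult; [apply hol_const|apply hol_mult; [|apply Cr_hol; auto]].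
    apply (derive_hol_H y (tf_hol _ _ _ _ _ H)); auto.
  - generalize (near_icusp_and _ _ derivative_power (near_icusp_and _ _ EA EB)); apply near_icusp_mono.
    intros z [-> [-> ->]]; auto.
Qed.

(** Since [(1 - 2 * al) + 1 = 2 * (1 - al)], and likewise for [be], multiplying by [Ar * Br] gives
    the square of the product in [derivative_power]. Dividing back leaves a multiple of [Qf y],
    which the Riccati equation expresses by [u^2 - u']. *)
Lemma product_second (A2 B2 : C -> C) : continued_power lA (rho * (1 - 2 * al)) A2 ->
  continued_power lB (rho * (1 - 2 * be)) B2 ->
  forall z, inH z -> (A2 z * B2 z)%C = ((ups * rho / tpi) ^ 2 * (u z ^ 2 - C_derive u z))%C.
Proof.
  intros [HA EA] [HB EB]; apply eq_on_H.
  - intros z Hz; apply hol_mult; auto.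
  - intros z Hz; apply hol_mult; [apply hol_const|apply hol_minus; [apply hol_pow; auto|]].
    apply derive_hol_H; auto.
  - generalize (near_icusp_and _ _ yy (near_icusp_and _ _ derivative_power (near_icusp_and _ _ Ar_power
      (near_icusp_and _ _ Br_power (near_icusp_and _ _ EA EB))))); apply near_icusp_mono.
    intros z [[Hz Gz] [E1 [E2 [E3 [-> ->]]]]].
    assert (Q : (Cexp ((rho * (1 - 2 * al))%R * lA z) * Cexp ((rho * (1 - 2 * be))%R * lB z) * (Ar z * Br z))%C =
      ((ups / tpi * (C_derive y z * Cr z)) ^ 2)%C).
    { rewrite E1, E2, E3; simpl; rewrite <- !Cexp_plus, Cmult_1_r, <- !Cexp_plus; f_equal.
      rewrite !RtoC_mult, !RtoC_minus, !RtoC_mult; ring. }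
    rewrite (u_riccati G al be ups y u H Hu Eu z Hz Gz); unfold Qf.
    assert (N0 : y z <> 0) by apply Gz.
    assert (N1 : (y z - 1)%C <> 0) by apply Cminus_eq_contra, Gz.
    assert (NC : Cr z <> 0) by apply Cexp_nz.
    assert (NA : Ar z <> 0) by (rewrite E2; apply Cexp_nz).
    assert (NB : Br z <> 0) by (rewrite E3; apply Cexp_nz).
    transitivity ((ups / tpi * (C_derive y z * Cr z)) ^ 2 / (Ar z * Br z))%C.
    { rewrite <- Q; field; auto. }
    replace ((1 - al - be) ^ 2 / 4)%C with (/ rho * / rho)%C.
    + assert (EAB : (Ar z * Br z)%C = (y z * (y z - 1) * (Cr z * Cr z))%C) by (unfold Ar, Br; ring).
      rewrite EAB; pose proof rho_nz; pose proof tpi_nz; simpl; field; auto.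
    + rewrite <- rho_inv, RtoC_div, !RtoC_minus by lra; simpl; field.
Qed.

Lemma E_eq (z : C) : inH z -> (ups * Dq Cr z / Cr z)%C = (ups * rho / tpi * u z)%C.
Proof.
  intros Hz; unfold Dq; rewrite (Cd_C_derive _ _ _ (Cr_derive z Hz)); fold tpi.
  assert (NC : Cr z <> 0) by apply Cexp_nz; field; auto using tpi_nz.
Qed.
End Forms.

(** The [u] of the final statement agrees with the constructed one on [inH] only. As this set is
    open, the total derivatives agree there too, at every stage of the recursion. *)
Lemma gen_chazy_ext (al be : R) (u v : C -> C) : holomorphic_H u -> (forall z, inH z -> v z = u z) ->
  forall z, inH z -> gen_chazy al be u z -> gen_chazy al be v z.
Proof.
  intros Hu E.
  pose proof (chazy_u4_hol u Hu) as H4; pose proof (chazy_next_hol 4 u _ Hu H4 : holomorphic_H (chazy_u6 u)) as H6.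
  assert (D : forall f g, holomorphic_H g -> (forall z, inH z -> f z = g z) -> forall z, inH z -> C_derive f z = C_derive g z).
  { intros f g Hg Efg z Hz; symmetry; apply C_derive_ext_near; auto.
    generalize (inH_near z Hz); apply near_mono; intros; symmetry; auto. }
  assert (E4 : forall z, inH z -> chazy_u4 v z = chazy_u4 u z).
  { intros z Hz; unfold chazy_u4; rewrite E, (D v u) by auto; auto. }
  assert (E6 : forall z, inH z -> chazy_u6 v z = chazy_u6 u z).
  { intros z Hz; unfold chazy_u6, chazy_next; rewrite E, E4, (D _ _ H4 E4) by auto; auto. }
  assert (E8 : forall z, inH z -> chazy_u8 v z = chazy_u8 u z).
  { intros z Hz; unfold chazy_u8; unfold chazy_next at 1 2; rewrite E, E6, (D _ _ H6 E6) by auto; auto. }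
  intros z Hz; unfold gen_chazy; rewrite E4, E6, E8 by auto; auto.
Qed.

(** * From [y] back to the Hauptmodul and the given logarithms *)

Section Transfer.
Variables (G : mat2 -> Prop) (al be ups : R) (t : P1 -> P1) (tstar : C) (u : C -> C).
Local Notation y := (yt t tstar).
Hypotheses (H : tri_fun G al be ups y) (Hu : forall a, inH a -> holomorphic_at u a)
  (Eu : forall a, inH a -> gen y a -> u a = U0 al be y a) (Hab : al + be < 1)
  (Hy : forall a, inH a -> t (Some a) = None /\ y a = 0 \/
     exists v, t (Some a) = Some v /\ v <> 0 /\ y a = (tstar / v)%C).

Lemma y_coordinate : near_icusp (fun z => inH z /\ gen y z /\
  exists v, t (Some z) = Some v /\ v <> 0 /\ tstar <> 0 /\ y z = (tstar / v)%C).
Proof.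
  generalize (gen_icusp G al be ups y H); apply near_icusp_mono; intros z [Hz Gz]; split; [auto|split; auto].
  destruct (Hy z Hz) as [[_ E]|[v [E1 [Nv E]]]]; [destruct (proj1 Gz E)|].
  exists v; repeat split; auto; intros K; apply (proj1 Gz); rewrite E, K; field; auto.
Qed.

Lemma calB_y : near_icusp (fun z =>
  calB al be 0 tstar t z = hyp2F1 ((1 - al - be) / 2) ((1 - al + be) / 2) 1 (/ y z)%C).
Proof.
  generalize y_coordinate; apply near_icusp_mono; intros z [Hz [Gz [v [E1 [Nv [Nt E2]]]]]].
  unfold calB; rewrite E1, E2; simpl fin_part; rewrite !Rminus_0_r; f_equal; field; auto.
Qed.

(** The argument [t / (t - tstar)] is [1 / (1 - y)], and the parameters are those of B with [al] and
    [be] exchanged: A is the form B of the data mirrored by [tri_fun_sym]. *)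
Lemma calA_y : near_icusp (fun z =>
  calA al be 0 tstar t z = hyp2F1 ((1 - be - al) / 2) ((1 - be + al) / 2) 1 (/ (1 - y z))%C).
Proof.
  generalize y_coordinate; apply near_icusp_mono; intros z [Hz [Gz [v [E1 [Nv [Nt E2]]]]]].
  assert (N1 : (v - tstar)%C <> 0).
  { intros K; apply (proj2 Gz); rewrite E2; replace tstar with (v - (v - tstar))%C by ring; rewrite K; field; auto. }
  unfold calA; rewrite E1, E2; simpl fin_part; rewrite !Rminus_0_r; f_equal; [lra|lra|field; auto].
Qed.

Lemma log_A : exists l, near_icusp (fun z => Cexp (l z) = calA al be 0 tstar t z) /\ vanishes_at_icusp l /\
  near_icusp (fun z => Cd l z (u z - ((1 - al - be) / 2)%R * (C_derive y z / (1 - y z)))%C).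
Proof.
  destruct (calB_log G be al ups (fun z => 1 - y z)%C u (tri_fun_sym _ _ _ _ _ H) Hu) as [l [K V]].
  { intros a Ha Ga; apply (proj1 (gen_sym y a)) in Ga; rewrite (U0_sym G al be ups y) by auto; auto. }
  exists l; split; [|split; [auto|]].
  - generalize (near_icusp_and _ _ K calA_y); apply near_icusp_mono; intros z [[_ E1] E2]; rewrite E1, E2; auto.
  - generalize (near_icusp_and _ _ K (gen_icusp G al be ups y H)); apply near_icusp_mono.
    intros z [[D _] [Hz Gz]]; eapply Cd_eqn; [exact D|].
    assert (Dy : Cd (fun v => 1 - y v)%C z (0 - C_derive y z)%C).
    { apply Cd_minus; [apply Cd_const|apply (y_first G al be ups y H); auto]. }
    rewrite (Cd_C_derive _ _ _ Dy); replace (1 - be - al) with (1 - al - be) by ring.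
    field; apply one_minus_neq, Gz.
Qed.

Lemma log_B : exists l, near_icusp (fun z => Cexp (l z) = calB al be 0 tstar t z) /\ vanishes_at_icusp l /\
  near_icusp (fun z => Cd l z (u z + ((1 - al - be) / 2)%R * (C_derive y z / y z))%C).
Proof.
  destruct (calB_log G al be ups y u H Hu Eu) as [l [K V]]; exists l; split; [|split; [auto|]].
  - generalize (near_icusp_and _ _ K calB_y); apply near_icusp_mono; intros z [[_ E1] E2]; rewrite E1, E2; auto.
  - generalize K; apply near_icusp_mono; tauto.
Qed.

Lemma log_t : exists l, near_icusp (fun z => holomorphic_at l z /\ Cexp (l z) = (- / y z)%C).
Proof.
  destruct (y_large G al be ups y H) as [Y [PY K]].
  destruct (log_exists (fun z => Y < Im z) (fun z => - / y z)%C) as [l Hl]; auto using upper_convex, upper_opn.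
  - intros z Hz; destruct (K z Hz) as [Hh Gz]; apply hol_opp, hol_inv; [apply (tf_hol _ _ _ _ _ H); auto|apply Gz].
  - intros z Hz E; destruct (K z Hz) as [Hh Gz]; apply (Cinv_nz (y z)); [apply Gz|].
    replace (/ y z)%C with (- - / y z)%C by ring; rewrite E; ring.
  - exists l, Y; intros z Hz; destruct (Hl z Hz) as [D E]; split; auto; eapply Cd_hol; eauto.
Qed.

Lemma t_over_y : near_icusp (fun z => (- fin_part (t (Some z)) / tstar)%C = (- / y z)%C).
Proof.
  generalize y_coordinate; apply near_icusp_mono; intros z [Hz [Gz [v [E1 [Nv [Nt E2]]]]]].
  rewrite E1, E2; simpl fin_part; field; auto.
Qed.

Lemma formal_forms_exist : exists lA lB lC, formal_forms al be 0 tstar t lA lB lC.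
Proof.
  destruct log_A as [lA [A1 [A2 A3]]]; destruct log_B as [lB [B1 [B2 B3]]]; destruct log_t as [lt Kt].
  exists lA, lB, (fun z => lt z / (2 / (1 - al - be - 0))%R + lB z)%C; unfold formal_forms; cbv zeta.
  split; [|split; [auto|split; [|split; [auto|]]]].
  - generalize (near_icusp_and _ _ A1 A3); apply near_icusp_mono; intros z [E D]; split; auto; eapply Cd_hol; eauto.
  - generalize (near_icusp_and _ _ B1 B3); apply near_icusp_mono; intros z [E D]; split; auto; eapply Cd_hol; eauto.
  - exists lt; split; [|exists 0; auto].
    generalize (near_icusp_and _ _ Kt t_over_y); apply near_icusp_mono; intros z [[Hl E1] E2]; split; auto; congruence.
Qed.

(** Both logarithms vanish at the cusp, so they coincide near it, and the derivative computed for
    the constructed one holds for the given one. *)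
Lemma log_transfer (l l0 d f : C -> C) : log_branch f l -> vanishes_at_icusp l ->
  near_icusp (fun z => Cexp (l0 z) = f z) -> vanishes_at_icusp l0 ->
  near_icusp (fun z => Cd l0 z (d z)) -> near_icusp (fun z => Cd l z (d z)).
Proof.
  intros L V E0 V0 D.
  assert (E : near_icusp (fun z => l z = l0 z)).
  { apply log_unique; auto; generalize (near_icusp_and _ _ L E0); apply near_icusp_mono.
    intros z [[_ ->] ->]; auto. }
  generalize (near_icusp_and _ _ D (near_icusp_near _ E)); apply near_icusp_mono; intros z [Dz Ez].
  apply (Cd_ext_near l0); auto; revert Ez; apply near_mono; intros; symmetry; auto.
Qed.

Lemma formal_forms_derive (lA lB lC : C -> C) : formal_forms al be 0 tstar t lA lB lC ->
  vanishes_at_icusp lA /\ vanishes_at_icusp lB /\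
  near_icusp (fun z => Cd lA z (u z - ((1 - al - be) / 2)%R * (C_derive y z / (1 - y z)))%C) /\
  near_icusp (fun z => Cd lB z (u z + ((1 - al - be) / 2)%R * (C_derive y z / y z))%C) /\
  exists lt, near_icusp (fun z => holomorphic_at lt z /\ Cexp (lt z) = (- / y z)%C) /\
    near_icusp (fun z => lC z = (lt z / (2 / (1 - al - be))%R + lB z)%C).
Proof.
  intros [LA [VA [LB [VB [lt [Lt LC]]]]]].
  destruct log_A as [lA' [A1 [A2 A3]]]; destruct log_B as [lB' [B1 [B2 B3]]].
  split; [auto|split; [auto|split; [|split]]].
  - eapply log_transfer; eauto.
  - eapply log_transfer; eauto.
  - exists lt; split.
    + generalize (near_icusp_and _ _ Lt t_over_y); apply near_icusp_mono; intros z [[Hl E1] E2]; split; auto; congruence.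
    + rewrite Rminus_0_r in LC; exact LC.
Qed.
End Transfer.

(** * Assembly of the system from one primitive of [u] *)

Theorem theorem5
  (G : mat2 -> Prop) (vA vB vC : P1) (nA nB nC : option nat)
  (upsilon : R) (t : P1 -> P1) (tstar : C)
  (al be ga rho : R)
  (h_triangle : triangle_group G vA vB vC nA nB nC)
  (h_al : al = inv_order nA) (h_be : be = inv_order nB) (h_ga : ga = inv_order nC)
  (h_hyp : al + be + ga < 1)
  (h_rho : rho = 2 / (1 - al - be - ga))
  (h_ga0 : ga = 0)
  (h_inf : equiv G vC None)
  (h_width : cusp_width_infty G upsilon)
  (h_t : hauptmodul G t)
  (h_tC : t vC = Some (RtoC 0))
  (h_tstar : tstar <> RtoC 0)
  (h_tA : t vA = Some tstar)
  (h_tB : t vB = None) :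
  (exists lA lB lC, formal_forms al be ga tstar t lA lB lC) /\
  forall lA lB lC : C -> C,
    formal_forms al be ga tstar t lA lB lC ->
    exists Arho Arho1 Arho2 Brho Brho1 Brho2 Crho C1 : C -> C,
      continued_power lA rho Arho /\
      continued_power lA (rho * (1 - al)) Arho1 /\
      continued_power lA (rho * (1 - 2 * al)) Arho2 /\
      continued_power lB rho Brho /\
      continued_power lB (rho * (1 - be)) Brho1 /\
      continued_power lB (rho * (1 - 2 * be)) Brho2 /\
      continued_power lC rho Crho /\
      continued_power lC 1 C1 /\
      (forall tau, inH tau -> Crho tau <> RtoC 0 /\ C1 tau <> RtoC 0) /\
      let E := fun tau : C => (upsilon * Dq Crho tau / Crho tau)%C in
      let u := fun tau : C => (2 * PI * Ci / (upsilon * rho) * E tau)%C in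
      quasi_modular G 2 1 E /\
      forall tau, inH tau ->
        Arho tau = (Brho tau + Crho tau)%C /\
        (upsilon * Dq Arho tau = E tau * Arho tau - Arho1 tau * Brho1 tau)%C /\
        (upsilon * Dq Brho tau = E tau * Brho tau - Arho1 tau * Brho1 tau)%C /\
        (upsilon * Dq Crho tau = E tau * Crho tau)%C /\
        (upsilon * rho * Dq E tau = E tau ^ 2 - Arho2 tau * Brho2 tau)%C /\
        u tau = (C_derive C1 tau / C1 tau)%C /\
        gen_chazy al be u tau.
Proof.
  subst ga; pose proof (tri_fun_of_hauptmodul G vA vB vC nA nB nC upsilon t tstar h_triangle h_inf h_width h_t
    h_tC h_tstar h_tA h_tB) as H; rewrite <- h_al, <- h_be in H.
  pose proof (yt_val G vA vB vC nA nB nC upsilon t tstar h_triangle h_inf h_width h_t h_tC) as Hy.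
  rewrite h_ga0, Rplus_0_r in h_hyp; rewrite h_ga0, Rminus_0_r in h_rho; rewrite h_ga0; clear h_ga0.
  set (y := yt t tstar) in *.
  destruct (u_exists G al be upsilon y H) as [u [Hu Eu]].
  split; [eapply formal_forms_exist; eauto|].
  intros lA lB lC FF.
  destruct (formal_forms_derive G al be upsilon t tstar u H Hu Eu Hy lA lB lC FF)
    as [VA [VB [KA [KB [lt [Kt KC]]]]]]; fold y in KA, KB, Kt; rewrite <- h_rho in KC.
  destruct (lC_continuation G al be upsilon rho y u lB lt lC H Hu h_hyp h_rho KB Kt KC) as [P [HP EP]].
  destruct (A_powers G al be upsilon rho y u lA lB lt lC H Eu h_hyp h_rho VA VB KA Kt KC P HP EP)
    as [A1 [A2 [HA1 HA2]]].
  destruct (B_powers G al be upsilon rho y u lB lt lC H h_hyp h_rho KB Kt KC P HP EP)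
    as [B1 [B2 [HB1 HB2]]].
  pose proof (product_first G al be upsilon rho y u lA lB lt lC H Eu h_hyp h_rho VA VB KA KB Kt KC P HP EP
    A1 B1 HA1 HB1) as E1.
  pose proof (product_second G al be upsilon rho y u lA lB lt lC H Hu Eu h_hyp h_rho VA VB KA KB Kt KC P HP EP
    A2 B2 HA2 HB2) as E2.
  assert (Nr : RtoC rho <> 0) by (apply (rho_nz al be); auto).
  assert (Nw : RtoC upsilon <> 0) by (apply RtoC_nz; pose proof (proj1 h_width); lra).
  set (C1 := fun z => Cexp (P z)).
  assert (DC1 : forall z, inH z -> Cd C1 z (Cexp (P z) * u z)%C) by (intros z Hz; apply Cd_exp; auto).
  exists (Ar rho y P), A1, A2, (Br rho y P), B1, B2, (Cr rho P), C1.
  split; [split; [apply (Ar_hol G al be upsilon rho y u); auto|eapply Ar_power; eauto]|].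
  split; [auto|split; [auto|]].
  split; [split; [apply (Br_hol G al be upsilon rho y u); auto|eapply Br_power; eauto]|].
  split; [auto|split; [auto|]].
  split; [split; [apply (Cr_hol rho u); auto|apply Cr_power; auto]|].
  split; [split|].
  { intros z Hz; eapply Cd_hol; eauto. }
  { generalize EP; apply near_icusp_mono; intros z Ez; unfold C1; rewrite Ez; f_equal; ring. }
  split; [intros z Hz; split; apply Cexp_nz|].
  cbv zeta; fold tpi.
  pose proof (E_eq upsilon rho u P HP) as EE.
  split; [eapply quasi_modular_u; eauto|].
  (* The function named [u] in the statement is a rescaled logarithmic derivative of [Cr]; on [inH]
     the two normalising factors cancel and the constructed [u] returns. *)
  assert (Eu' : forall z, inH z -> (tpi / (upsilon * rho) * (upsilon * Dq (Cr rho P) z / Cr rho P z))%C = u z).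
  { intros z Hz; rewrite EE by auto; field; auto using tpi_nz. }
  intros z Hz; cbv beta; fold tpi; rewrite Eu', EE, E1, E2 by auto.
  unfold Dq at 1 2 3; rewrite (Cd_C_derive _ _ _ (Ar_derive G al be upsilon rho y u H P HP z Hz)),
    (Cd_C_derive _ _ _ (Br_derive G al be upsilon rho y u H P HP z Hz)), (Cd_C_derive _ _ _ (Cr_derive rho u P HP z Hz)).
  fold tpi; pose proof tpi_nz.
  split; [unfold Ar, Br; ring|].
  split; [field; auto|split; [field; auto|split; [field; auto|]]].
  split; [|split].
  - unfold Dq; fold tpi.
    replace (C_derive _ z) with (upsilon * rho / tpi * C_derive u z)%C.
    + simpl; field; auto.
    + symmetry; apply Cd_C_derive, (Cd_ext_near (fun v => upsilon * rho / tpi * u v)%C).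
      * generalize (inH_near z Hz); apply near_mono; intros v Hv; symmetry; apply EE; auto.
      * eapply Cd_eqn; [apply Cd_mult; [apply Cd_const|apply hol_Cd; auto]|cbv beta; ring].
  - rewrite (Cd_C_derive _ _ _ (DC1 z Hz)); unfold C1; field; apply Cexp_nz.
  - apply (gen_chazy_ext al be u); auto; apply (chazy_H G al be upsilon y u); auto.
Qed.
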